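(* For every undirected $n$-vertex graph $G=(V,E)$ with $m$ edges and every positive integer $f$, there is a randomized $f$-fault-tolerant connectivity labeling scheme assigning to each vertex and edge a label of $O(\log^3 n)$ bits. The decoding time of the scheme is $\widetilde{O}(f)$, and the labels can be computed in time $\widetilde{O}(m+n)$.
   Context: An $f$-fault-tolerant connectivity labeling scheme assigns a bit-string label to every vertex and every edge of $G$, together with a decoding algorithm that, given only the labels of two vertices $s,t$ and of the edges of a set $F\subseteq E$ with $|F|\le f$, outputs whether $s$ and $t$ are connected in $G\setminus F$. ''Randomized'' means the labels are produced by a randomized algorithm and for each fixed query $\langle s,t,F\rangle$ the answer is correct with high probability (at least $1-1/n^c$ for a desired constant $c$). $\widetilde{O}$ hides polylogarithmic factors in $n$. *)

(* Defs.v *)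
From mathcomp Require Import all_boot all_order all_algebra.

Set Implicit Arguments.
Unset Strict Implicit.
Unset Printing Implicit Defensive.

(* Model of computation: a randomized word RAM presented as a structured      *)
(* language.  A word is a natural number below 2 ^ w; every operation is      *)
(* performed modulo 2 ^ w and costs one time unit, as does every memory       *)
(* access and every random bit.                                               *)

Inductive binop :=
  Add | Sub | Mul | Div | Mod | And | Or | Xor | Shl | Shr | Eqw | Ltw.

Inductive expr :=
  | Cst of nat
  | Var of nat
  | Fetch of expr
  | Bin of binop & expr & expr.

Inductive cmd :=
  | Skip
  | Assign of nat & expr
  | Store of expr & expr
  | Rand of nat
  | Seq of cmd & cmd
  | If of expr & cmd & cmd
  | While of expr & cmd.

Record state := State {
  vars : nat -> nat;
  memory : nat -> nat;
  tape : seq bool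
}.

Definition update (g : nat -> nat) (i x : nat) : nat -> nat :=
  fun j => if j == i then x else g j.

Definition binop_sem (w : nat) (o : binop) (x y : nat) : nat :=
  (match o with
   | Add => x + y
   | Sub => x + 2 ^ w - y
   | Mul => x * y
   | Div => x %/ y
   | Mod => x %% y
   | And => Nat.land x y
   | Or => Nat.lor x y
   | Xor => Nat.lxor x y
   | Shl => x * 2 ^ y
   | Shr => x %/ 2 ^ y
   | Eqw => x == y
   | Ltw => x < y
   end) %% 2 ^ w.

Fixpoint eval (w : nat) (st : state) (e : expr) : nat :=
  match e with
  | Cst k => k %% 2 ^ w
  | Var x => vars st x
  | Fetch a => memory st (eval w st a)
  | Bin o e1 e2 => binop_sem w o (eval w st e1) (eval w st e2)
  end.

Fixpoint ecost (e : expr) : nat :=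
  match e with
  | Cst _ | Var _ => 1
  | Fetch a => (ecost a).+1
  | Bin _ e1 e2 => (ecost e1 + ecost e2).+1
  end.

(* [exec w p st t st']: with w-bit words, p started in st halts in st' after  *)
(* exactly t time units.  [Rand x] puts the next tape bit in x; it is stuck   *)
(* on an empty tape, so a run that starts on an empty tape is deterministic.  *)
Inductive exec (w : nat) : cmd -> state -> nat -> state -> Prop :=
  | exec_skip st : exec w Skip st 1 st
  | exec_assign x e st :
      exec w (Assign x e) st (ecost e).+1
        (State (update (vars st) x (eval w st e)) (memory st) (tape st))
  | exec_store a e st :
      exec w (Store a e) st (ecost a + ecost e).+1
        (State (vars st) (update (memory st) (eval w st a) (eval w st e))
           (tape st))
  | exec_rand x st b bs : tape st = b :: bs ->
      exec w (Rand x) st 1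
        (State (update (vars st) x (b %% 2 ^ w)) (memory st) bs)
  | exec_seq p q st t st1 u st2 :
      exec w p st t st1 -> exec w q st1 u st2 ->
      exec w (Seq p q) st (t + u) st2
  | exec_if_true e p q st t st' :
      eval w st e != 0 -> exec w p st t st' ->
      exec w (If e p q) st (ecost e + t).+1 st'
  | exec_if_false e p q st t st' :
      eval w st e = 0 -> exec w q st t st' ->
      exec w (If e p q) st (ecost e + t).+1 st'
  | exec_while_true e p st t st1 u st2 :
      eval w st e != 0 -> exec w p st t st1 -> exec w (While e p) st1 u st2 ->
      exec w (While e p) st (ecost e + t + u).+1 st2
  | exec_while_false e p st :
      eval w st e = 0 -> exec w (While e p) st (ecost e).+1 st.

Definition init (w : nat) (input : seq nat) (bits : seq bool) : state :=
  State (fun=> 0) (fun i => nth 0 input i %% 2 ^ w) bits.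

Definition halts_within (w : nat) (p : cmd) (input : seq nat) (bits : seq bool)
    (T : nat) (st : state) : Prop :=
  exists2 t, t <= T & exec w p (init w input bits) t st.

(* A list of bit strings is stored as consecutive blocks, each made of a      *)
(* length followed by that many cells holding one bit each.                   *)
Definition write_strings (ls : seq (seq bool)) : seq nat :=
  flatten [seq size l :: map nat_of_bool l | l <- ls].

Fixpoint read_strings (g : nat -> nat) (a k : nat) : seq (seq bool) :=
  if k is k'.+1 then
    mkseq (fun j => g (a + 1 + j) != 0) (g a)
      :: read_strings g (a + 1 + g a) k'
  else [::].

Definition edge_of (n : nat) (p : 'I_n * 'I_n) : {set 'I_n} := [set p.1; p.2].

Definition edge_set (n : nat) (e : rel 'I_n) : {set {set 'I_n}} :=
  [set edge_of p | p : 'I_n * 'I_n & e p.1 p.2].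

(* E lists every edge of e once, in an arbitrary order and orientation. *)
Definition edge_list (n : nat) (e : rel 'I_n) (E : seq ('I_n * 'I_n)) : Prop :=
  uniq (map (@edge_of n) E) /\ map (@edge_of n) E =i edge_set e.

Definition delete_edges (n : nat) (e : rel 'I_n) (F : seq {set 'I_n}) :
    rel 'I_n :=
  [rel x y | e x y && (edge_of (x, y) \notin F)].

Record labeling (n : nat) := Labeling {
  vlabel : 'I_n -> seq bool;
  elabel : {set 'I_n} -> seq bool
}.

(* No fault set has more than [size E] edges, so f is capped there; otherwise *)
(* an arbitrarily large f would not fit in a word of O(log n) bits.           *)
Definition graph_input (n : nat) (E : seq ('I_n * 'I_n)) (f : nat) : seq nat :=
  [:: n, size E, minn f (size E)
    & flatten [seq [:: val p.1; val p.2] | p <- E]].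

(* The labels are output from the address in variable 0 on: those of the      *)
(* vertices 0, ..., n - 1, then those of the edges in the order of E.         *)
Definition computes_labeling (w : nat) (lab : cmd) (n : nat)
    (E : seq ('I_n * 'I_n)) (f : nat) (bits : seq bool) (T : nat)
    (L : labeling n) : Prop :=
  exists2 st, halts_within w lab (graph_input E f) bits T st &
    let ls := read_strings (memory st) (vars st 0) (n + size E) in
    (forall v : 'I_n, vlabel L v = nth [::] ls v) /\
    (forall x, x \in map (@edge_of n) E ->
       elabel L x = nth [::] ls (n + index x (map (@edge_of n) E))).

Definition query_input (n : nat) (L : labeling n) (s t : 'I_n)
    (F : seq {set 'I_n}) : seq nat :=
  size F :: write_strings [:: vlabel L s, vlabel L t & map (elabel L) F].

Definition decodes (w : nat) (dec : cmd) (n : nat) (L : labeling n)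
    (s t : 'I_n) (F : seq {set 'I_n}) (T : nat) (ans : bool) : Prop :=
  exists2 st, halts_within w dec (query_input L s t F) [::] T st &
    ans = (vars st 0 != 0).

Definition Pr (T : nat) (A : pred (T.-tuple bool)) : rat :=
  (#|A|%:R / #|{: T.-tuple bool}|%:R)%R.

(* Binary length of n: equals floor(log2 n) + 1, so that O and soft-O bounds  *)
(* make sense also for n = 1.                                                 *)
Definition lg (n : nat) : nat := (trunc_log 2 n).+1.

(* Main.v *)
Require Import Defs.

(* The vertices of each tree of a spanning forest are listed in a cyclic order,  *)
(* maintained by swapping two successors whenever two trees are joined.  Laid    *)
(* out on a line, the deletion of a set F of edges cuts this order at O(|F|)     *)
(* points into intervals, each of which stays connected without F.               *)
(*                                                                               *)
(* Every edge draws random words x and y and is described by x, y, x AND y and   *)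
(* the positions of its ends; for each of O(log n) phases and O(log n) sampling  *)
(* rates, the sketch of a position is the XOR of the descriptions of the sampled *)
(* edges at that position.  The label of an edge holds the prefix XORs at its    *)
(* cut points, O(log^2 n) words of O(log n) bits, and summation by parts turns   *)
(* these into the XOR of the surviving edges that leave any union of intervals.  *)
(*                                                                               *)
(* The decoder runs Boruvka phases on the intervals.  A sampled set of one edge  *)
(* reveals that edge; a larger set passes the test that the third word is the    *)
(* AND of the first two with probability at most (3/4)^w.  Some rate isolates a  *)
(* leaving edge with constant probability, so the expected number of unfinished  *)
(* classes shrinks by a constant factor per phase, each with fresh randomness.   *)

(* Two facts about positions on the line carry correctness. By [lay_key], a vertex is joined to its
   successor by edges that are cut at the successor, an invariant that [lay_step] keeps when trees
   are joined; hence a stretch of one tree without cut points stays connected after the deletion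
   ([loc_conn]). And for a union of intervals with indicator b, the XOR of the surviving edges that
   leave it is the sum over the cut points p of b(p) + b(p-1), modulo 2, times the prefix XOR at p,
   corrected by the deleted edges ([cut_identity], from [abel_lxor] and [loc_pred]). So the labels
   of the deleted edges determine the sketch of every union of intervals.

   Probabilities are counts of coin strings, and independence is expressed as invariance under
   flipping one coin. Positions and cut points do not depend on the coins, and the classes at the
   start of a phase depend only on the coins of earlier phases ([proc_agree]). A set of k edges,
   sampled at a rate between 1/(4k) and 1/(2k), is reduced to one edge with probability at least 1/8
   ([isolate_card]). Each unfinished class that isolates an edge lowers the number of unfinished
   classes by half a unit ([pstep_count]), so the expected number shrinks by 15/16 per phase
   ([expected_step]). A fixed false positive has probability at most (3/4)^w
   ([false_positive_card]). [failure_card] combines Markov's inequality with a union bound over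
   false positives, and [failure_small] checks the constants. Outside these failures every final
   class is connected without F and contains both ends of each surviving edge that meets it, so
   comparing classes and trees decides the query ([connected_iff]).

   Running times are proved for structured programs whose loop bounds are fixed on entry. [comp_ok]
   turns such a program into RAM code of exactly the same cost, and [hcost_le_bound] reads a bound
   off the nesting of loops. Only the walk along the cyclic orders needs an amortized count
   ([walk_cost]). *)
From Stdlib Require Import PeanoNat.
From HB Require Import structures.
From mathcomp Require Import all_boot all_order all_algebra all_fingroup zify.

Set Implicit Arguments.
Unset Strict Implicit.
Unset Printing Implicit Defensive.

(** * Structured programs *)

(* [HA a i j] is the entry (i, j) of the a-th two-dimensional array; array a  *)
(* occupies the D * D cells from address a * D * D on, where D is the value   *)
(* of the reserved variable vD.  Indices are reduced modulo D, so that the    *)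
(* translation to RAM code is correct without any side condition.             *)
Inductive hexpr :=
  | HC of nat
  | HV of nat
  | HA of nat & hexpr & hexpr
  | HB of binop & hexpr & hexpr.

(* [HFor x y p] runs p with x = 0, ..., (value of y) - 1. *)
Inductive hcmd :=
  | HAsg of nat & hexpr
  | HSet of nat & hexpr & hexpr & hexpr
  | HRand of nat
  | HSeq of hcmd & hcmd
  | HIf of hexpr & hcmd & hcmd
  | HFor of nat & nat & hcmd.

Definition vD := 1.

Record hst := HS { hv : nat -> nat; ha : nat -> nat -> nat -> nat; ht : seq bool }.

Definition setv (h : hst) (x k : nat) : hst :=
  HS (fun z => if z == x then k else hv h z) (ha h) (ht h).

Definition seta (h : hst) (a i j k : nat) : hst :=
  HS (hv h) (fun a' i' j' => if [&& a' == a, i' == i & j' == j] then k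
                             else ha h a' i' j') (ht h).

Definition sett (h : hst) (s : seq bool) : hst := HS (hv h) (ha h) s.

Fixpoint hiter T (f : nat -> T -> T) (k n : nat) (s : T) : T :=
  if n is n'.+1 then hiter f k.+1 n' (f k s) else s.

Fixpoint hcosts T (f : nat -> T -> T) (c : T -> nat) (k n : nat) (s : T) : nat :=
  if n is n'.+1 then c s + hcosts f c k.+1 n' (f k s) else 0.

Fixpoint compe (e : hexpr) : expr :=
  match e with
  | HC k => Cst k
  | HV x => Var x
  | HA a i j =>
      Fetch (Bin Add (Bin Mul (Bin Add (Bin Mul (Cst a) (Var vD))
                                 (Bin Mod (compe i) (Var vD))) (Var vD))
               (Bin Mod (compe j) (Var vD)))
  | HB o e1 e2 => Bin o (compe e1) (compe e2)
  end.

Fixpoint comp (p : hcmd) : cmd :=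
  match p with
  | HAsg x e => Assign x (compe e)
  | HSet a i j e =>
      Store (Bin Add (Bin Mul (Bin Add (Bin Mul (Cst a) (Var vD))
                                 (Bin Mod (compe i) (Var vD))) (Var vD))
               (Bin Mod (compe j) (Var vD))) (compe e)
  | HRand x => Rand x
  | HSeq p q => Seq (comp p) (comp q)
  | HIf e p q => If (compe e) (comp p) (comp q)
  | HFor x y p =>
      Seq (Assign x (Cst 0))
        (While (Bin Ltw (Var x) (Var y))
           (Seq (comp p) (Assign x (Bin Add (Var x) (Cst 1)))))
  end.

Fixpoint wv (p : hcmd) : seq nat :=
  match p with
  | HAsg x _ | HRand x => [:: x]
  | HSet _ _ _ _ => [::]
  | HSeq p q | HIf _ p q => wv p ++ wv q
  | HFor x _ p => x :: wv p
  end.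

Fixpoint wa (p : hcmd) : seq nat :=
  match p with
  | HAsg _ _ | HRand _ => [::]
  | HSet a _ _ _ => [:: a]
  | HSeq p q | HIf _ p q => wa p ++ wa q
  | HFor _ _ p => wa p
  end.

Fixpoint lims (p : hcmd) : seq nat :=
  match p with
  | HAsg _ _ | HRand _ | HSet _ _ _ _ => [::]
  | HSeq p q | HIf _ p q => lims p ++ lims q
  | HFor _ y p => y :: lims p
  end.

Fixpoint norand (p : hcmd) : bool :=
  match p with
  | HRand _ => false
  | HAsg _ _ | HSet _ _ _ _ => true
  | HSeq p q | HIf _ p q => norand p && norand q
  | HFor _ _ p => norand p
  end.

Definition narr := 64.

Fixpoint wfe (e : hexpr) : bool :=
  match e with
  | HC _ | HV _ => true
  | HA a i j => [&& a < narr, wfe i & wfe j]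
  | HB _ e1 e2 => wfe e1 && wfe e2
  end.

(** The body of a loop may assign neither its counter nor its bound. The number of rounds is then
    fixed on entry, which is what allows a total semantics by structural recursion. *)
Fixpoint wf (p : hcmd) : bool :=
  match p with
  | HAsg x e => (x != vD) && wfe e
  | HSet a i j e => [&& a < narr, wfe i, wfe j & wfe e]
  | HRand x => x != vD
  | HSeq p q => wf p && wf q
  | HIf e p q => [&& wfe e, wf p & wf q]
  | HFor x y p => [&& x != vD, x != y, x \notin wv p, y \notin wv p & wf p]
  end.

Section Machine.
Variables w D : nat.

Fixpoint heval (h : hst) (e : hexpr) : nat :=
  match e with
  | HC k => k %% 2 ^ w
  | HV x => hv h x
  | HA a i j => ha h a (heval h i %% D) (heval h j %% D)
  | HB o e1 e2 => binop_sem w o (heval h e1) (heval h e2)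
  end.

(** A coin drawn from an exhausted tape is [false]. The RAM would be stuck there, so [comp_ok] asks
    for a tape at least as long as the running time unless the program draws no coins. *)
Fixpoint hexec (p : hcmd) (h : hst) : hst :=
  match p with
  | HAsg x e => setv h x (heval h e)
  | HSet a i j e => seta h a (heval h i %% D) (heval h j %% D) (heval h e)
  | HRand x => sett (setv h x (head false (ht h))) (behead (ht h))
  | HSeq p q => hexec q (hexec p h)
  | HIf e p q => if heval h e != 0 then hexec p h else hexec q h
  | HFor x y p =>
      hiter (fun k s => setv (hexec p s) x k.+1) 0 (hv h y) (setv h x 0)
  end.

(** The exact cost of the translation. In an array access 11 counts the nodes of the address
    expression outside the two indices; in a loop 2 is the initialization, 8 the test and increment
    of a round, and 4 the final failing test. *)
Fixpoint hcost (p : hcmd) (h : hst) : nat :=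
  match p with
  | HAsg x e => (ecost (compe e)).+1
  | HSet a i j e => (ecost (compe i) + ecost (compe j) + 11 + ecost (compe e)).+1
  | HRand _ => 1
  | HSeq p q => hcost p h + hcost q (hexec p h)
  | HIf e p q =>
      (ecost (compe e) + if heval h e != 0 then hcost p h else hcost q h).+1
  | HFor x y p =>
      2 + (hcosts (fun k s => setv (hexec p s) x k.+1) (fun s => hcost p s + 8)
             0 (hv h y) (setv h x 0) + 4)
  end.

Definition same_off (xs as_ : seq nat) (h h' : hst) : Prop :=
  (forall z, z \notin xs -> hv h' z = hv h z) /\
  (forall a, a \notin as_ -> ha h' a = ha h a).

Lemma same_off_trans xs ys h1 h2 h3 :
  same_off xs ys h1 h2 -> same_off xs ys h2 h3 -> same_off xs ys h1 h3.
Proof.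
move=> [a1 b1] [a2 b2]; split=> z zn; first by rewrite a2 // a1.
by rewrite b2 // b1.
Qed.

Lemma same_off_sub xs xs' ys ys' h h' :
  {subset xs <= xs'} -> {subset ys <= ys'} ->
  same_off xs ys h h' -> same_off xs' ys' h h'.
Proof.
move=> sx sy [h1 h2]; split=> z; first by move=> zn; apply: h1; apply: contra zn => /sx.
by move=> zn; apply: h2; apply: contra zn => /sy.
Qed.

Lemma setv_same_off x k h : same_off [:: x] [::] h (setv h x k).
Proof. by split=> z //=; rewrite inE => /negbTE->. Qed.

Lemma hiter_ind T (I : nat -> T -> Prop) f k n s :
  I k s -> (forall i s', k <= i < k + n -> I i s' -> I i.+1 (f i s')) ->
  I (k + n) (hiter f k n s).
Proof.
elim: n k s => [|n IH] k s Ik Istep /=; first by rewrite addn0.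
rewrite addnS -addSn; apply: IH; first by apply: Istep => //; lia.
by move=> i s' hi; apply: Istep; lia.
Qed.

Lemma hexec_frame p h : same_off (wv p) (wa p) h (hexec p h).
Proof.
elim: p h => [x e|a i j e|x|p IHp q IHq|e p IHp q IHq|x y p IHp] h /=.
- exact: setv_same_off.
- split=> // b; rewrite inE => /negbTE bn.
  by rewrite /seta /= bn.
- by split=> // z; rewrite inE /= => /negbTE->.
- apply: (@same_off_trans _ _ _ (hexec p h)).
    by apply: same_off_sub (IHp h) => z; rewrite mem_cat => ->.
  by apply: same_off_sub (IHq _) => z; rewrite mem_cat orbC => ->.
- case: ifP => _.
    by apply: same_off_sub (IHp h) => z; rewrite mem_cat => ->.
  by apply: same_off_sub (IHq _) => z; rewrite mem_cat orbC => ->.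
- have key s k : same_off (x :: wv p) (wa p) s (setv s x k).
    by apply: same_off_sub (setv_same_off x k s) => z //; rewrite !inE => ->.
  apply: (@hiter_ind _ (fun _ s => same_off (x :: wv p) (wa p) h s)) => // i s _ hs.
  apply: same_off_trans (key _ _); apply: same_off_trans hs _.
  by apply: same_off_sub (IHp s) => z //; rewrite inE orbC => ->.
Qed.

(* The frame condition and the values of counter and bound come for free. *)
Lemma forP (I : nat -> hst -> Prop) x y p h :
  wf (HFor x y p) -> I 0 (setv h x 0) ->
  (forall k s, k < hv h y -> hv s x = k -> same_off (x :: wv p) (wa p) h s ->
     I k s -> I k.+1 (setv (hexec p s) x k.+1)) ->
  I (hv h y) (hexec (HFor x y p) h) /\ hv (hexec (HFor x y p) h) x = hv h y.
Proof.
move=> /and5P[_ _ _ _ _] I0 IS /=.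
have key s k : same_off (x :: wv p) (wa p) s (setv s x k).
  by apply: same_off_sub (setv_same_off x k s) => z //; rewrite !inE => ->.
set f := fun k s => _.
have /= := @hiter_ind _ (fun k s => [/\ I k s, hv s x = k
   & same_off (x :: wv p) (wa p) h s]) f 0 (hv h y) (setv h x 0).
rewrite add0n; case=> //; first by rewrite /= eqxx.
  move=> i s /= hi [Ii xi fr]; split; first by apply: IS.
    by rewrite /f /= eqxx.
  apply: same_off_trans (key _ _); apply: same_off_trans fr _.
  by apply: same_off_sub (hexec_frame p s) => z //; rewrite inE orbC => ->.
Qed.

Definition bounded (h : hst) : Prop :=
  (forall x, hv h x < 2 ^ w) /\ (forall a i j, ha h a i j < 2 ^ w).

Lemma binop_sem_lt o x y : binop_sem w o x y < 2 ^ w.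
Proof. by rewrite ltn_mod expn_gt0. Qed.

Lemma heval_lt h e : bounded h -> heval h e < 2 ^ w.
Proof.
move=> [bv ba]; case: e => *; [by rewrite ltn_mod expn_gt0 | exact: bv | exact: ba |].
exact: binop_sem_lt.
Qed.

Lemma bounded_setv h x k : bounded h -> k < 2 ^ w -> bounded (setv h x k).
Proof. by move=> [bv ba] hk; split=> //= z; case: eqP. Qed.

Lemma bool_lt_pow (b : bool) : 0 < w -> b < 2 ^ w.
Proof.
by move=> w0; apply: leq_ltn_trans (leq_b1 b) _; rewrite -[1](expn0 2) ltn_exp2l.
Qed.

(** Memory is constrained only on the cells of the [narr] arrays. *)
Definition sim (st : state) (h : hst) : Prop :=
  [/\ vars st =1 hv h, tape st = ht h, hv h vD = D, bounded h
    & forall a i j, a < narr -> i < D -> j < D ->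
        memory st ((a * D + i) * D + j) = ha h a i j].

Hypothesis w0 : 0 < w.
Hypothesis D0 : 0 < D.
Hypothesis Dw : narr * D * D <= 2 ^ w.

Lemma addr_lt a i j : a < narr -> i < D -> j < D -> (a * D + i) * D + j < 2 ^ w.
Proof.
move=> ha hi hj; apply: leq_trans Dw.
have h1 : a * D + i < narr * D by nia.
by nia.
Qed.

(** By [Dw] every address of the [narr] arrays is a word, so no intermediate result wraps around. *)
Lemma addr_eval st h a i j :
  hv h vD = D -> vars st =1 hv h -> a < narr ->
  eval w st (Bin Add (Bin Mul (Bin Add (Bin Mul (Cst a) (Var vD))
                                 (Bin Mod i (Var vD))) (Var vD))
               (Bin Mod j (Var vD)))
   = (a * D + eval w st i %% D) * D + eval w st j %% D.
Proof.
move=> hD ev ha /=.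
have hi := ltn_pmod (eval w st i) D0; have hj := ltn_pmod (eval w st j) D0.
rewrite !ev hD; move: hi hj; set x := _ %% D; set y := _ %% D => hx hy.
have Kl := addr_lt ha hx hy.
have DDw : narr * D <= 2 ^ w by apply: leq_trans Dw; rewrite leq_pmulr.
have xw : x < 2 ^ w by rewrite /narr in DDw; nia.
have yw : y < 2 ^ w by rewrite /narr in DDw; nia.
have aw : a < 2 ^ w by nia.
have aDw : a * D < 2 ^ w by nia.
have aDx : a * D + x < 2 ^ w by rewrite /narr in DDw ha; nia.
have aDxD : (a * D + x) * D < 2 ^ w by lia.
rewrite /binop_sem.
by rewrite (modn_small aw) (modn_small aDw) (modn_small xw) (modn_small aDx)
           (modn_small aDxD) (modn_small yw) (modn_small Kl).
Qed.

(** Digits in base [D] are unique, so a store changes a single array entry. *)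
Lemma addr_inj a i j a' i' j' :
  i < D -> j < D -> i' < D -> j' < D ->
  ((a * D + i) * D + j == (a' * D + i') * D + j') =
  [&& a == a', i == i' & j == j'].
Proof.
move=> hi hj hi' hj'; apply/eqP/and3P=> [e|[/eqP-> /eqP-> /eqP->] //].
have ej : j = j' by have := congr1 (modn^~ D) e; rewrite !modnMDl !modn_small.
have e2 : a * D + i = a' * D + i'.
  by have := congr1 (divn^~ D) e; rewrite !divnMDl // !(divn_small hj, divn_small hj') !addn0.
have ei : i = i' by have := congr1 (modn^~ D) e2; rewrite !modnMDl !modn_small.
have ea : a = a'.
  by have := congr1 (divn^~ D) e2; rewrite !divnMDl // !(divn_small hi, divn_small hi') !addn0.
by rewrite ea ei ej.
Qed.

Lemma compe_ok st h e : wfe e -> sim st h -> eval w st (compe e) = heval h e.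
Proof.
move=> + [ev _ hD bh em]; elim: e => [k|x|a i IHi j IHj|o e1 IH1 e2 IH2] //=.
  move=> /and3P[an wi wj]; have /= -> := addr_eval (compe i) (compe j) hD ev an.
  by rewrite IHi // IHj // em // ltn_mod.
by move=> /andP[/IH1-> /IH2->].
Qed.

(** Each coin costs a time unit. A tape as long as the running time therefore leaves enough coins
    for whatever part of the run remains. *)
Lemma size_ht_hexec p h : size (ht h) <= size (ht (hexec p h)) + hcost p h.
Proof.
elim: p h => [x e|a i j e|x|p IHp q IHq|e p IHp q IHq|x y p IHp] h /=; try lia.
- by rewrite size_behead; lia.
- by have := IHp h; have := IHq (hexec p h); lia.
- by case: ifP => _; [have := IHp h | have := IHq h]; lia.
- set f := fun k s => _.
  suff G k n s : size (ht s) <= size (ht (hiter f k n s)) +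
     hcosts f (fun s => hcost p s + 8) k n s.
    by have := G 0 (hv h y) (setv h x 0); rewrite /=; lia.
  elim: n k s => [|n IH] k s /=; first lia.
  by have := IHp s; have := IH k.+1 (f k s); rewrite /f /=; lia.
Qed.

Lemma sim_setv st h x k :
  x != vD -> k < 2 ^ w -> sim st h ->
  sim (State (update (vars st) x k) (memory st) (tape st)) (setv h x k).
Proof.
move=> xD kw [ev et hD bh em]; split=> //=.
- by move=> z; rewrite /update ev.
- by rewrite eq_sym (negbTE xD).
- exact: bounded_setv.
Qed.

(** The simulation is step-exact, so resource bounds can be proved for [hcost] and transferred to
    the RAM unchanged. *)
Lemma comp_ok p st h :
  wf p -> sim st h -> norand p || (hcost p h <= size (ht h)) ->
  exists2 st', exec w (comp p) st (hcost p h) st' & sim st' (hexec p h).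
Proof.
elim: p st h => [x e|a i j e|x|p IHp q IHq|e p IHp q IHq|x y p IHp] st h /=.
- move=> /andP[xD we] S _; rewrite -(compe_ok we S).
  eexists; first exact: exec_assign.
  by apply: sim_setv => //; rewrite (compe_ok we S); apply: heval_lt; case: S.
- move=> /and4P[ha wi wj we] S _.
  have := exec_store w (Bin Add (Bin Mul (Bin Add (Bin Mul (Cst a) (Var vD))
                                 (Bin Mod (compe i) (Var vD))) (Var vD))
               (Bin Mod (compe j) (Var vD))) (compe e) st.
  case: (S) => ev et hD bh em.
  rewrite (addr_eval _ _ hD ev ha) (compe_ok wi S) (compe_ok wj S) (compe_ok we S) /= => X.
  eexists; first by move: X; congr exec; rewrite /=; lia.
  split=> //=; first by case: bh => b1 b2; split=> //= *; case: ifP => // _; apply: heval_lt.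
  move=> a' i' j' a'n i'D j'D; rewrite /update /= addr_inj ?ltn_mod //.
  by case: ifP => // _; apply: em.
- move=> xD S /=; case: (S) => ev et hD bh em.
  case E : (ht h) => [|b bs] //= _; rewrite -et in E.
  eexists; first exact: exec_rand E.
  have b2 := bool_lt_pow b w0.
  rewrite (modn_small b2); case: (sim_setv xD b2 S) => *; split=> //=.
- move=> /andP[wp wq] S hr.
  have [|st1 e1 S1] := IHp st h wp S.
    by case/orP: hr => [/andP[->]//|]; case: norand => //=; lia.
  have [|st2 e2 S2] := IHq st1 (hexec p h) wq S1.
    case/orP: hr => [/andP[_ ->]//|]; case: norand => //=.
    by have := size_ht_hexec p h; lia.
  by exists st2 => //; apply: exec_seq e1 e2.
- move=> /and3P[we wp wq] S; rewrite -(compe_ok we S); case: ifP => he hr.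
    have [|st1 e1 S1] := IHp st h wp S.
      by case/orP: hr => [/andP[->]//|]; case: norand => //=; lia.
    by exists st1 => //; apply: exec_if_true.
  have [|st1 e1 S1] := IHq st h wq S.
    by case/orP: hr => [/andP[_ ->]//|]; case: norand => //=; lia.
  by exists st1 => //; apply: exec_if_false => //; apply/eqP/negPn; rewrite he.
- move=> wfor; case/and5P: (wfor) => xD xy xp yp wp S.
  set f := fun k s => _.
  have evlt st0 : eval w st0 (Bin Ltw (Var x) (Var y)) =
      (vars st0 x < vars st0 y) %% 2 ^ w by [].
  (* The loop is simulated from an arbitrary round [k] with [n] rounds left, for induction on
     [n]. *)
  have G n k s st1 : sim st1 s -> hv s x = k -> hv s y = k + n ->
     norand p || (hcosts f (fun s => hcost p s + 8) k n s <= size (ht s)) ->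
     exists2 st', exec w (While (Bin Ltw (Var x) (Var y))
       (Seq (comp p) (Assign x (Bin Add (Var x) (Cst 1))))) st1
        (hcosts f (fun s => hcost p s + 8) k n s + 4) st' & sim st' (hiter f k n s).
    elim: n k s st1 => [|n IH] k s st1 S1 hx hy hr /=.
      exists st1 => //; apply: exec_while_false.
      by rewrite evlt; case: S1 => ev _ _ _ _; rewrite !ev hx hy addn0 ltnn mod0n.
    have w2 : 1 < 2 ^ w by rewrite -[1](expn0 2) ltn_exp2l.
    have [|st2 e2 S2] := IHp st1 s wp S1.
      by case/orP: hr => [->//|/=]; case: norand => //=; lia.
    have [frv fra] := hexec_frame p s.
    (* The loop bound is itself stored in a word and is at least [k.+1], so the increment does not
       wrap. *)
    have kw : k.+1 < 2 ^ w.
      case: S1 => _ _ _ [bv _] _; have := bv y; rewrite hy; lia.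
    have S3 := sim_setv xD kw S2.
    have Ef : f k s = setv (hexec p s) x k.+1 by [].
    have ex : exec w (Assign x (Bin Add (Var x) (Cst 1))) st2 4
        (State (update (vars st2) x k.+1) (memory st2) (tape st2)).
      have := exec_assign w x (Bin Add (Var x) (Cst 1)) st2.
      have -> : eval w st2 (Bin Add (Var x) (Cst 1)) = k.+1 => //.
      have -> : eval w st2 (Bin Add (Var x) (Cst 1)) =
        (vars st2 x + 1 %% 2 ^ w) %% 2 ^ w by [].
      by case: S2 => ev _ _ _ _; rewrite ev frv // hx modnDmr addn1 modn_small.
    have [|||st3 e3 S4] := IH k.+1 (f k s) _ S3.
    + by rewrite Ef /= eqxx.
    + by rewrite Ef /= eq_sym (negbTE xy) frv // hy addSnnS.
    + apply/orP; case/orP: hr => hr; [by left | right].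
      have hr' : hcost p s + 8 + hcosts f (fun s => hcost p s + 8) k.+1 n (f k s)
        <= size (ht s) := hr.
      have Es : size (ht (f k s)) = size (ht (hexec p s)) := erefl.
      by have := size_ht_hexec p s; move: hr' Es; clear; lia.
    exists st3; last exact: S4.
    have -> : hcost p s + 8 + hcosts f (fun s => hcost p s + 8) k.+1 n (f k s) + 4
      = (3 + (hcost p s + 4) + (hcosts f (fun s => hcost p s + 8) k.+1 n (f k s) + 4)).+1 by lia.
    apply: exec_while_true e3; last exact: exec_seq e2 ex.
    rewrite evlt; case: S1 => ev _ _ _ _; rewrite !ev hx hy.
    by rewrite -addSnnS leq_addr modn_small.
  move=> hr.
  have Sx : sim (State (update (vars st) x 0) (memory st) (tape st)) (setv h x 0).
    by apply: sim_setv => //; rewrite expn_gt0.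
  have [|||st' e' S'] := G (hv h y) 0 _ _ Sx.
  + by rewrite /= eqxx.
  + by rewrite /= eq_sym (negbTE xy).
  + by case/orP: hr => [->//|]; case: norand => //=; lia.
  exists st' => //; apply: exec_seq e'.
  by have := exec_assign w x (Cst 0) st; rewrite /= mod0n.
Qed.

End Machine.
(** * Running times *)

(** Costs are bounded by monomials in two parameters [N] and [L]: [kc], [kd] and [kk] give the
    coefficient and the exponents for each loop bound. Exponents add under nesting and take the
    maximum in sequence. *)
Fixpoint bcoef (kc : nat -> nat) (p : hcmd) : nat :=
  match p with
  | HAsg x e => (ecost (compe e)).+1
  | HSet a i j e => (ecost (compe i) + ecost (compe j) + 11 + ecost (compe e)).+1
  | HRand _ => 1
  | HSeq p q => bcoef kc p + bcoef kc q
  | HIf e p q => (ecost (compe e)).+1 + (bcoef kc p + bcoef kc q)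
  | HFor x y p => kc y * (bcoef kc p + 8) + 6
  end.

Fixpoint bdeg (kd : nat -> nat) (p : hcmd) : nat :=
  match p with
  | HAsg _ _ | HSet _ _ _ _ | HRand _ => 0
  | HSeq p q | HIf _ p q => maxn (bdeg kd p) (bdeg kd q)
  | HFor x y p => kd y + bdeg kd p
  end.

Section CostBound.
Variables w D N L : nat.
Hypotheses (N0 : 0 < N) (L0 : 0 < L).
Variables kc kd kk : nat -> nat.

Let mono p q := N ^ p * L ^ q.

Lemma mono_le p p' q q' : p <= p' -> q <= q' -> mono p q <= mono p' q'.
Proof. by move=> hp hq; apply: leq_mul; apply: leq_pexp2l. Qed.

Lemma mono_gt0 p q : 0 < mono p q.
Proof. by rewrite muln_gt0 !expn_gt0 N0 L0. Qed.

(** Loop bounds are never assigned, so their initial values govern every later loop. The set [W]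
    replaces [wv p] so that the induction can pass to subprograms. *)
Lemma hcost_le_bound (W : seq nat) p h :
  {subset wv p <= W} -> {in lims p, forall y, y \notin W} ->
  (forall y, y \in lims p -> hv h y <= kc y * mono (kd y) (kk y)) ->
  hcost w D p h <= bcoef kc p * mono (bdeg kd p) (bdeg kk p).
Proof.
elim: p h => [x e|a i j e|x|p IHp q IHq|e p IHp q IHq|x y p IHp] h /= sW lW lb.
- by rewrite leq_pmulr ?mono_gt0.
- by rewrite leq_pmulr ?mono_gt0.
- by rewrite leq_pmulr ?mono_gt0.
- have hp : hcost w D p h <= bcoef kc p * mono (bdeg kd p) (bdeg kk p).
    by apply: IHp => [z hz|z hz|z hz]; [apply: sW|apply: lW|apply: lb]; rewrite mem_cat hz.
  have hq : hcost w D q (hexec w D p h) <=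
      bcoef kc q * mono (bdeg kd q) (bdeg kk q).
    apply: IHq => [z hz|z hz|z hz]; [apply: sW|apply: lW|]; rewrite ?mem_cat ?hz ?orbT //.
    have [fv _] := hexec_frame w D p h.
    have zl : z \in lims p ++ lims q by rewrite mem_cat hz orbT.
    rewrite fv; first exact: lb.
    by apply: contra (lW z zl) => zp; apply: sW; rewrite mem_cat zp.
  rewrite mulnDl; apply: leq_add.
    by apply: leq_trans hp _; rewrite leq_mul // mono_le // leq_maxl.
  by apply: leq_trans hq _; rewrite leq_mul // mono_le // leq_maxr.
- have hp : hcost w D p h <= bcoef kc p * mono (bdeg kd p) (bdeg kk p).
    by apply: IHp => [z hz|z hz|z hz]; [apply: sW|apply: lW|apply: lb]; rewrite mem_cat hz.
  have hq : hcost w D q h <= bcoef kc q * mono (bdeg kd q) (bdeg kk q).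
    by apply: IHq => [z hz|z hz|z hz]; [apply: sW|apply: lW|apply: lb]; rewrite mem_cat hz orbT.
  have hp' := leq_trans hp (leq_mul (leqnn (bcoef kc p))
    (mono_le (leq_maxl (bdeg kd p) (bdeg kd q)) (leq_maxl (bdeg kk p) (bdeg kk q)))).
  have hq' := leq_trans hq (leq_mul (leqnn (bcoef kc q))
    (mono_le (leq_maxr (bdeg kd p) (bdeg kd q)) (leq_maxr (bdeg kk p) (bdeg kk q)))).
  move: hp' hq' (mono_gt0 (maxn (bdeg kd p) (bdeg kd q)) (maxn (bdeg kk p) (bdeg kk q))).
  by case: ifP => _; nia.
- set B := bcoef kc p * mono (bdeg kd p) (bdeg kk p).
  set f := fun k s => _; set c := fun s => _.
  have G k n s : (forall z, z \notin W -> hv s z = hv h z) ->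
      hcosts f c k n s <= n * (B + 8).
    elim: n k s => [|n IH] k s hs //=.
    rewrite mulSn; apply: leq_add.
      rewrite /c leq_add2r; apply: IHp => [z hz|z hz|z hz].
      + by apply: sW; rewrite inE hz orbT.
      + by apply: lW; rewrite inE hz orbT.
      + by rewrite hs; [apply: lb | apply: lW]; rewrite inE hz orbT.
    apply: IH => z zW.
    have zx : z != x by apply: contra zW => /eqP->; apply: sW; rewrite inE eqxx.
    have [fv _] := hexec_frame w D p s; rewrite /f /= (negbTE zx) fv; first exact: hs.
    by apply: contra zW => hz; apply: sW; rewrite inE hz orbT.
  have := G 0 (hv h y) (setv h x 0); have yl := lb y (mem_head _ _).
  move=> /(_ _) G'.
  have {}G' : hcosts f c 0 (hv h y) (setv h x 0) <= hv h y * (B + 8).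
    apply: G' => z zW /=; case: eqP => // zx.
    by case/negP: zW; apply: sW; rewrite zx inE eqxx.
  have B8 : B + 8 <= (bcoef kc p + 8) * mono (bdeg kd p) (bdeg kk p).
    by rewrite mulnDl leq_add2l leq_pmulr // mono_gt0.
  have E : mono (kd y + bdeg kd p) (kk y + bdeg kk p) =
      mono (kd y) (kk y) * mono (bdeg kd p) (bdeg kk p).
    by rewrite /mono !expnD mulnACA.
  have H : hv h y * (B + 8) <= kc y * (bcoef kc p + 8) *
      mono (kd y + bdeg kd p) (kk y + bdeg kk p).
    rewrite E; apply: leq_trans (leq_mul yl B8) _.
    by rewrite mulnACA.
  have := mono_gt0 (kd y + bdeg kd p) (kk y + bdeg kk p).
  move: G' H; rewrite mulnDl; move: (hcosts _ _ _ _ _) (mono _ _) => X Y; nia.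
Qed.

End CostBound.

(** * The word size *)

(* Variable 2 receives the word size, found by shifting the largest word;     *)
(* variable 3 receives L where the word size is a * L.                        *)
Definition prelude (a d : nat) : cmd :=
  Seq (Assign 4 (Bin Defs.Sub (Cst 0) (Cst 1)))
    (Seq (While (Var 4) (Seq (Assign 4 (Bin Shr (Var 4) (Cst 1)))
                             (Assign 2 (Bin Add (Var 2) (Cst 1)))))
      (Seq (Assign 3 (Bin Div (Var 2) (Cst a)))
           (Assign vD (Bin Shl (Cst 1) (Bin Mul (Var 3) (Cst d)))))).

Definition prelude_vars (w L D : nat) (x : nat) : nat :=
  if x == vD then D else if x == 2 then w else if x == 3 then L else 0.

Section Prelude.
Variables a d L : nat.
Let w := a * L.
Let D := 2 ^ (d * L).
Hypotheses (L0 : 0 < L) (da : 2 * d + 6 <= a).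

Lemma word_gt0 : 0 < w.
Proof. by rewrite muln_gt0 L0 andbT; lia. Qed.

Lemma word_lt_pow : w < 2 ^ w.
Proof. exact: ltn_expl. Qed.

(** There are 2 ^ 6 arrays, which is where the 6 in [da] comes from. *)
Lemma dim_bound : narr * D * D <= 2 ^ w.
Proof.
rewrite /narr -[64]/(2 ^ 6) /D /w -!expnD leq_exp2l //.
by nia.
Qed.

(** Shifting 2 ^ j - 1 right by one gives 2 ^ (j - 1) - 1, so the number of rounds until zero is the
    number of bits. *)
Lemma shift_loop j v : j <= w -> v 4 = 2 ^ j - 1 -> v 2 = w - j ->
  forall mm tp, exists2 v',
    exec w (While (Var 4) (Seq (Assign 4 (Bin Shr (Var 4) (Cst 1)))
                             (Assign 2 (Bin Add (Var 2) (Cst 1)))))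
      (State v mm tp) (10 * j + 2) (State v' mm tp) &
    [/\ v' 4 = 0, v' 2 = w & forall z, z != 4 -> z != 2 -> v' z = v z].
Proof.
have one : 1 %% 2 ^ w = 1 by rewrite modn_small // -[1](expn0 2) ltn_exp2l // word_gt0.
elim: j v => [|j IH] v jw v4 v2 mm tp.
  exists v; last by rewrite v4 v2 subn0.
  by apply: (@exec_while_false w (Var 4)); rewrite /= v4.
have [|||v' ex [e1 e2 e3]] :=
    IH (update (update v 4 (2 ^ j - 1)) 2 (w - j)) _ _ _ mm tp.
- exact: ltnW.
- by rewrite /update.
- by rewrite /update.
exists v'.
  have -> : 10 * j.+1 + 2 = (1 + (4 + 4) + (10 * j + 2)).+1 by lia.
  apply: (@exec_while_true w (Var 4)); last exact: ex.
    by rewrite /= v4 -lt0n subn_gt0 -[1](expn0 2) ltn_exp2l.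
  apply: (@exec_seq w _ _ _ _ (State (update v 4 (2 ^ j - 1)) mm tp)).
    have := exec_assign w 4 (Bin Shr (Var 4) (Cst 1)) (State v mm tp).
    have -> // : eval w (State v mm tp) (Bin Shr (Var 4) (Cst 1)) = 2 ^ j - 1.
    have -> : eval w (State v mm tp) (Bin Shr (Var 4) (Cst 1)) =
      (v 4 %/ 2 ^ (1 %% 2 ^ w)) %% 2 ^ w by [].
    rewrite one v4 expn1 expnS.
    have -> : (2 * 2 ^ j - 1) %/ 2 = 2 ^ j - 1 by have := expn_gt0 2 j; lia.
    rewrite modn_small //; have : 2 ^ j < 2 ^ w by rewrite ltn_exp2l.
    by lia.
  have := exec_assign w 2 (Bin Add (Var 2) (Cst 1)) (State (update v 4 (2 ^ j - 1)) mm tp).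
  set st := State (update v 4 _) _ _.
  have -> // : eval w st (Bin Add (Var 2) (Cst 1)) = w - j.
  have -> : eval w st (Bin Add (Var 2) (Cst 1)) = (v 2 + 1 %% 2 ^ w) %% 2 ^ w by [].
  by rewrite one v2 modn_small; have := word_lt_pow; lia.
split=> // z z4 z2; rewrite e3 // /update (negbTE z2) (negbTE z4) //.
Qed.

Lemma prelude_exec mm tp :
  exists2 v, exec w (prelude a d) (State (fun=> 0) mm tp) (10 * w + 16) (State v mm tp)
    & v =1 prelude_vars w L D.
Proof.
have one : 1 %% 2 ^ w = 1 by rewrite modn_small // -[1](expn0 2) ltn_exp2l // word_gt0.
have wlt := word_lt_pow; have w0 := word_gt0.
have aw : a <= w by rewrite leq_pmulr.
set v1 := update (fun=> 0) 4 (2 ^ w - 1).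
have E1 : exec w (Assign 4 (Bin Defs.Sub (Cst 0) (Cst 1))) (State (fun=> 0) mm tp) 4
   (State v1 mm tp).
  have := exec_assign w 4 (Bin Defs.Sub (Cst 0) (Cst 1)) (State (fun=> 0) mm tp).
  set st := State _ _ _.
  have -> // : eval w st (Bin Defs.Sub (Cst 0) (Cst 1)) = 2 ^ w - 1.
  have -> : eval w st (Bin Defs.Sub (Cst 0) (Cst 1)) =
    (0 %% 2 ^ w + 2 ^ w - 1 %% 2 ^ w) %% 2 ^ w by [].
  by rewrite one mod0n add0n modn_small //; have := expn_gt0 2 w; lia.
have [|||v2 E2 [e4 e2 eo]] := @shift_loop w v1 _ _ _ mm tp => //.
  by rewrite /v1 /update subnn.
set v3 := update v2 3 L.
have E3 : exec w (Assign 3 (Bin Div (Var 2) (Cst a))) (State v2 mm tp) 4 (State v3 mm tp).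
  have := exec_assign w 3 (Bin Div (Var 2) (Cst a)) (State v2 mm tp).
  set st := State _ _ _.
  have -> // : eval w st (Bin Div (Var 2) (Cst a)) = L.
  have -> : eval w st (Bin Div (Var 2) (Cst a)) = (v2 2 %/ (a %% 2 ^ w)) %% 2 ^ w by [].
  rewrite e2 (@modn_small a); last by lia.
  rewrite /w mulKn; last by lia.
  by rewrite modn_small //; apply: leq_ltn_trans wlt; rewrite leq_pmull; lia.
set v4 := update v3 vD D.
have E4 : exec w (Assign vD (Bin Shl (Cst 1) (Bin Mul (Var 3) (Cst d)))) (State v3 mm tp) 6
   (State v4 mm tp).
  have := exec_assign w vD (Bin Shl (Cst 1) (Bin Mul (Var 3) (Cst d))) (State v3 mm tp).
  set st := State _ _ _.
  have -> // : eval w st (Bin Shl (Cst 1) (Bin Mul (Var 3) (Cst d))) = D.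
  have -> : eval w st (Bin Shl (Cst 1) (Bin Mul (Var 3) (Cst d))) =
    (1 %% 2 ^ w * 2 ^ ((L * (d %% 2 ^ w)) %% 2 ^ w)) %% 2 ^ w by [].
  rewrite one mul1n (@modn_small d); last by lia.
  have dLw : d * L < w by rewrite ltn_pmul2r //; lia.
  rewrite (@modn_small (L * d)); last by rewrite mulnC; lia.
  by rewrite modn_small mulnC // ltn_exp2l.
exists v4.
  have -> : 10 * w + 16 = 4 + ((10 * w + 2) + (4 + 6)) by lia.
  exact: exec_seq E1 (exec_seq E2 (exec_seq E3 E4)).
move=> z; rewrite /v4 /v3 /prelude_vars /update.
case: eqP => // _; case: (z =P 3) => [->//|z3].
case: (z =P 2) => [->//|z2]; case: (z =P 4) => [->//|z4].
by rewrite eo /v1 /update; repeat case: eqP.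
Qed.

(** The arrays are a view of the flat input: row 0 of array 0 shows its first [D] cells, and an
    input of at most [D] cells leaves all other arrays zero, see [start_zero]. *)
Definition start (input : seq nat) (bits : seq bool) : hst :=
  HS (prelude_vars w L D) (fun a i j => nth 0 input ((a * D + i) * D + j) %% 2 ^ w) bits.

Lemma start_bounded input bits : bounded w (start input bits).
Proof.
split=> [x|*] /=; last by rewrite ltn_mod expn_gt0.
have dLw : d * L < w by rewrite ltn_pmul2r //; lia.
have := word_lt_pow; have Lw : L <= w by rewrite leq_pmull //; lia.
rewrite /prelude_vars; case: ifP => _; first by rewrite ltn_exp2l.
by case: ifP => // _; case: ifP => _ *; [lia | rewrite expn_gt0].
Qed.

Lemma run_program p input bits T :
  wf p -> let h := start input bits in
  norand p || (hcost w D p h <= size bits) ->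
  10 * w + 16 + hcost w D p h <= T ->
  exists2 st, halts_within w (Seq (prelude a d) (comp p)) input bits T st
    & sim w D st (hexec w D p h).
Proof.
move=> wp /= hr hT.
have [v E ev] := prelude_exec (fun i => nth 0 input i %% 2 ^ w) bits.
have [|||st E2 S] := @comp_ok w D word_gt0 _ dim_bound p
    (State v (fun i => nth 0 input i %% 2 ^ w) bits) (start input bits) wp.
- by rewrite expn_gt0.
- by split=> //; exact: start_bounded.
- exact: hr.
exists st => //; exists (10 * w + 16 + hcost w D p (start input bits)) => //.
exact: exec_seq E E2.
Qed.

End Prelude.

(** * Words and exclusive or *)

HB.instance Definition _ := Monoid.isComLaw.Build nat 0 Nat.lxor
  (fun x y z => esym (Nat.lxor_assoc x y z)) Nat.lxor_comm Nat.lxor_0_l.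

Lemma pow_expn x k : Nat.pow x k = x ^ k.
Proof. by elim: k => //= k ->; rewrite expnS. Qed.

Lemma testbit_small x k w : x < 2 ^ w -> w <= k -> Nat.testbit x k = false.
Proof.
move=> hx hk; rewrite Nat.testbit_eqb Nat.div_small // pow_expn.
by apply/ltP/(leq_trans hx); rewrite leq_exp2l.
Qed.

Lemma lt_pow_testbit x w : (forall k, w <= k -> Nat.testbit x k = false) -> x < 2 ^ w.
Proof.
move=> hx; suff -> : x = Nat.modulo x (Nat.pow 2 w).
  by rewrite -pow_expn; apply/ltP/Nat.mod_upper_bound; rewrite pow_expn; apply/eqP; rewrite -lt0n expn_gt0.
apply: Nat.bits_inj => k; case: (leqP w k) => hk.
  by rewrite hx // Nat.mod_pow2_bits_high //; apply/leP.
by rewrite Nat.mod_pow2_bits_low //; apply/ltP.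
Qed.

Lemma lxor_lt x y w : x < 2 ^ w -> y < 2 ^ w -> Nat.lxor x y < 2 ^ w.
Proof.
move=> hx hy; apply: lt_pow_testbit => k hk.
by rewrite Nat.lxor_spec !(@testbit_small _ k w).
Qed.

Lemma land_lt x y w : x < 2 ^ w -> Nat.land x y < 2 ^ w.
Proof. by move=> hx; apply: lt_pow_testbit => k hk; rewrite Nat.land_spec (@testbit_small x k w). Qed.

Lemma big_lxor_lt I (s : seq I) (P : pred I) F w :
  (forall i, P i -> F i < 2 ^ w) -> \big[Nat.lxor/0]_(i <- s | P i) F i < 2 ^ w.
Proof. by move=> hF; elim/big_ind: _ => //; [rewrite expn_gt0 | move=> x y; apply: lxor_lt]. Qed.

Lemma testbit_big I (s : seq I) (P : pred I) F k :
  Nat.testbit (\big[Nat.lxor/0]_(i <- s | P i) F i) k =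
  \big[addb/false]_(i <- s | P i) Nat.testbit (F i) k.
Proof.
apply: (big_morph (fun x => Nat.testbit x k)) => [x y|]; last exact: Nat.bits_0.
by rewrite Nat.lxor_spec; do 2 case: Nat.testbit.
Qed.

(** An XOR rather than a sum, because [READ] and [GETBIT] assemble words in this way. *)
Definition wordof (b : nat -> bool) (w : nat) : nat :=
  \big[Nat.lxor/0]_(k < w) (b k * 2 ^ k).

Lemma testbit_bool_pow (b : bool) j k : Nat.testbit (b * 2 ^ j) k = b && (j == k).
Proof.
case: b; rewrite ?mul0n ?Nat.bits_0 // mul1n -pow_expn Nat.pow2_bits_eqb /=.
by apply/idP/eqP => [/Nat.eqb_eq|->]; last exact/Nat.eqb_eq.
Qed.

Lemma testbit_wordof b w k : Nat.testbit (wordof b w) k = (k < w) && b k.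
Proof.
rewrite /wordof testbit_big.
under eq_bigr do rewrite testbit_bool_pow.
case: (ltnP k w) => hk /=; last first.
  by rewrite big1 // => i _; rewrite (ltn_eqF (leq_trans (ltn_ord i) hk)) andbF.
rewrite (bigD1 (Ordinal hk)) //= eqxx andbT big1 ?addbF // => i.
by rewrite -val_eqE /= => /negbTE->; rewrite andbF.
Qed.

Lemma wordof_lt b w : wordof b w < 2 ^ w.
Proof. by apply: lt_pow_testbit => k hk; rewrite testbit_wordof ltnNge hk. Qed.

Lemma eq_wordof b b' w : (forall k, k < w -> b k = b' k) -> wordof b w = wordof b' w.
Proof. by move=> e; apply: eq_bigr => i _; rewrite e. Qed.

Lemma wordofK x w : x < 2 ^ w -> wordof (Nat.testbit x) w = x.
Proof.
move=> hx; apply: Nat.bits_inj => k; rewrite testbit_wordof; case: ltnP => //= hk.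
by rewrite (testbit_small hx hk).
Qed.

Lemma wordofS b k : wordof b k.+1 = Nat.lxor (wordof b k) (b k * 2 ^ k).
Proof. by rewrite /wordof big_ord_recr. Qed.

Lemma bit_testbit x k : Nat.land (x %/ 2 ^ k) 1 = Nat.testbit x k.
Proof.
have -> : x %/ 2 ^ k = Nat.shiftr x k.
  rewrite Nat.shiftr_div_pow2 pow_expn; set y := 2 ^ k.
  have y0 : 0 < y by rewrite expn_gt0.
  apply: (Nat.div_unique x y (x %/ y) (x %% y)); first exact/ltP/ltn_pmod.
  by rewrite {1}(divn_eq x y) mulnC.
rewrite (Nat.land_ones (Nat.shiftr x k) 1) Nat.pow_1_r.
by rewrite -Nat.bit0_mod Nat.shiftr_spec' Nat.add_0_l; case: Nat.testbit.
Qed.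

Lemma addb_lxor (b c : bool) x :
  ((b (+) c) * x) = Nat.lxor (b * x) (c * x).
Proof.
by case: b; case: c; rewrite [_ (+) _]/= ?mul1n ?mul0n ?Nat.lxor_nilpotent ?Nat.lxor_0_r ?Nat.lxor_0_l.
Qed.

(** * The last cut point before a position *)

(** An interval between consecutive cut points is named by its left end; with 0 as a cut point every
    position lies in one. *)
Definition loc (C : seq nat) (p : nat) : nat := \max_(c <- C | c <= p) c.

Section Locate.
Variable C : seq nat.
Hypothesis C0 : 0 \in C.

Lemma loc_le p : loc C p <= p.
Proof. by apply/bigmax_leqP_seq. Qed.

Lemma leq_loc c p : c \in C -> c <= p -> c <= loc C p.
Proof. by move=> cC cp; apply: (leq_bigmax_seq (F := id)). Qed.

Lemma loc_mem p : loc C p \in C.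
Proof.
have: forall s, {subset s <= C} -> \max_(c <- s | c <= p) c \in C.
  elim=> [_|c s IH sC]; first by rewrite big_nil.
  have IHs := IH (fun z zs => sC z (mem_behead (s := c :: s) zs)).
  rewrite big_cons; case: ifP => // _; rewrite /maxn; case: ifP => // _.
  exact/sC/mem_head.
by apply.
Qed.

Lemma loc_id c : c \in C -> loc C c = c.
Proof. by move=> cC; apply/eqP; rewrite eqn_leq loc_le leq_loc. Qed.

Lemma loc_mono p q : p <= q -> loc C p <= loc C q.
Proof. by move=> pq; apply: leq_loc (loc_mem p) _; apply: leq_trans (loc_le p) pq. Qed.

Lemma loc_eq p q : p <= q -> (forall c, c \in C -> p < c -> c <= q -> false) ->
  loc C p = loc C q.
Proof.
move=> pq no; apply/eqP; rewrite eqn_leq loc_mono //=.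
apply: leq_loc (loc_mem q) _; rewrite leqNgt; apply/negP => h.
by have := no _ (loc_mem q) h (loc_le q).
Qed.

(** In the summation by parts this kills every term whose position is not a cut point. *)
Lemma loc_pred p : 0 < p -> p \notin C -> loc C p.-1 = loc C p.
Proof.
move=> p0 pC; apply: loc_eq => [|c cC h1 h2]; first exact: leq_pred.
have ec : c = p by lia.
by rewrite -ec cC in pC.
Qed.

End Locate.

(* The dyadic blocks whose indices are read off the binary digits of q        *)
(* partition the interval [0, q).                                             *)
Lemma dyadic_cover L c q : q < 2 ^ L ->
  (c < q) = has (fun h => odd (q %/ 2 ^ h) && (c %/ 2 ^ h == (q %/ 2 ^ h).-1)) (iota 0 L).
Proof.
elim: L c q => [|L IH] c q hq; first by rewrite expn0 in hq; have -> : q = 0 by lia.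
rewrite -[L.+1]add1n iotaD has_cat /= orbF expn0 !divn1.
have e : iota (0 + 1) L = map succn (iota 0 L) by rewrite -[0 + 1]addn0 iotaDl.
rewrite e has_map.
rewrite (eq_has (a2 := fun h => odd (q./2 %/ 2 ^ h) && (c./2 %/ 2 ^ h == (q./2 %/ 2 ^ h).-1))); last first.
  by move=> h /=; rewrite expnS -!divn2 -!divnMA.
rewrite -IH; last by rewrite expnS in hq; lia.
apply/idP/orP => [h|[/andP[oq /eqP->]|h]]; last 2 first.
- by case: q oq {hq e} => //= q _; rewrite ltnSn.
- by lia.
(* The lowest bit of q contributes the block consisting of q - 1 alone; the rest is the same claim
   for the halves. *)
have : (c./2 < q./2) || (odd q && (c == q.-1)) by lia.
by case/orP=> ->; [right | left].
Qed.
(** * Counting with coordinate flips *)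

Section Flip.
Variable T : nat.
Implicit Types (r : T.-tuple bool) (A Q : pred (T.-tuple bool)).

(** Flips are measure-preserving involutions; a set of tapes does not depend on coin [k] exactly
    when it is invariant under [flip k]. *)
Definition flip (k : nat) r : T.-tuple bool :=
  [tuple tnth r x (+) (val x == k) | x < T].

Lemma nth_flip k r x : k < T -> nth false (flip k r) x = nth false r x (+) (x == k).
Proof.
move=> kT; case: (ltnP x T) => hx.
  by rewrite -[x]/(val (Ordinal hx)) -tnth_nth tnth_mktuple /= (tnth_nth false).
by rewrite !nth_default ?size_tuple // gtn_eqF // (leq_trans kT).
Qed.

Lemma flipK k : involutive (flip k).
Proof. by move=> r; apply: eq_from_tnth => x; rewrite !tnth_mktuple -addbA addbb addbF. Qed.

Definition invariant_at A k := forall r, A (flip k r) = A r.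

Lemma sum_flip A Q k : invariant_at A k ->
  \sum_(r | A r) Q (flip k r) = \sum_(r | A r) Q r.
Proof.
move=> iA; rewrite (reindex_inj (inv_inj (flipK k))) /=.
by apply: eq_big => r; rewrite ?iA // flipK.
Qed.

Lemma card_sum A Q : #|[pred r | A r && Q r]| = \sum_(r | A r) Q r.
Proof.
rewrite -sum1_card; under [RHS]eq_bigr do rewrite -[nat_of_bool _]/(if _ then 1 else 0).
by rewrite -big_mkcondr.
Qed.

Lemma card_half A k : k < T -> invariant_at A k ->
  2 * #|[pred r | A r && nth false r k]| = #|A|.
Proof.
move=> kT iA; rewrite card_sum mul2n -addnn -[X in X + _](sum_flip _ iA) -big_split /=.
rewrite -sum1_card; apply: eq_bigr => r _; rewrite nth_flip // eqxx.
by case: nth.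
Qed.

(** Average over the four tapes obtained from [r] by the two flips: they all lie in [A] or all
    outside, and at most three of them satisfy [Q]. *)
Lemma card_three_quarters A Q k l : invariant_at A k -> invariant_at A l ->
  (forall r, ~~ [&& Q r, Q (flip k r), Q (flip l r) & Q (flip k (flip l r))]) ->
  4 * #|[pred r | A r && Q r]| <= 3 * #|A|.
Proof.
move=> ik il hQ; rewrite card_sum.
have e1 := sum_flip Q ik; have e2 := sum_flip Q il.
have e3 := sum_flip (fun r => Q (flip k r)) il.
have -> : 4 * \sum_(r | A r) Q r = \sum_(r | A r) (Q r + Q (flip k r) + Q (flip l r)
    + Q (flip k (flip l r))).
  by rewrite !big_split /= e2 e3 e1 !mulSn mul0n addn0 !addnA.
rewrite -sum1_card big_distrr /=; apply: leq_sum => r _.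
by have := hQ r; do 4 case: (Q _).
Qed.

(** Independence: each of the coins of [s] halves the set [A], which depends on none of them. *)
Lemma card_all_ones A (s : seq nat) : uniq s -> all (fun k => k < T) s ->
  (forall k, k \in s -> invariant_at A k) ->
  2 ^ size s * #|[pred r | A r && all (nth false r) s]| = #|A|.
Proof.
elim: s => [|k s IH] /=; first by move=> _ _ _; rewrite mul1n; apply: eq_card => r; rewrite !inE andbT.
move=> /andP[ks us] /andP[kT sT] iA.
rewrite -(IH us sT) => [|k' hk']; last by apply: iA; rewrite inE hk' orbT.
rewrite expnSr -mulnA; congr (_ * _).
rewrite -(@card_half [pred r | A r && all (nth false r) s] k kT) => [|r /=].
  by congr (2 * _); apply: eq_card => r; rewrite !inE /= -!andbA; congr (_ && _); rewrite andbC.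
rewrite (iA k (mem_head _ _)); congr (_ && _); apply: eq_in_all => x xs.
by rewrite nth_flip //; case: eqP xs => [->|]; rewrite ?(negbTE ks) ?addbF.
Qed.

(** The events are treated one after another. It suffices that the flips belonging to event b leave
    the earlier events alone; the conjunction of those plays the part of [A] in
    [card_three_quarters]. *)
Lemma card_all_three_quarters (W : nat) (Q : nat -> pred (T.-tuple bool)) (k l : nat -> nat) :
  (forall b b' r, b < W -> b' < b -> Q b' (flip (k b) r) = Q b' r) ->
  (forall b b' r, b < W -> b' < b -> Q b' (flip (l b) r) = Q b' r) ->
  (forall b r, b < W -> ~~ [&& Q b r, Q b (flip (k b) r), Q b (flip (l b) r)
      & Q b (flip (k b) (flip (l b) r))]) ->
  4 ^ W * #|[pred r : T.-tuple bool | all (fun b => Q b r) (iota 0 W)]| <= 3 ^ W * 2 ^ T.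
Proof.
move=> hk hl hQ.
have {hk hl hQ} : forall V, V <= W ->
  4 ^ V * #|[pred r : T.-tuple bool | all (fun b => Q b r) (iota 0 V)]| <= 3 ^ V * 2 ^ T.
  elim=> [_|V IH VW].
    by rewrite !expn0 !mul1n -[X in _ <= X ^ _]card_bool -card_tuple max_card.
  have /= := @card_three_quarters [pred r | all (fun b => Q b r) (iota 0 V)] (Q V) (k V) (l V).
  have X r : all (fun b => Q b r) (iota 0 V.+1) = all (fun b => Q b r) (iota 0 V) && Q V r.
    by rewrite -addn1 iotaD all_cat /= andbT.
  have -> : #|[pred r : T.-tuple bool | all (fun b => Q b r) (iota 0 V.+1)]| =
      #|[pred r | all (fun b => Q b r) (iota 0 V) && Q V r]|.
    by apply: eq_card => r; apply: X.
  move=> H; have {}H := H _ _ _; have {}IH := IH (ltnW VW).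
  rewrite !expnSr; set c := #|_| in H IH *.
  suff : 4 * c <= 3 * #|[pred r : T.-tuple bool | all (fun b => Q b r) (iota 0 V)]| by nia.
  apply: H => [r|r|r]; last exact: hQ.
    by rewrite /=; apply: eq_in_all => b; rewrite mem_iota => hb; apply: hk => //; lia.
  by rewrite /=; apply: eq_in_all => b; rewrite mem_iota => hb; apply: hl => //; lia.
by apply.
Qed.

End Flip.

(** * Merging classes *)

(* A partition is given by the representative of each element; the second     *)
(* component is the size of the class of a representative, minus one.         *)
Definition ufs := ((nat -> nat) * (nat -> nat))%type.

Definition ulink (s : ufs) (a b : nat) : ufs :=
  (fun z => if s.1 z == a then b else s.1 z,
   fun z => if z == b then s.2 b + s.2 a + 1 else s.2 z).

Definition umerge (s : ufs) (x y : nat) : ufs :=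
  let a := s.1 x in let b := s.1 y in
  if a == b then s else if s.2 b < s.2 a then ulink s b a else ulink s a b.

Definition umerges (s : ufs) (l : seq (nat * nat)) : ufs :=
  foldl (fun s xy => umerge s xy.1 xy.2) s l.

(** A merge is a map [h] on representatives. In this form the merges of a whole phase compose, and
    each new class is a union of fibres of [h]. *)
Lemma umerge_coarse s x y : exists2 h : nat -> nat,
  (umerge s x y).1 =1 h \o s.1 & h (s.1 x) = h (s.1 y).
Proof.
rewrite /umerge; case: eqP => [e|ne]; first by exists id; rewrite //= e.
case: ifP => _.
  exists (fun z => if z == s.1 y then s.1 x else z) => //=.
  by rewrite eqxx; case: eqP.
exists (fun z => if z == s.1 x then s.1 y else z) => //=.
by rewrite eqxx; case: eqP.
Qed.

Lemma umerges_coarse s l : exists2 h : nat -> nat,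
  (umerges s l).1 =1 h \o s.1 & forall xy, xy \in l -> h (s.1 xy.1) = h (s.1 xy.2).
Proof.
elim: l s => [|xy l IH] s; first by exists id.
have [h1 e1 m1] := umerge_coarse s xy.1 xy.2.
have [h2 e2 m2] := IH (umerge s xy.1 xy.2).
exists (h2 \o h1) => [z|xy']; first by rewrite /= e2 /= e1.
rewrite inE => /predU1P[->|hl]; first by rewrite /= m1.
by have := m2 _ hl; rewrite !e1.
Qed.

(** * Merging related elements keeps classes within the relation *)

Section Sound.
Variables (C : seq nat) (Con : rel nat).
Hypotheses (Crefl : reflexive Con) (Csym : symmetric Con) (Ctrans : transitive Con).

Definition valid (s : ufs) : Prop :=
  {in C, forall c, s.1 c \in C} /\
  {in C &, forall c c', s.1 c = s.1 c' -> Con c c'}.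

Lemma umerge_valid s x y : x \in C -> y \in C -> s.1 x = s.1 y \/ Con x y ->
  valid s -> valid (umerge s x y).
Proof.
move=> xC yC hxy vs; rewrite /umerge; case: eqP => // ne.
case: hxy => // cxy.
(* As [Con] is symmetric, it does not matter which of the two classes absorbs the other. *)
wlog : x y xC yC cxy ne / ~~ (s.2 (s.1 y) < s.2 (s.1 x)).
  move=> H; case: ifP => [lt|/negbT ge].
    have := H y x yC xC; rewrite Csym => /(_ cxy (fun e => ne (esym e))).
    have nlt : ~~ (s.2 (s.1 x) < s.2 (s.1 y)) by rewrite -leqNgt ltnW.
    by move=> /(_ nlt); rewrite (negbTE nlt).
  by have := H x y xC yC cxy ne ge; rewrite (negbTE ge).
move=> /negbTE->; case: vs => v1 v2; split=> [c cC|c c' cC c'C] /=.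
  by case: ifP => _; apply: v1.
have H d d' : d \in C -> d' \in C -> s.1 d = s.1 x -> s.1 d' = s.1 y -> Con d d'.
  by move=> dC d'C e e'; apply: Ctrans (v2 _ _ dC xC e) (Ctrans cxy (v2 _ _ yC d'C (esym e'))).
case: eqP => [e|_]; case: eqP => [e'|_].
- by move=> _; apply: v2; rewrite // e.
- by move=> e2; apply: H.
- by move=> e2; rewrite Csym; apply: H.
- exact: v2.
Qed.

(** Trivial pairs are allowed because a class with no passing test proposes the pair (0, 0). *)
Lemma umerges_valid s l : valid s ->
  {in l, forall xy, [/\ xy.1 \in C, xy.2 \in C & xy.1 = xy.2 \/ Con xy.1 xy.2]} ->
  valid (umerges s l).
Proof.
elim: l s => [|xy l IH] s vs hl //=; apply: IH.
  have [x1 x2 h] := hl xy (mem_head _ _); apply: umerge_valid => //.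
  by case: h => [->|]; [left | right].
by move=> z zl; apply: hl; rewrite inE zl orbT.
Qed.

End Sound.
(** * Boruvka phases driven by random sketches *)

Section Process.
Variables (n m w J : nat) (pu pv : nat -> nat) (F : pred nat) (C Q : seq nat).

(** The coins of one edge in one phase: the two words of the AND test and one coin per sampling
    level. Coins are ordered by phase first, so that the past of a phase is a prefix of the tape. *)
Definition rbits := w + w + J.
Definition xbit (r : seq bool) (i e k : nat) := nth false r ((i * m + e) * rbits + k).
Definition ybit r i e k := xbit r i e (w + k).
Definition lbit r i e k := xbit r i e (w + w + k).

(** Requiring the first j level coins samples at rate 2 ^ -j with nested samples. *)
Definition sampled r i e j := all (lbit r i e) (iota 0 j).

Definition sval r i e (q : nat) : nat :=
  match q with
  | 0 => wordof (xbit r i e) w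
  | 1 => wordof (ybit r i e) w
  | 2 => Nat.land (wordof (xbit r i e) w) (wordof (ybit r i e) w)
  | 3 => pu e
  | _ => pv e
  end.

Definition crossing (rt : nat -> nat) (rho e : nat) : bool :=
  ~~ F e && ((rt (loc C (pu e)) == rho) (+) (rt (loc C (pv e)) == rho)).

Definition tsum r i rt rho j q : nat :=
  \big[Nat.lxor/0]_(e < m | crossing rt rho e && sampled r i e j) sval r i e q.

(** An empty sample gives 0 for both ends and is rejected by the first test, while a single edge has
    distinct ends. The AND test is meant to reject samples of two or more edges. *)
Definition passes r i rt rho j : bool :=
  (tsum r i rt rho j 3 != tsum r i rt rho j 4) &&
  (tsum r i rt rho j 2 == Nat.land (tsum r i rt rho j 0) (tsum r i rt rho j 1)).

Definition cand r i rt rho : nat * nat :=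
  foldl (fun uv j => if passes r i rt rho j
                     then (tsum r i rt rho j 3, tsum r i rt rho j 4) else uv)
    (0, 0) (iota 0 J).

Definition cand_loc r i rt rho : nat * nat :=
  (loc C (cand r i rt rho).1, loc C (cand r i rt rho).2).

Definition pstep r i (s : ufs) : ufs := umerges s (map (cand_loc r i s.1) Q).

Fixpoint proc r i : ufs :=
  if i is i'.+1 then pstep r i' (proc r i') else (id, fun=> 0).

(* Two sampled crossing edges that pass for a single one. *)
Definition false_positive r i rt (rho : 'I_n) (j : 'I_J) (e1 e2 : 'I_m) : bool :=
  [&& e1 != e2, crossing rt rho e1 && crossing rt rho e2,
      sampled r i e1 j && sampled r i e2 j & passes r i rt rho j].

Definition FP r i rt := [exists rho, exists j, exists e1, exists e2,
  false_positive r i rt rho j e1 e2].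

Definition okp r i := all (fun i' => ~~ FP r i' (proc r i').1) (iota 0 i).

Definition unfinished rt (rho : 'I_n) := [exists e : 'I_m, crossing rt rho e].

Definition isolated r i rt (rho : 'I_n) :=
  [exists j : 'I_J, #|[set e : 'I_m | crossing rt rho e && sampled r i e j]| == 1].

Definition nunf rt := #|[pred rho | unfinished rt rho]|.

Definition agree k (r r' : seq bool) := forall x, x < k -> nth false r x = nth false r' x.

Lemma xbit_agree i r r' e k : agree (i.+1 * m * rbits) r r' -> e < m -> k < rbits ->
  xbit r i e k = xbit r' i e k.
Proof.
move=> ag em kr; apply: ag.
have h : i * m + e < i.+1 * m by rewrite mulSn; lia.
have : (i * m + e).+1 * rbits <= i.+1 * m * rbits by rewrite leq_mul2r h orbT.
by rewrite mulSn; lia.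
Qed.

Lemma sampled_agree i r r' e j : agree (i.+1 * m * rbits) r r' -> e < m -> j <= J ->
  sampled r i e j = sampled r' i e j.
Proof.
move=> ag em jJ; apply: eq_in_all => k; rewrite mem_iota => hk.
by apply: xbit_agree => //; rewrite /rbits; lia.
Qed.

Lemma tsum_agree i r r' rt rho j q : agree (i.+1 * m * rbits) r r' -> j <= J ->
  tsum r i rt rho j q = tsum r' i rt rho j q.
Proof.
move=> ag jJ; apply: eq_big => e.
  by rewrite (sampled_agree ag (ltn_ord e) jJ).
move=> _; have E1 : wordof (xbit r i e) w = wordof (xbit r' i e) w.
  by apply: eq_wordof => k kw; apply: xbit_agree => //; rewrite /rbits; lia.
have E2 : wordof (ybit r i e) w = wordof (ybit r' i e) w.
  by apply: eq_wordof => k kw; apply: xbit_agree => //; rewrite /rbits; lia.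
by case: q => [|[|[|]]] //=; rewrite E1 E2.
Qed.

Lemma passes_agree i r r' rt rho j : agree (i.+1 * m * rbits) r r' -> j <= J ->
  passes r i rt rho j = passes r' i rt rho j.
Proof. by move=> ag jJ; rewrite /passes !(tsum_agree _ _ _ ag jJ). Qed.

Lemma agree_sub k k' r r' : k' <= k -> agree k r r' -> agree k' r r'.
Proof. by move=> kk ag x xk; apply: ag; lia. Qed.

(** The partition before phase [i] is independent of the coins of phase [i]; all conditioning in the
    probability analysis rests on this. *)
Lemma proc_agree i r r' : agree (i * m * rbits) r r' -> proc r i = proc r' i.
Proof.
elim: i => // i IH ag /=.
have {}IH : proc r i = proc r' i.
  by apply/IH/(agree_sub _ ag); rewrite -!mulnA leq_mul2r leqnSn orbT.
rewrite IH /pstep; congr umerges; apply: eq_map => q.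
rewrite /cand_loc; suff -> : cand r i (proc r' i).1 q = cand r' i (proc r' i).1 q by [].
rewrite /cand; move: (0, 0); have : {subset iota 0 J <= [pred j | j < J]}.
  by move=> j; rewrite mem_iota.
elim: (iota 0 J) => //= j s IHs sJ uv.
have jJ : j <= J by have := sJ j (mem_head _ _); rewrite inE => /ltnW.
rewrite (passes_agree _ _ ag jJ) !(tsum_agree _ _ _ ag jJ); apply: IHs => z zs.
by apply: sJ; rewrite inE zs orbT.
Qed.

Lemma okp_agree i r r' : agree (i * m * rbits) r r' -> okp r i = okp r' i.
Proof.
move=> ag; apply: eq_in_all => k; rewrite mem_iota /= => hk.
have le1 : k.+1 * m * rbits <= i * m * rbits by rewrite -!mulnA leq_mul2r; lia.
have ag1 := agree_sub le1 ag.
rewrite (proc_agree (r' := r') (agree_sub _ ag1)); last by rewrite -!mulnA leq_mul2r leqnSn orbT.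
congr (~~ _); rewrite /FP; apply: eq_existsb => rho; apply: eq_existsb => j.
apply: eq_existsb => e1; apply: eq_existsb => e2; rewrite /false_positive.
have jJ := ltnW (ltn_ord j).
by rewrite (passes_agree _ _ ag1 jJ) !(sampled_agree ag1 (ltn_ord _) jJ).
Qed.

Lemma okpS r i : okp r i.+1 = okp r i && ~~ FP r i (proc r i).1.
Proof. by rewrite /okp -(addn1 i) iotaD all_cat /= andbT. Qed.

(** ** Deterministic progress *)

Section Progress.
Variable Con : rel nat.
Hypotheses (Crefl : reflexive Con) (Csym : symmetric Con) (Ctrans : transitive Con).
Hypotheses (C0 : 0 \in C) (Cn : {in C, forall c, c < n}) (CQ : {subset C <= Q}).
Hypothesis Qn : {in Q, forall q, q < n}.
Hypothesis puv : forall e, e < m -> pu e != pv e.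
Hypothesis Ccross : forall e, e < m -> ~~ F e -> loc C (pu e) != loc C (pv e) ->
  Con (loc C (pu e)) (loc C (pv e)).

Let crossing_loc rt rho e : crossing rt rho e -> loc C (pu e) != loc C (pv e).
Proof. by case/andP=> _; apply: contraTneq => ->; rewrite addbb. Qed.

Lemma tsum_single r i rt rho j q (e : 'I_m) :
  [set e : 'I_m | crossing rt rho e && sampled r i e j] = [set e] ->
  tsum r i rt rho j q = sval r i e q.
Proof.
move=> /setP E; rewrite /tsum (big_pred1 e) // => e'.
by have := E e'; rewrite !inE.
Qed.

(** Two sampled edges would be a false positive and none would fail the first test, so the sample is
    a single edge and the XORs are its own words. *)
Lemma passes_edge r i rt (rho : nat) j : rho < n -> j < J -> ~~ FP r i rt ->
  passes r i rt rho j ->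
  exists2 e : 'I_m, crossing rt rho e &
    (tsum r i rt rho j 3, tsum r i rt rho j 4) = (pu e, pv e).
Proof.
move=> rn jJ nfp ps; set S := [set e : 'I_m | crossing rt rho e && sampled r i e j].
have S1 : #|S| <= 1.
  rewrite leqNgt; apply/negP => /card_gt1P[e1 [e2 []]].
  rewrite !inE => /andP[c1 s1] /andP[c2 s2] ne.
  case/existsP: nfp; exists (Ordinal rn); apply/existsP; exists (Ordinal jJ).
  apply/existsP; exists e1; apply/existsP; exists e2.
  by rewrite /false_positive /= ne c1 c2 s1 s2.
have : #|S| != 0.
  apply/negP=> /eqP/cards0_eq/setP E; case/andP: ps; rewrite /tsum !big_pred0 // => e;
    by have := E e; rewrite !inE.
move=> S0; have /cards1P[e Se] : #|S| == 1 by lia.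
exists e; last by rewrite !(tsum_single _ Se).
by have := set11 e; rewrite -Se inE => /andP[].
Qed.

Lemma isolated_passes r i rt (rho : 'I_n) : isolated r i rt rho ->
  exists2 j, j < J & passes r i rt rho j.
Proof.
case/existsP=> j /cards1P[e Se]; exists (nat_of_ord j) => //.
by rewrite /passes !(tsum_single _ Se) /= eqxx puv.
Qed.

Lemma cand_spec r i rt (rho : nat) : rho < n -> ~~ FP r i rt ->
  (cand r i rt rho = (0, 0) /\ (forall j, j < J -> ~~ passes r i rt rho j)) \/
  (exists2 e : 'I_m, crossing rt rho e & cand r i rt rho = (pu e, pv e)).
Proof.
move=> rn nfp; rewrite /cand.
have : forall K, K <= J -> let c := foldl (fun uv j => if passes r i rt rho j
      then (tsum r i rt rho j 3, tsum r i rt rho j 4) else uv) (0, 0) (iota 0 K) in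
   (c = (0, 0) /\ (forall j, j < K -> ~~ passes r i rt rho j)) \/
   (exists2 e : 'I_m, crossing rt rho e & c = (pu e, pv e)).
  elim=> [_|K IH KJ]; first by left.
  rewrite -(addn1 K) iotaD foldl_cat /= add0n; case: ifP => ps.
    by right; apply: passes_edge.
  case: (IH (ltnW KJ)) => [[-> h]|]; [left | by right].
  split=> // j; rewrite addn1 ltnS leq_eqVlt => /predU1P[->|]; first by rewrite ps.
  exact: h.
by apply.
Qed.

Lemma pstep_valid r i s : ~~ FP r i s.1 -> valid C Con s -> valid C Con (pstep r i s).
Proof.
move=> nfp vs; apply: umerges_valid => // xy /mapP[q qQ ->] /=.
split; [exact: loc_mem | exact: loc_mem |].
case: (cand_spec (Qn qQ) nfp) => [[-> _]|[e ce ->]]; first by left.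
right; apply: Ccross => //; first by case/andP: ce.
exact: crossing_loc ce.
Qed.

(** Charging argument: an unfinished old class weighs 1 if it isolates a leaving edge and 2
    otherwise. Each unfinished new class contains old classes of total weight at least 2, and the
    total weight is twice the number of unfinished classes minus the number of isolating ones. *)
Lemma pstep_count r i s : ~~ FP r i s.1 -> valid C Con s ->
  2 * nunf (pstep r i s).1 +
    #|[pred rho | unfinished s.1 rho && isolated r i s.1 rho]| <= 2 * nunf s.1.
Proof.
move=> nfp vs; set s' := pstep r i s.
have [h eh mh] := umerges_coarse s (map (cand_loc r i s.1) Q).
change (s'.1 =1 h \o s.1) in eh.
have rtC p : s.1 (loc C p) \in C by case: vs => v1 _; apply/v1/loc_mem.
pose rho_of p : 'I_n := Ordinal (Cn (rtC p)).
have hn rho : (s'.1 (loc C rho)) < n.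
  by apply: Cn; have [v1 _] := pstep_valid nfp vs; apply/v1/loc_mem.
pose wt (rho : 'I_n) := 2 - isolated r i s.1 rho.
have unfP rt (rho : 'I_n) : reflect (exists e : 'I_m, crossing rt rho e) (unfinished rt rho).
  exact: existsP.
have cr_u e : e < m -> ~~ F e -> s.1 (loc C (pu e)) != s.1 (loc C (pv e)) ->
    crossing s.1 (s.1 (loc C (pu e))) e && crossing s.1 (s.1 (loc C (pv e))) e.
  by move=> em nF ne; rewrite /crossing nF eqxx eq_sym (negbTE ne) eqxx.
(* An edge leaving the new class also leaves one of the old classes inside it, [rho] below. If [rho]
   isolates no edge, it has weight 2 alone. *)
have key (rho' : 'I_n) : unfinished s'.1 rho' ->
   2 <= \sum_(rho | unfinished s.1 rho && (h rho == rho')) wt rho.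
  case/unfP=> e /andP[nF cr].
  have {cr} [p [ep ne]] : exists p, h (s.1 (loc C p)) = rho' /\
       exists e : 'I_m, crossing s.1 (s.1 (loc C p)) e.
    have ne : s.1 (loc C (pu e)) != s.1 (loc C (pv e)).
      by apply: contraTneq cr; rewrite !eh /= => ->; rewrite addbb.
    have /andP[cu cv] := cr_u e (ltn_ord e) nF ne.
    move: cr; rewrite !eh /=; case: eqP => [<- _|_ /= /eqP <-].
      by exists (pu e); split=> //; exists e.
    by exists (pv e); split=> //; exists e.
  set rho := rho_of p.
  have urho : unfinished s.1 rho by apply/unfP.
  rewrite (bigD1 rho) /=; last by rewrite urho ep eqxx.
  rewrite {1}/wt; case iso : (isolated r i s.1 rho) => //.
  rewrite -[2]addn1 leq_add //.
  have [j jJ ps] := isolated_passes iso.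
  case: (cand_spec (ltn_ord rho) nfp) => [[_ /(_ j jJ)]|[e' ce' cd]]; first by rewrite ps.
  have mrg : h (s.1 (loc C (pu e'))) = h (s.1 (loc C (pv e'))).
    have := mh (cand_loc r i s.1 rho); rewrite /cand_loc cd /=; apply.
    by apply/mapP; exists (val rho); rewrite ?/cand_loc ?cd //; apply/CQ/rtC.
  have nF' : ~~ F e' by case/andP: ce'.
  have ne' : s.1 (loc C (pu e')) != s.1 (loc C (pv e')).
    by apply: contraTneq ce' => e0; rewrite /crossing e0 addbb andbF.
  have /andP[cu cv] := cr_u e' (ltn_ord e') nF' ne'.
  (* The edge [e'] proposed by [rho] has been merged, so the old class at its other end lies in
     [rho'] as well. That class is unfinished too, because [e'] leaves it, and it supplies the
     missing unit. *)
  have [q hq [cq nq]] : exists2 q, h (s.1 (loc C q)) = rho' &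
      crossing s.1 (s.1 (loc C q)) e' /\ s.1 (loc C q) != rho.
    case/andP: ce' => _; case: eqP => /= [eu ev|nu /eqP ev].
      exists (pv e'); first by rewrite -mrg eu.
      by split=> //.
    exists (pu e'); first by rewrite mrg ev.
    by split=> //; apply/eqP.
  rewrite (bigD1 (rho_of q)) /=; last first.
    by rewrite hq eqxx andbT -val_eqE /= nq andbT; apply/unfP; exists e'.
  by apply: leq_trans (leq_addr _ _); rewrite /wt; case: isolated.
have sumwt : \sum_(rho | unfinished s.1 rho) wt rho +
    #|[pred rho | unfinished s.1 rho && isolated r i s.1 rho]| = 2 * nunf s.1.
  have -> : #|[pred rho | unfinished s.1 rho && isolated r i s.1 rho]| =
      \sum_(rho | unfinished s.1 rho) isolated r i s.1 rho.
    rewrite -sum1_card big_mkcondr.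
    by apply: eq_bigr => rho _; case: isolated.
  have -> : 2 * nunf s.1 = \sum_(rho | unfinished s.1 rho) 2.
    by rewrite mulnC -sum_nat_const.
  rewrite -big_split /=; apply: eq_bigr => rho _; rewrite /wt.
  by case: isolated.
rewrite -sumwt leq_add2r mulnC /nunf -sum_nat_const.
have hle (rho : 'I_n) : unfinished s.1 rho -> h rho < n.
  case/unfP=> e /andP[_]; case: eqP => [<- _|_ /= /eqP<-].
    by have := hn (pu e); rewrite eh.
  by have := hn (pv e); rewrite eh.
case: (posnP n) => [n0|n0]; first by rewrite big_pred0 // => rho; have := ltn_ord rho; rewrite {2}n0.
pose hO (rho : 'I_n) : 'I_n := insubd (Ordinal n0) (h rho).
rewrite [leqRHS](partition_big hO predT) //=.
rewrite big_mkcond; apply: leq_sum => rho' _; case: ifP => // /key hk.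
apply: leq_trans hk _; rewrite [leqRHS](eq_bigl (fun rho => unfinished s.1 rho && (h rho == rho'))) //.
move=> rho; case u : (unfinished s.1 rho) => //=.
by rewrite -val_eqE /hO val_insubd hle.
Qed.

Lemma proc_valid r i : okp r i -> valid C Con (proc r i).
Proof.
elim: i => [_|i IH]; first by split=> //= c c' _ _ ->.
rewrite okpS => /andP[ok nfp].
by apply: pstep_valid => //; apply: IH.
Qed.

Lemma finished_eq r i : nunf (proc r i).1 = 0 -> okp r i ->
  forall e, e < m -> ~~ F e ->
    (proc r i).1 (loc C (pu e)) = (proc r i).1 (loc C (pv e)).
Proof.
move=> N0 ok e em nF; apply/eqP; apply/idPn => ne.
have [v1 _] := proc_valid ok.
have rn : (proc r i).1 (loc C (pu e)) < n by apply: Cn; apply: v1; apply: loc_mem.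
have := card0_eq N0 (Ordinal rn); rewrite !inE => /existsP[].
by exists (Ordinal em); rewrite /crossing /= nF eqxx eq_sym (negbTE ne).
Qed.

End Progress.
End Process.
(** * Failure probability of the phases *)

Section Failure.
Variables (n m w J P T : nat) (pu pv : nat -> nat) (F : pred nat) (C Q : seq nat).
Hypothesis TP : P * m * rbits w J <= T.
Hypothesis mJ : m < 2 ^ J.-2.

Let rb := rbits w J.
Let crd i e t := (i * m + e) * rb + t.

Implicit Types (r : T.-tuple bool).
Local Notation sampled := (sampled m w J).
Local Notation xbit := (xbit m w J).
Local Notation ybit := (ybit m w J).
Local Notation proc r i := (@proc m w J pu pv F C Q r i).
Local Notation okp r i := (@okp n m w J pu pv F C Q r i).
Local Notation crossing := (crossing pu pv F C).
Local Notation tsum := (tsum m w J pu pv F C).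

Lemma crd_lt i e t : i < P -> e < m -> t < rb -> crd i e t < T.
Proof.
move=> iP em tr; apply: leq_trans TP.
have h : i * m + e < P * m.
  have : i.+1 * m <= P * m by rewrite leq_mul2r iP orbT.
  by rewrite mulSn; lia.
have : (i * m + e).+1 * rb <= P * m * rb by rewrite leq_mul2r h orbT.
by rewrite /crd mulSn; lia.
Qed.

Lemma crd_eq i e t e' t' : e < m -> e' < m -> t < rb -> t' < rb ->
  (crd i e t == crd i e' t') = (e == e') && (t == t').
Proof.
move=> em em' tr tr'; have r0 : 0 < rb by lia.
apply/eqP/andP=> [E|[/eqP-> /eqP->] //].
have et : t = t' by have := congr1 (modn^~ rb) E; rewrite /crd !modnMDl !modn_small.
have := congr1 (divn^~ rb) E; rewrite /crd !divnMDl // !(divn_small tr, divn_small tr') !addn0.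
by move/addnI->; rewrite et !eqxx.
Qed.

Lemma flip_agree i e t r : i < P -> e < m -> t < rb ->
  agree (i * m * rb) (flip (crd i e t) r) r.
Proof.
move=> iP em tr x hx; rewrite nth_flip ?crd_lt // ltn_eqF ?addbF //.
by rewrite /crd mulnDl; apply: leq_trans hx _; lia.
Qed.

Lemma xbit_flip i e t r e' t' : i < P -> e < m -> t < rb -> e' < m -> t' < rb ->
  xbit (flip (crd i e t) r) i e' t' = xbit r i e' t' (+) ((e' == e) && (t' == t)).
Proof. by move=> iP em tr em' tr'; rewrite /xbit nth_flip ?crd_lt // -[_ == crd _ _ _]/(crd i e' t' == _) crd_eq. Qed.

Lemma proc_flip i e t r : i < P -> e < m -> t < rb ->
  proc (flip (crd i e t) r) i = proc r i.
Proof. by move=> iP em tr; apply/proc_agree/flip_agree. Qed.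

Lemma okp_flip i e t r : i < P -> e < m -> t < rb ->
  okp (flip (crd i e t) r) i = okp r i.
Proof. by move=> iP em tr; apply/okp_agree/flip_agree. Qed.

Lemma sampled_flip i e t r e' j : i < P -> e < m -> t < w + w -> e' < m -> j <= J ->
  sampled (flip (crd i e t) r) i e' j = sampled r i e' j.
Proof.
move=> iP em tr em' jJ; apply: eq_in_all => k; rewrite mem_iota => hk.
by rewrite /lbit xbit_flip //; rewrite /rb /rbits; lia.
Qed.

(** ** Isolating one crossing edge *)

Lemma sampled_ones r i e j :
  sampled r i e j = all (nth false r) (map (fun k => crd i e (w + w + k)) (iota 0 j)).
Proof. by rewrite all_map. Qed.

(** With x = k / M between 1/4 and 1/2, the fraction of tapes with exactly one sampled edge is at
    least x - x^2, which exceeds 1/8. *)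
Lemma second_moment_arith M k z y o a : 0 < k -> M <= 4 * k -> 2 * k <= M ->
  z <= o + y -> M * z = k * a -> M * M * y = k * (k.-1 * a) -> a <= 8 * o.
Proof.
move=> k0 M1 M2 H hz hy; have M0 : 0 < M by lia.
have e1 : M * k * a <= M * M * o + k * (k.-1 * a).
  by rewrite -hy -mulnA -hz mulnA -mulnDr leq_mul2l H orbT.
have e3 : k * k.-1 <= M * k by nia.
(* Expand (4k - M)(M - 2k) >= 0. *)
have e2 : M * M <= 8 * (M * k - k * k.-1).
  have : (4 * k - M) * (M - 2 * k) + (M * M + 8 * (k * k)) = 6 * (k * M) by nia.
  have : k * k.-1 <= k * k by rewrite leq_mul2l leq_pred orbT.
  rewrite (mulnC M k); clear.
  move: ((4 * k - M) * (M - 2 * k)) (M * M) (k * k) (k * M) (k * k.-1) => Z A B X Y.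
  by lia.
rewrite -(leq_pmul2l (m := M * M)) ?muln_gt0 ?M0 //.
apply: (@leq_trans (8 * (M * k - k * k.-1) * a)); first by rewrite leq_mul2r e2 orbT.
rewrite mulnCA -mulnA leq_mul2l /= mulnBl -mulnA; lia.
Qed.

(** Second moment method at the level whose rate is about 1/|X|; only pairwise independence of the
    samples is used. *)
Lemma isolate_card (A : pred (T.-tuple bool)) (X : {set 'I_m}) i : i < P -> X != set0 ->
  (forall e t, e < m -> t < rb -> invariant_at A (crd i e t)) ->
  #|A| <= 8 * #|[pred r : T.-tuple bool | A r && [exists j : 'I_J,
                   #|[set e in X | sampled r i e j]| == 1]]|.
Proof.
move=> iP X0 iA; set k := #|X|.
have k0 : 0 < k by rewrite card_gt0.
have km : k <= m by rewrite -[m]card_ord max_card.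
(* This level makes 2 ^ j lie between 2k and 4k; [mJ] ensures that it exists. *)
set l := trunc_log 2 k; set j := l.+2.
have /andP[l1 l2] : 2 ^ l <= k < 2 ^ l.+1 by apply: trunc_log_bounds.
have jJ : j < J.
  have : 2 ^ l < 2 ^ J.-2 by apply: leq_ltn_trans l1 (leq_ltn_trans km mJ).
  by rewrite ltn_exp2l // /j; lia.
set M := 2 ^ j.
have [M1 M2] : M <= 4 * k /\ 2 * k <= M.
  by rewrite /M /j !expnS in l2 *; split; lia.
pose crds e := map (fun t => crd i e (w + w + t)) (iota 0 j).
have crdsP e x : x \in crds e -> exists2 t, t < rb & x = crd i e t.
  case/mapP=> t; rewrite mem_iota => ht ->; exists (w + w + t) => //.
  by rewrite /rb /rbits; lia.
have crdsU (e : 'I_m) : uniq (crds e).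
  rewrite map_inj_in_uniq ?iota_uniq // => t t'; rewrite !mem_iota => ht ht'.
  have tr : w + w + t < rb by rewrite /rb /rbits; lia.
  have tr' : w + w + t' < rb by rewrite /rb /rbits; lia.
  by move=> /= /eqP; rewrite crd_eq // => /andP[_ /eqP /addnI].
have crdsT (e : 'I_m) : all (fun x => x < T) (crds e).
  by apply/allP => x /crdsP[t tr ->]; apply: crd_lt.
have crdsI (e : 'I_m) x : x \in crds e -> invariant_at A x.
  by case/crdsP=> t tr ->; apply: iA.
pose s (e : 'I_m) r := sampled r i e j.
have sz e : size (crds e) = j by rewrite size_map size_iota.
have S1 (e : 'I_m) : M * #|[pred r : T.-tuple bool | A r && s e r]| = #|A|.
  by rewrite -(card_all_ones (crdsU e) (crdsT e) (@crdsI e)) sz; congr (_ * _);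
    apply: eq_card => r; rewrite !inE /s sampled_ones.
have S2 (e e' : 'I_m) : e != e' -> M * M * #|[pred r : T.-tuple bool | A r && (s e r && s e' r)]| = #|A|.
  move=> ne; have <- := @card_all_ones T A (crds e ++ crds e').
  - rewrite size_cat !sz expnD; congr (_ * _); apply: eq_card => r.
    by rewrite !inE all_cat /s !sampled_ones.
  - rewrite cat_uniq !crdsU andTb andbT; apply/hasPn => x /crdsP[t tr ->].
    apply/negP => /crdsP[t' tr'] /eqP; rewrite crd_eq // => /andP[/eqP ee _].
    by case/eqP: ne; apply: val_inj.
  - by rewrite all_cat !crdsT.
  - by move=> x; rewrite mem_cat => /orP[]; apply: crdsI.
pose Z r := \sum_(e in X) s e r.
pose Y r := \sum_(e in X) \sum_(e' in X | e' != e) (s e r && s e' r).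
pose one r : bool := #|[set e in X | s e r]| == 1.
have ZE r : #|[set e in X | s e r]| = Z r.
  rewrite -sum1dep_card big_mkcondr; apply: eq_bigr => e _.
  by case: (s e r).
(* [Y] counts ordered pairs of distinct sampled edges, that is Z(Z - 1), which is at least Z as soon
   as Z >= 2. *)
have pointwise r : Z r <= one r + Y r.
  have : Z r * Z r = Z r + Y r.
    rewrite /Z /Y big_distrl -big_split /=; apply: eq_bigr => e eX.
    rewrite big_distrr (bigD1 e) //=; congr (_ + _); first by case: (s e r).
    by apply: eq_bigr => e' _; case: (s e r); case: (s e' r).
  rewrite /one ZE; case: (Z r) => [|[|z]] //=.
  by move: (Y r) => y h; nia.
have sumZ : M * \sum_(r | A r) Z r = k * #|A|.
  rewrite exchange_big /= big_distrr /= -sum_nat_const; apply: eq_bigr => e eX.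
  by rewrite -(S1 e) card_sum.
have sumY : M * M * \sum_(r | A r) Y r = k * (k.-1 * #|A|).
  rewrite exchange_big /= big_distrr /= -sum_nat_const; apply: eq_bigr => e eX.
  rewrite exchange_big /= big_distrr /=.
  have -> : k.-1 = #|[pred e' in X | e' != e]|.
    rewrite /k (cardD1 e) eX /=; apply: eq_card => e'; rewrite !inE andbC //.
  rewrite -sum_nat_const; apply: eq_big => [e'|e' /andP[_ ne]]; first by rewrite !inE.
  by rewrite -(S2 e e') 1?eq_sym // card_sum.
have H : \sum_(r | A r) Z r <= \sum_(r | A r) one r + \sum_(r | A r) Y r.
  by rewrite -big_split; apply: leq_sum => r _; apply: pointwise.
apply: (@leq_trans (8 * \sum_(r | A r) one r)); last first.
  rewrite leq_mul2l -card_sum /=; apply: subset_leq_card; apply/subsetP => r.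
  by rewrite !inE => /andP[-> h]; apply/existsP; exists (Ordinal jJ).
exact: second_moment_arith k0 M1 M2 H sumZ sumY.
Qed.

(** ** False positives *)

Section FalsePositive.
Variables (i : nat) (rho : 'I_n) (j : 'I_J) (e1 e2 : 'I_m).
Hypotheses (iP : i < P) (ne : e1 != e2).

Let inS r (e : 'I_m) := crossing (proc r i).1 rho e && sampled r i e j.
Let sx r b := \big[addb/false]_(e < m | inS r e) xbit r i e b.
Let sy r b := \big[addb/false]_(e < m | inS r e) ybit r i e b.
Let sz r b := \big[addb/false]_(e < m | inS r e) (xbit r i e b && ybit r i e b).
Let good b r := [&& inS r e1, inS r e2 & sz r b == (sx r b && sy r b)].

Let fx b r := flip (crd i e1 b) r.
Let fy b r := flip (crd i e2 (w + b)) r.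

Let xw b : b < w -> b < rb. Proof. by rewrite /rb /rbits; lia. Qed.
Let yw b : b < w -> w + b < rb. Proof. by rewrite /rb /rbits; lia. Qed.

Let inS_fx b r e : b < w -> inS (fx b r) e = inS r e.
Proof. by move=> bw; rewrite /inS proc_flip ?xw // sampled_flip //; [lia | exact: ltnW]. Qed.

Let inS_fy b r e : b < w -> inS (fy b r) e = inS r e.
Proof. by move=> bw; rewrite /inS proc_flip ?yw // sampled_flip //; [lia | exact: ltnW]. Qed.

Let big_addb_at (S : pred 'I_m) (G : 'I_m -> bool) (e0 : 'I_m) c : S e0 ->
  \big[addb/false]_(e < m | S e) (G e (+) ((e == e0) && c)) =
  \big[addb/false]_(e < m | S e) G e (+) c.
Proof.
move=> Se; rewrite big_split /=; congr (_ (+) _).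
rewrite (bigD1 e0) //= eqxx /= big1 ?addbF // => e /andP[_ /negbTE->] //.
Qed.

Let xyw b b' : b < w -> b' < w -> [/\ b < rb, w + b < rb, b' < rb & w + b' < rb].
Proof. by move=> bw bw'; split; [exact: xw | exact: yw | exact: xw | exact: yw]. Qed.

Let sx_fx b b' r : b < w -> b' < w -> inS r e1 -> sx (fx b r) b' = sx r b' (+) (b' == b).
Proof.
move=> bw bw' h; have [h1 h2 h3 h4] := xyw bw bw'; rewrite /sx -(big_addb_at _ (b' == b) h).
by apply: eq_big => e; [rewrite inS_fx | move=> _; rewrite xbit_flip // val_eqE].
Qed.

Let sy_fx b b' r : b < w -> b' < w -> sy (fx b r) b' = sy r b'.
Proof.
move=> bw bw'; have [h1 h2 h3 h4] := xyw bw bw'; apply: eq_big => e; [by rewrite inS_fx | move=> _].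
by rewrite /ybit xbit_flip // (@gtn_eqF b (w + b')) ?andbF ?addbF //; lia.
Qed.

Let sz_fx b b' r : b < w -> b' < w -> inS r e1 ->
  sz (fx b r) b' = sz r b' (+) ((b' == b) && ybit r i e1 b').
Proof.
move=> bw bw' h; have [h1 h2 h3 h4] := xyw bw bw'; rewrite /sz -(big_addb_at _ _ h).
apply: eq_big => e; [by rewrite inS_fx | move=> _].
rewrite /ybit !xbit_flip // (@gtn_eqF b (w + b')) ?andbF ?addbF ?val_eqE //; last by lia.
case: (e =P e1) => [->|_] /=; last by rewrite !addbF.
by case: (b' == b); case: (xbit _ _ _ b'); case: xbit.
Qed.

Let sx_fy b b' r : b < w -> b' < w -> sx (fy b r) b' = sx r b'.
Proof.
move=> bw bw'; have [h1 h2 h3 h4] := xyw bw bw'; apply: eq_big => e; [by rewrite inS_fy | move=> _].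
by rewrite xbit_flip // (@ltn_eqF b' (w + b)) ?andbF ?addbF //; lia.
Qed.

Let sy_fy b b' r : b < w -> b' < w -> inS r e2 -> sy (fy b r) b' = sy r b' (+) (b' == b).
Proof.
move=> bw bw' h; have [h1 h2 h3 h4] := xyw bw bw'; rewrite /sy -(big_addb_at _ (b' == b) h).
by apply: eq_big => e; [rewrite inS_fy |
  move=> _; rewrite /ybit xbit_flip // val_eqE eqn_add2l].
Qed.

Let sz_fy b b' r : b < w -> b' < w -> inS r e2 ->
  sz (fy b r) b' = sz r b' (+) ((b' == b) && xbit r i e2 b').
Proof.
move=> bw bw' h; have [h1 h2 h3 h4] := xyw bw bw'; rewrite /sz -(big_addb_at _ _ h).
apply: eq_big => e; [by rewrite inS_fy | move=> _].
rewrite /ybit !xbit_flip // (@ltn_eqF b' (w + b)) ?andbF ?addbF ?val_eqE ?eqn_add2l //; last by lia.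
case: (e =P e2) => [->|_] /=; last by rewrite !addbF.
by case: (b' == b); case: (xbit _ _ _ b'); case: xbit.
Qed.

(** For each bit b, flip bit b of x in [e1] by s and bit b of y in [e2] by t. The tested quantity
    [sz] + [sx] * [sy] modulo 2 is then a polynomial in s and t whose mixed term st comes from the
    product alone, since [e1] and [e2] differ. Its four values add up to 1, so the test cannot pass
    on all four tapes. Neither flip affects the sample or the classes. *)
Lemma false_positive_card :
  4 ^ w * #|[pred r : T.-tuple bool | @false_positive n m w J pu pv F C r i (proc r i).1 rho j e1 e2]|
    <= 3 ^ w * 2 ^ T.
Proof.
apply: (@leq_trans (4 ^ w * #|[pred r : T.-tuple bool | all (fun b => good b r) (iota 0 w)]|)).
  rewrite leq_mul2l; apply/orP; right; apply: subset_leq_card; apply/subsetP => r.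
  rewrite !inE => /and4P[_ /andP[c1 c2] /andP[s1 s2] /andP[_ /eqP ps]].
  apply/allP => b; rewrite mem_iota /= add0n => bw.
  rewrite /good /inS c1 c2 s1 s2 /=; apply/eqP.
  have := congr1 (Nat.testbit^~ b) ps; rewrite Nat.land_spec /tsum !testbit_big /=.
  by do 3![under [X in X = _ -> _]eq_bigr do rewrite ?Nat.land_spec ?testbit_wordof ?bw /=];
     do 3![under [X in _ = X && _ -> _]eq_bigr do rewrite ?testbit_wordof ?bw /=];
     do 3![under [X in _ = _ && X -> _]eq_bigr do rewrite ?testbit_wordof ?bw /=].
apply: (@card_all_three_quarters T w good (crd i e1) (fun b => crd i e2 (w + b)))
  => [b b' r bw lb|b b' r bw lb|b r bw].
- have bw' := ltn_trans lb bw; rewrite /good -/(fx b r) !inS_fx //.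
  case h1 : (inS r e1) => //=; rewrite sx_fx // sy_fx // sz_fx //.
  by rewrite (ltn_eqF lb) !addbF.
- have bw' := ltn_trans lb bw; rewrite /good -/(fy b r) !inS_fy //.
  case h1 : (inS r e1) => //=; case h2 : (inS r e2) => //=; rewrite sx_fy // sy_fy // sz_fy //.
  by rewrite (ltn_eqF lb) !addbF.
- rewrite -/(fx b r) -/(fy b r) -/(fx b (fy b r)) /good !(inS_fx, inS_fy) //.
  case h1 : (inS r e1) => //=; case h2 : (inS r e2) => //=.
  have h1' : inS (fy b r) e1 by rewrite inS_fy.
  rewrite !sx_fx // !sy_fx // !sz_fx // !sx_fy // !sy_fy // !sz_fy // eqxx /=.
  have -> : ybit (fy b r) i e1 b = ybit r i e1 b.
    by rewrite /ybit xbit_flip ?yw // val_eqE (negbTE ne) addbF.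
  by case: (sx r b); case: (sy r b); case: (sz r b); case: (ybit _ _ _ _);
     case: (xbit _ _ _ _).
Qed.

End FalsePositive.

(** Union bound over phase, class, level and pair of edges. *)
Lemma not_okp_card :
  4 ^ w * #|[pred r : T.-tuple bool | ~~ okp r P]| <= P * n * J * m * m * (3 ^ w * 2 ^ T).
Proof.
pose I := ('I_P * 'I_n * 'I_J * 'I_m * 'I_m)%type.
pose fp (x : I) r := @false_positive n m w J pu pv F C r x.1.1.1.1 (proc r x.1.1.1.1).1
   x.1.1.1.2 x.1.1.2 x.1.2 x.2.
have E : #|[pred r : T.-tuple bool | ~~ okp r P]| <= \sum_(x : I) #|[pred r : T.-tuple bool | fp x r]|.
  have -> : \sum_(x : I) #|[pred r : T.-tuple bool | fp x r]| = \sum_(r : T.-tuple bool) \sum_(x : I) fp x r.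
    rewrite exchange_big; apply: eq_bigr => x _; rewrite -sum1_card big_mkcond /=.
    by apply: eq_bigr => r _; rewrite inE; case: fp.
  rewrite -sum1_card big_mkcond; apply: leq_sum => r _; case: ifP => //.
  rewrite inE => /allPn[i]; rewrite mem_iota negbK /= add0n => iP.
  case/existsP=> rho /existsP[j /existsP[e1 /existsP[e2 h]]].
  rewrite (bigD1 ((Ordinal iP, rho, j, e1, e2) : I)) //= {1}/fp /= h.
  exact: leq_addr.
apply: leq_trans (leq_mul (leqnn _) E) _; rewrite big_distrr /=.
have -> : P * n * J * m * m = #|{: I}| by rewrite !card_prod !card_ord.
rewrite -sum_nat_const; apply: leq_sum => [[[[[i rho] j] e1] e2] _].
case: (eqVneq e1 e2) => [e12|ne]; last exact: false_positive_card.
rewrite eq_card0 ?muln0 // => r; rewrite !inE /fp /false_positive e12 /= eqxx //.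
Qed.

(** ** Expected number of unfinished classes *)

Section Expectation.
Variable Con : rel nat.
Hypotheses (Crefl : reflexive Con) (Csym : symmetric Con) (Ctrans : transitive Con).
Hypotheses (C0 : 0 \in C) (Cn : {in C, forall c, c < n}) (CQ : {subset C <= Q}).
Hypothesis Qn : {in Q, forall q, q < n}.
Hypothesis puv : forall e, e < m -> pu e != pv e.
Hypothesis Ccross : forall e, e < m -> ~~ F e -> loc C (pu e) != loc C (pv e) ->
  Con (loc C (pu e)) (loc C (pv e)).

Local Notation unf rt rho := (@unfinished n m pu pv F C rt rho).
Local Notation iso r i rt rho := (@isolated n m w J pu pv F C r i rt rho).
Local Notation N rt := (@nunf n m pu pv F C rt).

(** Only tapes without a false positive so far are counted, because progress is guaranteed on these
    alone. *)
Let S i := \sum_(r : T.-tuple bool) okp r i * N (proc r i).1.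

(** Condition on the set of edges leaving [rho]: it is determined by the earlier coins, so
    [isolate_card] applies to each part. *)
Lemma isolated_card i (rho : 'I_n) : i < P ->
  #|[pred r : T.-tuple bool | okp r i && unf (proc r i).1 rho]| <=
  8 * #|[pred r : T.-tuple bool | (okp r i && unf (proc r i).1 rho)
            && iso r i (proc r i).1 rho]|.
Proof.
move=> iP; pose X r := [set e : 'I_m | crossing (proc r i).1 rho e].
rewrite -!sum1_card (partition_big X (fun X0 => X0 != set0)) /=; last first.
  move=> r; rewrite inE => /andP[_ /existsP[e ce]].
  by apply/set0Pn; exists e; rewrite inE.
rewrite [X in _ <= 8 * X](partition_big X (fun X0 => X0 != set0)) /=; last first.
  move=> r; rewrite inE => /andP[/andP[_ /existsP[e ce]] _].
  by apply/set0Pn; exists e; rewrite inE.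
rewrite big_distrr /=; apply: leq_sum => X0 X0n.
have uX r : X r == X0 -> unf (proc r i).1 rho.
  move=> /eqP E; have /set0Pn[e] := X0n; rewrite -E inE => ce.
  by apply/existsP; exists e.
have inv e t : e < m -> t < rb ->
    invariant_at [pred r : T.-tuple bool | okp r i && (X r == X0)] (crd i e t).
  by move=> em tr r /=; rewrite okp_flip // /X proc_flip.
have H := isolate_card iP X0n inv; rewrite !sum1_card.
apply: leq_trans (leq_trans H _).
  apply: subset_leq_card; apply/subsetP => r; rewrite unfold_in !inE.
  by move=> /andP[/andP[-> _] ->].
rewrite leq_mul2l /=; apply: subset_leq_card; apply/subsetP => r.
rewrite !inE => /andP[/andP[ok Xr]] /existsP[j hj].
rewrite unfold_in !inE ok Xr (uX r Xr) /= andbT.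
apply/existsP; exists j; rewrite -(eqP hj); apply/eqP; apply: eq_card => e.
by rewrite -(eqP Xr) !inE.
Qed.

(** With I the number of isolating unfinished classes, [pstep_count] gives 2 S(i+1) + E I <= 2 S(i),
    and [isolated_card] gives S(i) <= 8 E I, where E I stands for the sum over good tapes. *)
Lemma expected_step i : i < P -> 16 * S i.+1 <= 15 * S i.
Proof.
move=> iP.
pose I r := #|[pred rho | unf (proc r i).1 rho && iso r i (proc r i).1 rho]|.
have h1 : 2 * S i.+1 + \sum_(r : T.-tuple bool) okp r i * I r <= 2 * S i.
  rewrite /S !big_distrr -big_split /=; apply: leq_sum => r _.
  have okS : okp r i.+1 = okp r i && ~~ @FP n m w J pu pv F C r i (proc r i).1.
    exact: okpS.
  rewrite okS; case ok : (okp r i) => //=; rewrite mul1n.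
  have IN : I r <= N (proc r i).1.
    by apply: subset_leq_card; apply/subsetP => rho; rewrite !inE => /andP[].
  case fp : (FP _ _ _ _ _ _ _ _ _ _ _) => /=; first by rewrite mul0n muln0; lia.
  rewrite !mul1n; apply: (pstep_count Csym Ctrans C0 Cn CQ Qn puv Ccross); rewrite ?fp //.
  exact: (proc_valid Crefl Csym Ctrans C0 Qn Ccross).
have h2 : S i <= 8 * \sum_(r : T.-tuple bool) okp r i * I r.
  have e1 : S i = \sum_(rho < n) #|[pred r : T.-tuple bool | okp r i && unf (proc r i).1 rho]|.
    under [RHS]eq_bigr do rewrite -sum1_card big_mkcond.
    rewrite exchange_big; apply: eq_bigr => r _ /=.
    rewrite /nunf -sum1_card big_distrr big_mkcond; apply: eq_bigr => rho _ /=.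
    by rewrite !inE; case: (okp r i); case: unfinished.
  have e2 : \sum_(r : T.-tuple bool) okp r i * I r =
    \sum_(rho < n) #|[pred r : T.-tuple bool | (okp r i && unf (proc r i).1 rho)
            && iso r i (proc r i).1 rho]|.
    under [RHS]eq_bigr do rewrite -sum1_card big_mkcond.
    rewrite exchange_big; apply: eq_bigr => r _ /=.
    rewrite /I -sum1_card big_distrr big_mkcond; apply: eq_bigr => rho _ /=.
    by rewrite !inE; case: (okp r i); case: unfinished; case: isolated.
  by rewrite e1 e2 big_distrr; apply: leq_sum => rho _; apply: isolated_card.
by lia.
Qed.

Lemma failure_arith a b s x y z u t v k : a <= b + s -> x * s <= y * (k * t) ->
  z * b <= v * (u * t) -> x * z * a <= (y * z * k + x * u * v) * t.
Proof.
move=> h1 h2 h3; apply: leq_trans (leq_mul (leqnn _) h1) _.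
have -> : x * z * (b + s) = x * (z * b) + z * (x * s) by nia.
have -> : (y * z * k + x * u * v) * t = x * (v * (u * t)) + z * (y * (k * t)) by nia.
by apply: leq_add; rewrite leq_mul2l ?h2 ?h3 orbT.
Qed.

(** Markov's inequality: a tape without false positives but with an unfinished class contributes at
    least one to [S P]. *)
Theorem failure_card :
  16 ^ P * 4 ^ w * #|[pred r : T.-tuple bool | ~~ (okp r P && (N (proc r P).1 == 0))]| <=
  (15 ^ P * 4 ^ w * n + 16 ^ P * 3 ^ w * (P * n * J * m * m)) * 2 ^ T.
Proof.
have hS : forall i, i <= P -> 16 ^ i * S i <= 15 ^ i * (n * 2 ^ T).
  elim=> [_|i IH iP].
    rewrite !mul1n /S -[X in _ <= _ * X ^ _]card_bool -card_tuple mulnC -sum_nat_const.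
    apply: leq_sum => r _; rewrite /= mul1n -[n in _ <= n]card_ord; exact: max_card.
  have := expected_step iP; have := IH (ltnW iP); rewrite !expnSr.
  move: (S i) (S i.+1) (16 ^ i) (15 ^ i) (n * 2 ^ T) => a b c d x h1 h2.
  nia.
have h : #|[pred r : T.-tuple bool | ~~ (okp r P && (N (proc r P).1 == 0))]| <=
    #|[pred r : T.-tuple bool | ~~ okp r P]| + S P.
  rewrite -!sum1_card /S big_mkcond [X in _ <= X + _]big_mkcond -big_split /=.
  apply: leq_sum => r _; rewrite !inE; case: (okp r P) => //=.
  by case: eqP => //= ?; lia.
exact: failure_arith h (hS P (leqnn P)) not_okp_card.
Qed.

End Expectation.
End Failure.
(** * Union-find and predecessor search *)

Lemma hexec_ht w D p h : norand p -> ht (hexec w D p h) = ht h.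
Proof.
elim: p h => [x e|a i j e|x|p IHp q IHq|e p IHp q IHq|x y p IHp] h //=.
- by move=> /andP[np nq]; rewrite IHq // IHp.
- by move=> /andP[np nq]; case: ifP => _; [apply: IHp | apply: IHq].
- move=> np; apply: (@hiter_ind _ (fun _ s => ht s = ht h)) => // i s _ <-.
  exact: IHp.
Qed.

(** * Word operations without overflow *)

Section Words.
Variable w : nat.
Local Notation sem := (binop_sem w).

Lemma addE x y : x + y < 2 ^ w -> sem Add x y = x + y.
Proof. exact: modn_small. Qed.

Lemma subE x y : y <= x -> x < 2 ^ w -> sem Defs.Sub x y = x - y.
Proof.
move=> yx xw; rewrite /binop_sem -addnBAC // modnDr modn_small //.
exact: leq_ltn_trans (leq_subr _ _) xw.
Qed.

Lemma mulE x y : x * y < 2 ^ w -> sem Mul x y = x * y.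
Proof. exact: modn_small. Qed.

Lemma shlE x y : x * 2 ^ y < 2 ^ w -> sem Shl x y = x * 2 ^ y.
Proof. exact: modn_small. Qed.

Lemma shrE x y : x < 2 ^ w -> sem Shr x y = x %/ 2 ^ y.
Proof. by move=> xw; apply: modn_small; apply: leq_ltn_trans (leq_div _ _) xw. Qed.

Lemma andE x y : x < 2 ^ w -> sem And x y = Nat.land x y.
Proof. by move=> xw; apply: modn_small; apply: land_lt. Qed.

Lemma xorE x y : x < 2 ^ w -> y < 2 ^ w -> sem Xor x y = Nat.lxor x y.
Proof. by move=> xw yw; apply: modn_small; apply: lxor_lt. Qed.

Lemma eqwE x y : 0 < w -> sem Eqw x y = (x == y).
Proof. by move=> w0; apply: modn_small; apply: bool_lt_pow. Qed.

Lemma ltwE x y : 0 < w -> sem Ltw x y = (x < y).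
Proof. by move=> w0; apply: modn_small; apply: bool_lt_pow. Qed.

End Words.

Lemma nat_oddE x : Nat.odd x = odd x.
Proof. by elim: x => // x IH; rewrite Nat.odd_succ -Nat.negb_odd IH. Qed.

Lemma land1E x : Nat.land x 1 = odd x.
Proof. by have := bit_testbit x 0; rewrite expn0 divn1 Nat.bit0_odd nat_oddE. Qed.

Definition fstep (par : nat -> nat) (x : nat) := if par x != 0 then par x - 1 else x.

(* [par x] is 0 at a representative and otherwise the parent of x plus one,   *)
(* so that zeroed memory represents the discrete partition.                   *)
Record uf_ok (N : nat) (par : nat -> nat) (s : ufs) : Prop := UfOk {
  uf_lt : forall x, x < N -> s.1 x < N;
  uf_root : forall x, x < N -> par x = 0 -> s.1 x = x;
  uf_par : forall x, x < N -> par x != 0 ->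
    [/\ par x - 1 < N, s.1 (par x - 1) = s.1 x & 2 * (s.2 x + 1) <= s.2 (par x - 1) + 1];
  uf_rep : forall x, x < N -> par (s.1 x) = 0;
  uf_sz : forall x, x < N -> s.2 x < N;
  uf_count : forall x, x < N -> par x = 0 ->
    s.2 x + 1 = count (fun z => s.1 z == x) (iota 0 N) }.

Lemma uf_ok_ext N par par' s : (forall x, x < N -> par x = par' x) ->
  uf_ok N par s -> uf_ok N par' s.
Proof.
move=> e [h1 h2 h3 h4 h5 h6]; split=> // x xN; rewrite -?e //; auto.
Qed.

Lemma uf_init N : uf_ok N (fun=> 0) (id, fun=> 0).
Proof.
split=> // x xN /=; first by apply: leq_ltn_trans xN.
move=> _; have -> : count (fun z => z == x) (iota 0 N) = count_mem x (iota 0 N) by [].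
by rewrite count_uniq_mem ?iota_uniq // mem_iota xN.
Qed.

(** Union by size: every parent step at least doubles the recorded size, so after L steps without
    meeting a root the size would be at least 2 ^ L > N. *)
Lemma uf_find N L par s x : uf_ok N par s -> N < 2 ^ L -> x < N ->
  iter L (fstep par) x = s.1 x.
Proof.
move=> ok NL xN.
have G k : let y := iter k (fstep par) x in
    [/\ y < N, s.1 y = s.1 x & par y = 0 \/ 2 ^ k <= s.2 y + 1].
  elim: k => [|k [yN sy hy]] /=; first by split=> //; right; rewrite expn0 addn1.
  move: (iter k (fstep par) x) yN sy hy => y yN sy hy.
  rewrite /fstep; case: (par y =P 0) => [p0|/eqP pn] /=; first by split=> //; left.
  have [h1 h2 h3] := uf_par ok yN pn; split=> //; first by rewrite h2.
  by right; case: hy => [p0|hy]; [rewrite p0 in pn | rewrite expnS; lia].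
have [yN <- [p0|hy]] := G L; first by rewrite (uf_root ok yN p0).
by have := uf_sz ok yN; lia.
Qed.

Lemma uf_link N par s a b : uf_ok N par s -> a < N -> b < N -> a != b ->
  par a = 0 -> par b = 0 -> s.2 a <= s.2 b ->
  uf_ok N (fun x => if x == a then b.+1 else par x) (ulink s a b).
Proof.
move=> ok aN bN ab pa pb ss; have := ok; case=> h1 h2 h3 h4 h5 h6.
have sb : s.1 b = b := h2 b bN pb; have sa : s.1 a = a := h2 a aN pa.
have ba : b == a = false by rewrite eq_sym (negbTE ab).
have cnt : s.2 b + s.2 a + 1 + 1 = count (fun z => (ulink s a b).1 z == b) (iota 0 N).
  have -> : count (fun z => (ulink s a b).1 z == b) (iota 0 N) =
     count (predU (fun z => s.1 z == b) (fun z => s.1 z == a)) (iota 0 N).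
    by apply: eq_count => z /=; case: (s.1 z =P a) => [->|]; rewrite ?eqxx ?orbT ?orbF.
  have := count_predUI (fun z => s.1 z == b) (fun z => s.1 z == a) (iota 0 N).
  rewrite (eq_count (a1 := predI _ _) (a2 := pred0)) ?count_pred0 ?addn0 => [->|z] /=.
    by rewrite -h6 // -(h6 a) //; lia.
  by apply/andP => [[/eqP-> /eqP e]]; rewrite e eqxx in ab.
split=> [x xN|x xN|x xN|x xN|x xN|x xN] /=.
- by case: ifP => // _; apply: h1.
- case: (x =P a) => // xa p0; rewrite (h2 x xN p0); case: eqP => //.
- case: (x =P a) => [-> _|xa pn]; first by rewrite subn1 /= sb sa ba !eqxx (negbTE ab); split=> //; lia.
  have [y1 y2 y3] := h3 x xN pn; rewrite y2; split=> //.
  have xb : x == b = false by apply/eqP => xb; rewrite xb pb in pn.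
  by rewrite xb; case: eqP => [eb|_]; rewrite ?eb in y3 *; lia.
- case: (s.1 x =P a) => [_|xa]; first by rewrite ba.
  by case: eqP => // _; apply: h4.
- case: eqP => [_|_]; last exact: h5.
  have : count (fun z => (ulink s a b).1 z == b) (iota 0 N) <= N.
    by apply: leq_trans (count_size _ _) _; rewrite size_iota.
  by rewrite -cnt; lia.
- case: (x =P a) => // xa p0; case: (x =P b) => [->|xb]; first by rewrite cnt.
  rewrite h6 //; apply: eq_count => z; case: (s.1 z =P a) => [->|] //.
  by rewrite (introF eqP (nesym xa)) (introF eqP (nesym xb)).
Qed.

(** * Program fragments for union-find and predecessor search *)

Definition vW := 2.     Definition vL := 3.     Definition vP := 5.
Definition vJ := 6.     Definition vJ5 := 7.    Definition vSZ := 8.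
Definition vNF := 9.    Definition v5 := 10.    Definition v4 := 11.
Definition v3 := 12.    Definition vN := 13.    Definition vM := 14.
Definition vO := 15.    Definition vF := 20.    Definition vFi := 21.
Definition vLx := 22.   Definition vQ := 23.    Definition vX := 24.
Definition vA := 25.    Definition vB := 26.    Definition vT := 27.

Definition aIN := 0.    Definition aOUT := 1.   Definition aPAR := 2.
Definition aSZ := 3.    Definition aFW := 16.

Definition hskip := HAsg vX (HV vX).

(** A fixed number of L rounds replaces a loop that stops at the root, which keeps the bound known
    on entry; by [uf_find] no path compression is needed. *)
Definition FIND : hcmd :=
  HFor vFi vL
    (HIf (HA aPAR (HV vF) (HC 0))
       (HAsg vF (HB Defs.Sub (HA aPAR (HV vF) (HC 0)) (HC 1))) hskip).

Definition LINK : hcmd :=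
  HSeq (HSet aPAR (HV vA) (HC 0) (HB Add (HV vB) (HC 1)))
    (HSet aSZ (HV vB) (HC 0)
       (HB Add (HB Add (HA aSZ (HV vB) (HC 0)) (HA aSZ (HV vA) (HC 0))) (HC 1))).

Definition UNION : hcmd :=
  HIf (HB Eqw (HV vA) (HV vB)) hskip
    (HSeq (HIf (HB Ltw (HA aSZ (HV vB) (HC 0)) (HA aSZ (HV vA) (HC 0)))
             (HSeq (HAsg vT (HV vA)) (HSeq (HAsg vA (HV vB)) (HAsg vB (HV vT)))) hskip)
       LINK).

Definition SEARCH : hcmd :=
  HFor vLx vL
    (HIf (HB And (HB Shr (HV vQ) (HV vLx)) (HC 1))
       (HSeq (HAsg vX (HA aFW (HV vLx) (HB Defs.Sub (HB Shr (HV vQ) (HV vLx)) (HC 1))))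
          (HIf (HB Ltw (HV vF) (HV vX)) (HAsg vF (HV vX)) hskip))
       hskip).

(* Replaces the position p in vF by the last cut point up to p, given the     *)
(* maximum of the cut points in each dyadic block.                            *)
Definition LOCATE : hcmd :=
  HSeq (HAsg vQ (HB Add (HV vF) (HC 1)))
    (HSeq (HAsg vF (HC 0))
       SEARCH).

Lemma lt_dim_pow w D x : 0 < D -> narr * D * D <= 2 ^ w -> x < 2 * D -> x < 2 ^ w.
Proof.
move=> D0 Dw h; apply: leq_trans Dw; apply: leq_trans h _.
by rewrite /narr -mulnA; nia.
Qed.

Section Macros.
Variables w D L N : nat.
Hypotheses (w10 : 10 <= w) (D0 : 0 < D) (Dw : narr * D * D <= 2 ^ w).
Hypotheses (ND : N < D) (NL : N < 2 ^ L) (LD : L <= D).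
Local Notation hexec := (hexec w D).
Local Notation heval := (heval w D).

Lemma small k : k < 1024 -> k %% 2 ^ w = k.
Proof.
move=> hk; apply: modn_small; apply: leq_trans hk _.
by rewrite -[1024]/(2 ^ 10) leq_exp2l.
Qed.

Let lt_D_pow x := @lt_dim_pow w D x D0 Dw.

Definition uf_at (h : hst) (s : ufs) : Prop :=
  uf_ok N (fun x => ha h aPAR x 0) s /\ (forall x, x < N -> ha h aSZ x 0 = s.2 x).

Lemma uf_at_ext h h' s : ha h' aPAR = ha h aPAR -> ha h' aSZ = ha h aSZ ->
  uf_at h s -> uf_at h' s.
Proof. by move=> e1 e2; rewrite /uf_at e1 e2. Qed.

Lemma find_exec h s : uf_at h s -> hv h vL = L -> hv h vF < N ->
  hv (hexec FIND h) vF = s.1 (hv h vF).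
Proof.
move=> [ok _] hL hF; rewrite -(uf_find ok NL hF).
have [] := @forP w D (fun k t => hv t vF = iter k (fstep (fun x => ha h aPAR x 0)) (hv h vF)
   /\ hv t vF < N) _ _ _ h (isT : wf FIND); rewrite ?hL //; last by case.
move=> k t kL _ [frv fra] [e1 e2].
rewrite /= -e1 (fra aPAR isT) !mod0n (small (k := 1)) // modn_small; last exact: ltn_trans e2 ND.
rewrite /fstep; case: (ha h aPAR (hv t vF) 0 =P 0) => [//|/eqP pn] /=.
have [y1 _ _] := uf_par ok e2 pn.
by rewrite subE //; [rewrite lt0n | apply: lt_D_pow; lia].
Qed.

Lemma union_exec h s x y : uf_at h s -> x < N -> y < N ->
  hv h vA = s.1 x -> hv h vB = s.1 y -> uf_at (hexec UNION h) (umerge s x y).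
Proof.
move=> [ok sz] xN yN hA hB.
have w0 : 0 < w by apply: leq_trans w10.
have aN := uf_lt ok xN; have bN := uf_lt ok yN.
have pa := uf_rep ok xN; have pb := uf_rep ok yN.
have key a b t : a < N -> b < N -> a != b -> ha t aPAR = ha h aPAR -> ha t aSZ = ha h aSZ ->
    ha h aPAR a 0 = 0 -> ha h aPAR b 0 = 0 -> s.2 a <= s.2 b ->
    hv t vA = a -> hv t vB = b ->
    uf_at (hexec LINK t)
      (ulink s a b).
  move=> lta ltb ab eP eS p1 p2 ss tA tB.
  have aD := ltn_trans lta ND; have bD := ltn_trans ltb ND.
  have sa := uf_sz ok lta; have sb := uf_sz ok ltb.
  rewrite /uf_at /= tA tB !mod0n !small // !(modn_small aD) !(modn_small bD) eS eP !sz //.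
  rewrite (@addE _ b) ?(@addE _ (s.2 b)) ?addE; try by apply: lt_D_pow; lia.
  split=> [|z zN].
    apply: uf_ok_ext (uf_link ok lta ltb ab p1 p2 ss) => z zN /=.
    by rewrite eqxx andbT addn1.
  by rewrite eqxx andbT sz.
set t := hexec (HIf (HB Ltw (HA aSZ (HV vB) (HC 0)) (HA aSZ (HV vA) (HC 0)))
   (HSeq (HAsg vT (HV vA)) (HSeq (HAsg vA (HV vB)) (HAsg vB (HV vT)))) hskip) h.
have [eP eS] : ha t aPAR = ha h aPAR /\ ha t aSZ = ha h aSZ.
  by split; apply: (hexec_frame w D _ h).2.
have tE : (hv t vA, hv t vB) =
    if s.2 (s.1 y) < s.2 (s.1 x) then (s.1 y, s.1 x) else (s.1 x, s.1 y).
  have aD := ltn_trans aN ND; have bD := ltn_trans bN ND.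
  rewrite /t /= ltwE // !mod0n hA hB (modn_small aD) (modn_small bD) !sz //.
  by case: ltnP => _ /=; rewrite ?hA ?hB.
have -> : hexec UNION h = if binop_sem w Eqw (hv h vA) (hv h vB) != 0
  then hexec hskip h else hexec LINK t by [].
rewrite /umerge eqwE // hA hB.
case: (s.1 x =P s.1 y) => [e|/eqP ne]; first exact: (conj ok sz).
rewrite [~~ (_ == 0)]/=.
move: tE; case: ltnP => lt [tA tB].
  by have := key _ _ t bN aN; apply=> //; [rewrite eq_sym | exact: ltnW].
by have := key _ _ t aN bN; apply.
Qed.

Definition fw_at (h : hst) (C : seq nat) : Prop :=
  forall k b, k < L -> b < N -> ha h aFW k b = \max_(c <- C | c %/ 2 ^ k == b) c.

(** The candidates are the cut points below q = p + 1. By [dyadic_cover] they are those in one block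
    for each binary digit 1 of q, so L table lookups suffice. *)
Lemma locate_exec h C : fw_at h C -> {in C, forall c, c < N} ->
  hv h vL = L -> hv h vF < N -> hv (hexec LOCATE h) vF = loc C (hv h vF).
Proof.
move=> fw CN hL hF.
have w0 : 0 < w by apply: leq_trans w10.
have hF1 : hv h vF + 1 < 2 ^ w by apply: lt_D_pow; lia.
have -> : hexec LOCATE h = hexec SEARCH
  (setv (setv h vQ (binop_sem w Add (hv h vF) (1 %% 2 ^ w))) vF (0 %% 2 ^ w)) by [].
rewrite mod0n small // addE // addn1.
set q := (hv h vF).+1.
set h1 := setv _ _ _.
pose M k := \max_(i < k | odd (q %/ 2 ^ i)) \max_(c <- C | c %/ 2 ^ i == (q %/ 2 ^ i).-1) c.
have [|k t kL tx [frv fra] e1| e2 _] := @forP w D (fun k t => hv t vF = M k) _ _ _ h1 (isT : wf SEARCH).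
- by rewrite /M big_ord0.
- have kL' : k < L by rewrite -hL.
  have tQ : hv t vQ = q := frv vQ isT.
  have qN : q <= N by [].
  have qw : q < 2 ^ w by apply: lt_D_pow; lia.
  rewrite /M big_mkcond big_ord_recr -big_mkcond /= tx tQ small // shrE // andE; last first.
    by apply: leq_ltn_trans (leq_div _ _) qw.
  rewrite land1E; case oq : (odd _) => /=; last by rewrite maxn0.
  have qk : q %/ 2 ^ k <= q := leq_div _ _.
  have q1 : 0 < q %/ 2 ^ k by case: (q %/ 2 ^ k) oq.
  rewrite subE //; last by apply: leq_ltn_trans qw.
  have kD : k < D by apply: leq_trans LD.
  rewrite ltwE // (modn_small kD) modn_small; last by lia.
  rewrite (fra aFW isT) fw //; last by lia.
  rewrite e1 subn1 /maxn -/(M k); case: ltnP => //= _.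
- rewrite -[RHS]/(loc C q.-1) e2 -[hv h1 vL]/(hv h vL) hL /M.
  have qL : q < 2 ^ L by apply: leq_ltn_trans NL.
  apply/eqP; rewrite eqn_leq; apply/andP; split.
    apply/bigmax_leqP => i oi; apply/bigmax_leqP_seq => c cC hc.
    apply: leq_loc => //; rewrite -ltnS (dyadic_cover c qL).
    by apply/hasP; exists (nat_of_ord i); rewrite ?mem_iota ?ltn_ord //= oi.
  apply/bigmax_leqP_seq => c cC; rewrite -ltnS => cq.
  have := dyadic_cover c qL; rewrite cq => /esym/hasP[i]; rewrite mem_iota add0n => iL /andP[oi ci].
  by apply: (bigmax_sup (Ordinal iL)) => //; apply: (leq_bigmax_seq (F := id)).
Qed.

End Macros.
(** * Spanning forests whose deletions cut cyclic orders into arcs *)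

Lemma connect_eq (T : finType) (A : Type) (e : rel T) (f : T -> A) :
  (forall x y, e x y -> f x = f y) -> forall x y, connect e x y -> f x = f y.
Proof.
move=> ef x y /connectP[p pth ->]; elim: p x pth => //= z p IH x /andP[xz zp].
by rewrite (ef _ _ xz); apply: IH.
Qed.

Lemma porbit_ind (T : finType) (g : {perm T}) (P : pred T) x :
  P x -> (forall z, P z -> P (g z)) -> forall y, y \in porbit g x -> P y.
Proof.
move=> Px Pg y /porbitP[i ->]; elim: i => [|i IH]; first by rewrite expg0 perm1.
by rewrite expgSr permM; apply: Pg.
Qed.

Lemma porbit_next (T : finType) (g : {perm T}) x z :
  z \in porbit g x -> g z \in porbit g x.
Proof.
case/porbitP=> i ->; have -> : g ((g ^+ i)%g x) = (g ^+ i.+1)%g x by rewrite expgSr permM.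
exact: mem_porbit.
Qed.

Lemma porbit_prev (T : finType) (g : {perm T}) x z :
  g z \in porbit g x -> z \in porbit g x.
Proof.
move=> h; rewrite -eq_porbit_mem in h; rewrite -eq_porbit_mem -(eqP h).
by have := porbit_perm g 1 z; rewrite expg1 => ->.
Qed.

(** Exchanging the successors of two elements on distinct cycles splices the cycles into one. *)
Lemma porbit_swap (T : finType) (g : {perm T}) (u v : T) : u \notin porbit g v ->
  let g' := (tperm u v * g)%g in
  {subset porbit g u <= porbit g' u} /\ {subset porbit g v <= porbit g' u}.
Proof.
move=> uv g'.
have g'u : g' u = g v by rewrite permM tpermL.
have g'v : g' v = g u by rewrite permM tpermR.
have g'z z : z != u -> z != v -> g' z = g z.
  by move=> zu zv; rewrite permM tpermD // eq_sym.
have inv y (p : {perm T}) : exists2 z, y = p z & forall x, y \in porbit p x -> z \in porbit p x.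
  exists ((p^-1)%g y); first by rewrite permKV.
  by move=> x yx; apply: porbit_prev; rewrite permKV.
have uu : u \in porbit g' u by apply: porbit_id.
have gv : g v \in porbit g' u by rewrite -g'u porbit_next.
have sv : {subset porbit g v <= porbit g' u}.
  (* Go round the cycle of [v] starting from [g v], the new successor of [u]; until the walk is back
     at [v], the two permutations agree. *)
  have H : forall z, z \in porbit g v -> (z \in porbit g v) && (g z \in porbit g' u).
    apply: (@porbit_ind _ g (fun z => (z \in porbit g v) && (g z \in porbit g' u))).
      by rewrite porbit_id gv.
    move=> z /andP[zv gz]; rewrite porbit_next //=.
    have [->//|yv] := eqVneq (g z) v.
    have yu : g z != u by apply: contraNneq uv => <-; apply: porbit_next.
    by rewrite -(g'z _ yu yv) porbit_next.
  by move=> y; have [z -> zp] := inv y g; move=> /zp /H /andP[].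
have gu : g u \in porbit g' u by rewrite -g'v porbit_next // sv // porbit_id.
split=> // y; have [z -> zp] := inv y g => /zp zu.
apply: (@porbit_ind _ g (fun z => g z \in porbit g' u) u gu _ z zu) => {y zp zu}z gz.
have [->//|yu] := eqVneq (g z) u.
have [->//|yv] := eqVneq (g z) v.
by rewrite -(g'z _ yu yv) porbit_next.
Qed.

Section Layout.
Variables (n m : nat) (eu ev : nat -> 'I_n).
Implicit Types (x y z : 'I_n) (s : ufs) (g : {perm 'I_n}) (Af Bf : nat -> nat).

Definition joins k x y : bool :=
  ((eu k == x) && (ev k == y)) || ((eu k == y) && (ev k == x)).

Definition erel k : rel 'I_n := fun x y => has (fun i => joins i x y) (iota 0 k).

Definition crel Af Bf k (c : nat) : rel 'I_n := fun x y =>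
  has (fun i => ((Af i == c) || (Bf i == c)) && joins i x y) (iota 0 k).

(* The permutation g lists the vertices of each tree of the forest in cyclic  *)
(* order.  Joining the trees of u and v exchanges the successors of u and v,  *)
(* and these two successors, Af k and Bf k, are where the deletion of edge k  *)
(* cuts the order: x and its successor are linked by edges cut there.         *)
Record lay k Af Bf s g : Prop := Lay {
  lay_conn : forall x y, s.1 x = s.1 y <-> connect (erel k) x y;
  lay_orb : forall x y, s.1 x = s.1 y -> y \in porbit g x;
  lay_next : forall x, s.1 (g x) = s.1 x;
  lay_key : forall x, connect (crel Af Bf k (g x)) x (g x);
  lay_cut : forall i, i < k -> exists2 ab : 'I_n * 'I_n,
    Af i = ab.1 /\ Bf i = ab.2 & s.1 ab.1 = s.1 (eu i) /\ s.1 ab.2 = s.1 (ev i) }.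

Lemma joins_sym k x y : joins k x y = joins k y x.
Proof. by rewrite /joins orbC. Qed.

Lemma erel_sym k : connect_sym (erel k).
Proof. by apply: sym_connect_sym => x y; apply: eq_has => i; apply: joins_sym. Qed.

Lemma erelS k x y : erel k.+1 x y = erel k x y || joins k x y.
Proof. by rewrite /erel -(addn1 k) iotaD has_cat /= orbF. Qed.

Lemma crelS Af Bf k c x y : crel Af Bf k.+1 c x y =
  crel Af Bf k c x y || (((Af k == c) || (Bf k == c)) && joins k x y).
Proof. by rewrite /crel -(addn1 k) iotaD has_cat /= orbF. Qed.

Lemma lay_ext k Af Bf Af' Bf' s g :
  (forall i, i < k -> Af i = Af' i) -> (forall i, i < k -> Bf i = Bf' i) ->
  lay k Af Bf s g -> lay k Af' Bf' s g.
Proof.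
move=> eA eB [h1 h2 h3 h4 h5]; split=> // [x|i ik].
  rewrite (eq_connect (e' := crel Af Bf k (g x))) // => y z.
  by apply: eq_in_has => i; rewrite mem_iota /= => ik; rewrite eA // eB.
by have [ab [a1 a2] h] := h5 i ik; exists ab => //; rewrite -eA // -eB.
Qed.

Lemma lay0 Af Bf : lay 0 Af Bf (id, fun=> 0) 1%g.
Proof.
split=> //= [x y|x y|x|x].
- split=> [/val_inj ->|]; first exact: connect0.
  by apply: (@connect_eq _ _ _ val).
- by move=> /val_inj ->; rewrite porbit_id.
- by rewrite perm1.
- by rewrite perm1 connect0.
Qed.

(** Only the successors of [u] and [v] change: [u] now precedes [g v] and [v] precedes [g u]. Both
    new links use edge k, which is recorded as cut at these two places. An edge inside one tree
    leaves the order alone and merely adds cut points. *)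
Lemma lay_step k Af Bf s g : lay k Af Bf s g ->
  Af k = g (eu k) -> Bf k = g (ev k) ->
  lay k.+1 Af Bf (umerge s (eu k) (ev k))
    (if s.1 (eu k) == s.1 (ev k) then g else (tperm (eu k) (ev k) * g)%g).
Proof.
move=> [h1 h2 h3 h4 h5] hA hB; set u := eu k in hA *; set v := ev k in hB *.
have subE x y : connect (erel k) x y -> connect (erel k.+1) x y.
  by apply: connect_sub => a b ab; apply: connect1; rewrite erelS ab.
have subC c x y : connect (crel Af Bf k c) x y -> connect (crel Af Bf k.+1 c) x y.
  by apply: connect_sub => a b ab; apply: connect1; rewrite crelS ab.
have uvE : connect (erel k.+1) u v.
  by apply: connect1; rewrite erelS /joins !eqxx orbT.
set s' := umerge s u v.
have [h eh muv] := umerge_coarse s u v; rewrite -/s' in eh.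
have conn' x y : s'.1 x = s'.1 y <-> connect (erel k.+1) x y.
  split; last first.
    apply: (@connect_eq _ _ _ (fun z : 'I_n => s'.1 z)) => a b; rewrite erelS.
    case/orP=> [ab|]; first by rewrite !eh /= (h1 a b).2 // connect1.
    by case/orP=> /andP[/eqP<- /eqP<-]; rewrite !eh /= muv.
  have base (a b : 'I_n) : s.1 a = s.1 b -> connect (erel k.+1) a b by move/h1/subE.
  have vuE : connect (erel k.+1) v u by rewrite erel_sym.
  have cross (a b c d : 'I_n) : s.1 a = s.1 c -> connect (erel k.+1) c d -> s.1 b = s.1 d ->
      connect (erel k.+1) a b.
    move=> ac cd bd; apply: connect_trans (base _ _ ac) (connect_trans cd _).
    exact/base.
  rewrite /s' /umerge; case: eqP => [_|_]; first exact: base.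
  case: ifP => _ /=.
    case: (s.1 x =P s.1 v) => xv; case: (s.1 y =P s.1 v) => yv e.
    + by apply: base; rewrite xv.
    + exact: cross xv vuE (esym e).
    + exact: cross e uvE yv.
    + exact: base.
  case: (s.1 x =P s.1 u) => xv; case: (s.1 y =P s.1 u) => yv e.
  + by apply: base; rewrite xv.
  + exact: cross xv uvE (esym e).
  + exact: cross e vuE yv.
  + exact: base.
have cut' i : i < k.+1 -> exists2 ab : 'I_n * 'I_n,
    Af i = ab.1 /\ Bf i = ab.2 & s'.1 ab.1 = s'.1 (eu i) /\ s'.1 ab.2 = s'.1 (ev i).
  rewrite ltnS leq_eqVlt => /predU1P[->|ik].
    by exists (g u, g v); rewrite //= !eh /= !h3.
  by have [ab e [e1 e2]] := h5 i ik; exists ab; rewrite // !eh /= e1 e2.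
case: eqP => [suv|/eqP suv].
  have -> : s' = s by rewrite /s' /umerge suv eqxx.
  have -> : s = s' by rewrite /s' /umerge suv eqxx.
  split=> // [x y|x|x].
  - by rewrite /s' /umerge suv eqxx; apply: h2.
  - by rewrite /s' /umerge suv eqxx h3.
  - exact/subC.
(* The permutation preserves classes, so distinct classes lie on distinct cycles. *)
have uv : u \notin porbit g v.
  apply: contra suv => uv; rewrite eq_sym.
  by apply: (@porbit_ind _ g (fun z : 'I_n => s.1 v == s.1 z)) uv => // z /eqP->; rewrite h3.
have [su sv] := porbit_swap uv.
set g' := (tperm u v * g)%g in su sv *.
have g'u : g' u = g v by rewrite permM tpermL.
have g'v : g' v = g u by rewrite permM tpermR.
have g'z z : z != u -> z != v -> g' z = g z.
  by move=> zu zv; rewrite permM tpermD // eq_sym.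
have Suv x : s.1 x = s.1 u \/ s.1 x = s.1 v -> x \in porbit g' u.
  by case=> e; [apply: su | apply: sv]; apply: h2.
have s'E x y : s'.1 x = s'.1 y -> s.1 x = s.1 y \/
   (s.1 x = s.1 u \/ s.1 x = s.1 v) /\ (s.1 y = s.1 u \/ s.1 y = s.1 v).
  rewrite /s' /umerge (negbTE suv); case: ifP => _ /=.
    by case: (s.1 x =P s.1 v) => xv; case: (s.1 y =P s.1 v) => yv e; auto.
  by case: (s.1 x =P s.1 u) => xv; case: (s.1 y =P s.1 u) => yv e; auto.
split=> // [x y|x|x].
- case: (boolP ((s.1 x == s.1 u) || (s.1 x == s.1 v))) => [/orP sx|].
    have {}sx : s.1 x = s.1 u \/ s.1 x = s.1 v by case: sx => /eqP; auto.
    move=> e; have sy : s.1 y = s.1 u \/ s.1 y = s.1 v.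
      by case: (s'E x y e) => [e'|[]//]; rewrite -e'.
    have xu := Suv _ sx; have yu := Suv _ sy.
    by rewrite -eq_porbit_mem in xu; rewrite (eqP xu).
  rewrite negb_or => /andP[xu xv]; case/s'E => [e|[[/eqP|/eqP]]]; rewrite ?(negbTE xu) ?(negbTE xv) //.
  have : (y \in porbit g' x) && (s.1 x == s.1 y); last by case/andP.
  apply: (@porbit_ind _ g (fun z => (z \in porbit g' x) && (s.1 x == s.1 z))) (h2 _ _ e).
    by rewrite porbit_id eqxx.
  move=> z /andP[zx /eqP sz]; rewrite h3 sz eqxx andbT -g'z ?porbit_next //.
    by apply: contra xu => /eqP <-; rewrite sz.
  by apply: contra xv => /eqP <-; rewrite sz.
- have [->|xu] := eqVneq x u; first by rewrite g'u !eh /= h3 muv.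
  have [->|xv] := eqVneq x v; first by rewrite g'v !eh /= h3 muv.
  by rewrite g'z // !eh /= h3.
- have [->|xu] := eqVneq x u.
    (* From [u] to its new successor [g v]: first edge k, cut at [g v], and then the old path from
       [v] to [g v]. *)
    rewrite g'u; apply: (@connect_trans _ _ v); last exact/subC.
    by apply: connect1; rewrite crelS hB eqxx orbT /joins !eqxx orbT.
  have [->|xv] := eqVneq x v.
    rewrite g'v; apply: (@connect_trans _ _ u); last exact/subC.
    by apply: connect1; rewrite crelS hA eqxx /= /joins !eqxx !orbT.
  by rewrite g'z //; apply/subC.
Qed.

End Layout.
(** * Labelling program: spanning forest and positions *)

Notation "p ;; q" := (HSeq p q) (at level 60, right associativity).

Definition vE := 30.    Definition vU := 31.    Definition vV := 32.
Definition vV0 := 33.   Definition vI := 34.    Definition vx := 35.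
Definition vy := 36.    Definition vs := 37.    Definition vk := 38.
Definition vj := 39.    Definition vq := 40.    Definition vt := 41.
Definition vcol := 42.  Definition vpu := 43.   Definition vpv := 44.
Definition vcnt := 45.  Definition vst := 46.   Definition vcur := 47.
Definition vlen := 48.  Definition vstep := 49. Definition vp := 50.
Definition vop := 51.   Definition vf := 52.    Definition vb := 53.
Definition vo := 55.

Definition aNX := 4.    Definition aA := 5.     Definition aB := 6.
Definition aPOS := 7.   Definition aST := 8.    Definition aVAL := 9.
Definition aSK := 10.   Definition aSE := 11.   Definition aPS := 12.
Definition aLB := 13.

(** All table sizes come from the word size alone. This is how the decoder, whose input does not
    contain n, knows the layout of the labels. *)
Definition CONSTS (p0 : nat) : hcmd :=
  HAsg vJ (HB Add (HB Mul (HC 2) (HV vL)) (HC 2)) ;;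
  HAsg vJ5 (HB Mul (HV vJ) (HC 5)) ;;
  HAsg vP (HB Mul (HC p0) (HV vL)) ;;
  HAsg vSZ (HB Mul (HV vP) (HV vJ5)) ;;
  HAsg vNF (HB Add (HC 5) (HB Mul (HC 4) (HV vSZ))) ;;
  HAsg v5 (HC 5) ;; HAsg v4 (HC 4) ;; HAsg v3 (HC 3).

Definition INITNX : hcmd := HFor vV0 vN (HSet aNX (HV vV0) (HC 0) (HV vV0)).

Definition ENDS : hcmd :=
  HAsg vU (HA aIN (HC 0) (HB Add (HC 3) (HB Mul (HC 2) (HV vE)))) ;;
  HAsg vV (HA aIN (HC 0) (HB Add (HC 4) (HB Mul (HC 2) (HV vE)))).

Definition CUTS : hcmd :=
  HAsg vB (HV vF) ;;
  HSet aA (HV vE) (HC 0) (HA aNX (HV vU) (HC 0)) ;;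
  HSet aB (HV vE) (HC 0) (HA aNX (HV vV) (HC 0)).

Definition SWAP : hcmd :=
  HSet aNX (HV vU) (HC 0) (HA aB (HV vE) (HC 0)) ;;
  HSet aNX (HV vV) (HC 0) (HA aA (HV vE) (HC 0)).

Definition EDGE : hcmd :=
  ((ENDS ;; HAsg vF (HV vU)) ;; FIND) ;;
  ((HAsg vA (HV vF) ;; HAsg vF (HV vV)) ;; FIND) ;;
  CUTS ;; HIf (HB Eqw (HV vA) (HV vB)) hskip SWAP ;; UNION.

Definition EDGES : hcmd := HFor vE vM EDGE.

Definition VISIT : hcmd :=
  HSet aPOS (HV vcur) (HC 0) (HV vcnt) ;;
  HSet aST (HV vcur) (HC 0) (HV vst) ;;
  HAsg vcnt (HB Add (HV vcnt) (HC 1)) ;;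
  HAsg vcur (HA aNX (HV vcur) (HC 0)).

Definition WALKINIT : hcmd :=
  HAsg vlen (HB Add (HA aSZ (HV vV0) (HC 0)) (HC 1)) ;;
  HAsg vst (HV vcnt) ;; HAsg vcur (HV vV0).

(** Only a representative, whose parent entry is 0, starts a walk; the stored size tells how long
    its cycle is. *)
Definition WALK1 : hcmd :=
  HIf (HA aPAR (HV vV0) (HC 0)) hskip (WALKINIT ;; HFor vstep vlen VISIT).

Definition WALK : hcmd := HAsg vcnt (HC 0) ;; HFor vV0 vN WALK1.

Lemma frame_v w D p h x : x \notin wv p -> hv (hexec w D p h) x = hv h x.
Proof. exact: (hexec_frame w D p h).1. Qed.

Lemma frame_a w D p h a : a \notin wa p -> ha (hexec w D p h) a = ha h a.
Proof. exact: (hexec_frame w D p h).2. Qed.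

Lemma index_rcons_mem (T : eqType) (s : seq T) x y :
  x \in s -> index x (rcons s y) = index x s.
Proof. by move=> xs; rewrite -cats1 index_cat xs. Qed.

Section Forest.
Variables w D L n m : nat.
Hypotheses (w10 : 10 <= w) (D0 : 0 < D) (Dw : narr * D * D <= 2 ^ w).
Hypotheses (nD : n < D) (nL : n < 2 ^ L) (LD : L <= D) (mD : 2 * m + 5 < D).
Variables (eu ev : nat -> 'I_n).
Local Notation hexec := (hexec w D).

Let small := (small w10).
Let ltD x := @lt_dim_pow w D x D0 Dw.
Let w0 : 0 < w := leq_trans (isT : 0 < 10) w10.
Let ordD (x : 'I_n) : x < D := ltn_trans (ltn_ord x) nD.

Definition ends_at (h : hst) : Prop := forall k, k < m ->
  ha h aIN 0 (3 + 2 * k) = eu k /\ ha h aIN 0 (4 + 2 * k) = ev k.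

Lemma ends_exec h k : k < m -> hv h vE = k -> ends_at h ->
  hexec ENDS h = setv (setv h vU (eu k)) vV (ev k).
Proof.
move=> km hE hin; have [e1 e2] := hin k km.
rewrite /= !hE !mod0n !small //.
have h0 : 2 * k < 2 ^ w by apply: ltD; lia.
have h1 : 3 + 2 * k < 2 ^ w by apply: ltD; lia.
have h2 : 4 + 2 * k < 2 ^ w by apply: ltD; lia.
rewrite !mulE // !addE // ![_ %% D]modn_small; try lia.
by rewrite e1 e2.
Qed.

Definition edges_inv k h : Prop := exists (s : ufs) (g : {perm 'I_n}),
  [/\ uf_at n h s, forall x : 'I_n, ha h aNX x 0 = g x
    & lay eu ev k (fun i => ha h aA i 0) (fun i => ha h aB i 0) s g].

Lemma edge_exec k h : k < m -> hv h vE = k -> hv h vL = L -> ends_at h ->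
  edges_inv k h -> edges_inv k.+1 (hexec EDGE h).
Proof.
move=> km hE hL hin [s [g [uf nx ly]]].
set u := eu k; set v := ev k; have kD : k < D by lia.
set h1 := hexec (ENDS ;; HAsg vF (HV vU)) h.
have h1E : h1 = setv (setv (setv h vU u) vV v) vF u.
  by rewrite /h1 -[LHS]/(hexec (HAsg vF (HV vU)) (hexec ENDS h)) (ends_exec km).
have uf1 : uf_at n h1 s by rewrite h1E.
set h2 := hexec FIND h1.
have h2F : hv h2 vF = s.1 u by rewrite (find_exec w10 D0 Dw nD nL LD uf1) h1E //= ltn_ord.
have uf2 : uf_at n h2 s by apply: uf_at_ext uf1; apply: frame_a.
set h3 := hexec (HAsg vA (HV vF) ;; HAsg vF (HV vV)) h2.
have h2V : hv h2 vV = v by rewrite (@frame_v _ _ FIND) // h1E.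
have h3E : h3 = setv (setv h2 vA (s.1 u)) vF v by rewrite /h3 /= h2V h2F.
set h4 := hexec FIND h3.
have uf3 : uf_at n h3 s by rewrite h3E.
have h3L : hv h3 vL = L by rewrite h3E /= (@frame_v _ _ FIND) // h1E.
have h4F : hv h4 vF = s.1 v by rewrite (find_exec w10 D0 Dw nD nL LD uf3) // h3E //= ltn_ord.
have uf4 : uf_at n h4 s by apply: uf_at_ext uf3; apply: frame_a.
have h4A : hv h4 vA = s.1 u by rewrite (@frame_v _ _ FIND) // h3E.
have h4v x : x \in [:: vU; vV; vE] -> hv h4 x = hv h1 x.
  by rewrite !inE => /or3P[] /eqP->; rewrite (@frame_v _ _ FIND) // h3E /= (@frame_v _ _ FIND).
have h4a a : ha h4 a = ha h a.
  by rewrite (@frame_a _ _ FIND) // h3E (@frame_a _ _ FIND) // h1E.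
have [h4U h4V h4E] : [/\ hv h4 vU = u, hv h4 vV = v & hv h4 vE = k].
  by rewrite !h4v // h1E /= hE.
set h5 := hexec CUTS h4.
have h5E : h5 = seta (seta (setv h4 vB (s.1 v)) aA k 0 (g u)) aB k 0 (g v).
  by rewrite /h5 /= h4F h4U h4V h4E !h4a !mod0n (modn_small kD) !(modn_small (ordD _)) !nx.
have h5v x : x != vB -> hv h5 x = hv h4 x by rewrite h5E /= => /negbTE->.
have uf5 : uf_at n h5 s by rewrite h5E.
set h6 := hexec (HIf (HB Eqw (HV vA) (HV vB)) hskip SWAP) h5.
have h5AB : hv h5 vA = s.1 u /\ hv h5 vB = s.1 v by rewrite h5E /= h4A.
have EE : hexec EDGE h = hexec UNION h6 by [].
clearbody h5.
have h6E : h6 = if s.1 u == s.1 v then setv h5 vX (hv h5 vX) else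
     seta (seta h5 aNX u 0 (g v)) aNX v 0 (g u).
  case: h5AB => hA hB; rewrite /h6 /= hA hB eqwE // !h5v // h4U h4V h4E !mod0n (modn_small kD)
    !(modn_small (ordD _)).
  by case: (s.1 u == s.1 v) => //=; rewrite h5E /= !eqxx.
have h6v x : x != vX -> hv h6 x = hv h5 x.
  by rewrite h6E; case: ifP => //= _ /negbTE->.
have uf6 : uf_at n h6 s by rewrite h6E; case: ifP.
have uf7 : uf_at n (hexec UNION h6) (umerge s u v).
  by apply: (union_exec w10 D0 Dw nD nL LD); rewrite ?ltn_ord ?h6v //; case: h5AB.
exists (umerge s u v), (if s.1 u == s.1 v then g else (tperm u v * g)%g).
rewrite EE; split=> //.
  move=> x; rewrite (@frame_a _ _ UNION) // h6E; case: ifP => [_|suv] /=.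
    by rewrite h5E /= h4a nx.
  rewrite !eqxx !andbT permM; case: tpermP => [->|->|/eqP xu /eqP xv].
  - by rewrite eqxx; case: (val u =P v) => // e; rewrite (val_inj e) eqxx in suv.
  - by rewrite eqxx.
  - by rewrite !val_eqE (negbTE xu) (negbTE xv) h5E /= h4a nx.
have [eA eB] : ha (hexec UNION h6) aA = ha h5 aA /\ ha (hexec UNION h6) aB = ha h5 aB.
  by split; rewrite (@frame_a _ _ UNION) // h6E; case: ifP.
rewrite eA eB h5E /=; apply: lay_step.
- by apply: lay_ext ly => i ik; rewrite /= (ltn_eqF ik) h4a.
- by rewrite !eqxx.
- by rewrite !eqxx.
Qed.

Lemma edges_exec h : hv h vL = L -> hv h vN = n -> hv h vM = m -> ends_at h ->
  (forall x, ha h aPAR x 0 = 0) -> (forall x, ha h aSZ x 0 = 0) ->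
  edges_inv m (hexec (INITNX ;; EDGES) h).
Proof.
move=> hL hN hM hin p0 s0; rewrite -[hexec _ _]/(hexec EDGES (hexec INITNX h)).
set h1 := hexec INITNX h.
have nx1 : forall x, x < n -> ha h1 aNX x 0 = x.
  have [] := @forP w D (fun k t => forall x, x < k -> ha t aNX x 0 = x) _ _ _ h
    (isT : wf INITNX); rewrite ?hN //.
  move=> k t kn tx _ IH x /=; rewrite tx !mod0n modn_small; last by apply: ltn_trans nD.
  rewrite ltnS leq_eqVlt => /predU1P[->|xk]; first by rewrite !eqxx.
  by rewrite (ltn_eqF xk) /=; apply: IH.
have [hL1 hN1 hM1] : [/\ hv h1 vL = L, hv h1 vN = n & hv h1 vM = m].
  by rewrite !(@frame_v _ _ INITNX).
have in1 : ends_at h1 by move=> k km; rewrite (@frame_a _ _ INITNX) //; apply: hin.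
have [] := @forP w D edges_inv _ _ _ h1 (isT : wf EDGES); rewrite ?hM1 //.
  exists (id, fun=> 0), 1%g; split.
  - split=> [|x _] /=; last by rewrite (@frame_a _ _ INITNX).
    apply: uf_ok_ext (uf_init n) => x _; by rewrite (@frame_a _ _ INITNX).
  - by move=> x; rewrite perm1 /= nx1.
  - exact: lay0.
move=> k t km tx [frv fra] [s [g [uf nx ly]]].
have := @edge_exec k t km tx _ _ (ex_intro _ s (ex_intro _ g (And3 uf nx ly))).
case.
- by rewrite (frv vL isT).
- by move=> i im; rewrite (fra aIN isT); apply: in1.
by move=> s' [g' [uf' nx' ly']]; exists s', g'; split.
Qed.

(** * Cyclic orders laid out on a line *)

Section Walk.
Variables (s : ufs) (g : {perm 'I_n}).
Hypothesis orb : forall x y : 'I_n, s.1 x = s.1 y -> y \in porbit g x.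
Hypothesis nxt : forall x : 'I_n, s.1 (g x) = s.1 x.

Let uf_h h := [/\ uf_at n h s, forall x : 'I_n, ha h aNX x 0 = g x & hv h vN = n].

Lemma orbit_class (x y : 'I_n) : (y \in porbit g x) = (s.1 y == s.1 x).
Proof.
apply/idP/eqP => [yx|e]; last exact: orb.
by apply/eqP; apply: (@porbit_ind _ g (fun z : 'I_n => s.1 z == s.1 x)) yx => // z; rewrite nxt.
Qed.

(** The trees form consecutive blocks sorted by representative; each block begins with its
    representative and follows [g]. *)
Record order_at (v : nat) (o : seq 'I_n) : Prop := OrderAt {
  ord_uniq : uniq o;
  ord_mem : forall x, (x \in o) = (s.1 x < v);
  ord_mono : forall z p q, p <= q < size o -> s.1 (nth z o p) <= s.1 (nth z o q);
  ord_next : forall z p, p.+1 < size o -> s.1 (nth z o p) = s.1 (nth z o p.+1) ->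
    nth z o p.+1 = g (nth z o p);
  ord_first : forall x y : 'I_n, x \in o -> s.1 x = y -> y \in o /\ index y o <= index x o }.

Definition placed (h : hst) (o : seq 'I_n) : Prop :=
  hv h vcnt = size o /\ forall x : 'I_n, x \in o -> ha h aPOS x 0 = index x o /\
    exists2 y : 'I_n, s.1 x = y & y \in o /\ ha h aST x 0 = index y o.

Lemma class_size h (v : 'I_n) : uf_at n h s -> ha h aPAR v 0 = 0 ->
  s.2 v + 1 = #|porbit g v|.
Proof.
move=> [ok _] pv; rewrite (uf_count ok) //.
have sv : s.1 v = v by apply: (uf_root ok).
rewrite -val_enum_ord count_map -sum1_count -sum1_card big_enum_cond /=.
by apply: eq_bigl => x; rewrite orbit_class sv.
Qed.

(** If [v] is a representative, its whole cycle is appended. It is disjoint from the vertices placed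
    so far, whose representatives are smaller. *)
Lemma walk1_exec h (v : 'I_n) o : uf_h h -> hv h vV0 = v -> order_at v o -> placed h o ->
  exists2 o', order_at v.+1 o' & placed (hexec WALK1 h) o'.
Proof.
move=> [uf nx hN] hv0 od pl; have [ok sz] := uf; have vD' := ordD v.
have -> : hexec WALK1 h = if ha h aPAR v 0 == 0 then
    hexec (HFor vstep vlen VISIT) (hexec WALKINIT h) else hexec hskip h.
  rewrite -[LHS]/(if ha h aPAR (hv h vV0 %% D) (0 %% 2 ^ w %% D) != 0 then
   hexec hskip h else hexec (HFor vstep vlen VISIT) (hexec WALKINIT h)).
  by rewrite hv0 !mod0n (modn_small vD'); case: eqP.
case: ifP => [/eqP pv|/eqP pv]; last first.
  exists o; last exact: pl.
  case: od => o1 o2 o3 o4 o5; split=> // x.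
  rewrite o2 [RHS]ltnS [RHS]leq_eqVlt; case: (s.1 x =P v) => [e|_] //=.
  by case: pv; rewrite -e; apply: (uf_rep ok).
have sv : s.1 v = v by exact: (uf_root ok (ltn_ord v) pv).
set len := #|porbit g v|; have lenE := class_size uf pv; rewrite -/len in lenE.
set h1 := hexec WALKINIT h.
have szn := uf_sz ok (ltn_ord v).
have h1E : h1 = setv (setv (setv h vlen len) vst (size o)) vcur v.
  case: pl => pc _; rewrite /h1 /= !hv0 !mod0n (modn_small vD') sz // small // addE ?lenE //.
    by rewrite pc.
  by rewrite -lenE; apply: ltD; lia.
have lenU := uniq_traject_porbit g v; have lenM := porbit_traject g v.
rewrite -/len in lenU lenM.
have trS x k : x \in traject g v k -> s.1 x = v.
  case/trajectP=> i _ ->; rewrite -sv; apply/eqP; rewrite -orbit_class -permX.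
  exact: mem_porbit.
case: (od) => o1 o2 o3 o4 o5.
have dis k x : x \in traject g v k -> x \notin o by move=> /trS e; rewrite o2 e ltnn.
have lenn : size o + len <= n.
  have : uniq (o ++ traject g v len).
    rewrite cat_uniq o1 lenU andbT; apply/hasPn => x /dis //.
  move=> /card_uniqP; rewrite size_cat size_traject => <-.
  by apply: leq_trans (max_card _) _; rewrite card_ord.
set I := fun k t => placed t (o ++ traject g v k) /\ hv t vcur = iter k g v.
have [] := @forP w D I _ _ _ h1 (isT : wf (HFor vstep vlen VISIT)).
- rewrite /I cats0 h1E /=; split=> //; case: pl => p1 p2; split=> //.
- have -> : hv h1 vlen = len by rewrite h1E.
  move=> k t kl tx [frv fra] [[pc pp] cu].
  have tst : hv t vst = size o by rewrite (frv vst isT) h1E.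
  have tnx (x : 'I_n) : ha t aNX x 0 = g x by rewrite (fra aNX isT) h1E /= nx.
  rewrite size_cat size_traject in pc.
  have cw : hv t vcnt + 1 < 2 ^ w by rewrite pc; apply: ltD; lia.
  set y := iter k g v.
  have trE : traject g v k.+1 = rcons (traject g v k) y by rewrite trajectSr.
  have yn : y \notin o ++ traject g v k.
    have yt : y \in traject g v k.+1 by rewrite trE mem_rcons mem_head.
    rewrite mem_cat (negbTE (dis _ _ yt)) /=.
    have := lenU; have -> : len = k.+1 + (len - k.+1) by lia.
    rewrite trajectD cat_uniq => /and3P[+ _ _]; rewrite trE rcons_uniq => /andP[] //.
  have E : o ++ traject g v k.+1 = rcons (o ++ traject g v k) y.
    by rewrite trE -!cats1 catA.
  have tE : setv (hexec VISIT t) vstep k.+1 =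
      setv (setv (setv (seta (seta t aPOS y 0 (size o + k)) aST y 0 (size o)) vcnt (size o + k + 1))
        vcur (g y)) vstep k.+1.
    rewrite /= cu tst !mod0n (modn_small (ordD y)) small // addE // pc.
    by rewrite /= tnx.
  rewrite /I tE; split=> //; rewrite E; split.
    by rewrite /= size_rcons size_cat size_traject addn1.
  move=> x; rewrite mem_rcons inE => /predU1P[->|xo].
    rewrite /= !eqxx; split.
      by rewrite -cats1 index_cat (negbTE yn) /= eqxx size_cat size_traject addn0.
    exists v; first by apply: (trS _ k.+1); rewrite trE mem_rcons mem_head.
    have vm : v \in o ++ traject g v k.+1 by rewrite mem_cat mem_head orbT.
    split; first by rewrite -E.
    have vo : v \notin o by rewrite o2 sv ltnn.
    by rewrite -E index_cat (negbTE vo) /= eqxx addn0.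
  have xy : x == y = false by apply/eqP => xy; rewrite -xy xo in yn.
  have [e1 [z e2 [zm e3]]] := pp x xo.
  rewrite /= !andbT val_eqE xy e1 e3 index_rcons_mem //; split=> //.
  by exists z; rewrite // index_rcons_mem // mem_rcons inE zm orbT.
have -> : hv h1 vlen = len by rewrite h1E.
move=> [pl' _] _; exists (o ++ traject g v len) => //; split.
- by rewrite cat_uniq o1 lenU andbT; apply/hasPn => x /dis.
- move=> x; rewrite mem_cat o2 -lenM orbit_class sv [RHS]ltnS [RHS]leq_eqVlt orbC //.
- move=> z p q; rewrite size_cat size_traject => pq; rewrite !nth_cat.
  have bl i : i < len -> s.1 (nth z (traject g v len) i) = v.
    by move=> il; apply: (trS _ len); rewrite mem_nth // size_traject.
  have ol i : i < size o -> s.1 (nth z o i) < v by move=> io; rewrite -o2 mem_nth.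
  case: (ltnP q (size o)) => hq.
    have -> : p < size o by lia.
    by apply: o3; lia.
  rewrite (bl (q - size o)); last by lia.
  by case: ltnP => hp; [apply/ltnW/ol | rewrite bl //; lia].
- move=> z p; rewrite size_cat size_traject => hp; rewrite !nth_cat.
  case: (ltnP p.+1 (size o)) => hp1.
    have -> : p < size o by lia.
    exact: o4.
  case: (ltnP p (size o)) => hp2.
    move=> e; have : s.1 (nth z o p) < v by rewrite -o2 mem_nth.
    rewrite e (trS _ len) ?ltnn // mem_nth // size_traject; lia.
  have nt i : i < len -> nth z (traject g v len) i = iter i g v.
    by move=> il; rewrite (set_nth_default v) ?size_traject // nth_traject.
  by move=> _; rewrite subSn // !nt //; lia.
- move=> x y; rewrite mem_cat => /orP[xo|xt] sx.
    by have [yo le] := o5 x y xo sx; rewrite mem_cat yo !index_cat xo yo.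
  have yv : y = v by apply: val_inj; rewrite /= -sx (trS _ _ xt).
  have vo : v \notin o by rewrite o2 sv ltnn.
  have vt : v \in traject g v len by rewrite -lenM porbit_id.
  rewrite yv mem_cat vt orbT !index_cat (negbTE vo) (negbTE (dis _ _ xt)); split=> //.
  rewrite leq_add2l; case: (len) vt => //= k _; by rewrite eqxx.
Qed.

Lemma walk_exec h : uf_h h ->
  exists2 o, order_at n o & placed (hexec WALK h) o.
Proof.
move=> [uf nx hN]; rewrite -[hexec _ _]/(hexec (HFor vV0 vN WALK1) (setv h vcnt (0 %% 2 ^ w))).
rewrite mod0n; set h1 := setv _ _ _.
have [] := @forP w D (fun k t => exists2 o, order_at k o & placed t o) _ _ _ h1
   (isT : wf (HFor vV0 vN WALK1)).
- by exists [::]; [split=> // z p q; rewrite ltn0 andbF | split].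
- rewrite -[hv h1 vN]/(hv h vN) hN => k t kn tx [frv fra] [o od pl].
  have ut : uf_h t.
    split; last by rewrite (frv vN isT).
      by apply: uf_at_ext uf; rewrite fra.
    by move=> x; rewrite (fra aNX isT) nx.
  have [o' od' pl'] := @walk1_exec t (Ordinal kn) o ut tx od pl.
  by exists o'.
by rewrite -[hv h1 vN]/(hv h vN) hN => [[o od pl]] _; exists o.
Qed.

End Walk.

Lemma hcosts_le T (I : nat -> T -> Prop) f c (b : nat -> nat) k q t :
  I k t -> (forall i t', k <= i < k + q -> I i t' -> c t' <= b i /\ I i.+1 (f i t')) ->
  hcosts f c k q t <= \sum_(k <= i < k + q) b i.
Proof.
elim: q k t => [|q IH] k t Ik Is /=; first by rewrite big_geq ?addn0.
have [h1 h2] := Is k t ltac:(lia) Ik.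
rewrite big_ltn; last by lia.
apply: leq_add => //; rewrite addnS -addSn; apply: IH => // i t' hi.
by apply: Is; lia.
Qed.

Lemma hcosts_const T (f : nat -> T -> T) c k q t : hcosts f (fun=> c) k q t = q * c.
Proof. by elim: q k t => //= q IH k t; rewrite IH mulSn. Qed.

(* The inner loops run over disjoint classes, so their lengths add up to n. *)
Lemma walk_cost h s : uf_at n h s -> hv h vN = n -> hcost w D WALK h <= 400 * n + 8.
Proof.
move=> uf hN; have [ok sz] := uf.
pose b v := 100 + (ha h aPAR v 0 == 0) * ((s.2 v + 1) * 150).
have H : \sum_(0 <= v < n) b v <= 400 * n - 150 * n.
  rewrite big_split /= sum_nat_const_nat subn0.
  have : \sum_(0 <= v < n) (ha h aPAR v 0 == 0) * ((s.2 v + 1) * 150) <=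
         \sum_(0 <= v < n) count (fun z => s.1 z == v) (iota 0 n) * 150.
    rewrite !big_mkord; apply: leq_sum => v _; case: eqP => //= pv.
    by rewrite mul1n (uf_count ok).
  rewrite -big_distrl /=.
  have -> : \sum_(0 <= v < n) count (fun z => s.1 z == v) (iota 0 n) = n.
    under eq_bigr do rewrite -sum1_count big_mkcond /=.
    rewrite exchange_big /= -{3}(size_iota 0 n) -sum1_size big_seq [RHS]big_seq.
    apply: eq_bigr => z; rewrite mem_iota => zn.
    rewrite big_mkord (bigD1 (Ordinal (uf_lt ok zn))) //= eqxx big1 // => v.
    by rewrite -val_eqE /= eq_sym => /negbTE->.
  by lia.
have -> : hcost w D WALK h = 2 + (2 + (hcosts (fun k t => setv (hexec WALK1 t) vV0 k.+1)
   (fun t => hcost w D WALK1 t + 8) 0 (hv h vN) (setv (setv h vcnt (0 %% 2 ^ w)) vV0 0) + 4)) by [].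
rewrite hN; set C := hcosts _ _ _ _ _.
suff : C <= \sum_(0 <= v < n) b v by lia.
have := @hcosts_le _ (fun i t => [/\ hv t vV0 = i, ha t aPAR = ha h aPAR & ha t aSZ = ha h aSZ])
  (fun k t => setv (hexec WALK1 t) vV0 k.+1) (fun t => hcost w D WALK1 t + 8) b 0 n
  (setv (setv h vcnt (0 %% 2 ^ w)) vV0 0).
rewrite add0n; apply=> // i t /andP[_ iN] [tv tP tS]; split; last first.
  by split=> //=; rewrite (@frame_a _ _ WALK1).
have iD : i < D by apply: ltn_trans nD.
have sn := uf_sz ok iN.
rewrite /= tv !mod0n (modn_small iD) tP tS /b; case: eqP => [_|_] /=; last by lia.
rewrite sz // small // addE; last by apply: ltD; lia.
rewrite hcosts_const; lia.
Qed.

End Forest.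
(** * Labelling program: sketches and labels *)

Definition READ (x : nat) : hcmd :=
  HAsg x (HC 0) ;;
  HFor vk vW (HRand vt ;; HAsg x (HB Xor (HV x) (HB Shl (HV vt) (HV vk)))).

Definition VALS : hcmd :=
  HSet aVAL (HC 0) (HC 0) (HV vx) ;; HSet aVAL (HC 0) (HC 1) (HV vy) ;;
  HSet aVAL (HC 0) (HC 2) (HB And (HV vx) (HV vy)) ;;
  HSet aVAL (HC 0) (HC 3) (HV vpu) ;; HSet aVAL (HC 0) (HC 4) (HV vpv).

Definition CELL : hcmd :=
  HAsg vcol (HB Add (HB Mul (HV vI) (HV vJ5)) (HB Add (HB Mul (HV vj) (HC 5)) (HV vq))) ;;
  HAsg vT (HB Mul (HV vs) (HA aVAL (HC 0) (HV vq))) ;;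
  HSet aSK (HV vpu) (HV vcol) (HB Xor (HA aSK (HV vpu) (HV vcol)) (HV vT)) ;;
  HSet aSK (HV vpv) (HV vcol) (HB Xor (HA aSK (HV vpv) (HV vcol)) (HV vT)) ;;
  HSet aSE (HV vE) (HV vcol) (HV vT).

Definition COIN : hcmd := HRand vt ;; HAsg vs (HB And (HV vs) (HV vt)).

Definition LEVELS : hcmd := HFor vj vJ (HFor vq v5 CELL ;; COIN).

Definition ENDPOS : hcmd :=
  ENDS ;; HAsg vpu (HA aPOS (HV vU) (HC 0)) ;; HAsg vpv (HA aPOS (HV vV) (HC 0)).

Definition SKEDGE : hcmd :=
  ENDPOS ;; READ vx ;; READ vy ;; (VALS ;; HAsg vs (HC 1)) ;; LEVELS.

Definition SKETCH : hcmd := HFor vI vP (HFor vE vM SKEDGE).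

Definition PREFIX : hcmd :=
  HFor vp vN (HFor vk vSZ
    (HSet aPS (HB Add (HV vp) (HC 1)) (HV vk)
       (HB Xor (HA aPS (HV vp) (HV vk)) (HA aSK (HV vp) (HV vk))))).

Lemma forN w D N (I : nat -> hst -> Prop) x y p h :
  hv h y = N -> wf (HFor x y p) -> I 0 (setv h x 0) ->
  (forall k s, k < N -> hv s x = k -> same_off (x :: wv p) (wa p) h s ->
     I k s -> I k.+1 (setv (hexec w D p s) x k.+1)) ->
  I N (hexec w D (HFor x y p) h).
Proof. by move=> <- wfp I0 IS; have [] := @forP w D I x y p h wfp I0 IS. Qed.

(** * Correctness of the sketches and their prefix XORs *)

Section Sketch.
Variables w D L n m p0 : nat.
Let P := p0 * L.
Let J := 2 * L + 2.
Let J5 := J * 5.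
Let SZ := P * J5.
Let NF := 5 + 4 * SZ.
Hypotheses (w10 : 10 <= w) (D0 : 0 < D) (Dw : narr * D * D <= 2 ^ w).
Hypothesis bigD : (n + m + 4) * (NF * w + 4) + 10 <= D.
Hypotheses (L0 : 0 < L) (pp0 : 0 < p0) (nL : n < 2 ^ L).
Variables (eu ev : nat -> 'I_n).
Local Notation hexec := (hexec w D).

Let small := (small w10).
Let ltD x := @lt_dim_pow w D x D0 Dw.
Let w0 : 0 < w := leq_trans (isT : 0 < 10) w10.

Definition cvars := [:: vW; vL; vP; vJ; vJ5; vSZ; vNF; v5; v4; v3].

Definition cval (x : nat) : nat :=
  if x == vW then w else if x == vL then L else if x == vP then P else
  if x == vJ then J else if x == vJ5 then J5 else if x == vSZ then SZ else
  if x == vNF then NF else if x == v5 then 5 else if x == v4 then 4 else 3.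

Definition consts_at (h : hst) := forall x, x \in cvars -> hv h x = cval x.

Lemma consts_fr xs ys h h' : same_off xs ys h h' -> all (fun x => x \notin xs) cvars ->
  consts_at h -> consts_at h'.
Proof. by move=> [fv _] /allP nx ch x xc; rewrite fv ?nx // ch. Qed.

Lemma sizes : [/\ NF + 4 <= D, SZ + 4 <= D, n + m + 4 <= D, J5 <= SZ & P <= SZ].
Proof.
have J50 : 0 < J5 by rewrite /J5 /J; lia.
have P0 : 0 < P by rewrite muln_gt0 pp0 L0.
have h1 : NF + 4 <= NF * w + 4 by nia.
have h2 : NF * w + 4 <= (n + m + 4) * (NF * w + 4) by rewrite leq_pmull //; lia.
have h3 : n + m + 4 <= (n + m + 4) * (NF * w + 4) by rewrite leq_pmulr //; lia.
have h4 : SZ <= NF by rewrite /NF; lia.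
have h5 : J5 <= SZ by rewrite leq_pmull.
have h6 : P <= SZ by rewrite leq_pmulr.
by split; lia.
Qed.

Lemma dims : [/\ n < D, L <= D & 2 * m + 5 < D].
Proof.
have [s1 s2 s3 s4 s5] := sizes.
have h1 : (n + m + 4) * 4 <= (n + m + 4) * (NF * w + 4) by rewrite leq_mul2l leq_addl orbT.
have h2 : L <= J5 by rewrite /J5 /J; lia.
by split; lia.
Qed.

Lemma consts_exec h : hv h vW = w -> hv h vL = L -> consts_at (hexec (CONSTS p0) h).
Proof.
move=> hW hL x xc; have [s1 s2 s3 s4 s5] := sizes.
have q1 : p0 <= P by rewrite leq_pmulr.
have q2 : 2 * L <= J by rewrite /J; lia.
have q3 : J * 5 <= SZ by [].
have E : hexec (CONSTS p0) h = setv (setv (setv (setv (setv (setv (setv (setv h vJ J) vJ5 J5) vP P)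
    vSZ SZ) vNF NF) v5 5) v4 4) v3 3.
  have c0 : p0 %% 2 ^ w = p0 by apply: modn_small; apply: ltD; lia.
  rewrite /CONSTS /= hL c0 !small //.
  rewrite (@mulE _ 2 L); last by apply: ltD; lia.
  rewrite (@addE _ (2 * L) 2) -/J; last by apply: ltD; lia.
  rewrite (@mulE _ J 5) -/J5; last by apply: ltD; lia.
  rewrite (@mulE _ p0 L) -/P; last by apply: ltD; lia.
  rewrite (@mulE _ P J5) -/SZ; last by apply: ltD; lia.
  rewrite (@mulE _ 4 SZ); last by apply: ltD; rewrite /NF in s1; lia.
  by rewrite (@addE _ 5) -/NF //; apply: ltD; lia.
rewrite E; move: xc; rewrite !inE.
do 9!(case/orP=> [/eqP->|]; first by rewrite /= ?hW ?hL).
by move=> /eqP->.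
Qed.

Lemma head_drop (r : seq bool) q : head false (drop q r) = nth false r q.
Proof. by rewrite -nth0 nth_drop addn0. Qed.

Lemma behead_drop (r : seq bool) q : behead (drop q r) = drop q.+1 r.
Proof. by rewrite -drop1 drop_drop add1n. Qed.

Lemma read_exec x h (r : seq bool) q : x \in [:: vx; vy] -> consts_at h -> ht h = drop q r ->
  hv (hexec (READ x) h) x = wordof (fun k => nth false r (q + k)) w /\
  ht (hexec (READ x) h) = drop (q + w) r.
Proof.
move=> xx ch hth.
have hW : hv h vW = w := ch vW isT.
have wf1 : wf (HFor vk vW (HRand vt ;; HAsg x (HB Xor (HV x) (HB Shl (HV vt) (HV vk))))).
  by move: xx; rewrite !inE => /orP[] /eqP->.
set FOR := HFor vk vW _ in wf1.
have -> : hexec (READ x) h = hexec FOR (setv h x (0 %% 2 ^ w)) by [].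
rewrite mod0n.
have xW : (vW == x) = false by move: xx; rewrite !inE => /orP[] /eqP->.
have xk : (x == vk) = false by move: xx; rewrite !inE => /orP[] /eqP->.
have xt : (x == vt) = false by move: xx; rewrite !inE => /orP[] /eqP->.
have hW' : hv (setv h x 0) vW = w by rewrite /= xW.
apply: (@forN w D w (fun k t => hv t x = wordof (fun k => nth false r (q + k)) k /\
   ht t = drop (q + k) r) _ _ _ (setv h x 0) hW' wf1).
- by rewrite /= xk eqxx /wordof big_ord0 addn0.
- move=> k t kw tk _ [e1 e2] /=.
  rewrite xk eqxx xt tk e1 e2 head_drop behead_drop addnS; split=> //.
  rewrite shlE; last first.
    by case: nth; rewrite ?mul1n ?mul0n ?expn_gt0 // ltn_exp2l.
  rewrite xorE ?wordofS //; first by apply: leq_trans (wordof_lt _ _) _; rewrite leq_exp2l // ltnW.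
  by case: nth; rewrite ?mul1n ?mul0n ?expn_gt0 // ltn_exp2l.
Qed.

Variables (r : seq bool) (pos : 'I_n -> nat).
Hypothesis pos_lt : forall x, pos x < n.
Let pu e := pos (eu e).
Let pv e := pos (ev e).
Local Notation sampled := (sampled m w J).
Local Notation sval := (sval m w J pu pv).
Local Notation rb := (rbits w J).

(* Column [i * J5 + (5 * j + q)] of a sketch belongs to phase i, level j and  *)
(* the q-th of the five words attached to an edge.                            *)
Definition ske e k : nat :=
  sampled r (k %/ J5) e (k %% J5 %/ 5) * sval r (k %/ J5) e (k %% J5 %% 5).

(** Marks the cells already written when the nested loops stand at phase i, edge e and offset t:
    lexicographic order on phase, edge, offset. *)
Definition dn i e t e' k : bool :=
  (k %/ J5 < i) || (k %/ J5 == i) && ((e' < e) || (e' == e) && (k %% J5 < t)).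

(** The sum modulo 2 makes the total over all positions cancel, see [psum_total]; for edges with
    distinct ends it is plain incidence. *)
Definition touch e p : bool := (pu e == p) (+) (pv e == p).

Definition sk_inv i e t h : Prop :=
  (forall e' k, e' < m -> k < SZ -> ha h aSE e' k = dn i e t e' k * ske e' k) /\
  (forall p k, p < n -> k < SZ -> ha h aSK p k =
     \big[Nat.lxor/0]_(e' < m) ((dn i e t e' k && touch e' p) * ske e' k)).

Lemma sval_lt i e q : sval r i e q < 2 ^ w.
Proof.
have [s1 s2 s3 s4 s5] := sizes.
have pw x : pos x < 2 ^ w by have := pos_lt x => h; apply: ltD; lia.
case: q => [|[|[|[|]]]] *; rewrite /sval ?wordof_lt ?land_lt ?wordof_lt //; exact: pw.
Qed.

Lemma bmul_lt (b : bool) x : x < 2 ^ w -> b * x < 2 ^ w.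
Proof. by case: b; rewrite ?mul1n // mul0n expn_gt0. Qed.

Lemma ske_lt e k : ske e k < 2 ^ w.
Proof. exact/bmul_lt/sval_lt. Qed.

Lemma col_div i t : t < J5 -> (i * J5 + t) %/ J5 = i /\ (i * J5 + t) %% J5 = t.
Proof.
move=> tJ; have J50 : 0 < J5 by lia.
by rewrite divnMDl // divn_small // addn0 modnMDl modn_small.
Qed.

Lemma col_lt i t : i < P -> t < J5 -> i * J5 + t < SZ.
Proof.
move=> iP tJ; have : i.+1 * J5 <= P * J5 by rewrite leq_mul2r iP orbT.
by rewrite mulSn /SZ; lia.
Qed.

Lemma dn_step i e t e' k : t < J5 ->
  dn i e t.+1 e' k = dn i e t e' k (+) ((e' == e) && (k == i * J5 + t)).
Proof.
move=> tJ; have J50 : 0 < J5 by lia.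
have [c1 c2] := col_div i tJ.
rewrite /dn; case: (e' =P e) => [->|ne] /=; last by rewrite addbF.
rewrite ltnn /=; case: (k =P i * J5 + t) => [->|nk].
  by rewrite c1 c2 ltnn eqxx ltnSn ltnn.
rewrite addbF; congr (_ || _); case: (k %/ J5 =P i) => //= ei.
rewrite ltnS leq_eqVlt; case: eqP => // et; case: nk.
by rewrite (divn_eq k J5) ei et.
Qed.

Lemma dn_next i e e' k : dn i e J5 e' k = dn i e.+1 0 e' k.
Proof.
have J50 : 0 < J5 by rewrite /J5 /J; lia.
rewrite /dn ltn_mod J50 ltn0 andbT andbF orbF; congr (_ || (_ && _)).
by rewrite [in RHS]ltnS [in RHS]leq_eqVlt orbC.
Qed.

Lemma dn0 e' k : dn 0 0 0 e' k = false.
Proof. by rewrite /dn !ltn0 andbF /= andbF. Qed.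

(** As the two ends occupy different positions, the two updates of [aSK] hit different rows and
    neither undoes the other. *)
Lemma cell_exec h i e j q :
  i < P -> e < m -> j < J -> q < 5 -> consts_at h ->
  hv h vI = i -> hv h vE = e -> hv h vj = j -> hv h vq = q ->
  hv h vpu = pu e -> hv h vpv = pv e -> pu e != pv e -> hv h vs = sampled r i e j ->
  ha h aVAL 0 q = sval r i e q ->
  sk_inv i e (j * 5 + q) h -> sk_inv i e (j * 5 + q).+1 (hexec CELL h).
Proof.
move=> iP em jJ q5 ch hI hE hj hq hpu hpv nuv hs hval [i1 i2].
have [s1 s2 s3 s4 s5] := sizes.
set t := j * 5 + q; have tJ : t < J5 by rewrite /t /J5; nia.
have colS := col_lt iP tJ; set cl := i * J5 + t in colS.
have [c1 c2] := col_div i tJ; rewrite -/cl in c1 c2.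
have [t1 t2] : t %/ 5 = j /\ t %% 5 = q by rewrite /t divnMDl // divn_small // addn0 modnMDl modn_small.
have val : sampled r i e j * sval r i e q = ske e cl by rewrite /ske c1 c2 t1 t2.
have eD : e < D by lia.
have cD : cl < D by lia.
have uD : pu e < D by apply: leq_trans (pos_lt _) _; lia.
have vD' : pv e < D by apply: leq_trans (pos_lt _) _; lia.
have iJ : i * J5 < SZ by rewrite /SZ ltn_mul2r iP andbT; lia.
have skl p : p < n -> ha h aSK p cl < 2 ^ w.
  by move=> pn; rewrite i2 //; apply: big_lxor_lt => *; apply/bmul_lt/ske_lt.
have E : hexec CELL h = seta (seta (seta (setv (setv h vcol cl) vT (ske e cl))
    aSK (pu e) cl (Nat.lxor (ha h aSK (pu e) cl) (ske e cl)))
    aSK (pv e) cl (Nat.lxor (ha h aSK (pv e) cl) (ske e cl))) aSE e cl (ske e cl).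
  rewrite /CELL /= hI hj hq hpu hpv hs hE (ch vJ5 isT) -[cval vJ5]/J5 !small // !mod0n.
  rewrite (@mulE _ i J5); last by apply: ltD; lia.
  rewrite (@mulE _ j 5); last by apply: ltD; lia.
  rewrite (@addE _ (j * 5) q) -/t; last by apply: ltD; lia.
  rewrite (@addE _ (i * J5) t) -/cl; last by apply: ltD; lia.
  rewrite (@modn_small q D) ?hval; last by lia.
  rewrite mulE ?val; last exact: ske_lt.
  rewrite (modn_small eD) (modn_small cD) (modn_small uD) (modn_small vD').
  rewrite (@xorE _ (ha h aSK (pu e) cl)) ?skl ?ske_lt ?pos_lt //.
  rewrite [pv e == pu e]eq_sym (negbTE nuv) /=.
  by rewrite (@xorE _ (ha h aSK (pv e) cl)) ?skl ?ske_lt ?pos_lt.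
rewrite E; split=> [e' k em' kS|p k pn kS] /=.
  rewrite dn_step // -/cl i1 //; case: (e' =P e) => [->|_] /=; last by rewrite addbF.
  case: (k =P cl) => [->|_] /=; last by rewrite addbF.
  by rewrite /dn c1 c2 !ltnn !eqxx [nat_of_bool _]/= mul1n.
pose c := touch e p && (k == cl).
have -> : \big[Nat.lxor/0]_(e' < m) ((dn i e t.+1 e' k && touch e' p) * ske e' k) =
   Nat.lxor (\big[Nat.lxor/0]_(e' < m) ((dn i e t e' k && touch e' p) * ske e' k))
     (c * ske e k).
  transitivity (Nat.lxor (\big[Nat.lxor/0]_(e' < m) ((dn i e t e' k && touch e' p) * ske e' k))
     (\big[Nat.lxor/0]_(e' < m) (((e' == e :> nat) && c) * ske e' k))).
    rewrite -big_split; apply: eq_bigr => e' _ /=; rewrite -addb_lxor dn_step // -/cl /c.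
    congr (nat_of_bool _ * _); case: (nat_of_ord e' =P e) => [->|_] /=; last by rewrite !addbF.
    by case: (dn _ _ _ _ _); case: (touch _ _); case: (k == cl).
  congr Nat.lxor; rewrite (bigD1 (Ordinal em)) //= eqxx /= big1 ?Nat.lxor_0_r // => e'.
  by rewrite -val_eqE /= => /negbTE->; rewrite mul0n.
rewrite -i2 // /c /touch; case: (k =P cl) => [->|_] /=; last first.
  by rewrite !andbF mul0n Nat.lxor_0_r.
rewrite !andbT; case: (p =P pv e) => [->|nv].
  by rewrite eqxx (negbTE nuv) /= mul1n.
case: (p =P pu e) => [->|nu]; first by rewrite eqxx [pv e == _]eq_sym (negbTE nuv) /= mul1n.
by rewrite !(introF eqP (nesym _)) //= mul0n Nat.lxor_0_r.
Qed.

Definition vals_at h i e := forall q, q < 5 -> ha h aVAL 0 q = sval r i e q.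

(** The flag [vs] is the conjunction of the level coins drawn so far, hence membership in the sample
    of the current level. These coins follow the 2w coins of the two words. *)
Lemma levels_exec h i e q0 :
  i < P -> e < m -> consts_at h -> hv h vI = i -> hv h vE = e ->
  hv h vpu = pu e -> hv h vpv = pv e -> pu e != pv e -> hv h vs = 1 ->
  vals_at h i e -> q0 = (i * m + e) * rb + (w + w) -> ht h = drop q0 r ->
  sk_inv i e 0 h ->
  sk_inv i e J5 (hexec LEVELS h) /\ ht (hexec LEVELS h) = drop (q0 + J) r.
Proof.
move=> iP em ch hI hE hpu hpv nuv hs hval q0E hth hsk.
have [||k1 k2 _] := @forN w D J (fun j t => [/\ sk_inv i e (j * 5) t, ht t = drop (q0 + j) r &
   hv t vs = sampled r i e j]) _ _ _ h (ch vJ isT) (isT : wf LEVELS); last by split.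
- by rewrite addn0.
- move=> j t jJ tj fr [k1 k2 k3]; have [frv fra] := fr.
  have ct : consts_at t := consts_fr fr isT ch.
  rewrite -[hexec (_ ;; _) t]/(hexec COIN (hexec (HFor vq v5 CELL) t)).
  set t1 := hexec (HFor vq v5 CELL) t.
  have t1s : sk_inv i e (j * 5 + 5) t1.
    apply: (@forN w D 5 (fun q t' => sk_inv i e (j * 5 + q) t') _ _ _ t (ct v5 isT)
       (isT : wf (HFor vq v5 CELL))).
    + by rewrite addn0.
    + move=> q t' q5 tq fr' k1'; have [frv' fra'] := fr'.
      have ct' : consts_at t' := consts_fr fr' isT ct.
      have q1 : hv t' vI = i by rewrite (frv' vI isT) (frv vI isT).
      have q2 : hv t' vE = e by rewrite (frv' vE isT) (frv vE isT).
      have q3 : hv t' vj = j by rewrite (frv' vj isT).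
      have q4 : hv t' vpu = pu e by rewrite (frv' vpu isT) (frv vpu isT).
      have q6 : hv t' vpv = pv e by rewrite (frv' vpv isT) (frv vpv isT).
      have q7 : hv t' vs = sampled r i e j by rewrite (frv' vs isT).
      have q8 : ha t' aVAL 0 q = sval r i e q by rewrite (fra' aVAL isT) (fra aVAL isT) hval.
      rewrite addnS.
      exact: (cell_exec iP em jJ q5 ct' q1 q2 q3 tq q4 q6 nuv q7 q8 k1').
  have t1t : ht t1 = drop (q0 + j) r by rewrite hexec_ht.
  have t1v : hv t1 vs = sampled r i e j by rewrite (@frame_v _ _ (HFor vq v5 CELL)).
  split.
  + by rewrite mulSn addnC.
  + by rewrite /= t1t behead_drop addnS.
  + rewrite /= t1t t1v head_drop andE; last exact: bool_lt_pow.
    rewrite /sampled -(addn1 j) iotaD all_cat /= andbT /lbit /xbit -/rb add0n.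
    by rewrite q0E -(addnA _ (w + w) j); case: all; case: nth.
Qed.

Lemma vals_exec h x y u v : hv h vx = x -> hv h vy = y -> hv h vpu = u -> hv h vpv = v ->
  x < 2 ^ w -> hexec (VALS ;; HAsg vs (HC 1)) h =
  setv (seta (seta (seta (seta (seta h aVAL 0 0 x) aVAL 0 1 y) aVAL 0 2 (Nat.land x y))
    aVAL 0 3 u) aVAL 0 4 v) vs 1.
Proof.
have [s1 s2 s3 s4 s5] := sizes.
move=> x3 y3 u3 w3 xw; rewrite /= x3 y3 u3 w3 !mod0n !small // !(@modn_small _ D); try lia.
by rewrite andE.
Qed.

Definition sk_in i e h : Prop :=
  [/\ sk_inv i e 0 h, ht h = drop ((i * m + e) * rb) r,
      forall x : 'I_n, ha h aPOS x 0 = pos x & ends_at m eu ev h].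

Lemma skedge_exec h i e : i < P -> e < m -> consts_at h -> hv h vI = i -> hv h vE = e ->
  pu e != pv e -> sk_in i e h -> sk_in i e.+1 (hexec SKEDGE h).
Proof.
move=> iP em ch hI hE nuv [hsk hth hpos hends].
have [s1 s2 s3 s4 s5] := sizes.
have ordD (x : 'I_n) : x < D by have := ltn_ord x; lia.
have [nD LD mD] := dims.
set h1 := hexec ENDPOS h.
have h1E : h1 = setv (setv (setv (setv h vU (eu e)) vV (ev e)) vpu (pu e)) vpv (pv e).
  rewrite /h1 -[LHS]/(hexec (HAsg vpu (HA aPOS (HV vU) (HC 0)) ;; HAsg vpv (HA aPOS (HV vV) (HC 0)))
    (hexec ENDS h)) (ends_exec w10 D0 Dw nD nL LD mD em hE hends).
  by rewrite /= !mod0n !(modn_small (ordD _)) !hpos.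
have c1 : consts_at h1 by rewrite h1E => x xc; rewrite -(ch x xc) /=; move: xc; rewrite !inE;
  do ![case/orP => [/eqP->|]] => // /eqP->.
have t1 : ht h1 = drop ((i * m + e) * rb) r by rewrite h1E.
have [x2 t2] := read_exec (isT : vx \in [:: vx; vy]) c1 t1.
set h2 := hexec (READ vx) h1 in x2 t2.
have c2 : consts_at h2 := consts_fr (hexec_frame w D (READ vx) h1) isT c1.
have [y3 t3] := read_exec (isT : vy \in [:: vx; vy]) c2 t2.
set h3 := hexec (READ vy) h2 in y3 t3.
have c3 : consts_at h3 := consts_fr (hexec_frame w D (READ vy) h2) isT c2.
have v3 x : x \notin wv (READ vy) ++ wv (READ vx) -> hv h3 x = hv h1 x.
  rewrite mem_cat negb_or => /andP[n1 n2].
  by rewrite (@frame_v _ _ (READ vy)) // (@frame_v _ _ (READ vx)).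
have a3 a : ha h3 a = ha h a.
  by rewrite (@frame_a _ _ (READ vy)) // (@frame_a _ _ (READ vx)) // h1E.
have x3 : hv h3 vx = sval r i e 0 by rewrite (@frame_v _ _ (READ vy)) // x2.
have {}y3 : hv h3 vy = sval r i e 1.
  by rewrite y3; apply: eq_wordof => k _; rewrite /ybit /xbit addnA.
have [u3 w3] : hv h3 vpu = pu e /\ hv h3 vpv = pv e by rewrite !v3 // h1E.
set h4 := hexec (VALS ;; HAsg vs (HC 1)) h3.
have EE : hexec SKEDGE h = hexec LEVELS h4 by [].
have c4 : consts_at h4 := consts_fr (hexec_frame w D (VALS ;; HAsg vs (HC 1)) h3) isT c3.
have h4E := vals_exec x3 y3 u3 w3 (sval_lt i e 0); rewrite -/h4 in h4E.
rewrite EE; clearbody h4 h3 h2.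
have p1 : hv h4 vI = i by rewrite h4E /= v3 // h1E.
have p2 : hv h4 vE = e by rewrite h4E /= v3 // h1E.
have p3 : hv h4 vpu = pu e by rewrite h4E /= u3.
have p4 : hv h4 vpv = pv e by rewrite h4E /= w3.
have p5 : hv h4 vs = 1 by rewrite h4E.
have p6 : vals_at h4 i e by rewrite h4E; do 5![case=> //].
have p7 : ht h4 = drop ((i * m + e) * rb + (w + w)) r by rewrite h4E /= t3 addnA.
have p8 : sk_inv i e 0 h4 by move: hsk; rewrite h4E /sk_inv /= !a3.
have [hs ht'] := levels_exec iP em c4 p1 p2 p3 p4 nuv p5 p6 erefl p7 p8.
have fr : same_off (wv LEVELS) (wa LEVELS) h4 (hexec LEVELS h4) by apply: hexec_frame.
case: fr => frv fra; split.
- move: hs; rewrite /sk_inv; case=> z1 z2; split=> [e' k em' kS|p k pn kS].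
    by rewrite z1 // dn_next.
  by rewrite z2 //; apply: eq_bigr => e' _; rewrite dn_next.
- by rewrite ht' /rbits; congr drop; rewrite addnS mulSn /rbits; lia.
- by move=> x; rewrite (fra aPOS isT) h4E /= a3.
- by move=> k km; rewrite (fra aIN isT) h4E /= a3; apply: hends.
Qed.

Lemma sk_in_setv i e h x k : sk_in i e h -> sk_in i e (setv h x k).
Proof. by []. Qed.

Lemma sketch_row h i : i < P -> consts_at h -> hv h vM = m -> hv h vI = i ->
  (forall e, e < m -> pu e != pv e) -> sk_in i 0 h ->
  sk_in i m (hexec (HFor vE vM SKEDGE) h).
Proof.
move=> iP ch hM hI nuv hin.
apply: (@forN w D m (fun e t' => sk_in i e t') _ _ _ h hM (isT : wf (HFor vE vM SKEDGE))).
  exact: sk_in_setv.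
move=> e t' em te fr' hin'; have [frv' fra'] := fr'.
have ct' : consts_at t' := consts_fr fr' isT ch.
have tI : hv t' vI = i by rewrite (frv' vI isT).
apply: sk_in_setv; exact: (skedge_exec iP em ct' tI te (nuv e em) hin').
Qed.

Lemma sketch_exec h : consts_at h -> hv h vM = m -> (forall e, e < m -> pu e != pv e) ->
  ht h = r -> (forall x : 'I_n, ha h aPOS x 0 = pos x) -> ends_at m eu ev h ->
  (forall i j, ha h aSK i j = 0) -> (forall i j, ha h aSE i j = 0) ->
  sk_inv P 0 0 (hexec SKETCH h).
Proof.
move=> ch hM nuv hth hpos hends z1 z2.
have K := @forN w D P (fun i t => sk_in i 0 t) _ _ _ h (ch vP isT) (isT : wf SKETCH).
have [|i t iP ti fr hin|k1 _ _ _] := K; last exact: k1.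
  apply: sk_in_setv; split; last exact: hends; last exact: hpos.
    split=> [e k em kS|p k pn kS] /=; first by rewrite z2 dn0.
    by rewrite z1 big1 // => e _; rewrite dn0.
  by rewrite mul0n drop0.
have [frv fra] := fr.
have ct : consts_at t := consts_fr fr isT ch.
have tM : hv t vM = m by rewrite (frv vM isT).
apply: sk_in_setv; have [k1 k2 k3 k4] := sketch_row iP ct tM ti nuv hin.
split; last exact: k4; last exact: k3; last by rewrite k2; congr drop; rewrite mulSn addn0; lia.
have eq e' k : e' < m -> dn i m 0 e' k = dn i.+1 0 0 e' k.
  move=> em; rewrite /dn em /= andbT !ltn0 !andbF orbF [in RHS]ltnS [in RHS]leq_eqVlt.
  by rewrite orbC.
case: k1 => f1 f2; split=> [e' k em kS|p k pn kS]; first by rewrite f1 // eq.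
by rewrite f2 //; apply: eq_bigr => e' _; rewrite eq.
Qed.

Lemma sketch_final h : sk_inv P 0 0 h ->
  (forall e k, e < m -> k < SZ -> ha h aSE e k = ske e k) /\
  (forall p k, p < n -> k < SZ -> ha h aSK p k =
     \big[Nat.lxor/0]_(e < m) (touch e p * ske e k)).
Proof.
have lt k : k < SZ -> k %/ J5 < P.
  by move=> kS; rewrite ltn_divLR //; rewrite /J5 /J; lia.
move=> [f1 f2]; split=> [e k em kS|p k pn kS]; first by rewrite f1 // /dn lt // mul1n.
by rewrite f2 //; apply: eq_bigr => e _; rewrite /dn lt.
Qed.

(** Row 0 of [aPS] is never written: the zero of fresh memory is the empty prefix. *)
Lemma prefix_exec h : consts_at h -> hv h vN = n ->
  (forall p k, p < n -> k < SZ -> ha h aSK p k < 2 ^ w) -> (forall i j, ha h aPS i j = 0) ->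
  forall p k, p <= n -> k < SZ ->
   ha (hexec PREFIX h) aPS p k = \big[Nat.lxor/0]_(p' < p) ha h aSK p' k.
Proof.
move=> ch hN skl z; have [s1 s2 s3 s4 s5] := sizes.
have H := @forN w D n (fun q t => forall p k, k < SZ -> ha t aPS p k = if p <= q then
   \big[Nat.lxor/0]_(p' < p) ha h aSK p' k else 0) _ _ _ h hN (isT : wf PREFIX).
move=> p0' k0' pn kS0; rewrite H // ?pn {p0' k0' pn kS0}//.
- by move=> [|p] k kS; rewrite /= z // big_ord0.
- move=> q t qn tq fr IH; have [frv fra] := fr.
  have ct : consts_at t := consts_fr fr isT ch.
  have H1 := @forN w D SZ (fun kk t' => forall p k, k < SZ -> ha t' aPS p k =
     if p <= q + (k < kk) then \big[Nat.lxor/0]_(p' < p) ha h aSK p' k else 0) _ _ _ t (ct vSZ isT)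
     (isT : wf (HFor vk vSZ (HSet aPS (HB Add (HV vp) (HC 1)) (HV vk)
       (HB Xor (HA aPS (HV vp) (HV vk)) (HA aSK (HV vp) (HV vk)))))).
  move=> p1 k1 kS1; rewrite /= H1 ?kS1 ?addn1 {p1 k1 kS1}//.
  + by move=> p k kS; rewrite ltn0 addn0 /= IH.
  + move=> kk t' kS tk fr' IH' p k kS'; have [frv' fra'] := fr'.
    rewrite /= tk (frv' vp isT) tq small // addE; last by apply: ltD; lia.
    rewrite !(@modn_small _ D); try lia.
    rewrite (fra' aSK isT) (fra aSK isT) IH' // leq_addr.
    rewrite xorE ?skl //; last by apply: big_lxor_lt => p' _; apply: skl => //; have := ltn_ord p'; lia.
    case: (k =P kk) => [->|nk] /=.
      rewrite andbT; case: (p =P q + 1) => [->|np].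
        by rewrite ltnSn /= leqnn addn1 big_ord_recr.
      rewrite IH' // ltnn ltnSn addn0 addn1.
      by have -> : (p <= q.+1) = (p <= q) by lia.
    rewrite andbF IH' //; have -> // : (k < kk.+1) = (k < kk) by rewrite ltnS leq_eqVlt; case: eqP nk.
Qed.

End Sketch.
(** * Labelling program: output *)

Definition VLAB : hcmd :=
  HFor vV0 vN
    (HSet aLB (HV vV0) (HC 0) (HA aPOS (HV vV0) (HC 0)) ;;
     HSet aLB (HV vV0) (HC 1) (HA aPOS (HV vV0) (HC 0)) ;;
     HSet aLB (HV vV0) (HC 5) (HA aST (HV vV0) (HC 0))).

Definition ELABV : hcmd :=
  HAsg vo (HB Add (HV vN) (HV vE)) ;;
  HAsg vst (HA aST (HV vU) (HC 0)) ;;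
  HAsg vpu (HA aPOS (HA aA (HV vE) (HC 0)) (HC 0)) ;;
  HAsg vpv (HA aPOS (HA aB (HV vE) (HC 0)) (HC 0)).

Definition ELABW : hcmd :=
  HSet aLB (HV vo) (HC 0) (HA aPOS (HV vU) (HC 0)) ;;
  HSet aLB (HV vo) (HC 1) (HA aPOS (HV vV) (HC 0)) ;;
  HSet aLB (HV vo) (HC 2) (HV vst) ;;
  HSet aLB (HV vo) (HC 3) (HV vpu) ;;
  HSet aLB (HV vo) (HC 4) (HV vpv).

Definition ELABT : hcmd := ELABV ;; ELABW.

Definition ELABK : hcmd :=
  HSet aLB (HV vo) (HB Add (HC 5) (HV vk)) (HA aPS (HV vst) (HV vk)) ;;
  HSet aLB (HV vo) (HB Add (HC 5) (HB Add (HB Mul (HC 1) (HV vSZ)) (HV vk)))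
    (HA aPS (HV vpu) (HV vk)) ;;
  HSet aLB (HV vo) (HB Add (HC 5) (HB Add (HB Mul (HC 2) (HV vSZ)) (HV vk)))
    (HA aPS (HV vpv) (HV vk)) ;;
  HSet aLB (HV vo) (HB Add (HC 5) (HB Add (HB Mul (HC 3) (HV vSZ)) (HV vk)))
    (HA aSE (HV vE) (HV vk)).

Definition ELAB1 : hcmd := (ENDS ;; ELABT) ;; HFor vk vSZ ELABK.

Definition ELAB : hcmd := HFor vE vM ELAB1.

Definition PUTBIT : hcmd :=
  HSet aOUT (HC 0) (HV vop) (HB And (HB Shr (HV vx) (HV vb)) (HC 1)) ;;
  HAsg vop (HB Add (HV vop) (HC 1)).

Definition PUTWORD : hcmd := HAsg vx (HA aLB (HV vo) (HV vf)) ;; HFor vb vW PUTBIT.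

Definition PUTLEN : hcmd :=
  HSet aOUT (HC 0) (HV vop) (HB Mul (HV vNF) (HV vW)) ;;
  HAsg vop (HB Add (HV vop) (HC 1)).

Definition OUTPUT : hcmd :=
  HAsg vop (HC 0) ;;
  HFor vo vO (PUTLEN ;; HFor vf vNF PUTWORD) ;;
  HAsg 0 (HB Mul (HV vD) (HV vD)).

(** * Contents of the labels *)

Section Output.
Variables w D L n m p0 : nat.
Let P := p0 * L.
Let J := 2 * L + 2.
Let J5 := J * 5.
Let SZ := P * J5.
Let NF := 5 + 4 * SZ.
Let LEN := NF * w.
Hypotheses (w10 : 10 <= w) (D0 : 0 < D) (Dw : narr * D * D <= 2 ^ w).
Hypothesis bigD : (n + m + 4) * (NF * w + 4) + 10 <= D.
Hypotheses (L0 : 0 < L) (pp0 : 0 < p0) (nL : n < 2 ^ L).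
Variables (eu ev : nat -> 'I_n).
Local Notation hexec := (hexec w D).
Local Notation consts_at := (consts_at w L p0).

Let small := (small w10).
Let ltD x := @lt_dim_pow w D x D0 Dw.
Let w0 : 0 < w := leq_trans (isT : 0 < 10) w10.

Let szs : [/\ NF + 4 <= D, SZ + 4 <= D, n + m + 4 <= D, J5 <= SZ & P <= SZ].
Proof. by eapply sizes; eassumption. Qed.

Let dms : [/\ n < D, L <= D & 2 * m + 5 < D].
Proof. by eapply dims; eassumption. Qed.

Variables (pos st : 'I_n -> nat) (Af Bf : nat -> 'I_n) (PS SE : nat -> nat -> nat).
Hypothesis pos_lt : forall x, pos x < n.
Hypothesis st_lt : forall x, st x < n.

(** A vertex label imitates the label of an edge with both ends at one position and all cut points
    0. The decoder can then treat the two query vertices as two extra deletions that contribute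
    nothing. Word 5 identifies the tree of the vertex. *)
Definition vword (x : 'I_n) (j : nat) : nat :=
  if j < 2 then pos x else if j == 5 then st x else 0.

(** The cut points of an edge are the start of its tree and the positions of [Af e] and [Bf e]. From
    word 5 on come four blocks of [SZ] words: the prefix XORs at these cut points, then the sampled
    descriptions of the edge itself. *)
Definition eword (e j : nat) : nat :=
  match j with
  | 0 => pos (eu e) | 1 => pos (ev e) | 2 => st (eu e)
  | 3 => pos (Af e) | 4 => pos (Bf e)
  | _ => let c := (j - 5) %% SZ in
         match (j - 5) %/ SZ with
         | 0 => PS (st (eu e)) c | 1 => PS (pos (Af e)) c | 2 => PS (pos (Bf e)) c
         | _ => SE e c
         end
  end.

Lemma ewordE e y : eword e (5 + y) =
  match y %/ SZ with
  | 0 => PS (st (eu e)) (y %% SZ) | 1 => PS (pos (Af e)) (y %% SZ)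
  | 2 => PS (pos (Bf e)) (y %% SZ) | _ => SE e (y %% SZ)
  end.
Proof. by rewrite /eword addKn. Qed.

Definition lab_inv (h : hst) : Prop :=
  [/\ forall x : 'I_n, ha h aPOS x 0 = pos x /\ ha h aST x 0 = st x,
      forall e, e < m -> ha h aA e 0 = Af e /\ ha h aB e 0 = Bf e,
      forall p k, p <= n -> k < SZ -> ha h aPS p k = PS p k,
      forall e k, e < m -> k < SZ -> ha h aSE e k = SE e k & ends_at m eu ev h].

Lemma lab_inv_ext h h' : (forall a, a \in [:: aPOS; aST; aA; aB; aPS; aSE; aIN] -> ha h' a = ha h a) ->
  lab_inv h -> lab_inv h'.
Proof. by move=> e [h1 h2 h3 h4 h5]; rewrite /lab_inv /ends_at !e. Qed.

Lemma vlab_exec h : hv h vN = n -> lab_inv h -> (forall i j, ha h aLB i j = 0) ->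
  forall i j, ha (hexec VLAB h) aLB i j = if insub i is Some x then vword x j else 0.
Proof.
move=> hN [hp _ _ _ _] z; have [nD LD mD] := dms.
suff H : forall i j, ha (hexec VLAB h) aLB i j =
   if insub i is Some x then if i < n then vword x j else 0 else 0.
  by move=> i j; rewrite H; case: insubP => // x i' _; rewrite i'.
apply: (@forN w D n (fun k t => forall i j, ha t aLB i j =
   if insub i is Some x then if i < k then vword x j else 0 else 0) _ _ _ h hN (isT : wf VLAB)).
- by move=> i j; rewrite /= z; case: insub.
- move=> k t kn tk [frv fra] IH i j; set x := Ordinal kn.
  have [e1 e2] := hp x.
  rewrite /= tk !mod0n !small // (@modn_small k D); last by lia.
  rewrite !(@modn_small _ D); try lia.
  rewrite (fra aPOS isT) (fra aST isT) -[k]/(nat_of_ord x) e1 e2 IH /=.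
  case: insubP => [y yi yE|ni]; last first.
    by have -> : (i == k) = false by apply: contraNF ni => /eqP->.
  case: (i =P k) => [ik|nik] /=; last by have -> : (i < k.+1) = (i < k) by lia.
  have -> : y = x by apply: val_inj; rewrite yE ik.
  rewrite ik ltnSn ltnn /vword.
  by case: j => [|[|[|[|[|[|j]]]]]].
Qed.

Lemma elabk_exec h e : e < m -> consts_at h -> hv h vo = n + e -> hv h vE = e ->
  hv h vst = st (eu e) -> hv h vpu = pos (Af e) -> hv h vpv = pos (Bf e) -> lab_inv h ->
  (forall j, j < 5 -> ha h aLB (n + e) j = eword e j) ->
  forall o j, j < NF -> ha (hexec (HFor vk vSZ ELABK) h) aLB o j =
    if o == n + e then eword e j else ha h aLB o j.
Proof.
move=> em ch ho hE hst hpu hpv [_ _ hPS hSE _] h5.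
have [s1 s2 s3 s4 s5] := szs.
have H := @forN w D SZ (fun kk t => forall o j, j < NF -> ha t aLB o j =
   if (o == n + e) && (4 < j) && ((j - 5) %% SZ < kk) then eword e j else ha h aLB o j)
   _ _ _ h (ch vSZ isT) (isT : wf (HFor vk vSZ ELABK)).
move=> o0 j0 jN0; rewrite H {H}//.
- case: (o0 =P n + e) => [->|_] //=; case: (ltnP 4 j0) => j5 /=; last by rewrite h5.
  by rewrite ltn_mod; have -> : 0 < SZ by rewrite /NF in jN0; lia.
- by move=> o j jN; rewrite ltn0 andbF.
- move=> {o0 j0 jN0} kk t kS tk fr IH o j jN; have [frv fra] := fr.
  have ct := consts_fr fr isT ch.
  have oD : n + e < D by lia.
  have q (c : nat) : c < 4 -> 5 + (c * SZ + kk) < D by rewrite /NF in s1; nia.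
  have b1 := q 0 isT; have b2 := q 1 isT; have b3 := q 2 isT; have b4 := q 3 isT.
  rewrite mul0n add0n in b1.
  have stD : st (eu e) < D by have := st_lt (eu e); lia.
  have pAD : pos (Af e) < D by have := pos_lt (Af e); lia.
  have pBD : pos (Bf e) < D by have := pos_lt (Bf e); lia.
  have eD : e < D by lia.
  have kD : kk < D by lia.
  have dm c : c < 4 -> (c * SZ + kk) %/ SZ = c /\ (c * SZ + kk) %% SZ = kk.
    by move=> _; rewrite divnMDl ?divn_small ?addn0 ?modnMDl ?modn_small //; lia.
  have E1 : eword e (5 + kk) = PS (st (eu e)) kk.
    by rewrite ewordE divn_small // modn_small.
  have E2 : eword e (5 + (1 * SZ + kk)) = PS (pos (Af e)) kk.
    by have [d1 d2] := dm 1 isT; rewrite ewordE d1 d2.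
  have E3 : eword e (5 + (2 * SZ + kk)) = PS (pos (Bf e)) kk.
    by have [d1 d2] := dm 2 isT; rewrite ewordE d1 d2.
  have E4 : eword e (5 + (3 * SZ + kk)) = SE e kk.
    by have [d1 d2] := dm 3 isT; rewrite ewordE d1 d2.
  have E : hexec ELABK t = seta (seta (seta (seta t aLB (n + e) (5 + kk) (PS (st (eu e)) kk))
      aLB (n + e) (5 + (1 * SZ + kk)) (PS (pos (Af e)) kk))
      aLB (n + e) (5 + (2 * SZ + kk)) (PS (pos (Bf e)) kk))
      aLB (n + e) (5 + (3 * SZ + kk)) (SE e kk).
    rewrite /ELABK /= tk (frv vo isT) (frv vst isT) (frv vpu isT) (frv vpv isT) (frv vE isT)
      ho hE hst hpu hpv (ct vSZ isT) -[cval _ _ _ vSZ]/SZ !small //.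
    rewrite (@mulE _ 1 SZ); last by apply: ltD; lia.
    rewrite (@mulE _ 2 SZ); last by apply: ltD; lia.
    rewrite (@mulE _ 3 SZ); last by apply: ltD; lia.
    rewrite (@addE _ (1 * SZ) kk); last by apply: ltD; lia.
    rewrite (@addE _ (2 * SZ) kk); last by apply: ltD; lia.
    rewrite (@addE _ (3 * SZ) kk); last by apply: ltD; lia.
    rewrite !addE; try by apply: ltD; lia.
    rewrite (modn_small oD) (modn_small b1) (modn_small b2) (modn_small b3) (modn_small b4)
      (modn_small stD) (modn_small pAD) (modn_small pBD) (modn_small eD) (modn_small kD).
    rewrite (fra aPS isT) (fra aSE isT) !hPS ?hSE //; apply: ltnW; by [apply: st_lt | apply: pos_lt].
  rewrite E -E1 -E2 -E3 -E4 {E E1 E2 E3 E4 h5}; move: (eword e) IH => ew IH /=.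
  case: (o =P n + e) => [->|no] /=; last by rewrite IH // (introF eqP no).
  case: (j =P 5 + (3 * SZ + kk)) => [->|n4]; first by rewrite addKn (dm 3 isT).2 ltnSn.
  case: (j =P 5 + (2 * SZ + kk)) => [->|n3]; first by rewrite addKn (dm 2 isT).2 ltnSn.
  case: (j =P 5 + (1 * SZ + kk)) => [->|n2]; first by rewrite addKn (dm 1 isT).2 ltnSn.
  case: (j =P 5 + kk) => [->|n1]; first by rewrite addKn modn_small // ltnSn.
  rewrite IH // eqxx /=; case: (ltnP 4 j) => //= j5.
  have -> // : ((j - 5) %% SZ < kk.+1) = ((j - 5) %% SZ < kk).
  rewrite ltnS leq_eqVlt; case: eqP => // ek.
  have jE := divn_eq (j - 5) SZ; rewrite ek in jE.
  have q4 : (j - 5) %/ SZ < 4 by rewrite ltn_divLR; [rewrite /NF in jN | ]; lia.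
  by case: ((j - 5) %/ SZ) q4 jE => [|[|[|[|c]]]] // _ jE; exfalso; lia.
Qed.

Lemma elab_exec h : consts_at h -> hv h vN = n -> hv h vM = m -> lab_inv h ->
  (forall o j, n <= o -> j < NF -> ha h aLB o j = 0) ->
  forall o j, j < NF -> ha (hexec ELAB h) aLB o j =
    if (n <= o) && (o < n + m) then eword (o - n) j else ha h aLB o j.
Proof.
move=> ch hN hM li z.
have [s1 s2 s3 s4 s5] := szs.
have [nD LD mD] := dms.
apply: (@forN w D m (fun k t => forall o j, j < NF -> ha t aLB o j =
  if (n <= o) && (o < n + k) then eword (o - n) j else ha h aLB o j) _ _ _ h hM (isT : wf ELAB)).
  by move=> o j jN; have -> : (n <= o) && (o < n + 0) = false by lia.
move=> e t em te fr IH o j jN; have [frv fra] := fr.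
have ct : consts_at t := consts_fr fr isT ch.
have tN : hv t vN = n by rewrite (frv vN isT).
have lt : lab_inv t.
  apply: lab_inv_ext li => a ai; rewrite fra //.
  by apply: (allP (isT : all (fun a => a \notin wa ELAB1)
    [:: aPOS; aST; aA; aB; aPS; aSE; aIN])) ai.
have [hp hA hPS hSE hends] := lt.
have ordD (x : 'I_n) : x < D by have := ltn_ord x; lia.
set t1 := hexec (ENDS ;; ELABT) t.
have t1E : t1 = seta (seta (seta (seta (seta (setv (setv (setv (setv (setv (setv t vU (eu e)) vV (ev e))
    vo (n + e)) vst (st (eu e))) vpu (pos (Af e))) vpv (pos (Bf e)))
    aLB (n + e) 0 (pos (eu e))) aLB (n + e) 1 (pos (ev e))) aLB (n + e) 2 (st (eu e)))
    aLB (n + e) 3 (pos (Af e))) aLB (n + e) 4 (pos (Bf e)).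
  rewrite /t1 -[LHS]/(hexec ELABT (hexec ENDS t)) (ends_exec w10 D0 Dw nD nL LD mD em te hends).
  have [a1 a2] := hA e em.
  have eD : e < D by lia.
  have oD : n + e < D by lia.
  set t0 := setv (setv t vU (eu e)) vV (ev e).
  have -> : hexec ELABT t0 = hexec ELABW (hexec ELABV t0) by [].
  set t4 := setv (setv (setv (setv t0 vo (n + e)) vst (st (eu e))) vpu (pos (Af e))) vpv (pos (Bf e)).
  have [p1 p2] := hp (eu e); have [p3 _] := hp (ev e).
  have [p4 _] := hp (Af e); have [p5 _] := hp (Bf e).
  have -> : hexec ELABV t0 = t4.
    rewrite /t4 /t0 /ELABV /= te tN !mod0n addE; last by apply: ltD; lia.
    rewrite (modn_small eD) a1 a2 (modn_small (ordD (eu e))) (modn_small (ordD (Af e))).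
    by rewrite (modn_small (ordD (Bf e))) p2 p4 p5.
  have [f1 f2 f3] : [/\ hv t4 vo = n + e, hv t4 vU = eu e & hv t4 vV = ev e] by [].
  have [f4 f5 f6] : [/\ hv t4 vst = st (eu e), hv t4 vpu = pos (Af e) & hv t4 vpv = pos (Bf e)] by [].
  have f7 : ha t4 aPOS = ha t aPOS by [].
  have sm k : k < 5 -> k %% 2 ^ w %% D = k by move=> k5; rewrite small ?modn_small //; lia.
  clearbody t4.
  rewrite /ELABW /= f1 f2 f3 f4 f5 f6 (sm 0 isT) (sm 1 isT) (sm 2 isT) (sm 3 isT) (sm 4 isT).
  by rewrite (modn_small oD) !(modn_small (ordD _)) f7 p1 p3.
have -> : hexec ELAB1 t = hexec (HFor vk vSZ ELABK) t1 by [].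
have fr1 := hexec_frame w D (ENDS ;; ELABT) t; rewrite -/t1 in fr1.
clearbody t1.
have ct1 : consts_at t1 := consts_fr fr1 isT ct.
have e6 : lab_inv t1.
  apply: lab_inv_ext lt => a ai; apply: fr1.2.
  by apply: (allP (isT : all (fun a => a \notin wa (ENDS ;; ELABT))
    [:: aPOS; aST; aA; aB; aPS; aSE; aIN])) ai.
have e1 : hv t1 vo = n + e by rewrite t1E.
have e2 : hv t1 vE = e by rewrite t1E.
have e3 : hv t1 vst = st (eu e) by rewrite t1E.
have e4 : hv t1 vpu = pos (Af e) by rewrite t1E.
have e5 : hv t1 vpv = pos (Bf e) by rewrite t1E.
have e7 i : i < 5 -> ha t1 aLB (n + e) i = eword e i.
  by case: i => [|[|[|[|[|i]]]]] // _; rewrite t1E /= ?eqxx.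
rewrite -[ha _ aLB o j]/(ha (hexec (HFor vk vSZ ELABK) t1) aLB o j).
rewrite (elabk_exec em ct1 e1 e2 e3 e4 e5 e6 e7 o jN).
case: (o =P n + e) => [->|no].
  by rewrite leq_addr addnS ltnSn addKn.
have -> : (o < n + e.+1) = (o < n + e) by lia.
by rewrite t1E /= (introF eqP no) /= IH.
Qed.

(** All labels have the same length, so the output is a sequence of blocks of [LEN.+1] cells, the
    first of which holds the length. *)
Definition ocell (lb : nat -> nat -> nat) (x : nat) : nat :=
  let o := x %/ LEN.+1 in let t := x %% LEN.+1 in
  if t == 0 then LEN else Nat.testbit (lb o (t.-1 %/ w)) (t.-1 %% w).

Lemma ocell_len lb o : ocell lb (o * LEN.+1) = LEN.
Proof. by rewrite /ocell modnMl. Qed.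

Lemma ocell_bit lb o t : t < LEN ->
  ocell lb (o * LEN.+1 + t.+1) = Nat.testbit (lb o (t %/ w)) (t %% w).
Proof. by move=> tL; rewrite /ocell divnMDl // divn_small // addn0 modnMDl modn_small. Qed.

Lemma output_exec h : consts_at h -> hv h vO = n + m -> hv h vD = D ->
  (forall o j, o < n + m -> j < NF -> ha h aLB o j < 2 ^ w) ->
  (forall x, x < (n + m) * LEN.+1 -> ha (hexec OUTPUT h) aOUT 0 x = ocell (ha h aLB) x) /\
  hv (hexec OUTPUT h) 0 = D * D.
Proof.
move=> ch hO hD lbw.
have [s1 s2 s3 s4 s5] := szs.
have lenD x : x < (n + m) * LEN.+1 -> x + 4 < D.
  move=> hx; have : (n + m) * LEN.+1 <= (n + m + 4) * (NF * w + 4) by apply: leq_mul; rewrite /LEN; lia.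
  by lia.
set h1 := hexec (HAsg vop (HC 0)) h.
set FOR := HFor vo vO (PUTLEN ;; HFor vf vNF PUTWORD).
have -> : hexec OUTPUT h = hexec (HAsg 0 (HB Mul (HV vD) (HV vD))) (hexec FOR h1) by [].
pose I q t := hv t vop = q /\ forall x, x < q -> ha t aOUT 0 x = ocell (ha h aLB) x.
have put t q v : I q t -> q < (n + m) * LEN.+1 -> v = ocell (ha h aLB) q ->
   I q.+1 (setv (seta t aOUT 0 q v) vop q.+1).
  move=> [i1 i2] qn vE; split=> // x; rewrite ltnS leq_eqVlt /= => /predU1P[->|xq].
    by rewrite !eqxx.
  by rewrite (ltn_eqF xq) i2.
have c1 : consts_at h1 := consts_fr (hexec_frame w D (HAsg vop (HC 0)) h) isT ch.
have hO1 : hv h1 vO = n + m by [].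
have H : I ((n + m) * LEN.+1) (hexec FOR h1).
  apply: (@forN w D (n + m) (fun o t => I (o * LEN.+1) t) _ _ _ h1 hO1 (isT : wf FOR)).
    by rewrite /I /= mod0n mul0n.
  move=> o t on to fr Io; have [frv fra] := fr.
  have ct : consts_at t := consts_fr fr isT c1.
  have oL : o * LEN.+1 + LEN.+1 <= (n + m) * LEN.+1 by rewrite addnC -mulSn leq_mul2r on orbT.
  set t1 := hexec PUTLEN t.
  have -> : hexec (PUTLEN ;; HFor vf vNF PUTWORD) t = hexec (HFor vf vNF PUTWORD) t1 by [].
  have It1 : I (o * LEN.+1).+1 t1.
    have [i1 i2] := Io.
    have -> : t1 = setv (seta t aOUT 0 (o * LEN.+1) LEN) vop (o * LEN.+1).+1.
      have lo := @lenD (o * LEN.+1); rewrite /t1 /PUTLEN /= i1 (ct vNF isT) (ct vW isT).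
      rewrite -[cval _ _ _ vNF]/NF -[cval _ _ _ vW]/w !mod0n small // mulE ?addE ?addn1 ?(@modn_small _ D) //.
      - by lia.
      - by apply: ltD; lia.
      - rewrite -/LEN; apply: ltD; have := @lenD LEN.
        have : LEN < (n + m) * LEN.+1 by apply: leq_trans (leq_pmull _ _) => //; lia.
        by lia.
    by apply: put; rewrite ?ocell_len //; lia.
  have ct1 : consts_at t1 := consts_fr (hexec_frame w D PUTLEN t) isT ct.
  have t1o : hv t1 vo = o by rewrite (@frame_v _ _ PUTLEN).
  have t1l : ha t1 aLB = ha h aLB by rewrite (@frame_a _ _ PUTLEN) // (fra aLB isT).
  have H2 : I ((o * LEN.+1).+1 + NF * w) (hexec (HFor vf vNF PUTWORD) t1).
    apply: (@forN w D NF (fun f t' => I ((o * LEN.+1).+1 + f * w) t') _ _ _ t1 (ct1 vNF isT)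
       (isT : wf (HFor vf vNF PUTWORD))).
      by rewrite mul0n addn0.
    move=> f t2 fN tf fr2 If; have [frv2 fra2] := fr2.
    have ct2 : consts_at t2 := consts_fr fr2 isT ct1.
    have fL : f * w + w <= LEN by rewrite addnC -mulSn leq_mul2r fN orbT.
    set t3 := hexec (HAsg vx (HA aLB (HV vo) (HV vf))) t2.
    have -> : hexec PUTWORD t2 = hexec (HFor vb vW PUTBIT) t3 by [].
    have x3 : hv t3 vx = ha h aLB o f.
      rewrite /t3 /= tf (frv2 vo isT) t1o !(@modn_small _ D); try lia.
      by rewrite (fra2 aLB isT) t1l.
    have If3 : I ((o * LEN.+1).+1 + f * w) t3 by [].
    have ct3 : consts_at t3 := consts_fr (hexec_frame w D (HAsg vx (HA aLB (HV vo) (HV vf))) t2) isT ct2.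
    clearbody t3.
    have H3 : I ((o * LEN.+1).+1 + f * w + w) (hexec (HFor vb vW PUTBIT) t3).
      apply: (@forN w D w (fun b t' => I ((o * LEN.+1).+1 + f * w + b) t') _ _ _ t3 (ct3 vW isT)
         (isT : wf (HFor vb vW PUTBIT))).
        by rewrite addn0.
      move=> b t4 bw tb [frv4 fra4] Ib; have [i1 i2] := Ib.
      have -> : hexec PUTBIT t4 = setv (seta t4 aOUT 0 ((o * LEN.+1).+1 + f * w + b)
          (Nat.testbit (ha h aLB o f) b)) vop ((o * LEN.+1).+1 + f * w + b).+1.
        have lo := @lenD ((o * LEN.+1).+1 + f * w + b).
        rewrite /PUTBIT /= i1 tb (frv4 vx isT) x3 !mod0n small // shrE ?lbw //.
        rewrite andE; last by apply: leq_ltn_trans (leq_div _ _) (lbw _ _ _ _).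
        rewrite bit_testbit addE ?addn1 ?(@modn_small _ D) //; first by lia.
        by apply: ltD; lia.
      rewrite addnS; have := @put t4 _ _ Ib _ erefl.
      have E : (o * LEN.+1).+1 + f * w + b = o * LEN.+1 + (f * w + b).+1 by lia.
      rewrite E ocell_bit; last by lia.
      rewrite divnMDl // divn_small // addn0 modnMDl modn_small // => put'.
      have {put'} [u1 u2] : I (o * LEN.+1 + (f * w + b).+1).+1 _ := put' ltac:(lia).
      by split.
    have [u1 u2] := H3; split; first by rewrite /= u1 mulSn; lia.
    by move=> x hx; apply: u2; rewrite mulSn in hx; lia.
  have [u1 u2] := H2; split; first by rewrite /= u1 mulSn /LEN; lia.
  by move=> x hx; apply: u2; rewrite mulSn /LEN in hx *; lia.
case: H => h1' h2'; split=> [x hx|] /=; first by rewrite h2'.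
have -> : hv (hexec FOR h1) vD = D by rewrite (@frame_v _ _ FOR).
by rewrite mulE //; apply: leq_trans Dw; rewrite /narr; nia.
Qed.

Lemma read_output (mem : nat -> nat) a0 lb K o k :
  (forall x, x < K * LEN.+1 -> mem (a0 + x) = ocell lb x) -> o + k <= K ->
  read_strings mem (a0 + o * LEN.+1) k =
  [seq mkseq (fun t => Nat.testbit (lb i (t %/ w)) (t %% w)) LEN | i <- iota o k].
Proof.
move=> hm; elim: k o => //= k IH o ok.
have oL : o.+1 * LEN.+1 <= K * LEN.+1 by rewrite leq_mul2r; apply/orP; right; lia.
rewrite mulSn in oL.
have e0 : mem (a0 + o * LEN.+1) = LEN by rewrite hm ?ocell_len //; lia.
rewrite e0; congr (_ :: _).
  apply/eq_in_map => t; rewrite mem_iota add0n => /andP[_ tL].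
  have -> : a0 + o * LEN.+1 + 1 + t = a0 + (o * LEN.+1 + t.+1) by lia.
  by rewrite hm ?ocell_bit //; [case: Nat.testbit | lia].
have -> : a0 + o * LEN.+1 + 1 + LEN = a0 + o.+1 * LEN.+1 by rewrite mulSn; lia.
by apply: IH; lia.
Qed.

End Output.
(** * Decoding program *)

Definition vc1 := 56.   Definition vR1 := 57.   Definition vR2 := 58.
Definition aDB := 14.   Definition aMK := 15.   Definition aQ1 := 17.
Definition aQ2 := 18.   Definition aT := 19.    Definition aCU := 20.
Definition aCV := 21.

Definition GETBIT : hcmd :=
  HAsg vx (HB Xor (HV vx) (HB Shl (HA aIN (HC 0) (HV vop)) (HV vb))) ;;
  HAsg vop (HB Add (HV vop) (HC 1)).

Definition GETBITS : hcmd := HFor vb vW GETBIT.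

Definition GETWORD : hcmd := (HAsg vx (HC 0) ;; GETBITS) ;; HSet aDB (HV vo) (HV vf) (HV vx).

Definition GETWORDS : hcmd := HFor vf vNF GETWORD.

Definition PARSE : hcmd :=
  HAsg vop (HC 1) ;; HFor vo vN (HAsg vop (HB Add (HV vop) (HC 1)) ;; GETWORDS).

(** Slots 0 to 2 of a label belong to its cut points; slot 3 stands for the deleted edge itself,
    looked up at its two ends. *)
Definition ENDQ : hcmd :=
  HFor vo vN (HSet aQ1 (HV vo) (HC 3) (HA aDB (HV vo) (HC 0)) ;;
              HSet aQ2 (HV vo) (HC 3) (HA aDB (HV vo) (HC 1))).

Definition MARKW : hcmd :=
  HFor vLx vL (HAsg vy (HB Shr (HV vx) (HV vLx)) ;;
    HIf (HB Ltw (HA aFW (HV vLx) (HV vy)) (HV vx)) (HSet aFW (HV vLx) (HV vy) (HV vx)) hskip).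

Definition MARK : hcmd :=
  (HSet aMK (HV vx) (HC 0) (HC 1) ;; HSet aQ1 (HV vo) (HV vc1) (HV vx) ;;
   HSet aQ2 (HV vo) (HV vc1) (HB Defs.Sub (HV vx) (HC 1))) ;; MARKW.

Definition CUT1 : hcmd :=
  HAsg vx (HA aDB (HV vo) (HB Add (HC 2) (HV vc1))) ;;
  HIf (HB Or (HB Eqw (HV vx) (HC 0)) (HA aMK (HV vx) (HC 0))) hskip MARK.

Definition CUTSET : hcmd := HFor vo vN (HFor vc1 v3 CUT1).

Definition GAMMA : hcmd := LOCATE ;; FIND.

(** The term is added to the classes on both sides. If these coincide, the two additions cancel,
    which is exactly the coefficient b(p) + b(p-1) modulo 2, without a test. *)
Definition SUMK : hcmd :=
  HAsg vcol (HB Add (HB Mul (HV vI) (HV vJ5)) (HV vk)) ;;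
  HAsg vy (HA aDB (HV vo) (HB Add (HC 5) (HB Add (HB Mul (HV vc1) (HV vSZ)) (HV vcol)))) ;;
  HSet aT (HV vR1) (HV vcol) (HB Xor (HA aT (HV vR1) (HV vcol)) (HV vy)) ;;
  HSet aT (HV vR2) (HV vcol) (HB Xor (HA aT (HV vR2) (HV vcol)) (HV vy)).

Definition GETR : hcmd :=
  (HAsg vF (HA aQ1 (HV vo) (HV vc1)) ;; GAMMA) ;;
  (HAsg vR1 (HV vF) ;; HAsg vF (HA aQ2 (HV vo) (HV vc1))) ;; GAMMA ;; HAsg vR2 (HV vF).

Definition SUM1 : hcmd := GETR ;; HFor vk vJ5 SUMK.

Definition SUMS : hcmd := HFor vo vN (HFor vc1 v4 SUM1).

Definition TEST : hcmd :=
  HAsg vy (HB Add (HB Mul (HV vI) (HV vJ5)) (HB Mul (HV vj) (HC 5))) ;;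
  HIf (HB And
        (HB Eqw (HB Eqw (HA aT (HV vcur) (HB Add (HV vy) (HC 3)))
                        (HA aT (HV vcur) (HB Add (HV vy) (HC 4)))) (HC 0))
        (HB Eqw (HA aT (HV vcur) (HB Add (HV vy) (HC 2)))
           (HB And (HA aT (HV vcur) (HV vy)) (HA aT (HV vcur) (HB Add (HV vy) (HC 1))))))
    (HAsg vU (HA aT (HV vcur) (HB Add (HV vy) (HC 3))) ;;
     HAsg vV (HA aT (HV vcur) (HB Add (HV vy) (HC 4)))) hskip.

Definition CAND1 : hcmd :=
  (HAsg vcur (HA aQ1 (HV vo) (HV vc1)) ;; HAsg vU (HC 0) ;; HAsg vV (HC 0)) ;;
  HFor vj vJ TEST ;;
  HSet aCU (HV vo) (HV vc1) (HV vU) ;; HSet aCV (HV vo) (HV vc1) (HV vV).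

Definition CANDS : hcmd := HFor vo vN (HFor vc1 v4 CAND1).

Definition MERGE1 : hcmd :=
  (HAsg vF (HA aCU (HV vo) (HV vc1)) ;; GAMMA) ;;
  (HAsg vA (HV vF) ;; HAsg vF (HA aCV (HV vo) (HV vc1))) ;; GAMMA ;;
  HAsg vB (HV vF) ;; UNION.

Definition MERGES : hcmd := HFor vo vN (HFor vc1 v4 MERGE1).

Definition PHASES : hcmd := HFor vI vP (SUMS ;; CANDS ;; MERGES).

Definition ANSWER : hcmd :=
  (HSet aCU (HC 0) (HC 0) (HA aDB (HC 0) (HC 0)) ;; HSet aCV (HC 0) (HC 0) (HA aDB (HC 1) (HC 0)) ;;
   HAsg vo (HC 0) ;; HAsg vc1 (HC 0)) ;;
  (HAsg vF (HA aCU (HV vo) (HV vc1)) ;; GAMMA) ;;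
  (HAsg vA (HV vF) ;; HAsg vF (HA aCV (HV vo) (HV vc1))) ;; GAMMA ;;
  HAsg 0 (HB And (HB Eqw (HV vA) (HV vF)) (HB Eqw (HA aDB (HC 0) (HC 5)) (HA aDB (HC 1) (HC 5)))).

Lemma hexecS w D p q h : hexec w D (p ;; q) h = hexec w D q (hexec w D p h).
Proof. by []. Qed.

(** Runs over pairs are indexed by the single number o * K + q, so that the invariants of the
    decoder speak of an initial segment. *)
Lemma for2 w D N K (I : nat -> hst -> Prop) x1 y1 x2 y2 p h :
  hv h y1 = N -> hv h y2 = K -> wf (HFor x1 y1 (HFor x2 y2 p)) -> x1 != y2 ->
  (forall t s x k, x \in [:: x1; x2] -> I t s -> I t (setv s x k)) -> I 0 h ->
  (forall o q s, o < N -> q < K -> hv s x1 = o -> hv s x2 = q ->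
     same_off (x1 :: x2 :: wv p) (wa p) h s ->
     I (o * K + q) s -> I (o * K + q).+1 (hexec w D p s)) ->
  I (N * K) (hexec w D (HFor x1 y1 (HFor x2 y2 p)) h).
Proof.
move=> hN hK wfp xy Iv I0 IS; case/and5P: (wfp) => w1 w2 w3 w4 w5.
case/and5P: (w5) => u1 u2 u3 u4 u5.
apply: (@forN w D N (fun o s => I (o * K) s) x1 y1 _ h hN wfp).
  by apply: (Iv); rewrite ?mem_head ?mul0n.
move=> o s oN so fr Io; have [frv fra] := fr.
have sK : hv s y2 = K.
  by rewrite frv // !inE !negb_or eq_sym xy eq_sym u2 u4.
apply: (Iv); first exact: mem_head.
rewrite mulSn addnC.
apply: (@forN w D K (fun q s' => I (o * K + q) s') x2 y2 p s sK w5).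
  by rewrite addn0; apply: (Iv); rewrite // !inE eqxx orbT.
move=> q s' qK sq [frv' fra'] Iq; rewrite addnS.
apply: (Iv); first by rewrite !inE eqxx orbT.
have x12 : x1 != x2 by move: w3; rewrite inE negb_or => /andP[].
apply: IS => //.
  by rewrite frv' // inE negb_or x12 /=; move: w3; rewrite /= inE negb_or => /andP[].
split=> [z|a an]; last by rewrite fra' // fra.
rewrite !inE !negb_or => /and3P[z1 z2 z3].
by rewrite frv' ?frv // !inE !negb_or ?z1 ?z2.
Qed.

(** * Correctness of the decoder: parsing and cut points *)

Section Decode.
Variables w D L n m p0 NO : nat.
Let P := p0 * L.
Let J := 2 * L + 2.
Let J5 := J * 5.
Let SZ := P * J5.
Let NF := 5 + 4 * SZ.
Let LEN := NF * w.
Hypotheses (w10 : 10 <= w) (D0 : 0 < D) (Dw : narr * D * D <= 2 ^ w).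
Hypothesis bigD : (n + m + 4) * (NF * w + 4) + 10 <= D.
Hypotheses (L0 : 0 < L) (pp0 : 0 < p0) (nL : n < 2 ^ L) (n0 : 0 < n) (NOm : NO <= m + 2).
Variable X : nat -> nat -> nat.
Hypothesis Xw : forall o j, o < NO -> j < NF -> X o j < 2 ^ w.
Hypothesis Xn : forall o q, o < NO -> q < 5 -> X o q < n.
Local Notation hexec := (hexec w D).
Local Notation consts_at := (consts_at w L p0).
Local Notation cval := (cval w L p0).

Let small := (small w10).
Let ltD x := @lt_dim_pow w D x D0 Dw.
Let w0 : 0 < w := leq_trans (isT : 0 < 10) w10.
Let szs : [/\ NF + 4 <= D, SZ + 4 <= D, n + m + 4 <= D, J5 <= SZ & P <= SZ].
Proof. by eapply sizes; eassumption. Qed.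
Let dms : [/\ n < D, L <= D & 2 * m + 5 < D].
Proof. by eapply dims; eassumption. Qed.

Definition input_at h := forall o t, o < NO -> t < LEN ->
  ha h aIN 0 (1 + (o * LEN.+1 + t.+1)) = Nat.testbit (X o (t %/ w)) (t %% w).

Definition words_at h := forall o j, o < NO -> j < NF -> ha h aDB o j = X o j.

Let in_lt o t : o < NO -> t <= LEN -> 1 + (o * LEN.+1 + t.+1) + 4 < D.
Proof.
move=> oN tL; have : o.+1 * LEN.+1 <= (n + m + 4) * (NF * w + 4).
  by apply: leq_mul; rewrite /LEN; lia.
rewrite mulSn; lia.
Qed.

Lemma parse_exec h : consts_at h -> hv h vN = NO -> input_at h -> words_at (hexec PARSE h).
Proof.
move=> ch hN hin; have [s1 s2 s3 s4 s5] := szs.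
set FOR := HFor vo vN (HAsg vop (HB Add (HV vop) (HC 1)) ;; GETWORDS).
set h1 := hexec (HAsg vop (HC 1)) h.
have -> : hexec PARSE h = hexec FOR h1 by [].
have c1 : consts_at h1 := consts_fr (hexec_frame w D (HAsg vop (HC 1)) h) isT ch.
have h1o : hv h1 vop = 1 by rewrite /= small.
have in1 : input_at h1 by [].
have N1 : hv h1 vN = NO by [].
clearbody h1.
pose I o f t := forall o' j, j < NF -> (o' < o) || (o' == o) && (j < f) -> ha t aDB o' j = X o' j.
suff [_ H] : hv (hexec FOR h1) vop = 1 + NO * LEN.+1 /\ I NO 0 (hexec FOR h1).
  by move=> o j oN jN; apply: H; rewrite ?oN.
apply: (@forN w D NO (fun o t => hv t vop = 1 + o * LEN.+1 /\ I o 0 t) _ _ _ h1 N1 (isT : wf FOR)).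
  by split=> // o' j _; rewrite !ltn0 andbF.
move=> o t oN to fr [to1 Io]; have [frv fra] := fr.
have ct : consts_at t := consts_fr fr isT c1.
set t1 := hexec (HAsg vop (HB Add (HV vop) (HC 1))) t.
have t1o : hv t1 vop = 1 + (o * LEN.+1 + (0 * w).+1).
  have b : 1 + o * LEN.+1 + 1 < 2 ^ w by apply: ltD; have := @in_lt o 0 oN; lia.
  by rewrite /= to1 small // addE //; lia.
have ct1 : consts_at t1 := consts_fr (hexec_frame w D (HAsg vop (HB Add (HV vop) (HC 1))) t) isT ct.
have t1v : hv t1 vo = o by [].
have It1 : I o 0 t1 by [].
have in1' : input_at t1 by move=> o' t' a b; rewrite -in1 // -(fra aIN isT).
have -> : hexec (HAsg vop (HB Add (HV vop) (HC 1)) ;; GETWORDS) t = hexec GETWORDS t1 by [].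
clearbody t1.
suff [e1 e2] : hv (hexec GETWORDS t1) vop = 1 + (o * LEN.+1 + (NF * w).+1) /\ I o NF (hexec GETWORDS t1).
  split; first by rewrite /= e1 mulSn /LEN; lia.
  move=> o' j jN h'; apply: e2 => //; move: h'; rewrite ltn0 andbF orbF ltnS leq_eqVlt orbC jN andbT //.
apply: (@forN w D NF (fun f t' => hv t' vop = 1 + (o * LEN.+1 + (f * w).+1) /\ I o f t')
   _ _ _ t1 (ct1 vNF isT) (isT : wf GETWORDS)) => //.
move=> f t2 fN tf fr2 [to2 If]; have [frv2 fra2] := fr2.
have ct2 : consts_at t2 := consts_fr fr2 isT ct1.
have fL : f * w + w <= LEN by rewrite addnC -mulSn leq_mul2r fN orbT.
set t3 := hexec (HAsg vx (HC 0) ;; GETBITS) t2.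
have [x3 o3] : hv t3 vx = wordof (Nat.testbit (X o f)) w /\
    hv t3 vop = 1 + (o * LEN.+1 + (f * w).+1) + w.
  have -> : t3 = hexec GETBITS (setv t2 vx (0 %% 2 ^ w)) by [].
  rewrite mod0n; set t4 := setv t2 vx 0.
  have ct4 : hv t4 vW = w := ct2 vW isT.
  apply: (@forN w D w (fun b t' => hv t' vx = wordof (Nat.testbit (X o f)) b /\
    hv t' vop = 1 + (o * LEN.+1 + (f * w).+1) + b) _ _ _ t4 ct4 (isT : wf GETBITS)).
    by rewrite /wordof big_ord0 addn0.
  move=> b t5 bw tb [frv5 fra5] [x5 o5].
  have il := @in_lt o (f * w + b) oN ltac:(lia).
  have bit : ha t5 aIN 0 (1 + (o * LEN.+1 + (f * w).+1) + b) = Nat.testbit (X o f) b.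
    rewrite (fra5 aIN isT) -[ha t4 aIN]/(ha t2 aIN) (fra2 aIN isT).
    have -> : 1 + (o * LEN.+1 + (f * w).+1) + b = 1 + (o * LEN.+1 + (f * w + b).+1) by lia.
    by rewrite in1' ?divnMDl ?divn_small ?addn0 ?modnMDl ?modn_small //; lia.
  have bl : Nat.testbit (X o f) b * 2 ^ b < 2 ^ w.
    by apply: bmul_lt; rewrite // ltn_exp2l.
  rewrite /= x5 o5 tb !mod0n small // (@modn_small _ D); last by lia.
  rewrite bit shlE // xorE ?wordofS //; last first.
    by apply: leq_trans (wordof_lt _ _) _; rewrite leq_exp2l // ltnW.
  by rewrite addE ?addnS ?addn0 //; apply: ltD; lia.
have v3 : hv t3 vo = o /\ hv t3 vf = f.
  by rewrite !(@frame_v _ _ (HAsg vx (HC 0) ;; GETBITS)) // (frv2 vo isT) t1v.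
have a3 : ha t3 aDB = ha t2 aDB by rewrite (@frame_a _ _ (HAsg vx (HC 0) ;; GETBITS)).
have -> : hexec GETWORD t2 = hexec (HSet aDB (HV vo) (HV vf) (HV vx)) t3 by [].
clearbody t3; case: v3 => v3 v3'.
rewrite /= v3 v3' x3 o3 wordofK ?Xw // !(@modn_small _ D); try lia.
split; first by rewrite mulSn; lia.
move=> o' j jN /=; case: (o' =P o) => [->|no] /=.
  rewrite ltnn /=; case: (j =P f) => [-> //|nj] jf; rewrite a3; apply: If => //.
  by rewrite eqxx ltnn /=; lia.
by rewrite orbF => lo; rewrite a3; apply: If; rewrite // lo.
Qed.

Definition clf t := X (t %/ 3) (2 + t %% 3).
Fixpoint cuts t : seq nat := if t is t'.+1 then clf t' :: cuts t' else [:: 0].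
(** A cut point shared by several deleted edges must be counted once. Repetitions become 0, which
    contributes nothing because 0 and its predecessor 0 lie in the same interval. *)
Definition newcut t := if clf t \in cuts t then 0 else clf t.

Lemma clf_lt t : t < NO * 3 -> clf t < n.
Proof.
by move=> tN; apply: Xn; [rewrite ltn_divLR | have := ltn_pmod t (isT : 0 < 3); lia].
Qed.

Lemma cuts0 t : 0 \in cuts t.
Proof. by elim: t => //= t IH; rewrite inE IH orbT. Qed.

Lemma cuts_lt t : t <= NO * 3 -> {in cuts t, forall c, c < n}.
Proof.
elim: t => [_ c|t IH tN c]; first by rewrite inE => /eqP->.
by rewrite inE => /predU1P[->|]; [apply: clf_lt | apply: IH; apply: ltnW].
Qed.

Definition cut_inv t h : Prop :=
  [/\ forall c, c < n -> ha h aMK c 0 = ((c != 0) && (c \in cuts t)),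
      fw_at L n h (cuts t) &
      forall o q, q < 3 -> ha h aQ1 o q = (if o * 3 + q < t then newcut (o * 3 + q) else 0) /\
        ha h aQ2 o q = (if o * 3 + q < t then (newcut (o * 3 + q)).-1 else 0)].

(** A number lies in exactly one dyadic block of each length, so inserting it updates at most L
    maxima. *)
Lemma markw_exec h C c : fw_at L n h C -> c < n -> hv h vL = L -> hv h vx = c ->
  fw_at L n (hexec MARKW h) (c :: C).
Proof.
move=> fw cn hL hx; have [nD LD mD] := dms.
suff H : forall k b, k < L -> b < n -> ha (hexec MARKW h) aFW k b =
   \max_(c' <- (if k < L then c :: C else C) | c' %/ 2 ^ k == b) c'.
  by move=> k b kL bn; rewrite H // kL.
apply: (@forN w D L (fun hh t => forall k b, k < L -> b < n -> ha t aFW k b =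
   \max_(c' <- (if k < hh then c :: C else C) | c' %/ 2 ^ k == b) c') _ _ _ h hL (isT : wf MARKW)).
  by move=> k b kL bn; rewrite ltn0; apply: fw.
move=> hh t hL' th [frv fra] IH k b kL bn.
have tx : hv t vx = c by rewrite (frv vx isT).
have cw : c < 2 ^ w by apply: ltD; lia.
have cl : c %/ 2 ^ hh <= c := leq_div _ _.
rewrite /= th tx shrE // ltwE // !(@modn_small _ D); try lia.
rewrite IH //; last by lia.
rewrite ltnn; set M := \max_(c' <- C | c' %/ 2 ^ hh == c %/ 2 ^ hh) c'.
case: (k =P hh) => [->|nk]; last first.
  have -> : (k < hh.+1) = (k < hh) by lia.
  by case: ifP => _ /=; rewrite ?(introF eqP nk) IH.
rewrite ltnSn big_cons; case: (b =P c %/ 2 ^ hh) => [->|nb].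
  rewrite eqxx -/M; case: (ltnP M c) => hM /=.
    by rewrite !eqxx.
  by rewrite IH ?ltnn //; lia.
have -> : (c %/ 2 ^ hh == b) = false by apply/eqP => e; case: nb.
by case: ifP => _ /=; rewrite ?(introF eqP nb) ?andbF IH ?ltnn.
Qed.

Lemma cut1_exec h o q : o < NO -> q < 3 -> consts_at h -> hv h vo = o -> hv h vc1 = q ->
  words_at h -> cut_inv (o * 3 + q) h -> cut_inv (o * 3 + q).+1 (hexec CUT1 h).
Proof.
move=> oN q3 ch ho hq hw [mk fw qq]; have [s1 s2 s3 s4 s5] := szs; have [nD LD mD] := dms.
set t := o * 3 + q; set c := clf t.
have [t1 t2] : t %/ 3 = o /\ t %% 3 = q by rewrite divnMDl // divn_small // addn0 modnMDl modn_small.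
have cE : c = X o (2 + q) by rewrite /c /clf t1 t2.
have cn : c < n by rewrite cE; apply: Xn => //; lia.
have jN : 2 + q < NF by rewrite /NF; lia.
set h1 := setv h vx c.
have -> : hexec CUT1 h = if c \in cuts t then hexec hskip h1 else hexec MARK h1.
  have -> : hexec CUT1 h = hexec (HIf (HB Or (HB Eqw (HV vx) (HC 0)) (HA aMK (HV vx) (HC 0))) hskip MARK)
     (hexec (HAsg vx (HA aDB (HV vo) (HB Add (HC 2) (HV vc1)))) h) by [].
  have -> : hexec (HAsg vx (HA aDB (HV vo) (HB Add (HC 2) (HV vc1)))) h = h1.
    rewrite /= ho hq small // addE; last by apply: ltD; lia.
    have oD : o < D by lia.
    have qD : 2 + q < D by lia.
    by rewrite (modn_small oD) (modn_small qD) hw // -cE.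
  have -> : hexec (HIf (HB Or (HB Eqw (HV vx) (HC 0)) (HA aMK (HV vx) (HC 0))) hskip MARK) h1 =
     if binop_sem w Or (binop_sem w Eqw c (0 %% 2 ^ w)) (ha h aMK (c %% D) (0 %% 2 ^ w %% D)) != 0
     then hexec hskip h1 else hexec MARK h1 by [].
  rewrite !mod0n eqwE // (@modn_small c D); last by lia.
  rewrite mk // -/t; have -> : (c \in cuts t) = (c == 0) || (c != 0) && (c \in cuts t).
    by case: (c =P 0) => [->|]; rewrite ?cuts0.
  rewrite /binop_sem; case: (c == 0); case: (c \in cuts t); rewrite /= ?small //.
have lin o' q' : q' < 3 -> (o' * 3 + q' < t.+1) = (o' * 3 + q' < t) || ((o' == o) && (q' == q)).
  by move=> q3'; rewrite /t; lia.
have nt o' q' : q' < 3 -> (o' == o) && (q' == q) -> o' * 3 + q' = t.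
  by move=> _ /andP[/eqP-> /eqP->].
case: ifP => cc.
  split=> [c' cn'|k b kL bn|o' q' q3'] /=.
  - rewrite mk // inE; case: (c' =P c) => [->|_] //=; by rewrite cc.
  - rewrite fw // big_cons; case: ifP => // /eqP kb.
    by apply/esym/maxn_idPr; apply: (leq_bigmax_seq (F := id)); rewrite ?kb //.
  - have [e1 e2] := qq o' q' q3'; rewrite e1 e2 lin //.
    case: ((o' == o) && (q' == q)) (nt o' q' q3') => [/(_ isT) ->|_]; last by rewrite orbF.
    by rewrite ltnn /= /newcut -/c cc.
set h2 := hexec (HSet aMK (HV vx) (HC 0) (HC 1) ;; HSet aQ1 (HV vo) (HV vc1) (HV vx) ;;
   HSet aQ2 (HV vo) (HV vc1) (HB Defs.Sub (HV vx) (HC 1))) h1.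
have c0 : 0 < c by rewrite lt0n; apply: contraFneq cc => ->; apply: cuts0.
have h2E : h2 = seta (seta (seta h1 aMK c 0 1) aQ1 o q c) aQ2 o q c.-1.
  rewrite /h2 /= ho hq !mod0n !small // subE ?subn1 //; last by apply: ltD; lia.
  by rewrite !(@modn_small _ D) //; lia.
have -> : hexec MARK h1 = hexec MARKW h2 by [].
clearbody h2.
have fr := hexec_frame w D MARKW h2; case: fr => frv fra.
split=> [c' cn'|| o' q' q3'].
- rewrite (fra aMK isT) h2E /= inE andbT; case: (c' =P c) => [->|nc] /=; last by rewrite mk.
  by rewrite -lt0n c0.
- by apply: markw_exec => //; rewrite h2E //=; exact: (ch vL isT).
- rewrite (fra aQ1 isT) (fra aQ2 isT) h2E /= lin //; have [e1 e2] := qq o' q' q3'.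
  case: ((o' == o) && (q' == q)) (nt o' q' q3') => [/(_ isT) ->|_]; last by rewrite orbF.
  by rewrite orbT /newcut -/c cc.
Qed.

Lemma cutset_exec h : consts_at h -> hv h vN = NO -> words_at h -> cut_inv 0 h ->
  cut_inv (NO * 3) (hexec CUTSET h).
Proof.
move=> ch hN hw ci.
apply: (@for2 w D NO 3 cut_inv _ _ _ _ _ h hN (ch v3 isT) (isT : wf CUTSET) isT) => //.
move=> o q s oN q3 so sq fr ci'; have [frv fra] := fr.
have cs : consts_at s := consts_fr fr isT ch.
apply: cut1_exec => //.
by move=> o' j oN' jN; rewrite (fra aDB isT) hw.
Qed.

(** * Correctness of the decoder: one Boruvka phase *)

Section Phase.
Variables (C : seq nat) (Q1 Q2 : nat -> nat).
Hypotheses (C0 : 0 \in C) (Cn : {in C, forall c, c < n}).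
Hypotheses (Q1n : forall t, t < NO * 4 -> Q1 t < n) (Q2n : forall t, t < NO * 4 -> Q2 t < n).

Definition query_at h : Prop :=
  [/\ consts_at h, hv h vN = NO, words_at h, fw_at L n h C &
      forall o q, o < NO -> q < 4 -> ha h aQ1 o q = Q1 (o * 4 + q) /\ ha h aQ2 o q = Q2 (o * 4 + q)].

Lemma query_fr xs ys h h' : same_off xs ys h h' ->
  all (fun x => x \notin xs) (vN :: cvars) ->
  all (fun a => a \notin ys) [:: aDB; aFW; aQ1; aQ2] -> query_at h -> query_at h'.
Proof.
move=> fr /= /andP[nx cx] /and5P[a1 a2 a3 a4 _] [q1 q2 q3 q4 q5].
have [frv fra] := fr; split.
- exact: consts_fr fr cx q1.
- by rewrite frv.
- by move=> o j oN jN; rewrite fra // q3.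
- by move=> k b kL bn; rewrite fra // q4.
- by move=> o q oN q4'; rewrite !fra //; apply: q5.
Qed.

Lemma gamma_exec h s : fw_at L n h C -> uf_at n h s -> hv h vL = L -> hv h vF < n ->
  hv (hexec GAMMA h) vF = s.1 (loc C (hv h vF)).
Proof.
move=> fw uf hL hF; have [nD LD mD] := dms.
have -> : hexec GAMMA h = hexec FIND (hexec LOCATE h) by [].
set h1 := hexec LOCATE h.
have h1F : hv h1 vF = loc C (hv h vF).
  by apply: (locate_exec w10 D0 Dw nD nL LD).
have uf1 : uf_at n h1 s by apply: uf_at_ext uf; apply: frame_a.
have l1 : hv h1 vL = L by rewrite (@frame_v _ _ LOCATE).
by rewrite (find_exec w10 D0 Dw nD nL LD uf1) // h1F // Cn // loc_mem.
Qed.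

(** Two class lookups in a row, shared by summation, merging and the final answer, which differ in
    the arrays they read and in where the first result is kept. *)
Lemma gamma2_exec (a1 a2 : nat) (v : nat) h s o q x y :
  v \in [:: vR1; vA] -> uf_at n h s -> query_at h -> o < NO -> q < 4 -> hv h vo = o -> hv h vc1 = q ->
  ha h a1 o q = x -> ha h a2 o q = y -> x < n -> y < n ->
  let h' := hexec GAMMA (hexec (HAsg v (HV vF) ;; HAsg vF (HA a2 (HV vo) (HV vc1)))
     (hexec (HAsg vF (HA a1 (HV vo) (HV vc1)) ;; GAMMA) h)) in
  [/\ hv h' v = s.1 (loc C x), hv h' vF = s.1 (loc C y) &
      same_off [:: v; vQ; vF; vLx; vX; vFi] [::] h h'].
Proof.
move=> vv uf qa oN q4 ho hq e1 e2 xn yn.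
have [s1 s2 s3 s4 s5] := szs.
have oD : o < D by lia.
have qD : q < D by lia.
have [ch hN hw fw _] := qa.
set h1 := setv h vF x.
have E1 : hexec (HAsg vF (HA a1 (HV vo) (HV vc1)) ;; GAMMA) h = hexec GAMMA h1.
  have -> : hexec (HAsg vF (HA a1 (HV vo) (HV vc1)) ;; GAMMA) h =
     hexec GAMMA (hexec (HAsg vF (HA a1 (HV vo) (HV vc1))) h) by [].
  by congr hexec; rewrite /= ho hq (modn_small oD) (modn_small qD) e1.
rewrite E1; set h2 := hexec GAMMA h1.
have h2F : hv h2 vF = s.1 (loc C x).
  by apply: gamma_exec => //=; exact: (ch vL isT).
have [frv2 fra2] := hexec_frame w D GAMMA h1; rewrite -/h2 in frv2 fra2.
have fa2 a : ha h2 a = ha h a by rewrite (fra2 a).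
set h3 := setv (setv h2 v (s.1 (loc C x))) vF y.
have vF' : (v == vF) = false by move: vv; rewrite !inE => /orP[] /eqP->.
have vo' : (vo == v) = false /\ (vc1 == v) = false /\ (vL == v) = false.
  by move: vv; rewrite !inE => /orP[] /eqP->.
have E3 : hexec (HAsg v (HV vF) ;; HAsg vF (HA a2 (HV vo) (HV vc1))) h2 = h3.
  case: vo' => n1 [n2 _].
  rewrite /h3 /= h2F n1 n2 (frv2 vo isT) (frv2 vc1 isT) /= ho hq (modn_small oD) (modn_small qD).
  by rewrite fa2 e2.
clearbody h2; rewrite E3; set h4 := hexec GAMMA h3.
have [frv4 fra4] := hexec_frame w D GAMMA h3; rewrite -/h4 in frv4 fra4.
have vn : v \notin wv GAMMA by move: vv; rewrite !inE => /orP[] /eqP->.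
split.
- by rewrite frv4 //= vF' eqxx.
- apply: gamma_exec => //=.
  + by move=> k b kL bn; rewrite /= fa2 fw.
  + by apply: uf_at_ext uf; rewrite /= fa2.
  + case: vo' => _ [_ ->] /=; rewrite (frv2 vL isT) /=; exact: (ch vL isT).
split=> [z|a _]; last by rewrite fra4 //= fa2.
rewrite !inE !negb_or => /and5P[z1 z2 z3 z4 /andP[z5 z6]].
have zg : z \notin wv GAMMA by rewrite /= !inE !negb_or z2 z3 z4 z5 z6.
by rewrite frv4 //= (negbTE z3) (negbTE z1) frv2 //= (negbTE z3).
Qed.

(** One term of the cut formula for class [rho]: label t / 4, slot t mod 4. *)
Definition contr (rt : nat -> nat) rho t col : nat :=
  ((rt (loc C (Q1 t)) == rho) (+) (rt (loc C (Q2 t)) == rho)) *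
  X (t %/ 4) (5 + (t %% 4 * SZ + col)).

Definition sum_inv i (rt : nat -> nat) (T0 : nat -> nat -> nat) t h : Prop :=
  forall rho col, rho < n -> col < SZ -> ha h aT rho col =
    if i * J5 <= col < i.+1 * J5 then \big[Nat.lxor/0]_(t' < t) contr rt rho t' col
    else T0 rho col.

Lemma sum1_exec h i s T0 o q : i < P -> o < NO -> q < 4 -> query_at h -> uf_at n h s ->
  hv h vI = i -> hv h vo = o -> hv h vc1 = q ->
  sum_inv i s.1 T0 (o * 4 + q) h -> sum_inv i s.1 T0 (o * 4 + q).+1 (hexec SUM1 h).
Proof.
move=> iP oN q4 qa uf hI ho hq si; have [ch hN hw fw hQ] := qa.
have [s1 s2 s3 s4 s5] := szs.
set t := o * 4 + q.
have tN : t < NO * 4 by rewrite /t; lia.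
have [t1 t2] : t %/ 4 = o /\ t %% 4 = q by rewrite divnMDl // divn_small // addn0 modnMDl modn_small.
have [e1 e2] := hQ o q oN q4.
have [g1 g2 gf] := gamma2_exec (isT : vR1 \in [:: vR1; vA]) uf qa oN q4 ho hq e1 e2 (Q1n tN) (Q2n tN).
set h4 := hexec GAMMA _ in g1 g2 gf.
set h5 := hexec (HAsg vR2 (HV vF)) h4.
have EE : hexec SUM1 h = hexec (HFor vk vJ5 SUMK) h5 by [].
have h5E : h5 = setv h4 vR2 (s.1 (loc C (Q2 t))) by rewrite /h5 /= g2.
clearbody h5 h4; rewrite EE; case: gf => gv ga.
set R1 := s.1 (loc C (Q1 t)); set R2 := s.1 (loc C (Q2 t)).
have [uf1 _] := uf.
have R1n : R1 < n by apply: (uf_lt uf1); apply/Cn/loc_mem.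
have R2n : R2 < n by apply: (uf_lt uf1); apply/Cn/loc_mem.
have v5 x : x \notin [:: vR1; vQ; vF; vLx; vX; vFi; vR2] -> hv h5 x = hv h x.
  rewrite !inE !negb_or => /and5P[z1 z2 z3 z4 /and3P[z5 z6 z7]].
  by rewrite h5E /= (negbTE z7) gv // !inE !negb_or z1 z2 z3 z4 z5 z6.
have a5 a : ha h5 a = ha h a by rewrite h5E /= ga.
have iS : i.+1 * J5 <= SZ by rewrite /SZ leq_mul2r iP orbT.
rewrite mulSn in iS.
have Xl k : k < J5 -> X o (5 + (q * SZ + (i * J5 + k))) < 2 ^ w.
  by move=> kJ; apply: Xw => //; rewrite /NF; nia.
suff H : forall rho col, rho < n -> col < SZ -> ha (hexec (HFor vk vJ5 SUMK) h5) aT rho col =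
   if i * J5 <= col < i * J5 + J5 then \big[Nat.lxor/0]_(t' < t.+1) contr s.1 rho t' col
   else ha h aT rho col.
  move=> rho col rn cS; rewrite H // si //.
  have -> : (col < i.+1 * J5) = (col < i * J5 + J5) by rewrite mulSn addnC.
  by case: (i * J5 <= col < i * J5 + J5).
apply: (@forN w D J5 (fun kk t' => forall rho col, rho < n -> col < SZ -> ha t' aT rho col =
   if i * J5 <= col < i * J5 + kk then \big[Nat.lxor/0]_(t' < t.+1) contr s.1 rho t' col
   else ha h aT rho col) _ _ _ h5 _ (isT : wf (HFor vk vJ5 SUMK))).
- by rewrite v5 //; exact: (ch vJ5 isT).
- move=> rho col rn cS; have -> : (i * J5 <= col < i * J5 + 0) = false by lia.
  by rewrite /= a5.
move=> kk t' kJ tk [frv fra] IH rho col rn cS.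
have cD : i * J5 + kk < D by lia.
have b1 : hv t' vR1 = R1 by rewrite (frv vR1 isT) h5E.
have b2 : hv t' vR2 = R2 by rewrite (frv vR2 isT) h5E.
have b3 : hv t' vo = o by rewrite (frv vo isT) v5.
have [b4 b5 b6 b7] : [/\ hv t' vI = i, hv t' vc1 = q, hv t' vJ5 = J5 & hv t' vSZ = SZ].
  by rewrite (frv vI isT) (frv vc1 isT) (frv vJ5 isT) (frv vSZ isT) !v5 // (ch vJ5 isT) (ch vSZ isT).
set cl := i * J5 + kk in cD; set y := X o (5 + (q * SZ + cl)).
have yw : y < 2 ^ w := Xl kk kJ.
have old rho' : rho' < n -> ha t' aT rho' cl = \big[Nat.lxor/0]_(u < t) contr s.1 rho' u cl.
  move=> rn'; rewrite IH //; last by rewrite /cl; lia.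
  have -> : (i * J5 <= cl < i * J5 + kk) = false by rewrite /cl; lia.
  rewrite si //; last by rewrite /cl; lia.
  by have -> : (i * J5 <= cl < i.+1 * J5) by rewrite mulSn /cl; lia.
have tl u : u < t -> u %/ 4 < NO by move=> ut; rewrite ltn_divLR //; lia.
have cw rho' : \big[Nat.lxor/0]_(u < t) contr s.1 rho' u cl < 2 ^ w.
  apply: big_lxor_lt => u _; apply: bmul_lt => //; apply: Xw; first exact: tl.
  have u4 : u %% 4 * SZ <= 3 * SZ by rewrite leq_mul2r -ltnS ltn_pmod ?orbT.
  by rewrite /NF /cl; lia.
have qS : q * SZ <= 3 * SZ by rewrite leq_mul2r -ltnS q4 orbT.
(* When [R2 = R1] the second update reads the result of the first and cancels it. *)
have E : hexec SUMK t' = seta (seta (setv (setv t' vcol cl) vy y)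
    aT R1 cl (Nat.lxor (ha t' aT R1 cl) y)) aT R2 cl
    (Nat.lxor (if R2 == R1 then Nat.lxor (ha t' aT R1 cl) y else ha t' aT R2 cl) y).
  rewrite /SUMK /= b1 b2 b3 b4 b5 b6 b7 tk.
  rewrite (@mulE _ i J5); last by apply: ltD; lia.
  rewrite (@addE _ (i * J5) kk) -/cl; last by apply: ltD; lia.
  have qs : q * SZ + cl + 5 < D by rewrite /NF in s1; rewrite /cl; lia.
  rewrite (@mulE _ q SZ); last by apply: ltD; lia.
  rewrite (@addE _ (q * SZ) cl); last by apply: ltD; lia.
  rewrite small // (@addE _ 5); last by apply: ltD; lia.
  rewrite (@modn_small (5 + _) D); last by lia.
  rewrite (modn_small cD) (@modn_small o D); last by lia.
  rewrite (@modn_small R1 D); last by lia.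
  rewrite (@modn_small R2 D); last by lia.
  rewrite (fra aDB isT) a5 hw //; last by rewrite /NF /cl; lia.
  rewrite -/y (@xorE _ (ha t' aT R1 cl)) // ?old //.
  rewrite eqxx andbT /= xorE //; case: ifP => // _; rewrite ?old //.
  exact: lxor_lt.
rewrite E /=.
case: (col =P cl) => [->|nc]; last first.
  rewrite !andbF IH //; suff -> : (col < i * J5 + kk.+1) = (col < i * J5 + kk) by [].
  by move: nc; rewrite /cl; lia.
rewrite !andbT; have -> : i * J5 <= cl < i * J5 + kk.+1 by rewrite /cl; lia.
rewrite big_ord_recr /= {2}/contr t1 t2 -/y -/R1 -/R2.
case: (rho =P R2) => [->|n2].
  rewrite eqxx; case: (R2 =P R1) => [<-|n12]; rewrite ?eqxx ?old //.
    by rewrite mul0n Nat.lxor_0_r Nat.lxor_assoc Nat.lxor_nilpotent Nat.lxor_0_r.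
  by rewrite eq_sym (introF eqP n12) /= mul1n.
have -> : (R2 == rho) = false by apply/eqP => e; case: n2.
case: (rho =P R1) => [->|n1]; first by rewrite eqxx /= mul1n old.
have -> : (R1 == rho) = false by apply/eqP => e; case: n1.
by rewrite mul0n Nat.lxor_0_r old.
Qed.

Lemma sums_exec h i s : i < P -> query_at h -> uf_at n h s -> hv h vI = i ->
  (forall rho col, rho < n -> i * J5 <= col < SZ -> ha h aT rho col = 0) ->
  sum_inv i s.1 (ha h aT) (NO * 4) (hexec SUMS h).
Proof.
move=> iP qa uf hI z; have [ch hN hw fw hQ] := qa.
apply: (@for2 w D NO 4 (sum_inv i s.1 (ha h aT)) _ _ _ _ _ h hN (ch v4 isT) (isT : wf SUMS) isT) => //.
- move=> rho col rn cS; case: ifP => // cc; rewrite big_ord0 z //; lia.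
move=> o q s' oN q4 so sq fr si; have [frv fra] := fr.
have qa' : query_at s' := query_fr fr isT isT qa.
have uf' : uf_at n s' s by apply: uf_at_ext uf; rewrite fra.
have hI' : hv s' vI = i by rewrite (frv vI isT).
exact: (sum1_exec iP oN q4 qa' uf' hI' so sq si).
Qed.

Lemma merges_exec h s (cu cv : nat -> nat) : query_at h -> uf_at n h s ->
  (forall t, t < NO * 4 -> cu t < n /\ cv t < n) ->
  (forall o q, o < NO -> q < 4 -> ha h aCU o q = cu (o * 4 + q) /\ ha h aCV o q = cv (o * 4 + q)) ->
  uf_at n (hexec MERGES h) (umerges s [seq (loc C (cu t), loc C (cv t)) | t <- iota 0 (NO * 4)]).
Proof.
move=> qa uf cn hc; have [ch hN hw fw hQ] := qa; have [nD LD mD] := dms.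
apply: (@for2 w D NO 4 (fun k t => uf_at n t (umerges s [seq (loc C (cu t), loc C (cv t)) | t <- iota 0 k]))
  _ _ _ _ _ h hN (ch v4 isT) (isT : wf MERGES) isT) => //.
move=> o q t oN q4 so sq fr uft; have [frv fra] := fr.
have qa' : query_at t := query_fr fr isT isT qa.
set k := o * 4 + q in uft *; set s' := umerges s _ in uft.
have kN : k < NO * 4 by rewrite /k; lia.
have [e1 e2] := hc o q oN q4; have [n1 n2] := cn k kN.
have e1' : ha t aCU o q = cu k by rewrite (fra aCU isT).
have e2' : ha t aCV o q = cv k by rewrite (fra aCV isT).
have [g1 g2 [gv ga]] := gamma2_exec (isT : vA \in [:: vR1; vA]) uft qa' oN q4 so sq e1' e2' n1 n2.
set h4 := hexec GAMMA _ in g1 g2 gv ga.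
have -> : hexec MERGE1 t = hexec UNION (setv h4 vB (hv h4 vF)) by [].
clearbody h4.
have -> : umerges s [seq (loc C (cu t), loc C (cv t)) | t <- iota 0 k.+1] =
   umerge s' (loc C (cu k)) (loc C (cv k)).
  by rewrite -(addn1 k) iotaD map_cat /= /umerges foldl_cat.
apply: (union_exec w10 D0 Dw nD nL LD) => //.
- by apply: uf_at_ext uft; rewrite /= ga.
- by apply/Cn/loc_mem.
- by apply/Cn/loc_mem.
Qed.

Section Cand.
Variables (i : nat) (tv : nat -> nat -> nat -> nat).
Hypothesis iP : i < P.
Hypothesis tvw : forall rho j q, rho < n -> j < J -> q < 5 -> tv rho j q < 2 ^ w.

Definition cfold rho k : nat * nat :=
  foldl (fun uv j => if (tv rho j 3 != tv rho j 4) && (tv rho j 2 == Nat.land (tv rho j 0) (tv rho j 1))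
                     then (tv rho j 3, tv rho j 4) else uv) (0, 0) (iota 0 k).

Definition tv_at h := forall rho j q, rho < n -> j < J -> q < 5 ->
  ha h aT rho (i * J5 + (j * 5 + q)) = tv rho j q.

Lemma test_exec h rho j : rho < n -> j < J -> consts_at h -> tv_at h -> hv h vI = i -> hv h vj = j ->
  hv h vcur = rho -> hv h vU = (cfold rho j).1 -> hv h vV = (cfold rho j).2 ->
  hv (hexec TEST h) vU = (cfold rho j.+1).1 /\ hv (hexec TEST h) vV = (cfold rho j.+1).2.
Proof.
move=> rn jJ ch ht hI hj hc hU hV; have [s1 s2 s3 s4 s5] := szs.
have iS : i.+1 * J5 <= SZ by rewrite /SZ leq_mul2r iP orbT.
rewrite mulSn in iS.
have jJ5 : j * 5 + 5 <= J5 by rewrite /J5; lia.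
set y := i * J5 + j * 5; have yD : y + 5 < D by rewrite /y; lia.
have -> : hexec TEST h = hexec (HIf (HB And
        (HB Eqw (HB Eqw (HA aT (HV vcur) (HB Add (HV vy) (HC 3)))
                        (HA aT (HV vcur) (HB Add (HV vy) (HC 4)))) (HC 0))
        (HB Eqw (HA aT (HV vcur) (HB Add (HV vy) (HC 2)))
           (HB And (HA aT (HV vcur) (HV vy)) (HA aT (HV vcur) (HB Add (HV vy) (HC 1))))))
    (HAsg vU (HA aT (HV vcur) (HB Add (HV vy) (HC 3))) ;;
     HAsg vV (HA aT (HV vcur) (HB Add (HV vy) (HC 4)))) hskip) (setv h vy y).
  have -> : setv h vy y = hexec (HAsg vy (HB Add (HB Mul (HV vI) (HV vJ5)) (HB Mul (HV vj) (HC 5)))) h.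
    rewrite /= hI hj (ch vJ5 isT) -[cval vJ5]/J5 small // !mulE ?addE //; apply: ltD; lia.
  by [].
have cell q : q < 5 -> ha h aT (rho %% D) (binop_sem w Add y (q %% 2 ^ w) %% D) = tv rho j q.
  move=> q5; rewrite small ?addE; last by lia.
    by rewrite !modn_small; [rewrite -addnA ht | lia | lia].
  by apply: ltD; lia.
have cell0 : ha h aT (rho %% D) (y %% D) = tv rho j 0.
  by rewrite !modn_small; [rewrite -[y]addn0 -addnA ht | lia | lia].
have -> : cfold rho j.+1 = if (tv rho j 3 != tv rho j 4) && (tv rho j 2 == Nat.land (tv rho j 0) (tv rho j 1))
                     then (tv rho j 3, tv rho j 4) else cfold rho j.
  by rewrite /cfold -(addn1 j) iotaD foldl_cat.
rewrite /= hc cell0 !cell // mod0n !eqwE // (@andE _ (tv rho j 0)) ?tvw // andE; last exact: bool_lt_pow.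
by case: (tv rho j 3 == tv rho j 4); case: (tv rho j 2 == _) => /=; rewrite ?hc ?cell.
Qed.

Lemma cand1_exec h o q : o < NO -> q < 4 -> query_at h -> tv_at h -> hv h vI = i ->
  hv h vo = o -> hv h vc1 = q ->
  forall o' q', ha (hexec CAND1 h) aCU o' q' =
      (if (o' == o) && (q' == q) then (cfold (Q1 (o * 4 + q)) J).1 else ha h aCU o' q') /\
    ha (hexec CAND1 h) aCV o' q' =
      (if (o' == o) && (q' == q) then (cfold (Q1 (o * 4 + q)) J).2 else ha h aCV o' q').
Proof.
move=> oN q4 [ch hN hw fw hQ] ht hI ho hq; have [s1 s2 s3 s4 s5] := szs.
set rho := Q1 (o * 4 + q).
have rn : rho < n by apply: Q1n; lia.
have oD : o < D by lia.
have qD : q < D by lia.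
set FOR := HFor vj vJ TEST.
set h1 := setv (setv (setv h vcur rho) vU 0) vV 0.
have E : hexec CAND1 h = hexec (HSet aCU (HV vo) (HV vc1) (HV vU) ;; HSet aCV (HV vo) (HV vc1) (HV vV))
    (hexec FOR h1).
  have -> : h1 = hexec (HAsg vcur (HA aQ1 (HV vo) (HV vc1)) ;; HAsg vU (HC 0) ;; HAsg vV (HC 0)) h.
    by rewrite /= ho hq (modn_small oD) (modn_small qD) (hQ o q oN q4).1 mod0n.
  by [].
have c1 : consts_at h1 by move=> x xc; rewrite -(ch x xc) /h1 /=; move: xc; rewrite !inE;
  do 9!(case/orP=> [/eqP->|] //); move=> /eqP->.
have [u1 u2] : hv (hexec FOR h1) vU = (cfold rho J).1 /\ hv (hexec FOR h1) vV = (cfold rho J).2.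
  apply: (@forN w D J (fun k t => hv t vU = (cfold rho k).1 /\ hv t vV = (cfold rho k).2)
     _ _ _ h1 (c1 vJ isT) (isT : wf FOR)) => //.
  move=> j t jJ tj fr [k1 k2]; have [frv fra] := fr.
  have ct : consts_at t := consts_fr fr isT c1.
  have tt : tv_at t by move=> rho' j' q' a b c; rewrite (fra aT isT) ht.
  have tI : hv t vI = i by rewrite (frv vI isT).
  have tc : hv t vcur = rho by rewrite (frv vcur isT).
  exact: (test_exec rn jJ ct tt tI tj tc k1 k2).
have [frv fra] := hexec_frame w D FOR h1.
set h2 := hexec FOR h1 in E u1 u2 frv fra *.
have v1 : hv h2 vo = o by rewrite (frv vo isT).
have v2 : hv h2 vc1 = q by rewrite (frv vc1 isT).
have b1 : ha h2 aCU = ha h aCU by rewrite (fra aCU isT).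
have b2 : ha h2 aCV = ha h aCV by rewrite (fra aCV isT).
clearbody h2; rewrite E => o' q' /=.
by rewrite v1 v2 u1 u2 (modn_small oD) (modn_small qD) b1 b2.
Qed.

Lemma cands_exec h : query_at h -> tv_at h -> hv h vI = i ->
  forall o q, o < NO -> q < 4 ->
    ha (hexec CANDS h) aCU o q = (cfold (Q1 (o * 4 + q)) J).1 /\
    ha (hexec CANDS h) aCV o q = (cfold (Q1 (o * 4 + q)) J).2.
Proof.
move=> qa ht hI; have [ch hN hw fw hQ] := qa.
suff H : forall o q, o < NO -> q < 4 -> o * 4 + q < NO * 4 ->
    ha (hexec CANDS h) aCU o q = (cfold (Q1 (o * 4 + q)) J).1 /\
    ha (hexec CANDS h) aCV o q = (cfold (Q1 (o * 4 + q)) J).2.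
  by move=> o q oN q4; apply: H => //; lia.
apply: (@for2 w D NO 4 (fun k t => forall o q, o < NO -> q < 4 -> o * 4 + q < k ->
    ha t aCU o q = (cfold (Q1 (o * 4 + q)) J).1 /\
    ha t aCV o q = (cfold (Q1 (o * 4 + q)) J).2)
  _ _ _ _ _ h hN (ch v4 isT) (isT : wf CANDS) isT) => //.
move=> o q t oN q4 so sq fr IH o' q' oN' q4' lt; have [frv fra] := fr.
have qa' : query_at t := query_fr fr isT isT qa.
have tt : tv_at t by move=> rho j' q'' a b c; rewrite (fra aT isT) ht.
have tI : hv t vI = i by rewrite (frv vI isT).
have [e1 e2] := cand1_exec oN q4 qa' tt tI so sq o' q'; rewrite e1 e2.
case: ifP => [/andP[/eqP-> /eqP->] //|ne]; apply: IH => //.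
by move: ne => /negbT; rewrite negb_and; lia.
Qed.
End Cand.

Section Run.
Variables (r : seq bool) (pu pv : nat -> nat) (F : pred nat).
Hypothesis pn : forall e, e < m -> pu e < n /\ pv e < n.
Hypothesis abel : forall rt i rho j q, i < P -> rho < n -> j < J -> q < 5 ->
  \big[Nat.lxor/0]_(t < NO * 4) contr rt rho t (i * J5 + (j * 5 + q)) =
  tsum m w J pu pv F C r i rt rho j q.
Let Q := [seq Q1 t | t <- iota 0 (NO * 4)].
Local Notation proc := (proc m w J pu pv F C Q r).
Local Notation okp := (okp n m w J pu pv F C Q r).

(** Each phase accumulates in its own columns of [aT], so the table is never cleared. Absence of
    false positives is needed for the candidates to be positions below n, where the lookups are
    correct. *)
Lemma phase_exec i h : i < P -> ~~ FP n m w J pu pv F C r i (proc i).1 -> query_at h -> hv h vI = i ->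
  uf_at n h (proc i) ->
  (forall rho col, rho < n -> i * J5 <= col < SZ -> ha h aT rho col = 0) ->
  uf_at n (hexec (SUMS ;; CANDS ;; MERGES) h) (proc i.+1) /\
  (forall rho col, rho < n -> i.+1 * J5 <= col < SZ ->
     ha (hexec (SUMS ;; CANDS ;; MERGES) h) aT rho col = 0).
Proof.
move=> iP nfp qa hI uf z; have [s1 s2 s3 s4 s5] := szs.
have si := sums_exec iP qa uf hI z.
have -> : hexec (SUMS ;; CANDS ;; MERGES) h = hexec MERGES (hexec CANDS (hexec SUMS h)) by [].
have fr1 := hexec_frame w D SUMS h; set h1 := hexec SUMS h in si fr1 *; clearbody h1.
have qa1 : query_at h1 := query_fr fr1 isT isT qa.
have [fv1 fa1] := fr1.
have I1 : hv h1 vI = i by rewrite (fv1 vI isT).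
have uf1 : uf_at n h1 (proc i) by apply: uf_at_ext uf; rewrite fa1.
set tv := tsum m w J pu pv F C r i (proc i).1.
have cS j q : j < J -> q < 5 -> i * J5 + (j * 5 + q) < i.+1 * J5.
  by move=> jJ q5; rewrite mulSn addnC ltn_add2r /J5; lia.
have iS : i.+1 * J5 <= SZ by rewrite /SZ leq_mul2r iP orbT.
have tvw rho j q : rho < n -> j < J -> q < 5 -> tv rho j q < 2 ^ w.
  move=> rn jJ q5; rewrite /tv -abel //; apply: big_lxor_lt => t _; apply: bmul_lt.
  have cS' := leq_trans (cS j q jJ q5) iS.
  have t4 := ltn_pmod t (isT : 0 < 4).
  apply: Xw; first by rewrite ltn_divLR // ltn_ord.
  by rewrite /NF; nia.
have tt : tv_at i tv h1.
  move=> rho j q rn jJ q5; rewrite si //; last by apply: leq_trans (cS j q jJ q5) iS.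
  by rewrite leq_addr cS //= abel.
have cd := cands_exec iP tvw qa1 tt I1.
have fr2 := hexec_frame w D CANDS h1; set h2 := hexec CANDS h1 in cd fr2 *; clearbody h2.
have qa2 : query_at h2 := query_fr fr2 isT isT qa1.
have [fv2 fa2] := fr2.
have uf2 : uf_at n h2 (proc i) by apply: uf_at_ext uf1; rewrite fa2.
have cn t : t < NO * 4 -> (cfold tv (Q1 t) J).1 < n /\ (cfold tv (Q1 t) J).2 < n.
  move=> tN; have [[e _]|[e _ E]] := cand_spec C0 (Q1n tN) nfp.
    by rewrite -[cfold _ _ _]/(cand m w J pu pv F C r i (proc i).1 (Q1 t)) e.
  by rewrite -[cfold _ _ _]/(cand m w J pu pv F C r i (proc i).1 (Q1 t)) E; apply: pn.
have mg := merges_exec qa2 uf2 cn cd.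
split.
  have -> // : proc i.+1 = umerges (proc i)
    [seq (loc C (cfold tv (Q1 t) J).1, loc C (cfold tv (Q1 t) J).2) | t <- iota 0 (NO * 4)].
  by rewrite /Q /= /pstep -map_comp.
move=> rho col rn /andP[c1 c2].
rewrite (@frame_a _ _ MERGES) // (fa2 aT isT) si // ltnNge c1 andbF z //.
by rewrite c2 andbT; apply: leq_trans c1; rewrite leq_mul2r leqnSn orbT.
Qed.

Lemma phases_exec h : query_at h -> uf_at n h (id, fun=> 0) ->
  (forall rho col, rho < n -> col < SZ -> ha h aT rho col = 0) -> okp P ->
  uf_at n (hexec PHASES h) (proc P).
Proof.
move=> qa uf z ok.
suff [] : uf_at n (hexec PHASES h) (proc P) /\
  (forall rho col, rho < n -> P * J5 <= col < SZ -> ha (hexec PHASES h) aT rho col = 0) by [].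
have [ch _ _ _ _] := qa.
apply: (@forN w D P (fun i t => uf_at n t (proc i) /\
  (forall rho col, rho < n -> i * J5 <= col < SZ -> ha t aT rho col = 0)) _ _ _ h (ch vP isT) (isT : wf PHASES)).
  by split=> // rho col rn /andP[_ cS]; apply: z.
move=> i t iP ti fr [uft zt].
have qat : query_at t := query_fr fr isT isT qa.
have nfp : ~~ FP n m w J pu pv F C r i (proc i).1.
  by apply: (allP ok); rewrite mem_iota.
have [u1 u2] := phase_exec iP nfp qat ti uft zt.
by split; [apply: uf_at_ext u1 | exact: u2].
Qed.
End Run.

Lemma answer_exec h s : 1 < NO -> query_at h -> uf_at n h s ->
  hv (hexec ANSWER h) 0 = (s.1 (loc C (X 0 0)) == s.1 (loc C (X 1 0))) && (X 0 5 == X 1 5).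
Proof.
move=> N1 qa uf; have [ch hN hw fw hQ] := qa; have [s1 s2 s3 s4 s5] := szs.
have N0 : 0 < NO by apply: ltnW.
have sm k : k < 6 -> k %% 2 ^ w %% D = k by move=> k5; rewrite small ?modn_small //; lia.
have sz5 : 5 < NF by rewrite /NF; nia.
set A := HSet aCU (HC 0) (HC 0) (HA aDB (HC 0) (HC 0)) ;; HSet aCV (HC 0) (HC 0) (HA aDB (HC 1) (HC 0)) ;;
   HAsg vo (HC 0) ;; HAsg vc1 (HC 0).
set h1 := hexec A h.
have h1E : h1 = setv (setv (seta (seta h aCU 0 0 (X 0 0)) aCV 0 0 (X 1 0)) vo 0) vc1 0.
  by rewrite /h1 /A /= (sm 0 isT) (sm 1 isT) mod0n !hw //; lia.
have fr1 := hexec_frame w D A h.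
have qa1 : query_at h1 := query_fr fr1 isT isT qa.
have uf1 : uf_at n h1 s by apply: uf_at_ext uf; rewrite h1E.
have e0 : hv h1 vo = 0 by rewrite h1E.
have e1 : hv h1 vc1 = 0 by rewrite h1E.
have e2 : ha h1 aCU 0 0 = X 0 0 by rewrite h1E.
have e3 : ha h1 aCV 0 0 = X 1 0 by rewrite h1E.
have [g1 g2 [gv ga]] := gamma2_exec (isT : vA \in [:: vR1; vA]) uf1 qa1 N0 (isT : 0 < 4) e0 e1 e2 e3
  (Xn N0 (isT : 0 < 5)) (Xn N1 (isT : 0 < 5)).
set h4 := hexec GAMMA _ in g1 g2 gv ga.
rewrite /ANSWER (@hexecS w D _ _ h) -/A -/h1 (@hexecS w D _ _ h1) (@hexecS w D _ _ (hexec _ h1)).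
rewrite (@hexecS w D _ _ (hexec _ (hexec _ h1))) -/h4.
clearbody h4 h1; have [_ _ hw1 _ _] := qa1.
have d4 : ha h4 aDB = ha h1 aDB by rewrite ga.
rewrite /= g1 g2 (sm 0 isT) (sm 1 isT) (sm 5 isT) d4 !hw1 // !eqwE // andE; last exact: bool_lt_pow.
by case: (_ == _); case: (_ == _).
Qed.

End Phase.

Lemma endq_exec h : consts_at h -> hv h vN = NO -> words_at h -> forall o q,
  ha (hexec ENDQ h) aQ1 o q = (if (q == 3) && (o < NO) then X o 0 else ha h aQ1 o q) /\
  ha (hexec ENDQ h) aQ2 o q = (if (q == 3) && (o < NO) then X o 1 else ha h aQ2 o q).
Proof.
move=> ch hN hw; have [s1 s2 s3 s4 s5] := szs.
have sm k : k < 6 -> k %% 2 ^ w %% D = k by move=> k5; rewrite small ?modn_small //; lia.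
apply: (@forN w D NO (fun k t => forall o q,
  ha t aQ1 o q = (if (q == 3) && (o < k) then X o 0 else ha h aQ1 o q) /\
  ha t aQ2 o q = (if (q == 3) && (o < k) then X o 1 else ha h aQ2 o q)) _ _ _ h hN (isT : wf ENDQ)).
  by move=> o q; rewrite ltn0 andbF.
move=> k t kN tk [frv fra] IH o q; have [i1 i2] := IH o q.
have kD : k < D by lia.
rewrite /= tk (modn_small kD) (sm 0 isT) (sm 1 isT) (sm 3 isT) (fra aDB isT) !hw ?i1 ?i2 //; try by rewrite /NF; lia.
case: (o =P k) => [->|nk] /=; first by rewrite ltnSn ltnn andbF andbT; case: (q == 3).
by have -> : (o < k.+1) = (o < k) by lia.
Qed.

End Decode.
(** * Cut identity *)

(* Summation by parts over the two-element field. *)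
Lemma abel_lxor (b : nat -> bool) (SK : nat -> nat) n :
  \big[Nat.lxor/0]_(p < n) (b p * SK p) =
  Nat.lxor (\big[Nat.lxor/0]_(p < n) ((b p (+) b p.-1) * \big[Nat.lxor/0]_(p' < p) SK p'))
    (b n.-1 * \big[Nat.lxor/0]_(p' < n) SK p').
Proof.
elim: n => [|n IH]; first by rewrite !big_ord0 muln0.
rewrite !big_ord_recr /= IH.
move: (\big[Nat.lxor/0]_(i < n) _) (\big[Nat.lxor/0]_(p' < n) SK p') (SK n) => S PS K.
case: (b n); case: (b n.-1); rewrite /= ?mul1n ?mul0n; apply: Nat.bits_inj => z;
  rewrite !Nat.lxor_spec ?Nat.bits_0; by do 3![case: (Nat.testbit _ z)].
Qed.

Lemma lxorC x y : Nat.lxor x y = Nat.lxor y x.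
Proof. exact: Nat.lxor_comm. Qed.

Lemma big_lxor_mulb (I : finType) (P : pred I) (b : bool) (G : I -> nat) :
  b * \big[Nat.lxor/0]_(i | P i) G i = \big[Nat.lxor/0]_(i | P i) (b * G i).
Proof.
by case: b; [rewrite mul1n; apply: eq_bigr => i _; rewrite mul1n | rewrite mul0n big1].
Qed.

Lemma big_lxor_seq m (l : seq nat) (G : nat -> nat) : uniq l -> {in l, forall e, e < m} ->
  \big[Nat.lxor/0]_(e <- l) G e = \big[Nat.lxor/0]_(e < m | nat_of_ord e \in l) G e.
Proof.
move=> ul lm.
rewrite -(big_mkord (fun e => e \in l) G) -[RHS]big_filter; apply: perm_big.
apply: uniq_perm => //; first by rewrite filter_uniq // iota_uniq.
move=> e; rewrite mem_filter mem_index_iota /=; case el: (e \in l) => //=.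
by rewrite lm.
Qed.

(** Replacing repetitions by 0 turns a sum over a list into a sum over the set of its entries. *)
Lemma big_lxor_cuts (n : nat) (clf : nat -> nat) (G : nat -> nat) K : G 0 = 0 ->
  (forall t, t < K -> clf t < n) -> 0 < n ->
  let cuts := fix cuts t : seq nat := if t is t'.+1 then clf t' :: cuts t' else [:: 0] in
  \big[Nat.lxor/0]_(t < K) G (if clf t \in cuts t then 0 else clf t) =
  \big[Nat.lxor/0]_(p < n | nat_of_ord p \in cuts K) G p.
Proof.
move=> G0 + n0 cuts; elim: K => [|K IH] lt.
  rewrite big_ord0 (eq_bigl (fun p : 'I_n => p == Ordinal n0)); last first.
    by move=> p; rewrite /= inE -val_eqE.
  by rewrite big_pred1_eq G0.
rewrite big_ord_recr /= IH; last by move=> t tK; apply: lt; apply: ltnW.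
have cK := lt K (ltnSn K).
case: ifP => cc.
  rewrite G0 Nat.lxor_0_r; apply: eq_bigl => p; rewrite inE.
  by case: eqP => [->|_] //=; rewrite cc.
rewrite [RHS](bigD1 (Ordinal cK)) /=; last by rewrite mem_head.
rewrite lxorC; congr Nat.lxor; apply: eq_bigl => p; rewrite inE -val_eqE /=.
by case: (nat_of_ord p =P clf K) => [->|_]; rewrite ?cc ?andbF ?andbT.
Qed.

Lemma big_ord4 (N : nat) (G : nat -> nat) :
  \big[Nat.lxor/0]_(t < N * 4) G t =
  Nat.lxor (\big[Nat.lxor/0]_(t < N * 3) G (t %/ 3 * 4 + t %% 3))
           (\big[Nat.lxor/0]_(o < N) G (o * 4 + 3)).
Proof.
elim: N => [|N IH]; first by rewrite !big_ord0.
rewrite mulSnr [N.+1 * 3]mulSnr !addnS !addn0 !big_ord_recr /= {}IH.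
have d q : q < 3 -> (N * 3 + q) %/ 3 = N /\ (N * 3 + q) %% 3 = q.
  by move=> q3; rewrite divnMDl // divn_small // addn0 modnMDl modn_small.
have [e1 e2] := d 0 isT; have [e3 e4] := d 1 isT; have [e5 e6] := d 2 isT.
rewrite !addn0 in e1 e2; rewrite !addn1 in e3 e4; rewrite !addn2 in e5 e6.
rewrite e1 e2 e3 e4 e5 e6 !addnS !addn0.
move: (\big[_/_]_(_ < _) _) (\big[_/_]_(_ < N) _) => A B; apply: Nat.bits_inj => z.
rewrite !Nat.lxor_spec; by do 6![case: (Nat.testbit _ z)].
Qed.

Section CutIdentity.
Variables (n m L p0 w NO : nat) (eu ev : nat -> 'I_n) (pos st : 'I_n -> nat) (Af Bf : nat -> 'I_n).
Variables (r : seq bool) (Fl : seq nat) (x1 x2 : 'I_n).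
Let J := 2 * L + 2.
Let J5 := J * 5.
Let SZ := p0 * L * J5.
Let pu e := pos (eu e).
Let pv e := pos (ev e).
Local Notation ske := (ske w L m eu ev r pos).
Hypothesis pos_lt : forall x, pos x < n.
Hypothesis st_lt : forall x, st x < n.
Hypotheses (ulf : uniq Fl) (Flm : {in Fl, forall e, e < m}) (NOE : NO = (size Fl).+2).

Definition psum p k := \big[Nat.lxor/0]_(p' < p) \big[Nat.lxor/0]_(e < m) (touch eu ev pos e p' * ske e k).

Definition qword o : nat -> nat :=
  if o is o'.+2 then eword L p0 eu ev pos st Af Bf psum ske (nth 0 Fl o')
  else vword pos st (if o is 1 then x2 else x1).

Local Notation C := (cuts qword (NO * 3)).
Definition cutq1 t := if t %% 4 == 3 then qword (t %/ 4) 0 else newcut qword (t %/ 4 * 3 + t %% 4).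
Definition cutq2 t := if t %% 4 == 3 then qword (t %/ 4) 1 else (newcut qword (t %/ 4 * 3 + t %% 4)).-1.

Let n0 : 0 < n. Proof. by apply: leq_trans (ltn_ord x1). Qed.

Lemma qword_lt o q : o < NO -> q < 5 -> qword o q < n.
Proof.
rewrite /qword; case: o => [|[|o]] oN q5; rewrite /vword.
- by case: ifP => // _; case: ifP.
- by case: ifP => // _; case: ifP.
by case: q q5 => [|[|[|[|[|q]]]]] //= _; rewrite ?pos_lt ?st_lt.
Qed.

(** Each edge occurs once at either end. The boundary term of the summation by parts therefore
    vanishes. *)
Lemma psum_total k : psum n k = 0.
Proof.
rewrite /psum exchange_big /= big1 // => e _.
have tE : forall p, touch eu ev pos e p = (pu e == p) (+) (pv e == p) by [].
have one x : x < n -> \big[Nat.lxor/0]_(p < n) ((x == p) * ske e k) = ske e k.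
  move=> xn; rewrite (bigD1 (Ordinal xn)) //= eqxx mul1n big1 ?Nat.lxor_0_r // => p.
  by rewrite -val_eqE /= eq_sym => /negbTE->; rewrite mul0n.
under eq_bigr do rewrite tE addb_lxor.
by rewrite big_split /= !one ?pos_lt // Nat.lxor_nilpotent.
Qed.

(** Let b indicate the positions whose class is [rho]. The XOR of the edges leaving [rho] is the sum
    of b(p) times the sketch of p; by parts it becomes a sum over p of b(p) + b(p-1) times the
    prefix XOR, supported on the cut points. The last slot of each deleted edge removes that
    edge. *)
Lemma cut_identity (rt : nat -> nat) rho col : col < SZ ->
  \big[Nat.lxor/0]_(t < NO * 4) contr L p0 qword C cutq1 cutq2 rt rho t col =
  \big[Nat.lxor/0]_(e < m | crossing pu pv (fun e => e \in Fl) C rt rho e) ske e col.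
Proof.
move=> cS; have SZ0 : 0 < SZ by lia.
pose b p := rt (loc C p) == rho.
have bE t : (contr L p0 qword C cutq1 cutq2 rt rho t col =
  (b (cutq1 t) (+) b (cutq2 t)) * qword (t %/ 4) (5 + (t %% 4 * SZ + col))) by [].
have C0 := cuts0 qword (NO * 3).
pose G p := (b p (+) b p.-1) * psum p col.
rewrite (@big_ord4 NO (fun t => contr L p0 qword C cutq1 cutq2 rt rho t col)).
have -> : \big[Nat.lxor/0]_(t < NO * 3) contr L p0 qword C cutq1 cutq2 rt rho (t %/ 3 * 4 + t %% 3) col =
   \big[Nat.lxor/0]_(t < NO * 3) G (newcut qword t).
  apply: eq_bigr => t _; have t3 := ltn_pmod t (isT : 0 < 3).
  have [e1 e2] : (t %/ 3 * 4 + t %% 3) %/ 4 = t %/ 3 /\ (t %/ 3 * 4 + t %% 3) %% 4 = t %% 3.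
    have q4 : t %% 3 < 4 := leqW t3.
    by rewrite divnMDl // (divn_small q4) addn0 modnMDl (modn_small q4).
  rewrite bE /cutq1 /cutq2 e1 e2 -divn_eq; have -> : (t %% 3 == 3) = false by lia.
  rewrite /G; case: (newcut qword t =P 0) => [->|]; first by rewrite addbb !mul0n.
  rewrite /newcut; case: ifP => // _ nz; congr (_ * _).
  move: nz; rewrite /clf; case: (t %/ 3) => [|[|o]].
  - by rewrite /= /vword; case: (t %% 3) t3 => [|[|[|]]].
  - by rewrite /= /vword; case: (t %% 3) t3 => [|[|[|]]].
  move=> _.
  have -> : qword o.+2 (5 + (t %% 3 * SZ + col)) =
    eword L p0 eu ev pos st Af Bf psum ske (nth 0 Fl o) (5 + (t %% 3 * SZ + col)) by [].
  rewrite ewordE -/J -/J5 -/SZ.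
  have -> : (t %% 3 * SZ + col) %/ SZ = t %% 3 by rewrite divnMDl // divn_small ?addn0.
  have -> : (t %% 3 * SZ + col) %% SZ = col by rewrite modnMDl modn_small.
  by case: (t %% 3) t3 => [|[|[|]]].
have -> : \big[Nat.lxor/0]_(t < NO * 3) G (newcut qword t) = \big[Nat.lxor/0]_(p < n | nat_of_ord p \in C) G p.
  apply: (@big_lxor_cuts n (clf qword) G) => //; first by rewrite /G addbb mul0n.
  move=> t tN; apply: qword_lt; first by rewrite ltn_divLR.
  by have := ltn_pmod t (isT : 0 < 3); lia.
(* Away from the cut points the indicator does not jump, by [loc_pred]. *)
have -> : \big[Nat.lxor/0]_(p < n | nat_of_ord p \in C) G p = \big[Nat.lxor/0]_(p < n) G p.
  rewrite [RHS](bigID (fun p : 'I_n => nat_of_ord p \in C)) /= [X in Nat.lxor _ X]big1 ?Nat.lxor_0_r // => p pC.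
  rewrite /G /b loc_pred ?addbb //; rewrite lt0n; apply: contra pC => /eqP->; exact: C0.
(* Summation by parts, then regrouping by edges: each edge is counted at its two positions, so it
   survives exactly when one end is inside. *)
have -> : \big[Nat.lxor/0]_(p < n) G p =
   \big[Nat.lxor/0]_(e < m) ((b (pu e) (+) b (pv e)) * ske e col).
  have := abel_lxor b (fun p => \big[Nat.lxor/0]_(e < m) (touch eu ev pos e p * ske e col)) n.
  rewrite -/(psum n col) psum_total muln0 Nat.lxor_0_r => <-.
  under eq_bigr do rewrite big_lxor_mulb.
  rewrite exchange_big /=; apply: eq_bigr => e _.
  have one x : x < n -> \big[Nat.lxor/0]_(p < n) (b p * ((x == p) * ske e col)) = b x * ske e col.
    move=> xn; rewrite (bigD1 (Ordinal xn)) //= eqxx mul1n big1 ?Nat.lxor_0_r // => p.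
    by rewrite -val_eqE /= eq_sym => /negbTE->; rewrite mul0n muln0.
  rewrite addb_lxor -(one (pu e)) ?pos_lt // -(one (pv e)) ?pos_lt // -big_split /=.
  apply: eq_bigr => p _; rewrite -/(touch eu ev pos e p) /touch -/(pu e) -/(pv e) addb_lxor.
  by case: (b p); rewrite ?mul1n ?mul0n.
have -> : \big[Nat.lxor/0]_(o < NO) contr L p0 qword C cutq1 cutq2 rt rho (o * 4 + 3) col =
   \big[Nat.lxor/0]_(e < m | nat_of_ord e \in Fl) ((b (pu e) (+) b (pv e)) * ske e col).
  rewrite -(@big_lxor_seq m Fl (fun e => (b (pu e) (+) b (pv e)) * ske e col)) //.
  have cE o : contr L p0 qword C cutq1 cutq2 rt rho (o * 4 + 3) col =
     (b (qword o 0) (+) b (qword o 1)) * qword o (5 + (3 * SZ + col)).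
    have [e1 e2] : (o * 4 + 3) %/ 4 = o /\ (o * 4 + 3) %% 4 = 3.
      by rewrite divnMDl // modnMDl addn0.
    by rewrite bE /cutq1 /cutq2 e1 e2.
  rewrite (eq_bigr _ (fun (o : 'I_NO) _ => cE o)).
  rewrite NOE !big_ord_recl /= !addbb !mul0n !Nat.lxor_0_l (big_nth 0) big_mkord.
  apply: eq_bigr => o _; congr (_ * _); rewrite -/J -/J5 -/SZ addKn.
  by rewrite divnMDl // divn_small ?addn0 // modnMDl modn_small.
(* The deleted edges now appear twice and cancel. *)
rewrite [X in Nat.lxor X _](bigID (fun e : 'I_m => nat_of_ord e \in Fl)) /= Nat.lxor_assoc lxorC.
rewrite Nat.lxor_assoc Nat.lxor_nilpotent Nat.lxor_0_r big_mkcond [RHS]big_mkcond /=.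
apply: eq_bigr => e _; rewrite /crossing /=; case: (nat_of_ord e \in Fl) => //=.
by rewrite -/(b _) -/(b _); case: (_ (+) _); rewrite ?mul1n ?mul0n.
Qed.

Lemma contr_tsum (rt : nat -> nat) i rho j q : i < p0 * L -> j < J -> q < 5 ->
  \big[Nat.lxor/0]_(t < NO * 4) contr L p0 qword C cutq1 cutq2 rt rho t (i * J5 + (j * 5 + q)) =
  tsum m w J pu pv (fun e => e \in Fl) C r i rt rho j q.
Proof.
move=> iP jJ q5.
have tJ : j * 5 + q < J5 by rewrite /J5; lia.
have J50 : 0 < J5 by lia.
have cS : i * J5 + (j * 5 + q) < SZ.
  by have : i.+1 * J5 <= SZ; [rewrite leq_mul2r iP orbT | rewrite mulSn; lia].
rewrite cut_identity // /tsum [RHS]big_mkcondr /=; apply: eq_bigr => e _.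
rewrite /ske -/J -/J5 divnMDl // divn_small // addn0 modnMDl modn_small //.
rewrite divnMDl // divn_small // addn0 modnMDl modn_small //.
by case: sampled; rewrite ?mul1n ?mul0n.
Qed.

End CutIdentity.

(** * Positions and connectivity *)

Section Positions.
Variables (n m : nat) (eu ev : nat -> 'I_n) (Af Bf : nat -> 'I_n) (s : ufs) (g : {perm 'I_n}).
Hypothesis ly : lay eu ev m Af Bf s g.
Variables (o : seq 'I_n) (x0 : 'I_n).
Hypothesis od : order_at s g n o.
Hypothesis sn : forall x : 'I_n, s.1 x < n.
Hypothesis ss : forall x : 'I_n, s.1 (s.1 x) = s.1 x.

Definition posf (x : 'I_n) := index x o.
Definition rootf (x : 'I_n) : 'I_n := Ordinal (sn x).
Definition stf (x : 'I_n) := index (rootf x) o.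
Let vx p := nth x0 o p.

Let mo x : x \in o. Proof. by rewrite (ord_mem od) sn. Qed.

Lemma size_order : size o = n.
Proof.
have /card_uniqP <- := ord_uniq od; rewrite -[RHS]card_ord; apply: eq_card => x.
by rewrite mo.
Qed.

Lemma posf_lt x : posf x < n.
Proof. by rewrite -size_order index_mem mo. Qed.

Lemma stf_lt x : stf x < n.
Proof. by rewrite -size_order index_mem mo. Qed.

Let vxK x : vx (posf x) = x. Proof. by rewrite /vx nth_index. Qed.
Let posK p : p < n -> posf (vx p) = p.
Proof. by move=> pn; rewrite /posf index_uniq ?size_order // (ord_uniq od). Qed.

Lemma posf_inj : injective posf.
Proof. exact: can_inj vxK. Qed.

Lemma stf_eq x y : (stf x == stf y) = (s.1 x == s.1 y).
Proof.
apply/eqP/eqP => [e|e]; last by rewrite /stf (_ : rootf x = rootf y) //; apply: val_inj.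
have : rootf x = rootf y by rewrite -[LHS](vxK) -[RHS]vxK /posf -/(stf x) -/(stf y) e.
by move/(congr1 val).
Qed.

Variables (Fl C : seq nat).
Hypothesis Flm : {in Fl, forall e, e < m}.
Hypothesis C0 : 0 \in C.
Hypothesis CF : forall e, e \in Fl -> [/\ stf (eu e) \in C, posf (Af e) \in C & posf (Bf e) \in C].
Hypothesis FC : forall c, c \in C -> c = 0 \/
  exists2 e, e \in Fl & [\/ c = stf (eu e), c = posf (Af e) | c = posf (Bf e)].

Definition drel : rel 'I_n := fun x y => has (fun i => (i \notin Fl) && joins eu ev i x y) (iota 0 m).

Let drel_sym : connect_sym drel.
Proof. by apply: sym_connect_sym => x y; apply: eq_has => i; rewrite joins_sym. Qed.

Let se e : e < m -> s.1 (eu e) = s.1 (ev e).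
Proof.
move=> em; apply/(lay_conn ly)/connect1/hasP; exists e; first by rewrite mem_iota.
by rewrite /joins !eqxx.
Qed.

Let cutcomp c : c \in C -> 0 < c -> exists2 e, e \in Fl & s.1 (vx c) = s.1 (eu e).
Proof.
move=> cC c0; case: (FC cC) => [e|[e eF ce]]; first by rewrite e in c0.
exists e => //; have em := Flm eF.
have [[a b] /= [ea eb] [sa sb]] := lay_cut ly em.
case: ce => ->; rewrite ?vxK.
- exact: ss.
- by rewrite -sa; congr s.1; exact: ea.
- by rewrite (se em) -sb; congr s.1; exact: eb.
Qed.

Let mono p q : p <= q -> q < n -> s.1 (vx p) <= s.1 (vx q).
Proof. by move=> pq qn; apply: (ord_mono od); rewrite pq size_order. Qed.

Let st_pos x : stf x <= posf x.
Proof. by have [] := ord_first od (y := rootf x) (mo x) erefl. Qed.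

(** Walk back from p to the left end of its interval. Successive positions of one tree are
    successors in [g], linked by edges that are cut at the later position; as that position is not a
    cut point, none of these edges is deleted. *)
Lemma loc_conn p : p < n -> stf (vx p) \in C -> connect drel (vx (loc C p)) (vx p).
Proof.
elim: p => [|p IH] pn stC; first by rewrite loc_id.
have [pC|pC] := boolP (p.+1 \in C); first by rewrite loc_id.
rewrite -(loc_pred C0 _ pC) //=.
(* The start of the tree is a cut point and [p.+1] is not, so the step back stays in the same
   tree. *)
have le : stf (vx p.+1) <= p.
  have := st_pos (vx p.+1); rewrite posK // leq_eqVlt => /predU1P[e|//].
  by rewrite e (negbTE pC) in stC.
have pn' : p < n := ltnW pn.
have sE : s.1 (vx p) = s.1 (vx p.+1).
  apply/eqP; rewrite eqn_leq mono //=.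
  by have := mono le pn'; rewrite {1}/vx /stf nth_index //= ss.
apply: connect_trans (IH pn' _) _; first by move: sE => /eqP; rewrite -stf_eq => /eqP->.
have nE : vx p.+1 = g (vx p) by apply: (ord_next od); rewrite ?size_order.
have := lay_key ly (vx p); rewrite -nE.
apply: connect_sub => x y /hasP[i]; rewrite mem_iota add0n => /andP[_ im] /andP[ci jn].
apply: connect1; apply/hasP; exists i; rewrite ?mem_iota // jn andbT.
apply: contra pC => iF; have [_ c1 c2] := CF iF.
by case/orP: ci => /eqP/val_inj e; rewrite e posK // in c1 c2.
Qed.

(** A cut point between two vertices of one tree lies in the block of that tree and so comes from a
    deleted edge of it, which also cuts at the start of the tree. *)
Lemma stf_mem (x y : 'I_n) : s.1 x = s.1 y -> loc C (posf x) != loc C (posf y) -> stf x \in C.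
Proof.
wlog le : x y / posf x <= posf y => [H sxy ne|sxy].
  have [/H|/ltnW/H] := leqP (posf x) (posf y); first exact.
  have /eqP : stf x == stf y by rewrite stf_eq sxy.
  by move=> ->; apply; rewrite // eq_sym.
apply: contraR => xC; apply/eqP/loc_eq => // c cC pc cq.
apply: contraR xC => _.
have cn : c < n by apply: leq_ltn_trans cq (posf_lt y).
have [f fF sc] := cutcomp cC (leq_ltn_trans (leq0n _) pc).
have sx : s.1 (eu f) = s.1 x.
  rewrite -sc; apply/eqP; rewrite eqn_leq.
  have := mono cq (posf_lt y); rewrite vxK -sxy => -> /=.
  by have := mono (ltnW pc) cn; rewrite vxK.
have [c1 _ _] := CF fF; have /eqP <- // : stf (eu f) == stf x by rewrite stf_eq sx.
Qed.

Definition pcon : rel nat := fun p q => connect drel (vx p) (vx q).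

Lemma pcon_refl : reflexive pcon. Proof. by move=> p; apply: connect0. Qed.
Lemma pcon_sym : symmetric pcon. Proof. by move=> p q; apply: drel_sym. Qed.
Lemma pcon_trans : transitive pcon. Proof. by move=> p q t; apply: connect_trans. Qed.

Lemma pcon_loc x : stf x \in C -> connect drel (vx (loc C (posf x))) x.
Proof. by move=> xC; have := loc_conn (posf_lt x); rewrite vxK; apply. Qed.

Lemma drel_edge e : e < m -> e \notin Fl -> drel (eu e) (ev e).
Proof.
by move=> em eF; apply/hasP; exists e; rewrite ?mem_iota // eF /joins !eqxx.
Qed.

Lemma pcon_cross e : e < m -> e \notin Fl -> loc C (posf (eu e)) != loc C (posf (ev e)) ->
  pcon (loc C (posf (eu e))) (loc C (posf (ev e))).
Proof.
move=> em eF ne; have sE := se em; have uC := stf_mem sE ne.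
have vC : stf (ev e) \in C by have /eqP <- : stf (eu e) == stf (ev e) by rewrite stf_eq sE.
apply: connect_trans (pcon_loc uC) _; apply: connect_trans (connect1 (drel_edge em eF)) _.
by rewrite drel_sym; apply: pcon_loc.
Qed.

(** If the tree of [x] has a deleted edge, its start is a cut point, its intervals are connected and
    the classes decide. Otherwise the whole tree is intact, but its positions may share an interval
    with other trees; this is why the starts of the trees are compared as well. *)
Lemma connected_iff (rt : nat -> nat) (x y : 'I_n) :
  {in C &, forall c c', rt c = rt c' -> pcon c c'} ->
  (forall e, e < m -> e \notin Fl -> rt (loc C (posf (eu e))) = rt (loc C (posf (ev e)))) ->
  (rt (loc C (posf x)) == rt (loc C (posf y))) && (stf x == stf y) = connect drel x y.
Proof.
move=> vl fin; apply/andP/idP => [[/eqP rE]|xy]; last first.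
  have de a b : drel a b -> exists2 i, i < m & (i \notin Fl) && joins eu ev i a b.
    by case/hasP=> i; rewrite mem_iota => im H; exists i.
  split; first (apply/eqP; apply: (@connect_eq _ _ _ (fun z => rt (loc C (posf z)))) xy => a b).
    move=> /de[i im /andP[iF /orP[]/andP[/eqP<- /eqP<-]]]; rewrite fin //.
  rewrite stf_eq; apply/eqP; apply: (@connect_eq _ _ _ (fun z : 'I_n => s.1 z)) xy => a b.
  by move=> /de[i im /andP[iF /orP[]/andP[/eqP<- /eqP<-]]]; rewrite se.
move=> stE; have [xC|xC] := boolP (stf x \in C).
  have yC : stf y \in C by rewrite -(eqP stE).
  have := vl _ _ (loc_mem C0 (posf x)) (loc_mem C0 (posf y)) rE => cc.
  rewrite -drel_sym drel_sym; apply: connect_trans (connect_trans cc (pcon_loc yC)).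
  by rewrite drel_sym; apply: pcon_loc.
have /(lay_conn ly) xy : s.1 x = s.1 y by apply/eqP; rewrite -stf_eq.
suff : connect drel x y && (s.1 x == s.1 y) by case/andP.
(* No edge of the untouched tree is deleted, so reachability from [x] within it is the same with and
   without the faults. *)
have H a b : erel eu ev m a b -> connect drel x a && (s.1 x == s.1 a) = connect drel x b && (s.1 x == s.1 b).
  case/hasP=> i; rewrite mem_iota add0n => /andP[_ im] jn.
  have sab : s.1 a = s.1 b.
    by apply/(lay_conn ly)/connect1/hasP; exists i; rewrite ?mem_iota.
  rewrite -sab; case: (s.1 x =P s.1 a) => sxa; rewrite ?andbF // !andbT.
  have iF : i \notin Fl.
    apply: contra xC => iF; have [c1 _ _] := CF iF.
    have /eqP <- // : stf (eu i) == stf x.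
    rewrite stf_eq sxa; case/orP: jn => /andP[/eqP e1 /eqP e2]; first by rewrite e1.
    by rewrite e1 sab.
  have dab : drel a b by apply/hasP; exists i; rewrite ?mem_iota // iF.
  by apply: same_connect_r => //; apply: connect1.
by rewrite -(connect_eq H xy) connect0 eqxx.
Qed.

End Positions.

(** * Fault sets as indices into the edge list *)

Section EdgeList.
Variables (n : nat) (e : rel 'I_n) (E : seq ('I_n * 'I_n)) (x0 : 'I_n).
Hypotheses (esym : symmetric e) (eirr : irreflexive e) (eE : edge_list e E).
Let m := size E.
Let p0 := (x0, x0).
Definition eufst k := (nth p0 E k).1.
Definition eusnd k := (nth p0 E k).2.
Local Notation es := (map (@edge_of n) E).

Lemma edge_of_eq (u v x y : 'I_n) : edge_of (u, v) = edge_of (x, y) ->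
  ((u == x) && (v == y)) || ((u == y) && (v == x)).
Proof.
rewrite /edge_of /= => H.
have: u \in [set x; y] by rewrite -H !inE eqxx.
have: v \in [set x; y] by rewrite -H !inE eqxx orbT.
have: x \in [set u; v] by rewrite H !inE eqxx.
have: y \in [set u; v] by rewrite H !inE eqxx orbT.
by rewrite !inE; do 4!(case/orP=> /eqP ?); subst; rewrite ?eqxx ?orbT.
Qed.

Lemma edge_of_sym (x y : 'I_n) : edge_of (x, y) = edge_of (y, x).
Proof. by rewrite /edge_of /= setUC. Qed.

Lemma nth_edge k : k < m -> nth set0 es k = edge_of (eufst k, eusnd k).
Proof. by move=> km; rewrite (nth_map p0) // /eufst /eusnd -surjective_pairing. Qed.

Lemma edge_rel x y : (edge_of (x, y) \in edge_set e) = e x y.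
Proof.
apply/imsetP/idP => [[[a b]]|xy]; last by exists (x, y); rewrite ?inE.
rewrite inE /= => ab /edge_of_eq /orP[]/andP[/eqP-> /eqP->] //.
by rewrite esym.
Qed.

Lemma size_edges : size E = #|edge_set e|.
Proof.
have [ue me] := eE; rewrite -(size_map (@edge_of n)); have /card_uniqP <- := ue.
exact: eq_card.
Qed.

Lemma size_edges_lt L : n < 2 ^ L -> size E < 2 ^ (2 * L).
Proof.
move=> nL; rewrite size_edges; apply: leq_ltn_trans (leq_imset_card _ _) _.
apply: leq_ltn_trans (max_card _) _; rewrite card_prod card_ord mul2n -addnn expnD.
by apply: ltn_mul.
Qed.

Lemma ends_neq k : k < m -> eufst k != eusnd k.
Proof.
move=> km; have [ue me] := eE.
have : edge_of (eufst k, eusnd k) \in edge_set e.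
  by rewrite -me -nth_edge // mem_nth // size_map.
by rewrite edge_rel; apply: contraTneq => ->; rewrite eirr.
Qed.

Variable F : seq {set 'I_n}.
Hypotheses (uF : uniq F) (sF : {subset F <= edge_set e}).
Definition faults := [seq index x es | x <- F].

Let Fes x : x \in F -> x \in es. Proof. by move=> /sF; rewrite eE.2. Qed.

Lemma faults_uniq : uniq faults.
Proof.
rewrite map_inj_in_uniq // => x y xF yF xy.
by rewrite -(nth_index set0 (Fes xF)) xy nth_index // Fes.
Qed.

Lemma faults_lt : {in faults, forall k, k < m}.
Proof. by move=> _ /mapP[x xF ->]; rewrite /m -(size_map (@edge_of n) E) index_mem Fes. Qed.

Lemma mem_faults k : k < m -> (k \in faults) = (nth set0 es k \in F).
Proof.
move=> km; apply/mapP/idP => [[x xF ->]|kF]; first by rewrite nth_index // Fes.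
by exists (nth set0 es k); rewrite // index_uniq ?size_map //; case: eE.
Qed.

Lemma delete_drel : delete_edges e F =2 drel m eufst eusnd faults.
Proof.
move=> x y; have [ue me] := eE; apply/andP/hasP => [[xy nF]|[k]].
  have xE : edge_of (x, y) \in es by rewrite me edge_rel.
  have km : index (edge_of (x, y)) es < m by rewrite /m -(size_map (@edge_of n) E) index_mem.
  exists (index (edge_of (x, y)) es); first by rewrite mem_iota.
  rewrite mem_faults // nth_index // nF /=; apply: edge_of_eq.
  by rewrite -nth_edge // nth_index.
rewrite mem_iota add0n => /andP[_ km] /andP[kF jn].
have xE : edge_of (x, y) = nth set0 es k.
  rewrite nth_edge //; case/orP: jn => /andP[/eqP-> /eqP->] //; exact: edge_of_sym.
rewrite xE -mem_faults //; split=> //.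
by rewrite -edge_rel xE -me mem_nth // size_map.
Qed.

End EdgeList.
(** * The two programs *)

Lemma heval_sett w D h b e : heval w D (sett h b) e = heval w D h e.
Proof. by elim: e => //= [a i -> j ->|o e1 -> e2 ->]. Qed.

(** Applied to the forest stage, which draws no coins: positions and cut points are then the same
    for every tape. *)
Lemma hexec_sett w D p h b : norand p -> hexec w D p (sett h b) = sett (hexec w D p h) b.
Proof.
elim: p h => [x e|a i j e|x|p IHp q IHq|e p IHp q IHq|x y p IHp] h //=.
- by rewrite heval_sett.
- by rewrite !heval_sett.
- by move=> /andP[np nq]; rewrite IHp // IHq.
- by move=> /andP[np nq]; rewrite heval_sett; case: ifP => _; [apply: IHp | apply: IHq].
move=> np; have H q : forall k s,
    hiter (fun k s => setv (hexec w D p s) x k.+1) k q (sett s b) =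
    sett (hiter (fun k s => setv (hexec w D p s) x k.+1) k q s) b.
  elim: q => //= q IH k s.
  by rewrite IHp // -[setv (sett _ b) x k.+1]/(sett (setv (hexec w D p s) x k.+1) b) IH.
exact: (H (hv h y) 0 (setv h x 0)).
Qed.

Lemma uf_at0 n h : (forall x, ha h aPAR x 0 = 0) -> (forall x, ha h aSZ x 0 = 0) ->
  uf_at n h (id, fun=> 0).
Proof.
move=> p z; split=> [|x _]; last exact: z.
split=> /= [x xn|x xn _|x xn|x xn|x xn|x xn _] //.
- by rewrite p.
- by apply: leq_ltn_trans xn.
rewrite -[count _ _]/(count_mem x (iota 0 n)) count_uniq_mem ?iota_uniq //.
by rewrite mem_iota add0n xn.
Qed.

Definition LABREAD : hcmd :=
  HAsg vN (HA aIN (HC 0) (HC 0)) ;; HAsg vM (HA aIN (HC 0) (HC 1)) ;;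
  HAsg vO (HB Add (HV vN) (HV vM)).

Definition LABPRE (p0 : nat) : hcmd := LABREAD ;; CONSTS p0.

Definition FORESTRUN : hcmd := (INITNX ;; EDGES) ;; WALK.

Definition LABTAIL : hcmd := SKETCH ;; PREFIX ;; VLAB ;; ELAB ;; OUTPUT.

Definition LAB (p0 : nat) : hcmd := (LABPRE p0 ;; FORESTRUN) ;; LABTAIL.

Definition DECPRE (p0 : nat) : hcmd := HAsg vN (HB Add (HA aIN (HC 0) (HC 0)) (HC 2)) ;; CONSTS p0.

Definition DECMAIN : hcmd := PARSE ;; CUTSET ;; ENDQ ;; PHASES ;; ANSWER.

Definition DEC (p0 : nat) : hcmd := DECPRE p0 ;; DECMAIN.

Lemma size_flat_pairs n (E : seq ('I_n * 'I_n)) :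
  size (flatten [seq [:: val p.1; val p.2] | p <- E]) = 2 * size E.
Proof. by elim: E => //= p E ->; rewrite mulnS. Qed.

Lemma nth_flat_pairs n (E : seq ('I_n * 'I_n)) z k : k < size E ->
  nth 0 (flatten [seq [:: val p.1; val p.2] | p <- E]) (2 * k) = (nth z E k).1 /\
  nth 0 (flatten [seq [:: val p.1; val p.2] | p <- E]) (2 * k).+1 = (nth z E k).2.
Proof. by elim: E k => //= p E IH [|k] kE //; rewrite mulnS /=; apply: IH. Qed.

Lemma nth_write_strings (ls : seq (seq bool)) K o t :
  (forall i, i < size ls -> size (nth [::] ls i) = K) -> o < size ls -> t < K ->
  nth 0 (write_strings ls) (o * K.+1 + t.+1) = nth false (nth [::] ls o) t.
Proof.
elim: ls o => //= l ls IH o sz os tK; have sl : size l = K := sz 0 isT.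
have -> : write_strings (l :: ls) = (size l :: map nat_of_bool l) ++ write_strings ls by [].
rewrite nth_cat /= size_map sl; case: o os => [|o] os.
  by rewrite mul0n add0n ltnS tK /= (nth_map false) ?sl.
have -> : (o.+1 * K.+1 + t.+1 < K.+1) = false by rewrite mulSn; lia.
have -> : o.+1 * K.+1 + t.+1 - K.+1 = o * K.+1 + t.+1 by rewrite mulSn; lia.
by apply: IH => // i il; exact: (sz i.+1 il).
Qed.

(** With [kd] and [kk], the monomial bounding each variable that limits a loop: the counts of
    vertices, edges or labels have degree 1 in N, the others are polynomials in L. *)
Definition kc (a p0 x : nat) : nat :=
  if x == vW then a else if x == vP then p0 else if x == vJ then 4 else if x == vJ5 then 20 else
  if x == vSZ then 20 * p0 else if x == vNF then 5 + 80 * p0 else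
  if x \in [:: v5; v4; v3] then 5 else 1.

Definition kd (x : nat) : nat := x \in [:: vN; vM; vO].

Definition kk (x : nat) : nat :=
  if x \in [:: vN; vM; vO; v5; v4; v3] then 0 else if x \in [:: vSZ; vNF] then 2 else 1.

Lemma run_cost w D L p0 a N p h : w = a * L -> consts_at w L p0 h -> 0 < N -> 0 < L ->
  all (fun y => y \notin wv p) (lims p) ->
  (forall y, y \in lims p -> (y \in cvars) || ((y \in [:: vN; vM; vO]) && (hv h y <= N))) ->
  hcost w D p h <= bcoef (kc a p0) p * (N ^ bdeg kd p * L ^ bdeg kk p).
Proof.
move=> wE ch N0 L0 /allP lw lb.
apply: (@hcost_le_bound w D N L N0 L0 (kc a p0) kd kk (wv p) p h) => //.
move=> y /lb /orP[yc|/andP[yv yN]]; last first.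
  by move: yv yN; rewrite !inE => /or3P[]/eqP-> yN; rewrite /kc /kd /kk /= !muln1 mul1n.
rewrite ch //; move: yc; rewrite !inE.
case/orP=> [/eqP->|]; first by rewrite /kc /kd /kk /cval /= wE mul1n.
case/orP=> [/eqP->|]; first by rewrite /kc /kd /kk /cval /= !mul1n.
case/orP=> [/eqP->|]; first by rewrite /kc /kd /kk /cval /= mul1n.
case/orP=> [/eqP->|]; first by rewrite /kc /kd /kk /cval /= mul1n; lia.
case/orP=> [/eqP->|]; first by rewrite /kc /kd /kk /cval /= mul1n; lia.
have L2 : p0 * L * ((2 * L + 2) * 5) <= 20 * p0 * (L * L) by nia.
case/orP=> [/eqP->|]; first by rewrite /kc /kd /kk /cval /= mul1n.
case/orP=> [/eqP->|]; first by rewrite /kc /kd /kk /cval /= mul1n; nia.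
by case/or3P=> /eqP->; rewrite /kc /kd /kk /cval /= !muln1.
Qed.

(** The summand 408 absorbs the bound 400 n + 8 of [walk_cost]. *)
Definition labC (a p0 : nat) : nat := bcoef (kc a p0) (LABPRE p0) + bcoef (kc a p0) (INITNX ;; EDGES) +
  408 + bcoef (kc a p0) LABTAIL.
Definition labK : nat := bdeg kk (INITNX ;; EDGES) + bdeg kk LABTAIL.
Definition decC (a p0 : nat) : nat := bcoef (kc a p0) (DECPRE p0) + bcoef (kc a p0) DECMAIN.
Definition decK : nat := bdeg kk DECMAIN.

Lemma hcostS w D p q h : hcost w D (p ;; q) h = hcost w D p h + hcost w D q (hexec w D p h).
Proof. by []. Qed.

Section Programs.
Variables (a d L p0 n f : nat) (e : rel 'I_n) (E : seq ('I_n * 'I_n)) (x0 : 'I_n).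
Let w := a * L.
Let D := 2 ^ (d * L).
Let m := size E.
Let J := 2 * L + 2.
Let SZ := p0 * L * (J * 5).
Let NF := 5 + 4 * SZ.
Let LEN := NF * w.
Hypotheses (L0 : 0 < L) (da : 2 * d + 6 <= a) (a10 : 10 <= a) (pp0 : 0 < p0) (nL : n < 2 ^ L).
Hypothesis bigD : (n + m + 4) * (NF * w + 4) + 10 <= D.
Hypotheses (esym : symmetric e) (eirr : irreflexive e) (eE : edge_list e E).
Let eu := eufst E x0.
Let ev := eusnd E x0.
Let n0 : 0 < n. Proof. exact: leq_trans (ltn_ord x0). Qed.
Let w10 : 10 <= w. Proof. exact: leq_trans a10 (leq_pmulr a L0). Qed.
Let D0 : 0 < D. Proof. by rewrite expn_gt0. Qed.
Let Dw : narr * D * D <= 2 ^ w. Proof. exact: (dim_bound L0 da). Qed.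
Let small := (small w10).
Let ltD x := @lt_dim_pow w D x D0 Dw.
Let szs : [/\ NF + 4 <= D, SZ + 4 <= D, n + m + 4 <= D, J * 5 <= SZ & p0 * L <= SZ].
Proof. by eapply sizes; eassumption. Qed.
Let dms : [/\ n < D, L <= D & 2 * m + 5 < D].
Proof. by eapply dims; eassumption. Qed.
Let sm k : k < 9 -> k %% 2 ^ w %% D = k.
Proof.
move=> k9; have [s1 _ _ _ _] := szs.
by rewrite small ?modn_small //; [rewrite /NF in s1; lia | lia].
Qed.

Lemma start_in input b j : nth 0 input j < 2 ^ w -> ha (start a d L input b) aIN 0 j = nth 0 input j.
Proof. by move=> lt; rewrite /start /= mul0n add0n modn_small. Qed.

Lemma start_zero input b A i j : size input <= D -> 0 < A -> ha (start a d L input b) A i j = 0.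
Proof.
move=> sD A0; rewrite /start /= -/D nth_default ?mod0n //.
have h1 : D <= A * D by rewrite leq_pmull.
have h2 : A * D + i <= (A * D + i) * D by rewrite leq_pmulr.
lia.
Qed.

Let input := graph_input E f.
Let h0 b := start a d L input b.

Let szin : size input <= D.
Proof. by rewrite /input /graph_input /= size_flat_pairs -/m; have [_ _ h] := dms; lia. Qed.

Lemma start_ends b : ends_at m eu ev (h0 b).
Proof.
move=> k km; have [e1 e2] := nth_flat_pairs (x0, x0) km.
have xw (x : 'I_n) : x < 2 ^ w by apply: ltD; have := ltn_ord x; have [] := dms; lia.
have E1 : nth 0 input (3 + 2 * k) = eu k by exact: e1.
have E2 : nth 0 input (4 + 2 * k) = ev k by exact: e2.
by rewrite !start_in ?E1 ?E2.
Qed.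

Lemma labpre_exec b : let h := hexec w D (LABPRE p0) (h0 b) in
  [/\ consts_at w L p0 h, hv h vN = n, hv h vM = m, hv h vO = n + m & hv h vD = D].
Proof.
have [nD LD mD] := dms.
have E1 : hexec w D LABREAD (h0 b) = setv (setv (setv (h0 b) vN n) vM m) vO (n + m).
  have i0 : ha (h0 b) 0 0 0 = n by apply: start_in; apply: ltD; rewrite /=; lia.
  have i1 : ha (h0 b) 0 0 1 = m by apply: start_in; apply: ltD; rewrite /= -/m; lia.
  move: (h0 b) i0 i1 => h i0 i1.
  rewrite /LABREAD /= (sm (k := 0) isT) (sm (k := 1) isT) i0 i1 addE //; by apply: ltD; lia.
rewrite /LABPRE hexecS E1; set h1 := setv _ _ _.
have c1 : consts_at w L p0 (hexec w D (CONSTS p0) h1).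
  by apply: (consts_exec w10 D0 Dw bigD L0 pp0 nL).
by split; rewrite ?frame_v.
Qed.

(** The empty tape serves as a representative of all tapes, by [hexec_sett]. *)
Let hP := hexec w D (LABPRE p0) (h0 [::]).
Let hF := hexec w D FORESTRUN hP.
Let frF : same_off (wv FORESTRUN) (wa FORESTRUN) hP hF := hexec_frame w D FORESTRUN hP.

Definition cutA i : 'I_n := insubd x0 (ha hF aA i 0).
Definition cutB i : 'I_n := insubd x0 (ha hF aB i 0).

Let haP A : ha hP A = ha (h0 [::]) A.
Proof. by rewrite /hP frame_a. Qed.

Lemma forest_exec : exists (s : ufs) (g : {perm 'I_n}) (o : seq 'I_n) (sn : forall x : 'I_n, s.1 x < n),
  [/\ lay eu ev m cutA cutB s g, order_at s g n o, forall x : 'I_n, s.1 (s.1 x) = s.1 x,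
      forall x : 'I_n, ha hF aPOS x 0 = posf o x /\ ha hF aST x 0 = stf o sn x
    & forall i, i < m -> ha hF aA i 0 = cutA i /\ ha hF aB i 0 = cutB i].
Proof.
have [nD LD mD] := dms; have [c1 N1 M1 O1 D1] := labpre_exec [::]; rewrite -/hP in c1 N1 M1 O1 D1.
have en : ends_at m eu ev hP by rewrite /ends_at haP; exact: start_ends.
have zP x : ha hP aPAR x 0 = 0 by rewrite haP; apply: start_zero.
have zS x : ha hP aSZ x 0 = 0 by rewrite haP; apply: start_zero.
have [s [g [uf nx ly]]] := edges_exec w10 D0 Dw nD nL LD mD (c1 vL isT) N1 M1 en zP zS.
set h2 := hexec w D (INITNX ;; EDGES) hP in uf nx ly.
have N2 : hv h2 vN = n by rewrite /h2 frame_v.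
have hFE : hF = hexec w D WALK h2 by [].
have [o od pl] := walk_exec w10 D0 Dw nD nL LD mD (lay_orb ly) (lay_next ly) (And3 uf nx N2).
rewrite -hFE in pl.
have aA2 : ha hF aA = ha h2 aA by rewrite hFE frame_a.
have aB2 : ha hF aB = ha h2 aB by rewrite hFE frame_a.
have cE i : i < m -> ha hF aA i 0 = cutA i /\ ha hF aB i 0 = cutB i.
  move=> im; have [[u v] /= [eu' ev'] _] := lay_cut ly im.
  by rewrite /cutA /cutB aA2 aB2 eu' ev' !valKd.
have [ok _] := uf.
have sn (x : 'I_n) : s.1 x < n by apply: (uf_lt ok).
exists s, g, o, sn; split=> //.
- apply: lay_ext ly => i im; have [] := cE i im; rewrite ?aA2 ?aB2 => h1 h2'; first exact: h1.
  exact: h2'.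
- by move=> x; apply: (uf_root ok (sn x)); apply: (uf_rep ok).
move=> x; have xo : x \in o by rewrite (ord_mem od) sn.
have [p1 [y sy [_ p2]]] := pl.2 x xo; rewrite p1 p2; split=> //.
by rewrite /stf; congr index; apply: val_inj; rewrite /= sy.
Qed.

(** The syntactic bound covers everything but [WALK], whose nested loops would be charged too
    much. *)
Lemma lab_cost r : hcost w D (LAB p0) (h0 r) <= labC a p0 * (n + m) * L ^ labK.
Proof.
have [nD LD mD] := dms; have [c1 N1 M1 O1 D1] := labpre_exec r.
have nm : 0 < n + m by lia.
have c0 : hcost w D (LABPRE p0) (h0 r) <= bcoef (kc a p0) (LABPRE p0).
  have := @hcost_le_bound w D (n + m) L nm L0 (kc a p0) kd kk (wv (LABPRE p0)) (LABPRE p0) (h0 r).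
  by rewrite -[bdeg kd _]/0 -[bdeg kk _]/0 !expn0 !muln1; apply.
rewrite /LAB hcostS hcostS hexecS; set h1 := hexec w D (LABPRE p0) (h0 r) in c1 N1 M1 O1 D1 *.
have a1 A : ha h1 A = ha (h0 r) A by rewrite /h1 frame_a.
clearbody h1.
have en : ends_at m eu ev h1 by rewrite /ends_at a1; exact: start_ends.
have zP x : ha h1 aPAR x 0 = 0 by rewrite a1; apply: start_zero.
have zS x : ha h1 aSZ x 0 = 0 by rewrite a1; apply: start_zero.
have [s [g [uf nx ly]]] := edges_exec w10 D0 Dw nD nL LD mD (c1 vL isT) N1 M1 en zP zS.
rewrite {1}/FORESTRUN hcostS.
have k1 : hcost w D (INITNX ;; EDGES) h1 <= bcoef (kc a p0) (INITNX ;; EDGES) *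
   ((n + m) * L ^ bdeg kk (INITNX ;; EDGES)).
  (* The degree in n + m evaluates to 1: no loop over vertices or edges is nested in another. *)
  rewrite -[X in _ * (X * _)]expn1 -[1 in X in _ <= X]/(bdeg kd (INITNX ;; EDGES)).
  apply: (@run_cost w D L p0 a (n + m)) => // y.
  have : all (fun y => (y \in cvars) || (y \in [:: vN; vM; vO])) (lims (INITNX ;; EDGES)) by [].
  move/allP=> ally /ally /orP[->//|yv]; rewrite yv /=; apply/orP; right.
  by move: yv; rewrite !inE => /or3P[]/eqP->; rewrite ?N1 ?M1 ?O1 ?leq_addr ?leq_addl.
have N2 : hv (hexec w D (INITNX ;; EDGES) h1) vN = n by rewrite frame_v.
have k2 := walk_cost w10 D0 Dw nD nL LD mD uf N2.
have fr := hexec_frame w D FORESTRUN h1; set h3 := hexec w D FORESTRUN h1 in fr *; clearbody h3.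
have [fv _] := fr; have c3 : consts_at w L p0 h3 := consts_fr fr isT c1.
have k3 : hcost w D LABTAIL h3 <= bcoef (kc a p0) LABTAIL * ((n + m) * L ^ bdeg kk LABTAIL).
  rewrite -[X in _ * (X * _)]expn1 -[1 in X in _ <= X]/(bdeg kd LABTAIL).
  apply: (@run_cost w D L p0 a (n + m)) => // y.
  have : all (fun y => (y \in cvars) || (y \in [:: vN; vM; vO])) (lims LABTAIL) by [].
  move/allP=> ally /ally /orP[->//|yv]; rewrite yv /=; apply/orP; right.
  by move: yv; rewrite !inE => /or3P[]/eqP->;
    rewrite ?(fv vN isT) ?(fv vM isT) ?(fv vO isT) ?N1 ?M1 ?O1 ?leq_addr ?leq_addl.
have g1 : L ^ bdeg kk (INITNX ;; EDGES) <= L ^ labK by apply: leq_pexp2l; rewrite // leq_addr.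
have g2 : L ^ bdeg kk LABTAIL <= L ^ labK by apply: leq_pexp2l; rewrite // leq_addl.
have g3 : 0 < L ^ labK by rewrite expn_gt0 L0.
have k1' := leq_trans k1 (leq_mul (leqnn _) (leq_mul (leqnn (n + m)) g1)).
have k3' := leq_trans k3 (leq_mul (leqnn _) (leq_mul (leqnn (n + m)) g2)).
have nX : n + m <= (n + m) * L ^ labK by rewrite leq_pmulr.
have k2' : hcost w D WALK (hexec w D (INITNX ;; EDGES) h1) <= 408 * ((n + m) * L ^ labK) by lia.
have c0' : hcost w D (LABPRE p0) (h0 r) <= bcoef (kc a p0) (LABPRE p0) * ((n + m) * L ^ labK).
  by apply: leq_trans c0 _; rewrite leq_pmulr // (leq_trans nm).
rewrite -mulnA; move: ((n + m) * L ^ labK) k1' k2' k3' c0' => Y k1' k2' k3' c0'.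
rewrite /labC; set B0 := bcoef _ (LABPRE p0) in c0' *; set B1 := bcoef _ (INITNX ;; EDGES) in k1' *.
set B2 := bcoef _ LABTAIL in k3' *; clearbody B0 B1 B2.
have -> : (B0 + B1 + 408 + B2) * Y = B0 * Y + (B1 * Y + 408 * Y) + B2 * Y by rewrite 3!mulnDl !addnA.
exact: leq_add (leq_add c0' (leq_add k1' k2')) k3'.
Qed.

Section Labels.
Variables (s : ufs) (g : {perm 'I_n}) (o : seq 'I_n) (sn : forall x : 'I_n, s.1 x < n).
Hypotheses (ly : lay eu ev m cutA cutB s g) (od : order_at s g n o).
Hypothesis ss : forall x : 'I_n, s.1 (s.1 x) = s.1 x.
Hypothesis hpos : forall x : 'I_n, ha hF aPOS x 0 = posf o x /\ ha hF aST x 0 = stf o sn x.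
Hypothesis hcut : forall i, i < m -> ha hF aA i 0 = cutA i /\ ha hF aB i 0 = cutB i.
Let pos := posf o.
Let st := stf o sn.
Let pos_lt x : pos x < n. Proof. exact: (posf_lt od sn). Qed.
Let st_lt x : st x < n. Proof. exact: (stf_lt od). Qed.
Let PS r := psum m L w eu ev pos r.
Let SE r := ske w L m eu ev r pos.
Let ew r := eword L p0 eu ev pos st cutA cutB (PS r) (SE r).

Let nw x : x < n -> x < 2 ^ w.
Proof. by move=> xn; apply: ltD; have [] := dms; lia. Qed.

Lemma labske_lt r i k : SE r i k < 2 ^ w.
Proof. exact: (ske_lt w10 D0 Dw bigD L0 pp0 nL). Qed.

Lemma psum_lt r p k : PS r p k < 2 ^ w.
Proof.
apply: big_lxor_lt => p' _; apply: big_lxor_lt => i _.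
by apply: bmul_lt; apply: labske_lt.
Qed.

Lemma eword_lt r i j : ew r i j < 2 ^ w.
Proof.
rewrite /ew /eword; case: j => [|[|[|[|[|j]]]]]; try by apply: nw.
by case: (_ %/ _) => [|[|[|q]]]; [exact: psum_lt | exact: psum_lt | exact: psum_lt | exact: labske_lt].
Qed.

Lemma vword_lt (x : 'I_n) j : vword pos st x j < 2 ^ w.
Proof.
rewrite /vword; case: ifP => _; first exact: nw.
by case: ifP => _; [apply: nw | rewrite expn_gt0].
Qed.

Definition labw r i j : nat := if insub i is Some x then vword pos st x j else ew r (i - n) j.

Lemma lab_exec r : let h := hexec w D (LAB p0) (h0 r) in
  (exists2 lb, forall i j, i < n + m -> j < NF -> lb i j = labw r i j &
     forall x, x < (n + m) * LEN.+1 -> ha h aOUT 0 x = ocell w L p0 lb x) /\ hv h 0 = D * D.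
Proof.
have [c1 N1 M1 O1 D1] := labpre_exec [::]; rewrite -/hP in c1 N1 M1 O1 D1.
rewrite /LAB hexecS hexecS -[h0 r]/(sett (h0 [::]) r) hexec_sett // hexec_sett // -/hP -/hF.
set h := sett hF r.
have [frv fra] := frF.
have cF : consts_at w L p0 h := consts_fr frF isT c1.
have NF' : hv h vN = n by rewrite -N1; apply: (frv vN isT).
have MF : hv h vM = m by rewrite -M1; apply: (frv vM isT).
have OF : hv h vO = n + m by rewrite -O1; apply: (frv vO isT).
have DF : hv h vD = D by rewrite -D1; apply: (frv vD isT).
have z A : 0 < A -> A \notin wa FORESTRUN -> forall i j, ha h A i j = 0.
  by move=> A0 An i j; rewrite -[ha h]/(ha hF) (fra A An) haP; apply: start_zero.
have enF : ends_at m eu ev h.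
  by rewrite /ends_at -[ha h]/(ha hF) (fra aIN isT) haP; exact: start_ends.
have posF (x : 'I_n) : ha h aPOS x 0 = pos x by exact: (hpos x).1.
have stF (x : 'I_n) : ha h aST x 0 = st x by exact: (hpos x).2.
have cutF i : i < m -> ha h aA i 0 = cutA i /\ ha h aB i 0 = cutB i by exact: hcut.
have nuv i : i < m -> pos (eu i) != pos (ev i).
  by move=> im; rewrite (inj_eq (posf_inj x0 od sn)); apply: (ends_neq x0 esym eirr eE).
have rF : ht h = r by [].
clearbody h.
have z10 : forall i j, ha h aSK i j = 0 by apply: z.
have z11 : forall i j, ha h aSE i j = 0 by apply: z.
have z12 : forall i j, ha h aPS i j = 0 by apply: z.
have z13 : forall i j, ha h aLB i j = 0 by apply: z.
have sk := sketch_exec w10 D0 Dw bigD L0 pp0 nL pos_lt cF MF nuv rF posF enF z10 z11.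
have [k1 k2] := sketch_final w10 D0 Dw bigD L0 pp0 nL sk.
rewrite /LABTAIL hexecS.
have fr1 := hexec_frame w D SKETCH h; set t1 := hexec w D SKETCH h in sk k1 k2 fr1 *; clearbody t1.
have [fv1 fa1] := fr1; have ct1 : consts_at w L p0 t1 := consts_fr fr1 isT cF.
have N1' : hv t1 vN = n by rewrite (fv1 vN isT).
have skl p k : p < n -> k < SZ -> ha t1 aSK p k < 2 ^ w.
  move=> pn kS; rewrite k2 //; apply: big_lxor_lt => i _; apply: bmul_lt; exact: labske_lt.
have z12' : forall i j, ha t1 aPS i j = 0 by move=> i j; rewrite (fa1 aPS isT).
have pf := prefix_exec w10 D0 Dw bigD L0 pp0 nL ct1 N1' skl z12'.
rewrite hexecS.
have fr2 := hexec_frame w D PREFIX t1; set t2 := hexec w D PREFIX t1 in pf fr2 *; clearbody t2.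
have [fv2 fa2] := fr2; have ct2 : consts_at w L p0 t2 := consts_fr fr2 isT ct1.
have N2 : hv t2 vN = n by rewrite (fv2 vN isT).
have li2 : lab_inv L m p0 eu ev pos st cutA cutB (PS r) (SE r) t2.
  split.
  - by move=> x; rewrite (fa2 aPOS isT) (fa1 aPOS isT) (fa2 aST isT) (fa1 aST isT).
  - by move=> i im; rewrite (fa2 aA isT) (fa1 aA isT) (fa2 aB isT) (fa1 aB isT); apply: cutF.
  - move=> p k pn kS; rewrite pf //; apply: eq_bigr => p' _; rewrite k2 //.
    exact: leq_trans (ltn_ord p') pn.
  - by move=> i k im kS; rewrite (fa2 aSE isT) k1.
  - by rewrite /ends_at (fa2 aIN isT) (fa1 aIN isT).
have z13' : forall i j, ha t2 aLB i j = 0 by move=> i j; rewrite (fa2 aLB isT) (fa1 aLB isT).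
have vl := vlab_exec w10 D0 Dw bigD L0 pp0 nL N2 li2 z13'.
rewrite hexecS.
have fr3 := hexec_frame w D VLAB t2; set t3 := hexec w D VLAB t2 in vl fr3 *; clearbody t3.
have [fv3 fa3] := fr3; have ct3 : consts_at w L p0 t3 := consts_fr fr3 isT ct2.
have N3 : hv t3 vN = n by rewrite (fv3 vN isT).
have M3 : hv t3 vM = m by rewrite (fv3 vM isT) (fv2 vM isT) (fv1 vM isT).
have li3 : lab_inv L m p0 eu ev pos st cutA cutB (PS r) (SE r) t3.
  apply: lab_inv_ext li2 => A; rewrite !inE => AA; apply: fa3.
  by do 6![case/orP: AA => [/eqP-> //|AA]]; rewrite (eqP AA).
have z3 i j : n <= i -> j < NF -> ha t3 aLB i j = 0.
  by move=> ni _; rewrite vl; case: insubP => // x; rewrite ltnNge ni.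
have el := elab_exec w10 D0 Dw bigD L0 pp0 nL pos_lt st_lt ct3 N3 M3 li3 z3.
rewrite hexecS.
have fr4 := hexec_frame w D ELAB t3; set t4 := hexec w D ELAB t3 in el fr4 *; clearbody t4.
have [fv4 fa4] := fr4; have ct4 : consts_at w L p0 t4 := consts_fr fr4 isT ct3.
have O4 : hv t4 vO = n + m by rewrite (fv4 vO isT) (fv3 vO isT) (fv2 vO isT) (fv1 vO isT).
have D4 : hv t4 vD = D by rewrite (fv4 vD isT) (fv3 vD isT) (fv2 vD isT) (fv1 vD isT).
have lbE i j : i < n + m -> j < NF -> ha t4 aLB i j = labw r i j.
  move=> im jN; rewrite el // im andbT /labw vl; case: insubP => [x xi _|ni].
    by rewrite leqNgt xi.
  by rewrite leqNgt ni.
have lbw i j : i < n + m -> j < NF -> ha t4 aLB i j < 2 ^ w.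
  move=> im jN; rewrite lbE // /labw; case: insub => [x|]; first exact: vword_lt.
  exact: eword_lt.
have [ot D5] := output_exec w10 D0 Dw bigD L0 pp0 nL ct4 O4 D4 lbw.
by split=> //; exists (ha t4 aLB).
Qed.

Definition labels r : labeling n := Labeling
  (fun v => mkseq (fun t => Nat.testbit (vword pos st v (t %/ w)) (t %% w)) LEN)
  (fun x => mkseq (fun t => Nat.testbit
              (ew r (index x (map (@edge_of n) E)) (t %/ w)) (t %% w)) LEN).

Lemma lab_computes (r : seq bool) T : hcost w D (LAB p0) (h0 r) <= size r ->
  10 * w + 16 + hcost w D (LAB p0) (h0 r) <= T ->
  computes_labeling w (Seq (prelude a d) (comp (LAB p0))) E f r T (labels r).
Proof.
move=> cr cT.
have wfL : wf (LAB p0) by [].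
have [st0 hw [vs _ _ _ mem]] := run_program L0 da (input := input) wfL (introT orP (or_intror cr)) cT.
have [[lb lbE oc] v0] := lab_exec r.
exists st0 => //; rewrite vs v0.
have memE x : x < (n + m) * LEN.+1 -> memory st0 (D * D + x) = ocell w L p0 lb x.
  move=> xl; have xD : x < D.
    have : (n + m) * LEN.+1 <= (n + m + 4) * (NF * w + 4) by apply: leq_mul; rewrite /LEN; lia.
    by lia.
  have := mem 1 0 x isT D0 xD; rewrite mul1n addn0 => ->; exact: oc.
have := @read_output w D L n m p0 w10 D0 Dw bigD L0 pp0 nL (memory st0) (D * D) lb (n + m) 0 (n + m)
  memE (leqnn _).
rewrite mul0n addn0 -/m => ->.
have key i : i < n + m -> nth [::] [seq mkseq (fun t => Nat.testbit (lb i (t %/ w)) (t %% w)) LEN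
   | i <- iota 0 (n + m)] i = mkseq (fun t => Nat.testbit (labw r i (t %/ w)) (t %% w)) LEN.
  move=> im; rewrite (nth_map 0) ?size_iota // nth_iota // add0n.
  apply/eq_in_map => t; rewrite mem_iota add0n => /andP[_ tL]; rewrite lbE // ltn_divLR //.
  by apply: leq_trans w10.
split=> [v|x xE].
  rewrite key; last by have := ltn_ord v; lia.
  by rewrite /= /labw insubT //= => vn; congr mkseq;
     rewrite (_ : Sub _ vn = v) //; apply: val_inj.
have xm : index x (map (@edge_of n) E) < m by rewrite /m -(size_map (@edge_of n) E) index_mem.
rewrite key; last by rewrite ltn_add2l.
by rewrite /= /labw insubF ?addKn //; lia.
Qed.

(** * A fixed query *)

Section Query.
Variables (F : seq {set 'I_n}) (x1 x2 : 'I_n).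
Hypotheses (uF : uniq F) (sF : {subset F <= edge_set e}).
Let Fl := faults E F.
Let NO := (size F).+2.
Let X r := qword m L p0 w eu ev pos st cutA cutB r Fl x1 x2.
Let C := cuts (X [::]) (NO * 3).
Let Q1 := cutq1 m L p0 w eu ev pos st cutA cutB [::] Fl x1 x2.
Let Q2 := cutq2 m L p0 w eu ev pos st cutA cutB [::] Fl x1 x2.
Let Q := [seq Q1 t | t <- iota 0 (NO * 4)].
Let pu i := pos (eu i).
Let pv i := pos (ev i).
Let Fp : pred nat := fun i => i \in Fl.
Let Con := pcon m eu ev o x0 Fl.
Definition okrun (r : seq bool) : bool := okp n m w J pu pv Fp C Q r (p0 * L) &&
  (nunf n m pu pv Fp C (proc m w J pu pv Fp C Q r (p0 * L)).1 == 0).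

Let Flu : uniq Fl := faults_uniq eE uF sF.
Let Flm : {in Fl, forall k, k < m} := faults_lt eE sF.
Let szF : size Fl = size F. Proof. by rewrite size_map. Qed.
Let NOE : NO = (size Fl).+2. Proof. by rewrite szF. Qed.

(** The first five words of a label hold positions only. Cut points and queried positions are thus
    independent of the coins, as the probability analysis requires of [C] and [Q]. *)
Let Xr r i q : q < 5 -> X r i q = X [::] i q.
Proof. by case: i => [|[|i]] //; case: q => [|[|[|[|[|q]]]]]. Qed.

Let clfE r t : clf (X r) t = clf (X [::]) t.
Proof. by apply: Xr; have := ltn_pmod t (isT : 0 < 3); lia. Qed.

Let cutsE r t : cuts (X r) t = cuts (X [::]) t.
Proof. by elim: t => //= t ->; rewrite clfE. Qed.

Let newE r t : newcut (X r) t = newcut (X [::]) t.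
Proof. by rewrite /newcut cutsE clfE. Qed.

Let XnF r i q : i < NO -> q < 5 -> X r i q < n.
Proof. by move=> iN q5; eapply qword_lt; eassumption. Qed.

Let XwF r i j : i < NO -> j < NF -> X r i j < 2 ^ w.
Proof.
by case: i => [|[|i]] _ _; [exact: vword_lt | exact: vword_lt | exact: eword_lt].
Qed.

Let NOm : NO <= m + 2.
Proof.
rewrite /NO addn2 !ltnS -szF -(size_iota 0 m); apply: uniq_leq_size => // k /Flm km.
by rewrite mem_iota.
Qed.

Let C0 : 0 \in C := cuts0 _ _.
Let Cn : {in C, forall c, c < n}.
Proof. exact: (cuts_lt w10 D0 Dw bigD L0 pp0 nL n0 NOm (XnF [::]) (leqnn _)). Qed.

Let new_lt t : t < NO * 3 -> newcut (X [::]) t < n.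
Proof.
move=> tN; rewrite /newcut; case: ifP => // _.
exact: (clf_lt w10 D0 Dw bigD L0 pp0 nL n0 NOm (XnF [::])).
Qed.

Let t43 t : t < NO * 4 -> t %% 4 == 3 = false -> t %/ 4 * 3 + t %% 4 < NO * 3.
Proof.
move=> tN t3; have t4 := ltn_pmod t (isT : 0 < 4).
have : t %/ 4 < NO by rewrite ltn_divLR.
by lia.
Qed.

Let Q1n t : t < NO * 4 -> Q1 t < n.
Proof.
move=> tN; rewrite /Q1 /cutq1; case: ifP => t3; last exact: new_lt (t43 tN t3).
by apply: (XnF [::]); rewrite ?ltn_divLR.
Qed.

Let Q2n t : t < NO * 4 -> Q2 t < n.
Proof.
move=> tN; rewrite /Q2 /cutq2; case: ifP => t3.
  by apply: (XnF [::]); rewrite ?ltn_divLR.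
exact: leq_ltn_trans (leq_pred _) (new_lt (t43 tN t3)).
Qed.

(** Class representatives are cut points, so every class is asked for a candidate edge. *)
Let CQ : {subset C <= Q}.
Proof.
have H K : K <= NO * 3 -> {subset cuts (X [::]) K <= Q}.
  elim: K => [_ c|K IH KN c].
    rewrite inE => /eqP->; apply/mapP; exists 0; first by rewrite mem_iota.
    by [].
  rewrite /= inE => /predU1P[->|]; last by apply: IH; apply: ltnW.
  have [cK|cK] := boolP (clf (X [::]) K \in cuts (X [::]) K).
    by apply: IH cK; apply: ltnW.
  have K3 := ltn_pmod K (isT : 0 < 3); have q4 : K %% 3 < 4 := leqW K3.
  apply/mapP; exists (K %/ 3 * 4 + K %% 3).
    have : K %/ 3 < NO by rewrite ltn_divLR.
    by rewrite mem_iota; lia.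
  rewrite /Q1 /cutq1 divnMDl // (divn_small q4) addn0 modnMDl (modn_small q4).
  have -> : (K %% 3 == 3) = false by lia.
  by rewrite -divn_eq /newcut -/(X [::]) (negbTE cK).
exact: H.
Qed.

Let Qn : {in Q, forall q, q < n}.
Proof. by move=> q /mapP[t]; rewrite mem_iota => tN ->; apply: Q1n. Qed.

Let cuts_mem K t : t < K -> clf (X [::]) t \in cuts (X [::]) K.
Proof.
elim: K => // K IH; rewrite ltnS leq_eqVlt inE => /predU1P[->|/IH ->]; rewrite ?eqxx ?orbT //.
Qed.

Let CF i : i \in Fl -> [/\ st (eu i) \in C, pos (cutA i) \in C & pos (cutB i) \in C].
Proof.
move=> iF; set k := index i Fl.
have kF : k < size Fl by rewrite index_mem.
have H q : q < 3 -> X [::] k.+2 (2 + q) \in C.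
  move=> q3; have -> : X [::] k.+2 (2 + q) = clf (X [::]) (k.+2 * 3 + q).
    by rewrite /clf divnMDl // divn_small // addn0 modnMDl modn_small.
  by apply: cuts_mem; rewrite NOE; lia.
have E1 q : X [::] k.+2 q = ew [::] i q by rewrite /X /qword nth_index.
by split; [have := H 0 isT | have := H 1 isT | have := H 2 isT]; rewrite E1.
Qed.

Let FC c : c \in C -> c = 0 \/
  exists2 i, i \in Fl & [\/ c = st (eu i), c = pos (cutA i) | c = pos (cutB i)].
Proof.
have H K : K <= NO * 3 -> c \in cuts (X [::]) K -> c = 0 \/
    exists2 i, i \in Fl & [\/ c = st (eu i), c = pos (cutA i) | c = pos (cutB i)].
  elim: K => [_|K IH KN]; first by rewrite inE => /eqP; left.
  rewrite /= inE => /predU1P[->|]; last by apply: IH; apply: ltnW.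
  have K3 := ltn_pmod K (isT : 0 < 3).
  have kN : K %/ 3 < NO by rewrite ltn_divLR.
  rewrite /clf; case: (K %/ 3) kN => [|[|k]] kN.
  - by left; case: (K %% 3) K3 => [|[|[|]]].
  - by left; case: (K %% 3) K3 => [|[|[|]]].
  right; exists (nth 0 Fl k); first by apply: mem_nth; move: kN; rewrite NOE.
  by case: (K %% 3) K3 => [|[|[|]]] // _; [constructor 1 | constructor 2 | constructor 3].
exact: H.
Qed.

Let Ccross i : i < m -> ~~ Fp i -> loc C (pu i) != loc C (pv i) -> Con (loc C (pu i)) (loc C (pv i)).
Proof. by move=> im iF ne; exact: (pcon_cross ly x0 od (sn := sn) ss Flm C0 CF FC im iF ne). Qed.

Lemma fault_card T : p0 * L * m * rbits w J <= T -> m < 2 ^ J.-2 ->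
  16 ^ (p0 * L) * 4 ^ w * #|[pred r : T.-tuple bool | ~~ okrun r]| <=
  (15 ^ (p0 * L) * 4 ^ w * n + 16 ^ (p0 * L) * 3 ^ w * (p0 * L * n * J * m * m)) * 2 ^ T.
Proof.
move=> TP mJ; rewrite /okrun.
have puv i : i < m -> pu i != pv i.
  by move=> im; rewrite /pu /pv (inj_eq (posf_inj x0 od sn)); apply: (ends_neq x0 esym eirr eE).
exact: (failure_card TP mJ (pcon_refl m eu ev o x0 Fl) (pcon_sym m eu ev o x0 Fl)
  (@pcon_trans n m eu ev o x0 Fl) C0 Cn CQ Qn puv Ccross).
Qed.

Let qin r := query_input (labels r) x1 x2 F.
Let hq r := start a d L (qin r) [::].

Let lsz r i : i < NO ->
  size (nth [::] [:: vlabel (labels r) x1, vlabel (labels r) x2 & map (elabel (labels r)) F] i) = LEN.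
Proof.
case: i => [|[|i]] iN /=; rewrite ?size_mkseq // (nth_map set0) ?size_mkseq //.
Qed.

Let ls_nth r i t : i < NO -> t < LEN ->
  nth false (nth [::] [:: vlabel (labels r) x1, vlabel (labels r) x2 & map (elabel (labels r)) F] i) t =
  Nat.testbit (X r i (t %/ w)) (t %% w).
Proof.
case: i => [|[|i]] iN tL /=; rewrite ?nth_mkseq // (nth_map set0) // nth_mkseq //.
by rewrite /X /qword /Fl /faults (nth_map set0).
Qed.

Let write_size (ls : seq (seq bool)) K : (forall i, i < size ls -> size (nth [::] ls i) = K) ->
  size (write_strings ls) = size ls * K.+1.
Proof.
elim: ls => // l ls IH sz.
have -> : write_strings (l :: ls) = (size l :: map nat_of_bool l) ++ write_strings ls by [].
by rewrite size_cat /= size_map (sz 0 isT) IH ?mulSn // => i il; exact: (sz i.+1 il).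
Qed.

Let szq r : size (qin r) <= D.
Proof.
have Sz : size [:: vlabel (labels r) x1, vlabel (labels r) x2 & map (elabel (labels r)) F] = NO.
  by rewrite /= size_map.
rewrite /qin /query_input; set ls := [:: _, _ & _] in Sz *;
rewrite -[X in X <= _]/(size (write_strings ls)).+1 (@write_size ls LEN) ?Sz.
  have : NO * LEN.+1 <= (n + m + 4) * (NF * w + 4) by apply: leq_mul; rewrite /LEN; have := NOm; lia.
  by lia.
by move=> i iN; apply: lsz.
Qed.

Let query_input_at r h : ha h aIN = ha (hq r) aIN -> input_at w L p0 NO (X r) h.
Proof.
move=> hE i t iN tL; rewrite hE.
have Sz : size [:: vlabel (labels r) x1, vlabel (labels r) x2 & map (elabel (labels r)) F] = NO.
  by rewrite /= size_map.
have E1 : nth 0 (qin r) (1 + (i * LEN.+1 + t.+1)) = Nat.testbit (X r i (t %/ w)) (t %% w).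
  have -> : nth 0 (qin r) (1 + (i * LEN.+1 + t.+1)) = nth 0 (write_strings
     [:: vlabel (labels r) x1, vlabel (labels r) x2 & map (elabel (labels r)) F]) (i * LEN.+1 + t.+1) by [].
  rewrite (@nth_write_strings _ LEN) ?ls_nth ?Sz // => k; exact: lsz.
by rewrite start_in E1 //; apply: bool_lt_pow; apply: leq_trans w10.
Qed.

Lemma decpre_exec r : let h := hexec w D (DECPRE p0) (hq r) in
  [/\ consts_at w L p0 h, hv h vN = NO & forall A, ha h A = ha (hq r) A].
Proof.
have [nD LD mD] := dms.
have E1 : hexec w D (HAsg vN (HB Add (HA aIN (HC 0) (HC 0)) (HC 2))) (hq r) = setv (hq r) vN NO.
  have sF' : size F < 2 ^ w by apply: ltD; have := NOm; rewrite /NO; lia.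
  have i0 : ha (hq r) 0 0 0 = size F by apply: start_in.
  move: (hq r) i0 => h i0.
  rewrite /= (sm (k := 0) isT) i0 small // addE ?addn2 //.
  by apply: ltD; have := NOm; rewrite /NO; lia.
rewrite /DECPRE hexecS E1; set h1 := setv _ _ _.
have c1 : consts_at w L p0 (hexec w D (CONSTS p0) h1).
  by apply: (consts_exec w10 D0 Dw bigD L0 pp0 nL).
by split=> // [|A]; rewrite ?frame_v ?frame_a.
Qed.

Lemma dec_exec r : okp n m w J pu pv Fp C Q r (p0 * L) ->
  hv (hexec w D (DEC p0) (hq r)) 0 =
  (((proc m w J pu pv Fp C Q r (p0 * L)).1 (loc C (pos x1)) ==
    (proc m w J pu pv Fp C Q r (p0 * L)).1 (loc C (pos x2))) && (st x1 == st x2)).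
Proof.
move=> ok; have [c1 N1 aE] := decpre_exec r.
rewrite /DEC hexecS; set h1 := hexec w D (DECPRE p0) (hq r) in c1 N1 aE *; clearbody h1.
have z A : 0 < A -> forall i j, ha h1 A i j = 0 by move=> A0 i j; rewrite aE; apply: start_zero => //; apply: szq.
have in1 := query_input_at (aE aIN).
have w1 := parse_exec w10 D0 Dw bigD L0 pp0 nL n0 NOm (XwF r) c1 N1 in1.
rewrite /DECMAIN hexecS.
have fr1 := hexec_frame w D PARSE h1; set t1 := hexec w D PARSE h1 in w1 fr1 *; clearbody t1.
have [fv1 fa1] := fr1; have ct1 : consts_at w L p0 t1 := consts_fr fr1 isT c1.
have Nt1 : hv t1 vN = NO by rewrite (fv1 vN isT).
have ci0 : cut_inv L n (X r) 0 t1.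
  split=> [c cn|k b kL bn|i q q3].
  - by rewrite (fa1 aMK isT) z // inE andNb.
  - by rewrite (fa1 aFW isT) z // -[cuts _ 0]/[:: 0] big_cons big_nil; case: ifP.
  - by rewrite (fa1 aQ1 isT) (fa1 aQ2 isT) !z.
have ci := cutset_exec w10 D0 Dw bigD L0 pp0 nL n0 NOm (XnF r) ct1 Nt1 w1 ci0.
rewrite hexecS.
have fr2 := hexec_frame w D CUTSET t1; set t2 := hexec w D CUTSET t1 in ci fr2 *; clearbody t2.
have [fv2 fa2] := fr2; have ct2 : consts_at w L p0 t2 := consts_fr fr2 isT ct1.
have Nt2 : hv t2 vN = NO by rewrite (fv2 vN isT).
have w2 : words_at L p0 NO (X r) t2 by move=> i j iN jN; rewrite (fa2 aDB isT) w1.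
have eq := endq_exec w10 D0 Dw bigD L0 pp0 nL n0 NOm ct2 Nt2 w2.
rewrite hexecS.
have fr3 := hexec_frame w D ENDQ t2; set t3 := hexec w D ENDQ t2 in eq fr3 *; clearbody t3.
have [fv3 fa3] := fr3; have ct3 : consts_at w L p0 t3 := consts_fr fr3 isT ct2.
case: ci => _ fw qq.
have qa : query_at w L n p0 NO (X r) C Q1 Q2 t3.
  split=> //.
  - by rewrite (fv3 vN isT).
  - by move=> i j iN jN; rewrite (fa3 aDB isT) w2.
  - by move=> k b kL bn; rewrite (fa3 aFW isT) fw // cutsE.
  move=> i q iN q4; have [-> ->] := eq i q; rewrite iN andbT.
  have [d1 d2] : (i * 4 + q) %/ 4 = i /\ (i * 4 + q) %% 4 = q.
    by rewrite divnMDl // divn_small // addn0 modnMDl modn_small.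
  rewrite /Q1 /Q2 /cutq1 /cutq2 d1 d2; case: (q =P 3) => [_|nq].
    by rewrite -/(X [::]) -!(Xr r).
  have q3 : q < 3 by lia.
  have [-> ->] := qq i q q3; have -> : i * 3 + q < NO * 3 by lia.
  by rewrite -/(X [::]) newE.
have pf A : A \notin wa PARSE -> A \notin wa CUTSET -> A \notin wa ENDQ -> 0 < A ->
    forall i j, ha t3 A i j = 0.
  by move=> A1 A2 A3 A0 i j; rewrite fa3 // fa2 // fa1 // z.
have uf0 : uf_at n t3 (id, fun=> 0) by apply: uf_at0 => x; apply: pf.
have zT rho col : rho < n -> col < SZ -> ha t3 aT rho col = 0 by move=> _ _; apply: pf.
have pn i : i < m -> pu i < n /\ pv i < n by move=> _; split; apply: pos_lt.
have ab rt i rho j q : i < p0 * L -> rho < n -> j < J -> q < 5 ->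
   \big[Nat.lxor/0]_(t < NO * 4) contr L p0 (X r) C Q1 Q2 rt rho t (i * (J * 5) + (j * 5 + q)) =
   tsum m w J pu pv Fp C r i rt rho j q.
  move=> iP _ jJ q5.
  have := contr_tsum w eu ev cutA cutB r x1 x2 pos_lt st_lt Flu Flm NOE rt rho iP jJ q5.
  rewrite -/(X r) cutsE -/C; move=> <-; apply: eq_bigr => t _; rewrite /contr.
  have t4 := ltn_pmod t (isT : 0 < 4).
  have [<- <-] : cutq1 m L p0 w eu ev pos st cutA cutB r Fl x1 x2 t = Q1 t /\
     cutq2 m L p0 w eu ev pos st cutA cutB r Fl x1 x2 t = Q2 t.
    rewrite /Q1 /Q2 /cutq1 /cutq2 -/(X r) -/(X [::]) newE; by case: ifP => _; rewrite ?Xr.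
  by [].
have up := phases_exec w10 D0 Dw bigD L0 pp0 nL n0 NOm (XwF r) C0 Cn Q1n Q2n pn ab qa uf0 zT ok.
rewrite hexecS.
have fr4 := hexec_frame w D PHASES t3; set t4 := hexec w D PHASES t3 in up fr4 *; clearbody t4.
have qa4 : query_at w L n p0 NO (X r) C Q1 Q2 t4 := query_fr fr4 isT isT qa.
by rewrite (answer_exec w10 D0 Dw bigD L0 pp0 nL n0 NOm (XnF r) C0 Cn (isT : 1 < NO) qa4 up).
Qed.

Definition decans (r : seq bool) : bool := hv (hexec w D (DEC p0) (hq r)) 0 != 0.

(** Validity of the classes gives one direction, absence of unfinished classes the other; both feed
    [connected_iff]. *)
Lemma dec_correct r : okrun r -> decans r = connect (delete_edges e F) x1 x2.
Proof.
rewrite /okrun /decans; case/andP=> ok /eqP nf; rewrite dec_exec // (eq_connect (delete_drel x0 esym eE sF)).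
set rt := (proc _ _ _ _ _ _ _ _ _ _).1.
have Cs := pcon_sym m eu ev o x0 Fl; have Ct := @pcon_trans n m eu ev o x0 Fl.
have [_ vl] := proc_valid (Con := Con) (pcon_refl m eu ev o x0 Fl) Cs Ct C0 Qn Ccross ok.
have fin i : i < m -> i \notin Fl -> rt (loc C (pos (eu i))) = rt (loc C (pos (ev i))).
  by move=> im iF; exact: (finished_eq (Con := Con) (pcon_refl m eu ev o x0 Fl) Cs Ct C0 Cn Qn Ccross nf ok).
have CE : (rt (loc C (pos x1)) == rt (loc C (pos x2))) && (st x1 == st x2) = connect (drel m eu ev Fl) x1 x2.
  by eapply connected_iff; eassumption.
rewrite -[connect _ _ _]/(connect (drel m eu ev Fl) x1 x2) -CE.
by case: (_ && _).
Qed.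

Lemma dec_decodes r T : 10 * w + 16 + hcost w D (DEC p0) (hq r) <= T ->
  decodes w (Seq (prelude a d) (comp (DEC p0))) (labels r) x1 x2 F T (decans r).
Proof.
move=> cT; have wfD : wf (DEC p0) by [].
have nr : norand (DEC p0) || (hcost w D (DEC p0) (hq r) <= size ([::] : seq bool)) by [].
have [st0 hw [vs _ _ _ _]] := run_program L0 da (input := qin r) wfD nr cT.
by exists st0 => //; rewrite vs.
Qed.

Lemma dec_cost r : hcost w D (DEC p0) (hq r) <= decC a p0 * NO * L ^ decK.
Proof.
have [c1 N1 aE] := decpre_exec r.
have c0 : hcost w D (DECPRE p0) (hq r) <= bcoef (kc a p0) (DECPRE p0).
  have := @hcost_le_bound w D 1 L isT L0 (kc a p0) kd kk (wv (DECPRE p0)) (DECPRE p0) (hq r).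
  by rewrite -[bdeg kd _]/0 -[bdeg kk _]/0 !expn0 !muln1; apply.
rewrite /DEC hcostS; set h1 := hexec w D (DECPRE p0) (hq r) in c1 N1 *; clearbody h1.
have k1 : hcost w D DECMAIN h1 <= bcoef (kc a p0) DECMAIN * (NO * L ^ decK).
  rewrite -[X in _ * (X * _)]expn1 -[1 in X in _ <= X]/(bdeg kd DECMAIN).
  apply: (@run_cost w D L p0 a NO) => // y.
  have : all (fun y => (y \in cvars) || (y == vN)) (lims DECMAIN) by [].
  by move/allP=> ally /ally /orP[->//|/eqP->]; rewrite N1 leqnn orbT.
have g3 : 0 < L ^ decK by rewrite expn_gt0 L0.
apply: leq_trans (leq_add c0 k1) _; rewrite /decC -mulnA mulnDl leq_add2r leq_pmulr //.
by rewrite muln_gt0 g3.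
Qed.

End Query.
End Labels.

(** All that the choice of constants needs to know of the programs; [okr] is the success event of a
    query. *)
Lemma programs_spec : exists lab : seq bool -> labeling n,
  [/\ forall (r : seq bool) T, labC a p0 * (n + m) * L ^ labK <= size r ->
        10 * w + 16 + labC a p0 * (n + m) * L ^ labK <= T ->
        computes_labeling w (Seq (prelude a d) (comp (LAB p0))) E f r T (lab r),
      forall r v, size (vlabel (lab r) v) = LEN,
      forall r x, size (elabel (lab r) x) = LEN
    & forall F x1 x2, uniq F -> {subset F <= edge_set e} ->
      exists (okr : pred (seq bool)) (ans : seq bool -> bool),
      [/\ forall T, p0 * L * m * rbits w J <= T -> m < 2 ^ J.-2 ->
            16 ^ (p0 * L) * 4 ^ w * #|[pred r : T.-tuple bool | ~~ okr r]| <=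
            (15 ^ (p0 * L) * 4 ^ w * n + 16 ^ (p0 * L) * 3 ^ w * (p0 * L * n * J * m * m)) * 2 ^ T,
          forall r, okr r -> ans r = connect (delete_edges e F) x1 x2
        & forall r T, 10 * w + 16 + decC a p0 * (size F).+2 * L ^ decK <= T ->
            decodes w (Seq (prelude a d) (comp (DEC p0))) (lab r) x1 x2 F T (ans r)]].
Proof.
have [s [g [o [sn [ly od ss hpos hcut]]]]] := forest_exec.
exists (labels o sn); split.
- move=> r T c1 c2; eapply lab_computes; try eassumption.
    exact: leq_trans (lab_cost r) c1.
  by apply: leq_trans c2; rewrite leq_add2l; apply: lab_cost.
- by move=> r v; rewrite size_mkseq.
- by move=> r x; rewrite size_mkseq.
move=> F x1 x2 uF sF; exists (okrun o sn F x1 x2), (decans o sn F x1 x2); split.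
- by move=> T TP mJ; eapply fault_card; eassumption.
- by move=> r ok; eapply dec_correct; eassumption.
move=> r T cT; apply: dec_decodes.
by apply: leq_trans cT; rewrite leq_add2l; eapply dec_cost; eassumption.
Qed.

End Programs.
(** * Parameters and success probability *)

(** Bernoulli's inequality in the form (1 + 1/x)^x >= 2. *)
Lemma double_pow x : 0 < x -> 2 * x ^ x <= x.+1 ^ x.
Proof.
move=> x0; have B k : x ^ k * (x + k) <= x * x.+1 ^ k.
  elim: k => [|k IH]; first by rewrite !expn0 mul1n muln1 addn0.
  rewrite !expnS mulnCA; apply: leq_trans (leq_mul (leqnn x.+1) IH).
  by rewrite mulnCA -mulnA [x * (x ^ k * _)]mulnCA leq_mul2l; apply/orP; right; nia.
have := B x; have -> : x ^ x * (x + x) = x * (2 * x ^ x).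
  by rewrite addnn -mul2n mulnCA [x ^ x * x]mulnC mulnCA.
by rewrite leq_pmul2l.
Qed.

Lemma leq_exp2rW x y k : x <= y -> x ^ k <= y ^ k.
Proof. by move=> xy; elim: k => // k IH; rewrite !expnS leq_mul. Qed.

(** Used for x = 15 and x = 3: fifteen phases, respectively three bits of the test words, halve the
    corresponding failure bound. *)
Lemma halving x k : 0 < x -> 2 ^ k * x ^ (x * k) <= x.+1 ^ (x * k).
Proof. by move=> x0; rewrite !expnM -expnMn; exact: leq_exp2rW (double_pow x0). Qed.

Lemma le_pow x L : 0 < L -> x <= 2 ^ (x * L).
Proof.
move=> L0; apply: leq_trans (ltnW (ltn_expl x (isT : 1 < 2))) _.
by rewrite leq_exp2l // leq_pmulr.
Qed.

(** One array row must hold all n + m labels with their length cells. The left side is polynomial in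
    2 ^ L, so a constant multiple of L as exponent suffices. *)
Lemma params_dim (p0 q L n m : nat) : 0 < L -> n < 2 ^ L -> m < 2 ^ (2 * L) -> p0 <= q -> 20 <= q ->
  (n + m + 4) * ((5 + 4 * (p0 * L * ((2 * L + 2) * 5))) * (3 * (2 * (23 + 2 * q) + 6 + q) * L) + 4) + 10
  <= 2 ^ ((23 + 2 * q) * L).
Proof.
move=> L0 nL mL pq q20.
have x2 : 2 <= 2 ^ L by rewrite -[X in X <= _]expn1 leq_exp2l.
have yE : 2 ^ (2 * L) = 2 ^ L * 2 ^ L by rewrite mul2n -addnn expnD.
have A1 : n + m + 4 <= 2 ^ (4 * L).
  have -> : 4 * L = 2 * L + 2 * L by lia.
  rewrite expnD; move: mL; rewrite yE; move: (2 ^ L) nL x2 => x nx x2 mx.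
  have y4 : 4 <= x * x := leq_mul x2 x2.
  have xy : x <= x * x by rewrite leq_pmulr // ltnW.
  have yy : 4 * (x * x) <= x * x * (x * x) by rewrite leq_mul2r y4 orbT.
  lia.
have A2 : (5 + 4 * (p0 * L * ((2 * L + 2) * 5))) * (3 * (2 * (23 + 2 * q) + 6 + q) * L) + 4 <=
   2 ^ ((14 + 2 * q) * L).
  have h1 : 5 + 4 * (p0 * L * ((2 * L + 2) * 5)) <= 85 * (q * (L * L)).
    have l1 : p0 * L * ((2 * L + 2) * 5) <= q * L * (20 * L) by apply: leq_mul; [rewrite leq_mul2r pq orbT | lia].
    have l2 : q * L * (20 * L) = 20 * (q * (L * L)) by rewrite -!mulnA [L * (20 * _)]mulnCA [q * (20 * _)]mulnCA.
    have l3 : 1 <= q * (L * L) by rewrite !muln_gt0 L0 andbT; lia.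
    lia.
  have h2 : 3 * (2 * (23 + 2 * q) + 6 + q) * L <= 23 * q * L by rewrite leq_mul2r; apply/orP; right; lia.
  have h3 := leq_mul h1 h2.
  have l3 : 0 < q * (L * L) * (q * L) by rewrite !muln_gt0 L0 !andbT; lia.
  have h4 : 85 * (q * (L * L)) * (23 * q * L) = 1955 * (q * (L * L) * (q * L)).
    by first [lia | nia].
  have h5 : q * (L * L) * (q * L) <= 2 ^ ((2 * q + 3) * L).
    have -> : 2 ^ ((2 * q + 3) * L) = 2 ^ (q * L) * (2 ^ L * 2 ^ L) * (2 ^ (q * L) * 2 ^ L).
      by rewrite -!expnD; congr (2 ^ _); lia.
    have lL : L <= 2 ^ L by rewrite ltnW // ltn_expl.
    have qL := @le_pow q L L0.
    exact: leq_mul (leq_mul qL (leq_mul lL lL)) (leq_mul qL lL).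
  have h6 : 2048 <= 2 ^ (11 * L) by rewrite -[2048]/(2 ^ 11) leq_exp2l // leq_pmulr.
  have -> : 2 ^ ((14 + 2 * q) * L) = 2 ^ (11 * L) * 2 ^ ((2 * q + 3) * L).
    by rewrite -expnD; congr (2 ^ _); lia.
  apply: leq_trans (leq_mul h6 h5); move: h3 l3; rewrite h4.
  move: (q * (L * L) * (q * L)) ((5 + _) * _) => Y Z; lia.
have A3 : 10 <= 2 ^ ((18 + 2 * q) * L).
  by apply: (@leq_trans (2 ^ 4)) => //; rewrite leq_exp2l //; nia.
have A4 : 2 * 2 ^ ((18 + 2 * q) * L) <= 2 ^ ((23 + 2 * q) * L).
  by rewrite -expnS leq_exp2l //; nia.
have A5 : 2 ^ (4 * L) * 2 ^ ((14 + 2 * q) * L) = 2 ^ ((18 + 2 * q) * L).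
  by rewrite -expnD; congr (_ ^ _); lia.
have := leq_mul A1 A2; rewrite A5; lia.
Qed.

(** Each of the two failure terms is at most half of n ^ -c: 15 (c + 2) L phases bring (15/16)^P
    down to 2 ^ -((c + 2) L), and the number of possible false positives, at most 2 ^ ((p0 + 9) L),
    is outweighed by (3/4)^(3 b L) <= 2 ^ -(b L). *)
Lemma failure_small (c p0 b n m L B T : nat) : 0 < n -> 0 < L -> n < 2 ^ L -> m < 2 ^ (2 * L) ->
  p0 = 15 * (c + 2) -> p0 + 10 + c <= b ->
  16 ^ (p0 * L) * 4 ^ (3 * b * L) * B <=
    (15 ^ (p0 * L) * 4 ^ (3 * b * L) * n +
     16 ^ (p0 * L) * 3 ^ (3 * b * L) * (p0 * L * n * (2 * L + 2) * m * m)) * 2 ^ T ->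
  n ^ c * B <= 2 ^ T.
Proof.
move=> n0 L0 nL mL pE pb.
set M := p0 * L * n * (2 * L + 2) * m * m.
have x2 : 2 <= 2 ^ L by rewrite -[X in X <= _]expn1 leq_exp2l.
have nc : n ^ c <= 2 ^ (c * L) by rewrite mulnC expnM; apply: leq_exp2rW; exact: ltnW.
have H1 : 2 * (n ^ c * n) * 15 ^ (p0 * L) <= 16 ^ (p0 * L).
  have := @halving 15 ((c + 2) * L) isT; rewrite mulnA -pE; apply: leq_trans.
  rewrite leq_mul2r; apply/orP; right.
  have -> : 2 ^ ((c + 2) * L) = 2 ^ L * (2 ^ (c * L) * 2 ^ L) by rewrite -!expnD; congr (2 ^ _); lia.
  exact: leq_mul x2 (leq_mul nc (ltnW nL)).
have H2 : 2 * (n ^ c * M) * 3 ^ (3 * b * L) <= 4 ^ (3 * b * L).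
  have := @halving 3 (b * L) isT; rewrite mulnA; apply: leq_trans.
  rewrite leq_mul2r; apply/orP; right.
  have MM : M <= 2 ^ ((p0 + 9) * L).
    have -> : 2 ^ ((p0 + 9) * L) =
       2 ^ (p0 * L) * 2 ^ L * 2 ^ L * (2 ^ (2 * L) * 2 ^ L) * 2 ^ (2 * L) * 2 ^ (2 * L).
      by rewrite -!expnD; congr (2 ^ _); lia.
    have lL : L <= 2 ^ L by rewrite ltnW // ltn_expl.
    have J4 : 2 * L + 2 <= 2 ^ (2 * L) * 2 ^ L.
      have h4 : 4 <= 2 ^ (2 * L) by rewrite -[4]/(2 ^ 2) leq_exp2l // leq_pmulr.
      by apply: leq_trans (leq_mul h4 lL); lia.
    have mL' := ltnW mL; have pL := @le_pow p0 L L0.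
    exact: leq_mul (leq_mul (leq_mul (leq_mul (leq_mul pL lL) (ltnW nL)) J4) mL') mL'.
  apply: (@leq_trans (2 ^ L * (2 ^ (c * L) * 2 ^ ((p0 + 9) * L)))).
    exact: leq_mul x2 (leq_mul nc MM).
  rewrite -!expnD leq_exp2l //.
  have -> : L + (c * L + (p0 + 9) * L) = (p0 + 10 + c) * L by lia.
  by rewrite leq_mul2r pb orbT.
have G0 : 0 < 16 ^ (p0 * L) * 4 ^ (3 * b * L) by rewrite muln_gt0 !expn_gt0.
move: (15 ^ _) (16 ^ _) (3 ^ _) (4 ^ _) (2 ^ T) M H1 H2 G0 => U V W Z T2 M H1 H2 G0 H.
have G2 : 0 < 2 * (V * Z) by rewrite muln_gt0 G0.
rewrite -(leq_pmul2l G2).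
apply: (@leq_trans (2 * n ^ c * ((U * Z * n + V * W * M) * T2))).
  have -> : 2 * (V * Z) * (n ^ c * B) = 2 * n ^ c * (V * Z * B) by lia.
  by rewrite leq_mul2l H orbT.
have -> : 2 * n ^ c * ((U * Z * n + V * W * M) * T2) =
  (2 * (n ^ c * n) * U) * (Z * T2) + (2 * (n ^ c * M) * W) * (V * T2) by lia.
have -> : 2 * (V * Z) * T2 = V * (Z * T2) + Z * (V * T2) by lia.
by apply: leq_add; rewrite leq_mul2r ?H1 ?H2 orbT.
Qed.

Import Order.TTheory GRing.Theory Num.Theory.

Lemma success_probability T (A Bd : pred (T.-tuple bool)) (N : nat) : 0 < N ->
  (forall r, ~~ Bd r -> A r) -> N * #|Bd| <= 2 ^ T -> (1 - (N%:R)^-1 <= Pr A)%R.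
Proof.
move=> N0 AB H; rewrite /Pr card_tuple card_bool.
have T0 : (0 < (2 ^ T)%:R :> rat)%R by rewrite ltr0n expn_gt0.
have Np : (0 < N%:R :> rat)%R by rewrite ltr0n.
rewrite ler_pdivlMr // mulrBl mul1r lerBlDr.
have cAB : 2 ^ T <= #|A| + #|Bd|.
  rewrite -[2 ^ T](_ : #|{: T.-tuple bool}| = _); last by rewrite card_tuple card_bool.
  rewrite -cardUI; apply: leq_trans (leq_addr _ _).
  apply: subset_leq_card; apply/subsetP => r _; rewrite inE.
  by have := AB r; rewrite !unfold_in; case: (Bd r); rewrite ?orbT // => ->.
apply: (@le_trans _ _ (#|A|%:R + #|Bd|%:R)%R); first by rewrite -natrD ler_nat.
by rewrite lerD2l ler_pdivlMl // -natrM ler_nat.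
Qed.

Lemma label_size p0 a L : 0 < L ->
  (5 + 4 * (p0 * L * ((2 * L + 2) * 5))) * (a * L) <= (5 + 80 * p0) * a * L ^ 3.
Proof.
move=> L0; have h0 : 1 <= L * L by rewrite muln_gt0 L0.
have h1 : p0 * L * ((2 * L + 2) * 5) <= 20 * (p0 * (L * L)).
  have h' : (2 * L + 2) * 5 <= 20 * L by lia.
  apply: leq_trans (leq_mul (leqnn (p0 * L)) h') _.
  by rewrite -!mulnA [L * (20 * _)]mulnCA [p0 * (20 * _)]mulnCA.
have h2 : 5 + 4 * (p0 * L * ((2 * L + 2) * 5)) <= (5 + 80 * p0) * (L * L).
  have -> : (5 + 80 * p0) * (L * L) = 5 * (L * L) + 80 * (p0 * (L * L)) by rewrite mulnDl -(mulnA 80).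
  move: (p0 * L * ((2 * L + 2) * 5)) (p0 * (L * L)) (L * L) h0 h1 => *; lia.
apply: leq_trans (leq_mul h2 (leqnn (a * L))) _.
by rewrite !expnS expn0 muln1 mulnACA !mulnA.
Qed.

Lemma coins_le p0 a L m n : 0 < L ->
  p0 * L * m * rbits (a * L) (2 * L + 2) <= p0 * (2 * a + 4) * ((m + n) * L ^ 2).
Proof.
move=> L0; rewrite /rbits.
have h1 : a * L + a * L + (2 * L + 2) <= (2 * a + 4) * L by nia.
apply: leq_trans (leq_mul (leqnn (p0 * L * m)) h1) _.
have -> : p0 * L * m * ((2 * a + 4) * L) = p0 * (2 * a + 4) * (m * L ^ 2).
  by rewrite expnS expn1; move: (2 * a + 4) => A; lia.
by rewrite leq_mul2l leq_mul2r leq_addr !orbT.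
Qed.

Theorem theorem3p7 (c : nat) :
  exists (a C k : nat) (lab dec : cmd),
  forall (n : nat) (e : rel 'I_n) (E : seq ('I_n * 'I_n)) (f : nat),
    0 < n -> symmetric e -> irreflexive e -> edge_list e E -> 0 < f ->
    let w := a * lg n in
    let m := #|edge_set e| in
    let Tlab := C * (m + n) * lg n ^ k in
    let Tdec := C * f * lg n ^ k in
    exists L : Tlab.-tuple bool -> labeling n,
      [/\ forall r : Tlab.-tuple bool, computes_labeling w lab E f r Tlab (L r),
          forall r v, size (vlabel (L r) v) <= C * lg n ^ 3,
          forall r x, x \in edge_set e -> size (elabel (L r) x) <= C * lg n ^ 3
        & forall (s t : 'I_n) (F : seq {set 'I_n}),
            uniq F -> {subset F <= edge_set e} -> size F <= f ->
            exists2 ans : Tlab.-tuple bool -> bool,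
              forall r, decodes w dec (L r) s t F Tdec (ans r) &
              (1 - (n%:R ^+ c)^-1 <=
                 Pr [pred r | ans r == connect (delete_edges e F) s t])%R].
Proof.
(* [p0] and [b] are dictated by [failure_small], [q] and [d] by [params_dim]; [a] is a multiple of 3
   for [halving] and at least 2 d + 6 for [dim_bound]. *)
pose p0 := 15 * (c + 2); pose q := p0 + c + 20; pose d := 23 + 2 * q.
pose b := 2 * d + 6 + q; pose a := 3 * b.
(* The exponent dominates both programs, the square in the number of coins and the linear cost of
   the prelude. *)
pose K := labK + decK + 3.
pose C := (10 * a + 16) + labC a p0 + 3 * decC a p0 + p0 * (2 * a + 4) + (5 + 80 * p0) * a.
have [C1 C2 C3 C4] : [/\ 10 * a + 16 + labC a p0 <= C, 10 * a + 16 + 3 * decC a p0 <= C,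
    p0 * (2 * a + 4) <= C & (5 + 80 * p0) * a <= C].
  rewrite /C; move: (10 * a + 16) (labC a p0) (3 * decC a p0) (p0 * _) ((5 + _) * a) => *.
  by split; lia.
clearbody C.
exists a, C, K, (Seq (prelude a d) (comp (LAB p0))), (Seq (prelude a d) (comp (DEC p0))).
move=> n e E f n0 esym eirr eE f0 w m Tlab Tdec.
have L0 : 0 < lg n by [].
have nL : n < 2 ^ lg n by apply: trunc_log_ltn.
have mE : m = size E by rewrite /m (size_edges eE).
have mL : m < 2 ^ (2 * lg n) by rewrite mE; apply: (size_edges_lt eE).
have pp0 : 0 < p0 by rewrite muln_gt0 addn2.
have da : 2 * d + 6 <= a by rewrite /a /b; lia.
have a10 : 10 <= a by rewrite /a /b /d; lia.
have bigD : (n + size E + 4) * ((5 + 4 * (p0 * lg n * ((2 * lg n + 2) * 5))) * (a * lg n) + 4) + 10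
    <= 2 ^ (d * lg n).
  by rewrite -mE; apply: params_dim => //; rewrite /q; lia.
have LK i : i <= K -> lg n ^ i <= lg n ^ K by move=> iK; rewrite leq_pexp2l.
have LK0 : 0 < lg n ^ K by rewrite expn_gt0.
have base : 10 * (a * lg n) + 16 <= (10 * a + 16) * lg n ^ K.
  have l1 : lg n <= lg n ^ K by rewrite -{1}[lg n]expn1 LK // /K; lia.
  rewrite mulnDl mulnA; apply: leq_add; first by rewrite leq_mul2l l1 orbT.
  by rewrite leq_pmulr.
have [lab [lab1 lab2 lab3 lab4]] :=
  programs_spec f (Ordinal n0) L0 da a10 pp0 nL bigD esym eirr eE.
have nm : 0 < n + m by rewrite addn_gt0 n0.
have labb : 10 * w + 16 + labC a p0 * (n + size E) * lg n ^ labK <= Tlab.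
  have h1 : (10 * a + 16) * lg n ^ K <= (10 * a + 16) * ((m + n) * lg n ^ K).
    by rewrite leq_mul2l; apply/orP; right; rewrite leq_pmull // addnC.
  have h2 : labC a p0 * (n + size E) * lg n ^ labK <= labC a p0 * ((m + n) * lg n ^ K).
    by rewrite -mE -mulnA addnC leq_mul2l leq_mul2l LK ?orbT // /K -addnA leq_addr.
  apply: leq_trans (leq_add (leq_trans base h1) h2) _.
  by rewrite /Tlab -[C * _ * _]mulnA -mulnDl leq_mul2r C1 orbT.
have rb : p0 * lg n * size E * rbits (a * lg n) (2 * lg n + 2) <= Tlab.
  rewrite -mE; have l2 : lg n ^ 2 <= lg n ^ K by apply: LK; rewrite /K; lia.
  apply: leq_trans (coins_le p0 a m n L0) _.
  rewrite /Tlab -[C * _ * _]mulnA; apply: (leq_mul C3).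
  by rewrite leq_mul2l l2 orbT.
have szL : (5 + 4 * (p0 * lg n * ((2 * lg n + 2) * 5))) * (a * lg n) <= C * lg n ^ 3.
  by apply: leq_trans (label_size p0 a L0) _; rewrite leq_mul2r C4 orbT.
exists (fun r => lab r); split.
- move=> r; apply: lab1 => //; rewrite size_tuple; apply: leq_trans labb; exact: leq_addl.
- by move=> r v; rewrite lab2.
- by move=> r x _; rewrite lab3.
move=> s t F uF sF Ff; have [okr [ans [ok1 ok2 ok3]]] := lab4 F s t uF sF.
have decb : 10 * w + 16 + decC a p0 * (size F).+2 * lg n ^ decK <= Tdec.
  have h1 : (10 * a + 16) * lg n ^ K <= (10 * a + 16) * (f * lg n ^ K).
    by rewrite leq_mul2l leq_pmull ?orbT.
  have h2 : decC a p0 * (size F).+2 * lg n ^ decK <= 3 * decC a p0 * (f * lg n ^ K).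
    (* The decoder reads the labels of two vertices besides those of F; positivity of f absorbs
       them. *)
    have F3 : (size F).+2 <= 3 * f by lia.
    have -> : 3 * decC a p0 * (f * lg n ^ K) = decC a p0 * (3 * f * lg n ^ K).
      by rewrite -!mulnA mulnCA.
    rewrite -mulnA leq_mul2l; apply/orP; right; apply: leq_mul => //; apply: LK.
    by rewrite /K; lia.
  apply: leq_trans (leq_add (leq_trans base h1) h2) _.
  by rewrite /Tdec -[C * _ * _]mulnA -mulnDl leq_mul2r C2 orbT.
exists (fun r => ans r) => [r|]; first exact: ok3.
rewrite -natrX.
apply: (@success_probability _ _ [pred r : Tlab.-tuple bool | ~~ okr r]).
- by rewrite expn_gt0 n0.
- by move=> r /=; rewrite negbK => /ok2 ->.
have mJ : size E < 2 ^ (2 * lg n + 2).-2 by rewrite addn2 /= -mE.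
apply: (@failure_small c p0 b n (size E) (lg n) _ _ n0 L0 nL) => //; first by rewrite -mE.
  by rewrite /b /q; lia.
exact: ok1 rb mJ.
Qed.
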